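(* Let $g \in \mathrm{BMOA}$ and $1 \le p < \infty$. Suppose $(f_n)$ is a sequence in $H^p$ with $\|f_n\|_{H^p}=1$ for all $n$ and $f_n\to 0$ uniformly on compact subsets of $\mathbb{D}$. If $\liminf_{n\to\infty}\|T_g f_n\|_{H^p}>0$, then there is a subsequence $(f_{n_j})$ such that $(T_g f_{n_j})$ is equivalent to the unit vector basis of $\ell^p$, i.e. there is a constant $c>0$ with \[ c^{-1}\Bigl(\sum_j|\alpha_j|^p\Bigr)^{1/p}\le\Bigl\|\sum_j\alpha_j T_g f_{n_j}\Bigr\|_{H^p}\le c\Bigl(\sum_j|\alpha_j|^p\Bigr)^{1/p}\] for all $(\alpha_j)\in\ell^p$.
   Context: $\mathbb{D}$ is the open unit disc. For $0<p<\infty$, $H^p$ is the Hardy space on $\mathbb{D}$. For $a\in\mathbb{D}$ let $\sigma_a(z)=\frac{a-z}{1-\bar a z}$. $\mathrm{BMOA}$ is the space of analytic $f\colon\mathbb{D}\to\mathbb{C}$ with $\sup_{a\in\mathbb{D}}\|f\circ\sigma_a-f(a)\|_{H^2}<\infty$. For analytic $g$ on $\mathbb{D}$, $T_g f(z)=\int_0^z f(w)g'(w)\,dw$. *)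

(* Defs.v *)
From Stdlib Require Import Reals Lra ClassicalEpsilon.
Open Scope R_scope.

Definition Cx : Type := (R * R)%type.
Definition RtoC (x : R) : Cx := (x, 0).
Definition C0 : Cx := (0, 0).
Definition C1 : Cx := (1, 0).
Definition Cadd (z w : Cx) : Cx := (fst z + fst w, snd z + snd w).
Definition Copp (z : Cx) : Cx := (- fst z, - snd z).
Definition Csub (z w : Cx) : Cx := Cadd z (Copp w).
Definition Cmul (z w : Cx) : Cx :=
  (fst z * fst w - snd z * snd w, fst z * snd w + snd z * fst w).
Definition Cconj (z : Cx) : Cx := (fst z, - snd z).
Definition Cmod (z : Cx) : R := sqrt (fst z ^ 2 + snd z ^ 2).
Definition Cinv (z : Cx) : Cx :=
  (fst z / (fst z ^ 2 + snd z ^ 2), - snd z / (fst z ^ 2 + snd z ^ 2)).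
Definition Cdiv (z w : Cx) : Cx := Cmul z (Cinv w).

Definition in_disc (z : Cx) : Prop := Cmod z < 1.

(** x^q for x >= 0, q > 0 (with 0^q = 0; Stdlib's Rpower 0 q = 1). *)
Definition rpow (x q : R) : R := if Rle_dec x 0 then 0 else Rpower x q.

Definition has_cderiv (f : Cx -> Cx) (z l : Cx) : Prop :=
  forall eps, 0 < eps -> exists delta, 0 < delta /\
    forall h : Cx, h <> C0 -> Cmod h < delta ->
      Cmod (Csub (Cdiv (Csub (f (Cadd z h)) (f z)) h) l) < eps.
Definition cderiv (f : Cx -> Cx) (z : Cx) : Cx :=
  epsilon (inhabits C0) (fun l => has_cderiv f z l).

Definition analytic (f : Cx -> Cx) : Prop :=
  forall z, in_disc z -> exists l, has_cderiv f z l.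

(** Riemann integral over [a,b] (value irrelevant if not integrable). *)
Definition RInt (a b : R) (F : R -> R) : R :=
  epsilon (inhabits 0)
    (fun l => exists pr : Riemann_integrable F a b, RiemannInt pr = l).

Definition CInt01 (F : R -> Cx) : Cx :=
  (RInt 0 1 (fun t => fst (F t)), RInt 0 1 (fun t => snd (F t))).

(** Volterra operator: T_g f (z) = int_0^z f(w) g'(w) dw, along the segment
    w = t z, t in [0,1]. *)
Definition Tg (g f : Cx -> Cx) : Cx -> Cx :=
  fun z => CInt01 (fun t =>
    Cmul (Cmul (f (Cmul (RtoC t) z)) (cderiv g (Cmul (RtoC t) z))) z).

Definition Mp (p : R) (f : Cx -> Cx) (r : R) : R :=
  rpow (/ (2 * PI) *
        RInt 0 (2 * PI) (fun t => rpow (Cmod (f (r * cos t, r * sin t))) p))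
       (/ p).

Definition in_Hp (p : R) (f : Cx -> Cx) : Prop :=
  analytic f /\ exists B, forall r, 0 <= r < 1 -> Mp p f r <= B.
Definition Hp_norm (p : R) (f : Cx -> Cx) : R :=
  epsilon (inhabits 0)
    (is_lub (fun x => exists r, 0 <= r < 1 /\ x = Mp p f r)).

Definition sigma (a z : Cx) : Cx :=
  Cdiv (Csub a z) (Csub C1 (Cmul (Cconj a) z)).

Definition BMOA (g : Cx -> Cx) : Prop :=
  analytic g /\
  (forall a, in_disc a -> in_Hp 2 (fun z => Csub (g (sigma a z)) (g a))) /\
  exists B, forall a, in_disc a ->
    Hp_norm 2 (fun z => Csub (g (sigma a z)) (g a)) <= B.

Fixpoint Clincomb (alpha : nat -> Cx) (h : nat -> Cx -> Cx) (N : nat) (z : Cx) : Cx :=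
  match N with
  | O => C0
  | S N' => Cadd (Clincomb alpha h N' z) (Cmul (alpha N') (h N' z))
  end.

(* Main.v *)
From Stdlib Require Import Reals Lra Lia Psatz ClassicalEpsilon.
From Coquelicot Require Import Coquelicot.
Require Defs.
Open Scope R_scope.
Local Notation rpow := Defs.rpow.

(* Everything rests on one monotonicity principle: the mean of a smooth subharmonic function
   over the circle of radius r increases with r, because it is convex in log r and bounded
   near r = 0. It is applied to explicit functions of f, g and h = T_g f, where h' = f g'.

   Boundedness of T_g: the difference phi between the harmonic extension of |g|^2 from a
   circle and |g|^2 itself lies between 0 and the square of the BMOA norm, and
   Δphi = -4|g'|^2; hence Δ(|f|^p e^{-phi}) >= c |f|^p |g'|^2 dominates the Laplacian of
   |h|^p (p >= 2), resp. of (|h|^2 + |f|^2)^{p/2} (p <= 2), up to a multiple of Δ|f|^p.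

   Decay: for 1/q = 1/p + 1/2 the same comparison with |f|^p + |g|^2 bounds the increment
   of the q-th mean of h between two circles by that of the square mean of g, which is small
   near the boundary; so the q-th means of T_g f_n tend to 0 uniformly over all circles.

   Disjointness: for k in H^p the autocorrelations of |k|^{p/2} on circles increase with
   the radius, so its traces are equicontinuous in L^2, and the means of
   |k|^{p/2} |T_g f_n|^{p/2} tend to 0 uniformly over all circles. As |x+y|^p - |x|^p - |y|^p
   is at most eta (|x|^p + |y|^p) + C_eta |x|^{p/2} |y|^{p/2}, a subsequence chosen inductively
   satisfies ||sum a_j T_g f_{n_j}||^p = sum |a_j|^p ||T_g f_{n_j}||^p up to a small multiple
   of sum |a_j|^p. *)

(** * Complex differentiability and continuity *)

(** No boundary function and no measure on the circle is used: a norm is a supremum of means over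
    circles, so each estimate is proved on one circle with constants independent of its radius. The
    obstacle is that [T_g f_n] is small on compact sets but not in norm. Its mass escapes to the
    boundary, and it has to be shown that the masses of distant terms sit on essentially disjoint
    sets. The exponent with [1/q = 1/p + 1/2] is where this becomes visible: it is Hölder's exponent
    for [f] in [H^p] and [g] in [H^2], and there [g] enters through its square mean, whose
    increments vanish at the boundary. In [H^p] itself only the BMOA norm of [g] is available, which
    gives boundedness but no smallness. Decay of a lower mean together with boundedness in [H^p] is
    concentration on small sets. Powers such as [|f|^p] need not be smooth at the zeros of [f], so
    the comparison functions are built from [|f|^2 + e] with [e > 0], and [e] tends to 0 only after
    integration. *)

Definition cdiff (F : C -> C) (z l : C) : Prop :=
  forall eps, 0 < eps -> exists d, 0 < d /\ forall w, Cmod (w - z) < d ->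
    Cmod (F w - F z - l * (w - z)) <= eps * Cmod (w - z).

Definition ccont (F : C -> C) (z : C) : Prop :=
  forall eps, 0 < eps -> exists d, 0 < d /\ forall w, Cmod (w - z) < d ->
    Cmod (F w - F z) < eps.

Definition rcont (u : C -> R) (z : C) : Prop :=
  forall eps, 0 < eps -> exists d, 0 < d /\ forall w, Cmod (w - z) < d ->
    Rabs (u w - u z) < eps.

Lemma Cmod_triangle3 (a b c : C) : Cmod (a + b + c) <= Cmod a + Cmod b + Cmod c.
Proof.
  pose proof (Cmod_triangle (a + b) c); pose proof (Cmod_triangle a b); lra.
Qed.

Lemma Cmod_minus_sym (a b : C) : Cmod (a - b) = Cmod (b - a).
Proof. rewrite <- Cmod_opp; f_equal; ring. Qed.

Lemma Cmod_triangle_sub (a b : C) : Cmod a <= Cmod b + Cmod (a - b).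
Proof.
  replace a with (b + (a - b))%C at 1 by ring; apply Cmod_triangle.
Qed.

Lemma Cmod_pos (z : C) : z <> 0 -> 0 < Cmod z.
Proof. apply Cmod_gt_0. Qed.

Lemma Cmod_fst (z : C) : Rabs (fst z) <= Cmod z.
Proof. apply re_le_Cmod. Qed.

Lemma Cmod_snd (z : C) : Rabs (snd z) <= Cmod z.
Proof.
  pose proof (Rmax_Cmod z); pose proof (Rmax_r (Rabs (fst z)) (Rabs (snd z))); lra.
Qed.

Lemma Cmod_le_parts (z : C) : Cmod z <= Rabs (fst z) + Rabs (snd z).
Proof.
  rewrite <- (sqrt_pow2 (Rabs (fst z) + Rabs (snd z))).
  - apply sqrt_le_1_alt. rewrite <- (pow2_abs (fst z)), <- (pow2_abs (snd z)).
    pose proof (Rabs_pos (fst z)); pose proof (Rabs_pos (snd z)); nra.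
  - pose proof (Rabs_pos (fst z)); pose proof (Rabs_pos (snd z)); lra.
Qed.

Lemma Cmod_sqr (z : C) : Cmod z ^ 2 = fst z ^ 2 + snd z ^ 2.
Proof. apply pow2_sqrt; nra. Qed.

(** For functions whose remainder is an explicit multiple of [(w - z)^2], such as [1/z] and the
    Cauchy kernels. *)
Lemma cdiff_quad (F : C -> C) (z l : C) (M d : R) :
  0 < d ->
  (forall w, Cmod (w - z) < d ->
     Cmod (F w - F z - l * (w - z)) <= M * Cmod (w - z) ^ 2) ->
  cdiff F z l.
Proof.
  intros Hd H eps He.
  exists (Rmin d (eps / (Rabs M + 1))).
  pose proof (Rabs_pos M).
  assert (0 < eps / (Rabs M + 1)) by (apply Rdiv_lt_0_compat; lra).
  split; [apply Rmin_pos; lra|].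
  intros w Hw.
  pose proof (Rmin_l d (eps / (Rabs M + 1))).
  pose proof (Rmin_r d (eps / (Rabs M + 1))).
  eapply Rle_trans; [apply H; lra|].
  assert (Cmod (w - z) * (Rabs M + 1) <= eps).
  { apply Rlt_le. apply Rlt_le_trans with (eps / (Rabs M + 1) * (Rabs M + 1)).
    apply Rmult_lt_compat_r; lra. right; field; lra. }
  pose proof (Cmod_ge_0 (w - z)). pose proof (Rle_abs M).
  assert (M * Cmod (w - z) <= eps) by nra. nra.
Qed.

Lemma cdiff_lip (F : C -> C) (z l : C) : cdiff F z l ->
  exists d, 0 < d /\ forall w, Cmod (w - z) < d ->
    Cmod (F w - F z) <= (Cmod l + 1) * Cmod (w - z).
Proof.
  intros H. destruct (H 1 Rlt_0_1) as [d [Hd H1]]. exists d; split; auto.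
  intros w Hw. specialize (H1 w Hw).
  replace (F w - F z)%C with ((F w - F z - l * (w - z)) + l * (w - z))%C by ring.
  eapply Rle_trans; [apply Cmod_triangle|]. rewrite Cmod_mult. lra.
Qed.

Lemma cdiff_ccont (F : C -> C) (z l : C) : cdiff F z l -> ccont F z.
Proof.
  intros H eps He. destruct (cdiff_lip _ _ _ H) as [d [Hd H1]].
  pose proof (Cmod_ge_0 l).
  assert (0 < eps / (Cmod l + 1)) by (apply Rdiv_lt_0_compat; lra).
  exists (Rmin d (eps / (Cmod l + 1))). split; [apply Rmin_pos; lra|].
  intros w Hw.
  pose proof (Rmin_l d (eps / (Cmod l + 1))).
  pose proof (Rmin_r d (eps / (Cmod l + 1))).
  eapply Rle_lt_trans; [apply H1; lra|].
  apply Rlt_le_trans with ((Cmod l + 1) * (eps / (Cmod l + 1))).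
  apply Rmult_lt_compat_l; lra. right; field; lra.
Qed.

Lemma cdiff_ext_loc (F G : C -> C) (z l : C) (d : R) : 0 < d ->
  (forall w, Cmod (w - z) < d -> F w = G w) -> cdiff F z l -> cdiff G z l.
Proof.
  intros Hd H HF eps He. destruct (HF eps He) as [d1 [Hd1 H1]].
  exists (Rmin d d1). split; [apply Rmin_pos; lra|].
  intros w Hw. pose proof (Rmin_l d d1). pose proof (Rmin_r d d1).
  rewrite <- !H; try lra. apply H1; lra.
  replace (z - z)%C with (RtoC 0) by ring. rewrite Cmod_0; lra.
Qed.

Lemma cdiff_unique (F : C -> C) (z l m : C) : cdiff F z l -> cdiff F z m -> l = m.
Proof.
  intros Hl Hm.
  assert (Cmod (l - m) = 0).
  { apply Rle_antisym; [|apply Cmod_ge_0].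
    apply Rnot_lt_le; intros Hlt.
    destruct (Hl (Cmod (l - m) / 4)) as [d1 [Hd1 H1]]; [lra|].
    destruct (Hm (Cmod (l - m) / 4)) as [d2 [Hd2 H2]]; [lra|].
    set (t := Rmin d1 d2 / 2). assert (0 < t) by (pose proof (Rmin_pos _ _ Hd1 Hd2); unfold t; lra).
    pose proof (Rmin_l d1 d2); pose proof (Rmin_r d1 d2).
    assert (E : (z + t - z)%C = RtoC t) by ring.
    specialize (H1 (z + t)%C); specialize (H2 (z + t)%C).
    rewrite E, Cmod_R, (Rabs_pos_eq t) in H1, H2 by lra.
    specialize (H1 ltac:(unfold t; lra)); specialize (H2 ltac:(unfold t; lra)).
    assert (Hm2 : Cmod ((l - m) * t) <= Cmod (l - m) / 2 * t).
    { replace ((l - m) * t)%C with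
        ((F (z + t) - F z - m * t) + - (F (z + t) - F z - l * t))%C by ring.
      eapply Rle_trans; [apply Cmod_triangle|]. rewrite Cmod_opp. lra. }
    rewrite Cmod_mult, Cmod_R, Rabs_pos_eq in Hm2 by lra. nra. }
  apply Cmod_eq_0 in H. 
  replace l with ((l - m) + m)%C by ring. rewrite H; ring.
Qed.

Lemma cdiff_const (c z : C) : cdiff (fun _ => c) z 0.
Proof.
  apply (cdiff_quad _ _ _ 0 1 Rlt_0_1). intros w _.
  replace (c - c - 0 * (w - z))%C with (RtoC 0) by ring. rewrite Cmod_0; lra.
Qed.

Lemma cdiff_id (z : C) : cdiff (fun w => w) z 1.
Proof.
  apply (cdiff_quad _ _ _ 0 1 Rlt_0_1). intros w _.
  replace (w - z - 1 * (w - z))%C with (RtoC 0) by ring. rewrite Cmod_0; lra.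
Qed.

Lemma cdiff_plus (F G : C -> C) (z l m : C) : cdiff F z l -> cdiff G z m ->
  cdiff (fun w => (F w + G w)%C) z (l + m).
Proof.
  intros HF HG eps He.
  destruct (HF (eps / 2)) as [d1 [Hd1 H1]]; [lra|].
  destruct (HG (eps / 2)) as [d2 [Hd2 H2]]; [lra|].
  exists (Rmin d1 d2). split; [apply Rmin_pos; lra|]. intros w Hw.
  pose proof (Rmin_l d1 d2); pose proof (Rmin_r d1 d2).
  specialize (H1 w ltac:(lra)); specialize (H2 w ltac:(lra)).
  replace (F w + G w - (F z + G z) - (l + m) * (w - z))%C with
    ((F w - F z - l * (w - z)) + (G w - G z - m * (w - z)))%C by ring.
  eapply Rle_trans; [apply Cmod_triangle|]. lra.
Qed.

Lemma cdiff_mult (F G : C -> C) (z l m : C) : cdiff F z l -> cdiff G z m ->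
  cdiff (fun w => (F w * G w)%C) z (l * G z + F z * m).
Proof.
  intros HF HG eps He.
  set (K := Cmod (G z) + 1 + Cmod l + Cmod (F z)).
  pose proof (Cmod_ge_0 (G z)); pose proof (Cmod_ge_0 (F z)); pose proof (Cmod_ge_0 l).
  set (e := Rmin 1 (eps / (3 * K))).
  assert (HK : 0 < K) by (unfold K; lra).
  assert (He' : 0 < eps / (3 * K)) by (apply Rdiv_lt_0_compat; lra).
  assert (0 < e) by (apply Rmin_pos; lra).
  assert (e <= 1) by apply Rmin_l.
  assert (HeK : 3 * K * e <= eps).
  { replace eps with (3 * K * (eps / (3 * K))) by (field; lra).
    apply Rmult_le_compat_l; [lra|]. apply Rmin_r. }
  destruct (HF e) as [d1 [Hd1 H1']]; [lra|].
  destruct (HG e) as [d2 [Hd2 H2']]; [lra|].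
  destruct (cdiff_ccont _ _ _ HG e) as [d3 [Hd3 H3']]; [lra|].
  exists (Rmin d1 (Rmin d2 d3)). split; [repeat apply Rmin_pos; lra|]. intros w Hw.
  pose proof (Rmin_l d1 (Rmin d2 d3)); pose proof (Rmin_r d1 (Rmin d2 d3)).
  pose proof (Rmin_l d2 d3); pose proof (Rmin_r d2 d3).
  specialize (H1' w ltac:(lra)); specialize (H2' w ltac:(lra)); specialize (H3' w ltac:(lra)).
  replace (F w * G w - F z * G z - (l * G z + F z * m) * (w - z))%C with
    ((F w - F z - l * (w - z)) * G w + l * (w - z) * (G w - G z)
     + F z * (G w - G z - m * (w - z)))%C by ring.
  eapply Rle_trans; [apply Cmod_triangle3|]. rewrite !Cmod_mult.
  pose proof (Cmod_triangle_sub (G w) (G z)).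
  pose proof (Cmod_ge_0 (w - z)).
  set (a := Cmod (w - z)) in *.
  assert (Cmod (F w - F z - l * (w - z)) * Cmod (G w) <= e * a * K).
  { apply Rmult_le_compat; try apply Cmod_ge_0; unfold K; lra. }
  assert (Cmod l * a * Cmod (G w - G z) <= K * a * e).
  { apply Rmult_le_compat; try apply Cmod_ge_0; try lra.
    apply Rmult_le_pos; lra. apply Rmult_le_compat_r; unfold K; lra. }
  assert (Cmod (F z) * Cmod (G w - G z - m * (w - z)) <= K * (e * a)).
  { apply Rmult_le_compat; try apply Cmod_ge_0; unfold K; lra. }
  assert (3 * K * e * a <= eps * a) by (apply Rmult_le_compat_r; lra).
  lra.
Qed.

Lemma cdiff_eq (F : C -> C) (z l m : C) : l = m -> cdiff F z l -> cdiff F z m.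
Proof. intros ->; auto. Qed.

Lemma cdiff_scal (c : C) (F : C -> C) (z l : C) : cdiff F z l ->
  cdiff (fun w => (c * F w)%C) z (c * l).
Proof.
  intros H. eapply cdiff_eq; [|apply cdiff_mult; [apply cdiff_const|exact H]]. cbv beta; ring.
Qed.

Lemma cdiff_comp (F G : C -> C) (z l m : C) : cdiff F z l -> cdiff G (F z) m ->
  cdiff (fun w => G (F w)) z (m * l).
Proof.
  intros HF HG eps He.
  destruct (cdiff_lip _ _ _ HF) as [d0 [Hd0 H0]].
  pose proof (Cmod_ge_0 l); pose proof (Cmod_ge_0 m).
  destruct (HG (eps / 2 / (Cmod l + 1))) as [d1 [Hd1 H1']].
  { repeat apply Rdiv_lt_0_compat; lra. }
  destruct (HF (eps / 2 / (Cmod m + 1))) as [d2 [Hd2 H2']].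
  { repeat apply Rdiv_lt_0_compat; lra. }
  destruct (cdiff_ccont _ _ _ HF d1 Hd1) as [d3 [Hd3 H3']].
  exists (Rmin d0 (Rmin d2 d3)). split; [repeat apply Rmin_pos; lra|]. intros w Hw.
  pose proof (Rmin_l d0 (Rmin d2 d3)); pose proof (Rmin_r d0 (Rmin d2 d3)).
  pose proof (Rmin_l d2 d3); pose proof (Rmin_r d2 d3).
  specialize (H0 w ltac:(lra)); specialize (H2' w ltac:(lra)); specialize (H3' w ltac:(lra)).
  specialize (H1' _ H3').
  replace (G (F w) - G (F z) - m * l * (w - z))%C with
    ((G (F w) - G (F z) - m * (F w - F z)) + m * (F w - F z - l * (w - z)))%C by ring.
  eapply Rle_trans; [apply Cmod_triangle|]. rewrite Cmod_mult.
  pose proof (Cmod_ge_0 (w - z)). set (a := Cmod (w - z)) in *.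
  assert (eps / 2 / (Cmod l + 1) * Cmod (F w - F z) <= eps / 2 * a).
  { apply Rle_trans with (eps / 2 / (Cmod l + 1) * ((Cmod l + 1) * a)).
    apply Rmult_le_compat_l; auto. apply Rlt_le; repeat apply Rdiv_lt_0_compat; lra.
    right; field; lra. }
  assert (Cmod m * Cmod (F w - F z - l * (w - z)) <= eps / 2 * a).
  { apply Rle_trans with ((Cmod m + 1) * (eps / 2 / (Cmod m + 1) * a)).
    apply Rmult_le_compat; try apply Cmod_ge_0; lra.
    right; field; lra. }
  lra.
Qed.

Lemma Cmod_near (z w : C) : Cmod (w - z) < Cmod z / 2 -> Cmod z / 2 < Cmod w.
Proof.
  intros H. pose proof (Cmod_triangle_sub z w). rewrite Cmod_minus_sym in H. lra.
Qed.

Lemma Cmod_neq0 (z : C) : 0 < Cmod z -> z <> 0.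
Proof. intros H; apply Cmod_gt_0, H. Qed.

Lemma cdiff_inv (z : C) : z <> 0 -> cdiff Cinv z (- / (z * z)).
Proof.
  intros Hz. pose proof (Cmod_pos _ Hz) as Hp.
  apply (cdiff_quad _ _ _ (2 / Cmod z ^ 3) (Cmod z / 2)); [lra|].
  intros w Hw. pose proof (Cmod_near _ _ Hw).
  assert (Hw0 : w <> 0) by (apply Cmod_neq0; lra).
  replace (/ w - / z - - / (z * z) * (w - z))%C with
    ((w - z) * (w - z) * / (z * z * w))%C by (field; auto).
  rewrite !Cmod_mult, Cmod_inv by (repeat apply Cmult_neq_0; auto).
  rewrite !Cmod_mult.
  replace (2 / Cmod z ^ 3 * Cmod (w - z) ^ 2) with
    (Cmod (w - z) * Cmod (w - z) * / (Cmod z * Cmod z * (Cmod z / 2))) by (field; lra).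
  apply Rmult_le_compat_l. apply Rmult_le_pos; apply Cmod_ge_0.
  apply Rinv_le_contravar. repeat apply Rmult_lt_0_compat; lra.
  apply Rmult_le_compat_l; nra.
Qed.

Definition adisc (rho : R) (F : C -> C) : Prop :=
  forall z, Cmod z < rho -> exists l, cdiff F z l.

Lemma ccont_fst (F : C -> C) (z : C) : ccont F z -> rcont (fun w => fst (F w)) z.
Proof.
  intros H eps He. destruct (H eps He) as [d [Hd H1]]. exists d; split; auto.
  intros w Hw. specialize (H1 w Hw). pose proof (Cmod_fst (F w - F z)). simpl in H0.
  unfold Rminus. lra.
Qed.

Lemma ccont_snd (F : C -> C) (z : C) : ccont F z -> rcont (fun w => snd (F w)) z.
Proof.
  intros H eps He. destruct (H eps He) as [d [Hd H1]]. exists d; split; auto.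
  intros w Hw. specialize (H1 w Hw). pose proof (Cmod_snd (F w - F z)). simpl in H0.
  unfold Rminus. lra.
Qed.

Lemma rcont_ccont (F : C -> C) (z : C) : rcont (fun w => fst (F w)) z ->
  rcont (fun w => snd (F w)) z -> ccont F z.
Proof.
  intros H1 H2 eps He.
  destruct (H1 (eps / 2)) as [d1 [Hd1 K1]]; [lra|].
  destruct (H2 (eps / 2)) as [d2 [Hd2 K2]]; [lra|].
  exists (Rmin d1 d2); split; [apply Rmin_pos; auto|]. intros w Hw.
  pose proof (Rmin_l d1 d2); pose proof (Rmin_r d1 d2).
  specialize (K1 w ltac:(lra)); specialize (K2 w ltac:(lra)).
  pose proof (Cmod_le_parts (F w - F z)) as H3. simpl in H3. unfold Rminus in *. lra.
Qed.

Lemma rcont_2d (u : C -> R) (a b : R -> R -> R) (x y : R) :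
  rcont u (a x y, b x y) -> continuity_2d_pt a x y -> continuity_2d_pt b x y ->
  continuity_2d_pt (fun x y => u (a x y, b x y)) x y.
Proof.
  intros Hu Ha Hb eps. destruct (Hu eps (cond_pos eps)) as [d [Hd H]].
  assert (Hd2 : 0 < d / 2) by lra.
  specialize (Ha (mkposreal _ Hd2)); specialize (Hb (mkposreal _ Hd2)).
  generalize (locally_2d_and _ _ _ _ Ha Hb). apply locally_2d_impl.
  apply locally_2d_forall. simpl. intros s t [H1 H2]. apply H.
  eapply Rle_lt_trans; [apply Cmod_le_parts|]. simpl. unfold Rminus in *. lra.
Qed.

Lemma continuity_2d_1d_snd (f : R -> R -> R) (x y : R) :
  continuity_2d_pt f x y -> continuity_pt (f x) y.
Proof.
  intros H. apply continuity_pt_locally. intros eps. destruct (H eps) as [d Hd].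
  exists d. intros t Ht. apply Hd; auto. rewrite Rminus_diag, Rabs_R0. apply cond_pos.
Qed.

Lemma continuity_1d_2d_snd (f : R -> R) (x y : R) :
  continuity_pt f y -> continuity_2d_pt (fun _ t => f t) x y.
Proof.
  intros H. apply (continuity_1d_2d_pt_comp f (fun _ t => t)); auto.
  apply continuity_2d_pt_id2.
Qed.

Lemma continuity_1d_2d_fst (f : R -> R) (x y : R) :
  continuity_pt f x -> continuity_2d_pt (fun t _ => f t) x y.
Proof.
  intros H. apply (continuity_1d_2d_pt_comp f (fun t _ => t)); auto.
  apply continuity_2d_pt_id1.
Qed.

Lemma rcont_1d (u : C -> R) (a b : R -> R) (t : R) :
  rcont u (a t, b t) -> continuity_pt a t -> continuity_pt b t ->
  continuity_pt (fun t => u (a t, b t)) t.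
Proof.
  intros Hu Ha Hb.
  apply (continuity_2d_1d_snd (fun _ t => u (a t, b t)) 0 t).
  apply (rcont_2d u (fun _ t => a t) (fun _ t => b t)); auto;
    apply continuity_1d_2d_snd; auto.
Qed.

Lemma ex_RInt_cpt (f : R -> R) (a b : R) :
  (forall t, Rmin a b <= t <= Rmax a b -> continuity_pt f t) -> ex_RInt f a b.
Proof.
  intros H. apply (ex_RInt_continuous (V := R_CompleteNormedModule)).
  intros t Ht. apply continuity_pt_filterlim. apply H, Ht.
Qed.

(** * Goursat's lemma on rectangles *)

Definition CI (phi : R -> C) (a b : R) : C :=
  (RInt (fun t => fst (phi t)) a b, RInt (fun t => snd (phi t)) a b).

Definition ex_CI (phi : R -> C) (a b : R) : Prop :=
  ex_RInt (fun t => fst (phi t)) a b /\ ex_RInt (fun t => snd (phi t)) a b.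

Definition ccurve (phi : R -> C) (t : R) : Prop :=
  continuity_pt (fun t => fst (phi t)) t /\ continuity_pt (fun t => snd (phi t)) t.

Lemma ex_CI_curve (phi : R -> C) (a b : R) :
  (forall t, Rmin a b <= t <= Rmax a b -> ccurve phi t) -> ex_CI phi a b.
Proof. intros H; split; apply ex_RInt_cpt; intros t Ht; apply (H t Ht). Qed.

Lemma Ceq (z w : C) : fst z = fst w -> snd z = snd w -> z = w.
Proof. destruct z, w; simpl; intros -> ->; auto. Qed.

Lemma CI_ext (phi psi : R -> C) (a b : R) :
  (forall t, Rmin a b < t < Rmax a b -> phi t = psi t) -> CI phi a b = CI psi a b.
Proof.
  intros H; unfold CI; f_equal; apply RInt_ext; intros t Ht; rewrite H; auto.
Qed.

Lemma CI_plus (phi psi : R -> C) (a b : R) : ex_CI phi a b -> ex_CI psi a b ->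
  CI (fun t => (phi t + psi t)%C) a b = (CI phi a b + CI psi a b)%C.
Proof.
  intros [H1 H2] [H3 H4]. apply Ceq; simpl.
  - exact (RInt_plus _ _ _ _ H1 H3).
  - exact (RInt_plus _ _ _ _ H2 H4).
Qed.

Lemma ex_CI_scal (c : C) (phi : R -> C) (a b : R) : ex_CI phi a b ->
  ex_CI (fun t => (c * phi t)%C) a b.
Proof.
  intros [H1 H2]; split; simpl.
  - exact (ex_RInt_minus _ _ _ _ (ex_RInt_scal _ _ _ (fst c) H1) (ex_RInt_scal _ _ _ (snd c) H2)).
  - exact (ex_RInt_plus _ _ _ _ (ex_RInt_scal _ _ _ (fst c) H2) (ex_RInt_scal _ _ _ (snd c) H1)).
Qed.

Lemma CI_scal (c : C) (phi : R -> C) (a b : R) : ex_CI phi a b ->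
  CI (fun t => (c * phi t)%C) a b = (c * CI phi a b)%C.
Proof.
  intros [H1 H2]. apply Ceq; simpl.
  - rewrite <- (RInt_scal (V := R_CompleteNormedModule) _ _ _ _ H1), <- (RInt_scal (V := R_CompleteNormedModule) _ _ _ _ H2).
    exact (RInt_minus _ _ _ _ (ex_RInt_scal _ _ _ (fst c) H1) (ex_RInt_scal _ _ _ (snd c) H2)).
  - rewrite <- (RInt_scal (V := R_CompleteNormedModule) _ _ _ _ H1), <- (RInt_scal (V := R_CompleteNormedModule) _ _ _ _ H2).
    exact (RInt_plus _ _ _ _ (ex_RInt_scal _ _ _ (fst c) H2) (ex_RInt_scal _ _ _ (snd c) H1)).
Qed.

Lemma ex_CI_minus (phi psi : R -> C) (a b : R) : ex_CI phi a b -> ex_CI psi a b ->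
  ex_CI (fun t => (phi t - psi t)%C) a b.
Proof.
  intros [H1 H2] [H3 H4]; split; simpl.
  - exact (ex_RInt_minus _ _ _ _ H1 H3).
  - exact (ex_RInt_minus _ _ _ _ H2 H4).
Qed.

Lemma CI_minus (phi psi : R -> C) (a b : R) : ex_CI phi a b -> ex_CI psi a b ->
  CI (fun t => (phi t - psi t)%C) a b = (CI phi a b - CI psi a b)%C.
Proof.
  intros [H1 H2] [H3 H4]. apply Ceq; simpl.
  - exact (RInt_minus _ _ _ _ H1 H3).
  - exact (RInt_minus _ _ _ _ H2 H4).
Qed.

Lemma CI_Chasles (phi : R -> C) (a b c : R) : ex_CI phi a b -> ex_CI phi b c ->
  CI phi a c = (CI phi a b + CI phi b c)%C.
Proof.
  intros [H1 H2] [H3 H4]. apply Ceq; simpl; symmetry.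
  - exact (RInt_Chasles _ _ _ _ H1 H3).
  - exact (RInt_Chasles _ _ _ _ H2 H4).
Qed.

Lemma CI_point (phi : R -> C) (a : R) : CI phi a a = RtoC 0.
Proof. unfold CI; rewrite !RInt_point; reflexivity. Qed.

Lemma CI_swap (phi : R -> C) (a b : R) : ex_CI phi a b -> CI phi a b = (- CI phi b a)%C.
Proof.
  intros [H1 H2].
  assert (H3 : ex_CI phi b a) by (split; apply ex_RInt_swap; auto).
  pose proof (CI_Chasles phi a b a (conj H1 H2) H3) as H.
  rewrite CI_point in H.
  replace (CI phi a b) with ((CI phi a b + CI phi b a) - CI phi b a)%C by ring.
  rewrite <- H; ring.
Qed.

Lemma abs_RInt_le_const_gen (f : R -> R) (a b M : R) : ex_RInt f a b ->
  (forall t, Rmin a b <= t <= Rmax a b -> Rabs (f t) <= M) ->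
  Rabs (RInt f a b) <= Rabs (b - a) * M.
Proof.
  intros He H. destruct (Rle_dec a b) as [Hab|Hab].
  - rewrite (Rabs_pos_eq (b - a)) by lra. apply abs_RInt_le_const; auto.
    intros t Ht; apply H. rewrite Rmin_left, Rmax_right; lra.
  - rewrite (Rabs_left (b - a)) by lra.
    rewrite <- (opp_RInt_swap (V := R_CompleteNormedModule)) by (apply ex_RInt_swap; auto).
    unfold opp; simpl. rewrite Rabs_Ropp.
    replace (- (b - a)) with (a - b) by ring.
    apply abs_RInt_le_const; try lra. apply ex_RInt_swap; auto.
    intros t Ht; apply H. rewrite Rmin_right, Rmax_left; lra.
Qed.

(** The factor 2 is the price of estimating real and imaginary parts separately. Only the order of
    magnitude matters later. *)
Lemma CI_bound (phi : R -> C) (a b M : R) : ex_CI phi a b ->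
  (forall t, Rmin a b <= t <= Rmax a b -> Cmod (phi t) <= M) ->
  Cmod (CI phi a b) <= 2 * M * Rabs (b - a).
Proof.
  intros [H1 H2] H.
  eapply Rle_trans; [apply Cmod_le_parts|]. simpl.
  pose proof (abs_RInt_le_const_gen _ a b M H1). pose proof (abs_RInt_le_const_gen _ a b M H2).
  pose proof (fun t Ht => Rle_trans _ _ _ (Cmod_fst (phi t)) (H t Ht)).
  pose proof (fun t Ht => Rle_trans _ _ _ (Cmod_snd (phi t)) (H t Ht)).
  specialize (H0 H4); specialize (H3 H5). lra.
Qed.

Lemma CI_FTC (phi dphi : R -> C) (a b : R) :
  (forall t, Rmin a b <= t <= Rmax a b ->
    is_derive (fun t => fst (phi t)) t (fst (dphi t)) /\
    is_derive (fun t => snd (phi t)) t (snd (dphi t))) ->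
  (forall t, Rmin a b <= t <= Rmax a b -> ccurve dphi t) ->
  CI dphi a b = (phi b - phi a)%C.
Proof.
  intros H1 H2. apply Ceq; simpl.
  - apply is_RInt_unique.
    apply (is_RInt_derive (fun t => fst (phi t)) (fun t => fst (dphi t))); intros t Ht.
    apply H1, Ht. apply continuity_pt_filterlim, (H2 t Ht).
  - apply is_RInt_unique.
    apply (is_RInt_derive (fun t => snd (phi t)) (fun t => snd (dphi t))); intros t Ht.
    apply H1, Ht. apply continuity_pt_filterlim, (H2 t Ht).
Qed.

Lemma CI_affine (A B : C) (a b : R) :
  ex_CI (fun t => (A + B * t)%C) a b /\
  CI (fun t => (A + B * t)%C) a b = (A * (b - a) + B * ((b * b - a * a) / 2))%C.
Proof.
  assert (Hc : forall t, ccurve (fun t => (A + B * t)%C) t).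
  { intros t; split; simpl; apply derivable_continuous_pt; apply ex_derive_Reals_0; auto_derive; auto. }
  split.
  - apply ex_CI_curve. intros; apply Hc.
  - rewrite (CI_FTC (fun t => (A * t + B * (t * t / 2))%C)).
    + apply Ceq; destruct A, B; simpl; field.
    + intros t _; destruct A, B; simpl; split; auto_derive; auto; field.
    + intros; apply Hc.
Qed.

(** The integral of [F(z) dz] along the boundary of the rectangle [[a,b] x [c,d]], counterclockwise;
    it changes sign when [a, b] or [c, d] are exchanged. *)
Definition mu (F : C -> C) (a b c d : R) : C :=
  (CI (fun t => F (t, c)) a b + Ci * CI (fun t => F (b, t)) c d
   - CI (fun t => F (t, d)) a b - Ci * CI (fun t => F (a, t)) c d)%C.

Definition rect_cont (F : C -> C) (a b c d : R) : Prop :=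
  forall x y, a <= x <= b -> c <= y <= d -> ccont F (x, y).

Lemma ccurve_h (F : C -> C) (x y : R) : ccont F (x, y) -> ccurve (fun t => F (t, y)) x.
Proof.
  intros H; split.
  - apply (rcont_1d (fun z => fst (F z)) (fun t => t) (fun _ => y)).
    apply ccont_fst, H. apply continuity_pt_id. apply continuity_pt_const; intros ? ?; auto.
  - apply (rcont_1d (fun z => snd (F z)) (fun t => t) (fun _ => y)).
    apply ccont_snd, H. apply continuity_pt_id. apply continuity_pt_const; intros ? ?; auto.
Qed.

Lemma ccurve_v (F : C -> C) (x y : R) : ccont F (x, y) -> ccurve (fun t => F (x, t)) y.
Proof.
  intros H; split.
  - apply (rcont_1d (fun z => fst (F z)) (fun _ => x) (fun t => t)).
    apply ccont_fst, H. apply continuity_pt_const; intros ? ?; auto. apply continuity_pt_id.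
  - apply (rcont_1d (fun z => snd (F z)) (fun _ => x) (fun t => t)).
    apply ccont_snd, H. apply continuity_pt_const; intros ? ?; auto. apply continuity_pt_id.
Qed.

Lemma ex_h (F : C -> C) (a b c d u v y : R) : rect_cont F a b c d ->
  a <= u <= v -> v <= b -> c <= y <= d -> ex_CI (fun t => F (t, y)) u v.
Proof.
  intros H Hu Hv Hy. apply ex_CI_curve. intros t Ht.
  rewrite Rmin_left, Rmax_right in Ht by lra. apply ccurve_h, H; lra.
Qed.

Lemma ex_v (F : C -> C) (a b c d u v x : R) : rect_cont F a b c d ->
  c <= u <= v -> v <= d -> a <= x <= b -> ex_CI (fun t => F (x, t)) u v.
Proof.
  intros H Hu Hv Hy. apply ex_CI_curve. intros t Ht.
  rewrite Rmin_left, Rmax_right in Ht by lra. apply ccurve_v, H; lra.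
Qed.

Lemma mu_split_x (F : C -> C) (a b c d m : R) : rect_cont F a b c d ->
  a <= m <= b -> c <= d -> mu F a b c d = (mu F a m c d + mu F m b c d)%C.
Proof.
  intros H Hm Hcd. unfold mu.
  rewrite (CI_Chasles (fun t => F (t, c)) a m b), (CI_Chasles (fun t => F (t, d)) a m b).
  ring. all: apply (ex_h F a b c d); auto; lra.
Qed.

Lemma mu_split_y (F : C -> C) (a b c d m : R) : rect_cont F a b c d ->
  c <= m <= d -> a <= b -> mu F a b c d = (mu F a b c m + mu F a b m d)%C.
Proof.
  intros H Hm Hcd. unfold mu.
  rewrite (CI_Chasles (fun t => F (b, t)) c m d), (CI_Chasles (fun t => F (a, t)) c m d).
  ring. all: apply (ex_v F a b c d); auto; lra.
Qed.

Lemma mu_ext (F G : C -> C) (a b c d : R) : (forall w, F w = G w) ->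
  mu F a b c d = mu G a b c d.
Proof.
  intros H. unfold mu.
  rewrite (CI_ext (fun t => F (t, c)) (fun t => G (t, c))),
    (CI_ext (fun t => F (t, d)) (fun t => G (t, d))),
    (CI_ext (fun t => F (a, t)) (fun t => G (a, t))),
    (CI_ext (fun t => F (b, t)) (fun t => G (b, t))) by auto.
  reflexivity.
Qed.

(** This removes the first-order Taylor polynomial in the proof of [goursat], leaving only the
    remainder to be estimated. *)
Lemma mu_affine (A B : C) (a b c d : R) : mu (fun w => (A + B * w)%C) a b c d = 0%C.
Proof.
  unfold mu.
  assert (Hh : forall y, CI (fun t => (A + B * ((t, y) : C))%C) a b
     = ((A + B * (Ci * y)) * (b - a) + B * ((b * b - a * a) / 2))%C).
  { intros y. rewrite <- (proj2 (CI_affine (A + B * (Ci * y)) B a b)).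
    apply CI_ext; intros t _. apply Ceq; destruct A, B; simpl; ring. }
  assert (Hv : forall x, CI (fun t => (A + B * ((x, t) : C))%C) c d
     = ((A + B * x) * (d - c) + (B * Ci) * ((d * d - c * c) / 2))%C).
  { intros y. rewrite <- (proj2 (CI_affine (A + B * y) (B * Ci) c d)).
    apply CI_ext; intros t _. apply Ceq; destruct A, B; simpl; ring. }
  rewrite !Hh, !Hv. apply Ceq; destruct A, B; simpl; field.
Qed.

Lemma mu_bound (F : C -> C) (a b c d M : R) : rect_cont F a b c d ->
  a <= b -> c <= d ->
  (forall x y, a <= x <= b -> c <= y <= d -> Cmod (F (x, y)) <= M) ->
  Cmod (mu F a b c d) <= 4 * M * ((b - a) + (d - c)).
Proof.
  intros H Hab Hcd HM. unfold mu.
  assert (Hh : forall y, c <= y <= d -> Cmod (CI (fun t => F (t, y)) a b) <= 2 * M * (b - a)).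
  { intros y Hy. rewrite <- (Rabs_pos_eq (b - a)) by lra. apply CI_bound.
    apply (ex_h F a b c d); auto; lra.
    intros t Ht. rewrite Rmin_left, Rmax_right in Ht by lra. apply HM; lra. }
  assert (Hv : forall x, a <= x <= b -> Cmod (CI (fun t => F (x, t)) c d) <= 2 * M * (d - c)).
  { intros y Hy. rewrite <- (Rabs_pos_eq (d - c)) by lra. apply CI_bound.
    apply (ex_v F a b c d); auto; lra.
    intros t Ht. rewrite Rmin_left, Rmax_right in Ht by lra. apply HM; lra. }
  pose proof (Hh c ltac:(lra)); pose proof (Hh d ltac:(lra)).
  pose proof (Hv a ltac:(lra)); pose proof (Hv b ltac:(lra)).
  unfold Cminus.
  eapply Rle_trans; [apply Cmod_triangle|]. rewrite Cmod_opp, Cmod_mult, Cmod_Ci.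
  eapply Rle_trans; [apply Rplus_le_compat_r, Cmod_triangle|]. rewrite Cmod_opp.
  eapply Rle_trans; [apply Rplus_le_compat_r, Rplus_le_compat_r, Cmod_triangle|].
  rewrite Cmod_mult, Cmod_Ci. lra.
Qed.

Lemma ccont_plus (F G : C -> C) (z : C) : ccont F z -> ccont G z ->
  ccont (fun w => (F w + G w)%C) z.
Proof.
  intros HF HG eps He.
  destruct (HF (eps / 2)) as [d1 [Hd1 H1]]; [lra|].
  destruct (HG (eps / 2)) as [d2 [Hd2 H2]]; [lra|].
  exists (Rmin d1 d2); split; [apply Rmin_pos; auto|]. intros w Hw.
  pose proof (Rmin_l d1 d2); pose proof (Rmin_r d1 d2).
  specialize (H1 w ltac:(lra)); specialize (H2 w ltac:(lra)).
  replace (F w + G w - (F z + G z))%C with ((F w - F z) + (G w - G z))%C by ring.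
  eapply Rle_lt_trans; [apply Cmod_triangle|]; lra.
Qed.

Lemma ccont_mult (F G : C -> C) (z : C) : ccont F z -> ccont G z ->
  ccont (fun w => (F w * G w)%C) z.
Proof.
  intros HF HG eps He.
  pose proof (Cmod_ge_0 (F z)); pose proof (Cmod_ge_0 (G z)).
  set (K := Cmod (F z) + Cmod (G z) + 1).
  assert (0 < K) by (unfold K; lra).
  assert (0 < eps / (2 * K)) by (apply Rdiv_lt_0_compat; lra).
  destruct (HF (Rmin 1 (eps / (2 * K)))) as [d1 [Hd1 H1']]; [apply Rmin_pos; lra|].
  destruct (HG (eps / (2 * K))) as [d2 [Hd2 H2']]; [lra|].
  exists (Rmin d1 d2); split; [apply Rmin_pos; auto|]. intros w Hw.
  pose proof (Rmin_l d1 d2); pose proof (Rmin_r d1 d2).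
  pose proof (Rmin_l 1 (eps / (2 * K))); pose proof (Rmin_r 1 (eps / (2 * K))).
  specialize (H1' w ltac:(lra)); specialize (H2' w ltac:(lra)).
  replace (F w * G w - F z * G z)%C with (F w * (G w - G z) + (F w - F z) * G z)%C by ring.
  eapply Rle_lt_trans; [apply Cmod_triangle|]. rewrite !Cmod_mult.
  pose proof (Cmod_triangle_sub (F w) (F z)).
  pose proof (Cmod_ge_0 (F w)). pose proof (Cmod_ge_0 (G w - G z)). pose proof (Cmod_ge_0 (F w - F z)).
  assert (Cmod (F w) <= Cmod (F z) + 1) by lra.
  assert (E : (Cmod (F z) + 1) * (eps / (2 * K)) + (eps / (2 * K)) * Cmod (G z) = eps / 2).
  { unfold K; field. unfold K in *; lra. }
  assert (Cmod (F w) * Cmod (G w - G z) <= (Cmod (F z) + 1) * (eps / (2 * K))) by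
    (apply Rmult_le_compat; lra).
  assert (Cmod (F w - F z) * Cmod (G z) <= (eps / (2 * K)) * Cmod (G z)) by
    (apply Rmult_le_compat_r; lra).
  lra.
Qed.

Lemma ccont_const (c z : C) : ccont (fun _ => c) z.
Proof. apply (cdiff_ccont _ _ _ (cdiff_const c z)). Qed.

Lemma ccont_id (z : C) : ccont (fun w => w) z.
Proof. apply (cdiff_ccont _ _ _ (cdiff_id z)). Qed.

Lemma ccont_scal (c : C) (F : C -> C) (z : C) : ccont F z -> ccont (fun w => (c * F w)%C) z.
Proof. intros H. apply (ccont_mult (fun _ => c)); auto. apply ccont_const. Qed.

Lemma ccont_minus (F G : C -> C) (z : C) : ccont F z -> ccont G z ->
  ccont (fun w => (F w - G w)%C) z.
Proof.
  intros HF HG eps He.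
  destruct (ccont_plus F (fun w => (- (1) * G w)%C) z HF (ccont_scal _ _ _ HG) eps He)
    as [d [Hd H]].
  exists d; split; auto. intros w Hw. specialize (H w Hw).
  replace (F w - G w - (F z - G z))%C with (F w + - (1) * G w - (F z + - (1) * G z))%C by ring.
  exact H.
Qed.

Lemma mu_plus (F G : C -> C) (a b c d : R) : a <= b -> c <= d ->
  rect_cont F a b c d -> rect_cont G a b c d ->
  mu (fun w => (F w + G w)%C) a b c d = (mu F a b c d + mu G a b c d)%C.
Proof.
  intros Hab Hcd HF HG. unfold mu.
  assert (Fh : forall y, c <= y <= d -> ex_CI (fun t => F (t, y)) a b) by
    (intros; apply (ex_h F a b c d); auto; lra).
  assert (Gh : forall y, c <= y <= d -> ex_CI (fun t => G (t, y)) a b) by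
    (intros; apply (ex_h G a b c d); auto; lra).
  assert (Fv : forall x, a <= x <= b -> ex_CI (fun t => F (x, t)) c d) by
    (intros; apply (ex_v F a b c d); auto; lra).
  assert (Gv : forall x, a <= x <= b -> ex_CI (fun t => G (x, t)) c d) by
    (intros; apply (ex_v G a b c d); auto; lra).
  rewrite (CI_plus _ _ a b (Fh c ltac:(lra)) (Gh c ltac:(lra))),
    (CI_plus _ _ a b (Fh d ltac:(lra)) (Gh d ltac:(lra))),
    (CI_plus _ _ c d (Fv a ltac:(lra)) (Gv a ltac:(lra))),
    (CI_plus _ _ c d (Fv b ltac:(lra)) (Gv b ltac:(lra))).
  ring.
Qed.

Lemma nested_intervals (u v : nat -> R) : (forall n, 0 <= v n) ->
  (forall n, u n <= u (S n) /\ u (S n) + v (S n) <= u n + v n) ->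
  exists X, forall n, u n <= X <= u n + v n.
Proof.
  intros Hv Hu.
  assert (Hk : forall n k, u n <= u (n + k)%nat /\ u (n + k)%nat + v (n + k)%nat <= u n + v n).
  { intros n; induction k; [rewrite Nat.add_0_r; lra|].
    rewrite Nat.add_succ_r. destruct (Hu (n + k)%nat). lra. }
  assert (B : forall m n, u m <= u n + v n).
  { intros m n. destruct (Nat.le_ge_cases n m) as [L|L].
    - replace m with (n + (m - n))%nat by lia. pose proof (Hk n (m - n)%nat).
      pose proof (Hv (n + (m - n))%nat). lra.
    - replace n with (m + (n - m))%nat by lia. pose proof (Hk m (n - m)%nat).
      pose proof (Hv (m + (n - m))%nat). lra. }
  destruct (completeness (fun x => exists n, x = u n)) as [X [X1 X2]].
  - exists (u O + v O). intros x [n ->]. apply B.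
  - exists (u O), O; auto.
  - exists X. intros n. split. apply X1; eauto. apply X2. intros x [m ->]. apply B.
Qed.

(* Bisection: if the boundary integral were nonzero, one of the quarters would carry at
   least a quarter of it at each stage, against the differentiability at the limit point. *)
Lemma goursat (F : C -> C) (a c W H : R) : 0 <= W -> 0 <= H ->
  (forall x y, a <= x <= a + W -> c <= y <= c + H -> exists l, cdiff F (x, y) l) ->
  mu F a (a + W) c (c + H) = 0%C.
Proof.
  intros HW HH HF.
  assert (HC : rect_cont F a (a + W) c (c + H)).
  { intros x y Hx Hy. destruct (HF x y Hx Hy) as [l Hl]. eapply cdiff_ccont, Hl. }
  set (w := fun n => W / 2 ^ n). set (h := fun n => H / 2 ^ n).
  assert (Hpow : forall n, 0 < 2 ^ n) by (intros; apply pow_lt; lra).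
  assert (HwS : forall n, w n = w (S n) + w (S n)).
  { intros n; unfold w; simpl; field. specialize (Hpow n); lra. }
  assert (HhS : forall n, h n = h (S n) + h (S n)).
  { intros n; unfold h; simpl; field. specialize (Hpow n); lra. }
  assert (Hw0 : forall n, 0 <= w n) by
    (intros n; unfold w; apply Rmult_le_pos; [lra|apply Rlt_le, Rinv_0_lt_compat, Hpow]).
  assert (Hh0 : forall n, 0 <= h n) by
    (intros n; unfold h; apply Rmult_le_pos; [lra|apply Rlt_le, Rinv_0_lt_compat, Hpow]).
  set (M := fun n p => Cmod (mu F (fst p) (fst p + w n) (snd p) (snd p + h n))).
  set (In := fun n (p : R * R) => a <= fst p /\ fst p + w n <= a + W /\
                         c <= snd p /\ snd p + h n <= c + H).
  set (step := fun n (p q : R * R) => In (S n) q /\ fst p <= fst q /\ fst q + w (S n) <= fst p + w n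
     /\ snd p <= snd q /\ snd q + h (S n) <= snd p + h n /\ M n p <= 4 * M (S n) q).
  assert (Hstep : forall n p, In n p -> exists q, step n p q).
  { intros n [x y] (I1 & I2 & I3 & I4); simpl in *.
    specialize (HwS n). specialize (HhS n).
    pose proof (Hw0 (S n)); pose proof (Hh0 (S n)).
    assert (HC' : rect_cont F x (x + w n) y (y + h n)) by (intros s t Hs Ht; apply HC; lra).
    assert (E : mu F x (x + w n) y (y + h n) =
      (mu F x (x + w (S n)) y (y + h (S n))
       + mu F (x + w (S n)) (x + w (S n) + w (S n)) y (y + h (S n))
       + (mu F x (x + w (S n)) (y + h (S n)) (y + h (S n) + h (S n))
       + mu F (x + w (S n)) (x + w (S n) + w (S n)) (y + h (S n)) (y + h (S n) + h (S n))))%C).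
    { rewrite (mu_split_y F x (x + w n) y (y + h n) (y + h (S n))) by (auto; lra).
      rewrite (mu_split_x F x (x + w n) y (y + h (S n)) (x + w (S n)));
        [|intros s t Hs Ht; apply HC'; lra|lra|lra].
      rewrite (mu_split_x F x (x + w n) (y + h (S n)) (y + h n) (x + w (S n)));
        [|intros s t Hs Ht; apply HC'; lra|lra|lra].
      rewrite HwS, HhS, !Rplus_assoc. reflexivity. }
    assert (T : M n (x, y) <= M (S n) (x, y) + M (S n) (x + w (S n), y)
       + (M (S n) (x, y + h (S n)) + M (S n) (x + w (S n), y + h (S n)))).
    { unfold M; simpl fst; simpl snd. rewrite E.
      eapply Rle_trans; [apply Cmod_triangle|].
      apply Rplus_le_compat; apply Cmod_triangle. }
    assert (K : forall q, (q = (x, y) \/ q = (x + w (S n), y) \/ q = (x, y + h (S n))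
        \/ q = (x + w (S n), y + h (S n))) -> M n (x, y) <= 4 * M (S n) q -> step n (x, y) q).
    { intros q Hq HM. unfold step, In.
      destruct Hq as [Hq | [Hq | [Hq | Hq]]]; subst q; simpl; repeat split; try lra; exact HM. }
    destruct (Rle_dec (M n (x, y)) (4 * M (S n) (x, y))); [exists (x, y); apply K; auto|].
    destruct (Rle_dec (M n (x, y)) (4 * M (S n) (x + w (S n), y))); [exists (x + w (S n), y); apply K; auto|].
    destruct (Rle_dec (M n (x, y)) (4 * M (S n) (x, y + h (S n)))); [exists (x, y + h (S n)); apply K; auto|].
    exists (x + w (S n), y + h (S n)); apply K; [auto|]. lra. }
  (* [epsilon] turns the existence of a good quarter into a sequence of lower left corners. *)
  set (p := fix p n : R * R := match n with
    | O => (a, c) | S n => epsilon (inhabits (0, 0)) (step n (p n)) end).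
  assert (Hp : forall n, In n (p n)).
  { induction n.
    - unfold In, w, h; simpl. lra.
    - simpl. pose proof (epsilon_spec (inhabits (0,0)) _ (Hstep n (p n) IHn)) as K. apply K. }
  assert (Hps : forall n, step n (p n) (p (S n))).
  { intros n. simpl. apply (epsilon_spec (inhabits (0,0)) _ (Hstep n (p n) (Hp n))). }
  assert (HM : forall n, M O (p O) <= 4 ^ n * M n (p n)).
  { induction n. simpl; lra. destruct (Hps n) as (_ & _ & _ & _ & _ & K).
    eapply Rle_trans; [exact IHn|]. simpl (4 ^ S n).
    assert (0 < 4 ^ n) by (apply pow_lt; lra). nra. }
  assert (Lim : exists X Y, forall n, fst (p n) <= X <= fst (p n) + w n /\
                            snd (p n) <= Y <= snd (p n) + h n).
  { destruct (nested_intervals (fun n => fst (p n)) w Hw0) as [X HX].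
    { intros n. destruct (Hps n) as (_ & K1 & K2 & _); auto. }
    destruct (nested_intervals (fun n => snd (p n)) h Hh0) as [Y HY].
    { intros n. destruct (Hps n) as (_ & _ & _ & K1 & K2 & _); auto. }
    exists X, Y. intros n; auto. }
  destruct Lim as (X & Y & HXY).
  assert (HXY0 := HXY O). unfold w, h in HXY0; simpl in HXY0.
  destruct (HF X Y) as [l Hl]; [lra|lra|].
  assert (Small : forall d, 0 < d -> exists n, w n + h n < d).
  { intros d Hd. destruct (pow_lt_1_zero (1 / 2)) with (y := d / (W + H + 1)) as [n Hn].
    rewrite Rabs_pos_eq; lra. apply Rdiv_lt_0_compat; lra.
    exists n. specialize (Hn n (le_n n)). unfold w, h.
    rewrite Rabs_pos_eq in Hn by (apply pow_le; lra).
    unfold Rdiv at 1 in Hn. rewrite Rmult_1_l, pow_inv in Hn.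
    apply Rle_lt_trans with ((W + H + 1) * / 2 ^ n).
    - pose proof (Rinv_0_lt_compat _ (Hpow n)). unfold Rdiv; nra.
    - apply Rlt_le_trans with ((W + H + 1) * (d / (W + H + 1))).
      apply Rmult_lt_compat_l; lra. right; field; lra. }
  (* On the rectangle of generation [n] the function differs from its affine part at the limit point
     by at most [eps * (w n + h n)], and the perimeter is again of size [w n + h n = (W + H) / 2^n].
     The factor [4^n] cancels exactly. *)
  assert (Key : forall eps, 0 < eps -> M O (p O) <= 4 * eps * (W + H) ^ 2).
  { intros eps He. destruct (Hl eps He) as [d [Hd Hd']].
    destruct (Small d Hd) as [n Hn].
    destruct (HXY n) as [HX HY]. destruct (Hp n) as (I1 & I2 & I3 & I4).
    set (x := fst (p n)) in *; set (y := snd (p n)) in *.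
    pose (z := (X, Y) : C).
    assert (HE : rect_cont (fun v => (F v - F z - l * (v - z))%C) x (x + w n) y (y + h n)).
    { intros s t Hs Ht. apply ccont_minus; [apply ccont_minus; [apply HC; lra|apply ccont_const]|].
      apply ccont_scal, ccont_minus; [apply ccont_id|apply ccont_const]. }
    assert (E : M n (p n) <= 4 * (eps * (w n + h n)) * ((x + w n - x) + (y + h n - y))).
    { unfold M. fold x y.
      replace (mu F x (x + w n) y (y + h n)) with
        (mu (fun v => (F v - F z - l * (v - z) + ((F z - l * z) + l * v))%C) x (x + w n) y (y + h n)).
      - rewrite mu_plus; [|pose proof (Hw0 n); lra|pose proof (Hh0 n); lra| |].
        + rewrite mu_affine, Cplus_0_r. 
          apply mu_bound; [exact HE|pose proof (Hw0 n); lra|pose proof (Hh0 n); lra|].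
          intros s t Hs Ht.
          assert (Hst : Cmod (((s, t) : C) - z) <= w n + h n).
          { eapply Rle_trans; [apply Cmod_le_parts|]. simpl.
            apply Rplus_le_compat; apply Rabs_le; lra. }
          eapply Rle_trans; [apply Hd'; eapply Rle_lt_trans; [exact Hst|exact Hn]|].
          apply Rmult_le_compat_l; [lra|exact Hst].
        + exact HE.
        + intros s t Hs Ht. apply ccont_plus; [apply ccont_const|]. apply ccont_scal, ccont_id.
      - apply mu_ext; intros v; cbv beta; ring. }
    eapply Rle_trans; [apply (HM n)|].
    replace (4 * eps * (W + H) ^ 2) with (4 ^ n * (4 * (eps * (w n + h n)) * ((x + w n - x) + (y + h n - y)))).
    apply Rmult_le_compat_l; auto. apply pow_le; lra.
    unfold w, h. replace 4 with (2 * 2) at 1 by ring. rewrite Rpow_mult_distr. field.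
    specialize (Hpow n); lra. }
  apply Cmod_eq_0. 
  assert (E0 : M O (p O) = Cmod (mu F a (a + W) c (c + H))).
  { unfold M, w, h; simpl. rewrite !Rdiv_1_r. reflexivity. }
  rewrite <- E0. apply Rle_antisym; [|apply Cmod_ge_0].
  apply Rnot_lt_le; intros Hlt.
  assert (0 <= (W + H) ^ 2) by (apply pow2_ge_0).
  (* With this [eps] the bound becomes at most half of [M O (p O)] itself. The added 1 covers a
     rectangle degenerate to a point. *)
  specialize (Key (M O (p O) / (8 * ((W + H) ^ 2 + 1)))).
  assert (0 < M O (p O) / (8 * ((W + H) ^ 2 + 1))) by (apply Rdiv_lt_0_compat; lra).
  specialize (Key H1).
  assert (4 * (M O (p O) / (8 * ((W + H) ^ 2 + 1))) * ((W + H) ^ 2 + 1) = M O (p O) / 2) by (field; lra).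
  nra.
Qed.

(** * Primitives and curves *)

Lemma mu_swap_x (F : C -> C) (a b c d : R) :
  ex_CI (fun t => F (t, c)) a b -> ex_CI (fun t => F (t, d)) a b ->
  mu F a b c d = (- mu F b a c d)%C.
Proof.
  intros H1 H2. unfold mu. rewrite (CI_swap _ a b H1), (CI_swap _ a b H2). ring.
Qed.

Lemma mu_swap_y (F : C -> C) (a b c d : R) :
  ex_CI (fun t => F (a, t)) c d -> ex_CI (fun t => F (b, t)) c d ->
  mu F a b c d = (- mu F a b d c)%C.
Proof.
  intros H1 H2. unfold mu. rewrite (CI_swap _ c d H1), (CI_swap _ c d H2). ring.
Qed.

(** Corners in any order: the primitive below integrates from the origin to a point of an arbitrary
    quadrant. *)
Lemma goursat_gen (F : C -> C) (a b c d : R) :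
  (forall x y, Rmin a b <= x <= Rmax a b -> Rmin c d <= y <= Rmax c d ->
     exists l, cdiff F (x, y) l) ->
  mu F a b c d = 0%C.
Proof.
  intros H.
  assert (Hh : forall y, Rmin c d <= y <= Rmax c d -> ex_CI (fun t => F (t, y)) a b).
  { intros y Hy. apply ex_CI_curve. intros t Ht. apply ccurve_h.
    destruct (H t y Ht Hy) as [l Hl]; eapply cdiff_ccont, Hl. }
  assert (Hv : forall x, Rmin a b <= x <= Rmax a b -> ex_CI (fun t => F (x, t)) c d).
  { intros y Hy. apply ex_CI_curve. intros t Ht. apply ccurve_v.
    destruct (H y t Hy Ht) as [l Hl]; eapply cdiff_ccont, Hl. }
  assert (G : forall a b c d, a <= b -> c <= d ->
    (forall x y, a <= x <= b -> c <= y <= d -> exists l, cdiff F (x, y) l) ->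
    mu F a b c d = 0%C).
  { clear. intros a b c d Hab Hcd H.
    replace b with (a + (b - a)) by ring. replace d with (c + (d - c)) by ring.
    apply goursat; try lra. intros x y Hx Hy; apply H; lra. }
  pose proof (Rmin_l a b); pose proof (Rmin_r a b); pose proof (Rmax_l a b); pose proof (Rmax_r a b).
  pose proof (Rmin_l c d); pose proof (Rmin_r c d); pose proof (Rmax_l c d); pose proof (Rmax_r c d).
  assert (Hv' : forall x, Rmin a b <= x <= Rmax a b -> ex_CI (fun t => F (x, t)) d c).
  { intros x Hx; destruct (Hv x Hx); split; apply ex_RInt_swap; auto. }
  destruct (Rle_dec a b) as [Hab|Hab]; destruct (Rle_dec c d) as [Hcd|Hcd].
  - apply G; auto. intros x y Hx Hy; apply H; rewrite ?Rmin_left, ?Rmax_right; lra.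
  - rewrite mu_swap_y by (apply Hv; lra).
    rewrite G; [ring|lra|lra|]. intros x y Hx Hy; apply H; lra.
  - rewrite mu_swap_x by (apply Hh; lra).
    rewrite G; [ring|lra|lra|]. intros x y Hx Hy; apply H; lra.
  - rewrite mu_swap_x by (apply Hh; lra). rewrite mu_swap_y by (apply Hv; lra).
    rewrite G; [ring|lra|lra|]. intros x y Hx Hy; apply H; lra.
Qed.

Lemma Cmod_mono (x y x' y' : R) : Rabs x <= Rabs x' -> Rabs y <= Rabs y' ->
  Cmod (x, y) <= Cmod (x', y').
Proof.
  intros Hx Hy. unfold Cmod; simpl fst; simpl snd. apply sqrt_le_1_alt.
  rewrite <- (pow2_abs x), <- (pow2_abs x'), <- (pow2_abs y), <- (pow2_abs y').
  pose proof (Rabs_pos x); pose proof (Rabs_pos y).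
  apply Rplus_le_compat; apply pow_incr; lra.
Qed.

Lemma Rabs_between (a b t : R) : Rmin a b <= t <= Rmax a b ->
  Rabs t <= Rabs a \/ Rabs t <= Rabs b.
Proof.
  unfold Rmin, Rmax. destruct (Rle_dec a b); intros H; unfold Rabs;
    destruct (Rcase_abs t), (Rcase_abs a), (Rcase_abs b); lra.
Qed.

Lemma Cmod_between_h (x x' y t rho : R) : Cmod (x, y) < rho -> Cmod (x', y) < rho ->
  Rmin x x' <= t <= Rmax x x' -> Cmod (t, y) < rho.
Proof.
  intros H1 H2 Ht. destruct (Rabs_between _ _ _ Ht) as [K|K];
    eapply Rle_lt_trans; [apply Cmod_mono; [exact K|apply Rle_refl]|auto
      |apply Cmod_mono; [exact K|apply Rle_refl]|auto].
Qed.

Lemma Cmod_between_v (x y y' t rho : R) : Cmod (x, y) < rho -> Cmod (x, y') < rho ->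
  Rmin y y' <= t <= Rmax y y' -> Cmod (x, t) < rho.
Proof.
  intros H1 H2 Ht. destruct (Rabs_between _ _ _ Ht) as [K|K];
    eapply Rle_lt_trans; [apply Cmod_mono; [apply Rle_refl|exact K]|auto
      |apply Cmod_mono; [apply Rle_refl|exact K]|auto].
Qed.

Lemma adisc_ccont (rho : R) (F : C -> C) (z : C) : adisc rho F -> Cmod z < rho -> ccont F z.
Proof. intros H Hz; destruct (H z Hz) as [l Hl]; eapply cdiff_ccont, Hl. Qed.

Lemma ex_CI_const (c : C) (a b : R) : ex_CI (fun _ => c) a b.
Proof. split; apply ex_RInt_const. Qed.

Lemma CI_const (c : C) (a b : R) : CI (fun _ => c) a b = (c * (b - a))%C.
Proof.
  unfold CI. rewrite !RInt_const. unfold scal; simpl; unfold mult; simpl.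
  apply Ceq; simpl; ring.
Qed.

(** The primitive integrates [F] from 0 along the real axis and then vertically. By Goursat the path
    that runs vertically first gives the same value ([Alt]). The first form yields vertical
    increments, the second horizontal ones. The rectangle spanned by 0 and a point of the disc stays
    in the disc. *)
Lemma primitive_exists (rho : R) (F : C -> C) : adisc rho F ->
  exists H, forall z, Cmod z < rho -> cdiff H z (F z).
Proof.
  intros HF.
  set (H := fun z : C => (CI (fun t => F (t, 0)) 0 (fst z) + Ci * CI (fun s => F (fst z, s)) 0 (snd z))%C).
  exists H.
  assert (Ch : forall x x' y, Cmod (x, y) < rho -> Cmod (x', y) < rho -> ex_CI (fun t => F (t, y)) x x').
  { intros x x' y H1 H2. apply ex_CI_curve. intros t Ht. apply ccurve_h.
    eapply adisc_ccont; eauto. apply (Cmod_between_h x x' y); auto. }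
  assert (Cv : forall x y y', Cmod (x, y) < rho -> Cmod (x, y') < rho -> ex_CI (fun t => F (x, t)) y y').
  { intros x y y' H1 H2. apply ex_CI_curve. intros t Ht. apply ccurve_v.
    eapply adisc_ccont; eauto. apply (Cmod_between_v x y y'); auto. }
  assert (Z : forall x y, Rabs 0 <= Rabs x /\ Rabs 0 <= Rabs y).
  { intros; rewrite Rabs_R0; split; apply Rabs_pos. }
  assert (Hx : forall x y, Cmod (x, y) < rho -> Cmod (x, 0) < rho).
  { intros x y Hxy. eapply Rle_lt_trans; [|exact Hxy]. apply Cmod_mono; [lra|apply (Z x y)]. }
  assert (Hy : forall x y, Cmod (x, y) < rho -> Cmod (0, y) < rho).
  { intros x y Hxy. eapply Rle_lt_trans; [|exact Hxy]. apply Cmod_mono; [apply (Z x y)|lra]. }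
  assert (Alt : forall x y, Cmod (x, y) < rho ->
    H (x, y) = (CI (fun t => F (t, y)) 0 x + Ci * CI (fun s => F (0, s)) 0 y)%C).
  { intros x y Hxy. unfold H; simpl fst; simpl snd.
    assert (M : mu F 0 x 0 y = 0%C).
    { apply goursat_gen. intros s t Hs Ht. apply HF.
      apply (Cmod_between_h 0 x); [| |exact Hs]; apply (Cmod_between_v _ 0 y); eauto. }
    unfold mu in M.
    match goal with |- ?L = ?R => replace L with (L - R + R)%C by ring end.
    match goal with |- (?L - ?R + ?R)%C = _ => replace (L - R)%C with (RtoC 0) end. ring.
    rewrite <- M; ring. }
  intros [x y] Hz eps He.
  (* A quarter of [eps]: the increment consists of two segments, and [CI_bound] loses a factor 2 on
     each. *)
  destruct (adisc_ccont _ _ _ HF Hz (eps / 4)) as [d [Hd Hc]]; [lra|].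
  exists (Rmin d (rho - Cmod (x, y))). split; [apply Rmin_pos; lra|].
  intros [x' y'] Hw.
  pose proof (Rmin_l d (rho - Cmod (x, y))); pose proof (Rmin_r d (rho - Cmod (x, y))).
  set (a := Cmod ((x', y') - (x, y))) in *.
  assert (Ha1 : Rabs (x' - x) <= a) by apply (Cmod_fst ((x', y') - (x, y))%C).
  assert (Ha2 : Rabs (y' - y) <= a) by apply (Cmod_snd ((x', y') - (x, y))%C).
  assert (near : forall w, Cmod (w - (x, y)) <= a -> Cmod w < rho /\ Cmod (F w - F (x, y)) <= eps / 4).
  { intros w Hw'. split. pose proof (Cmod_triangle_sub w (x, y)); lra. apply Rlt_le, Hc; lra. }
  assert (In' : Cmod (x', y') < rho) by (apply near; unfold a; lra).
  assert (Hm : Cmod (x', y) < rho).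
  { apply near. unfold Cminus, Cplus, Copp; simpl. unfold a, Cminus, Cplus, Copp; simpl.
    apply Cmod_mono; [lra|]. rewrite Rplus_opp_r, Rabs_R0; apply Rabs_pos. }
  assert (E1 : (H (x', y') - H (x', y) = Ci * CI (fun s => F (x', s)) y y')%C).
  { unfold H; simpl fst; simpl snd.
    rewrite (CI_Chasles (fun s => F (x', s)) 0 y y') by (apply Cv; eauto). ring. }
  assert (E2 : (H (x', y) - H (x, y) = CI (fun t => F (t, y)) x x')%C).
  { rewrite !Alt by auto.
    rewrite (CI_Chasles (fun t => F (t, y)) 0 x x') by (apply Ch; eauto). ring. }
  replace (H (x', y') - H (x, y))%C with
    ((H (x', y') - H (x', y)) + (H (x', y) - H (x, y)))%C by ring.
  rewrite E1, E2.
  replace (Ci * CI (fun s => F (x', s)) y y' + CI (fun t => F (t, y)) x x'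
    - F (x, y) * ((x', y') - (x, y)))%C with
   (Ci * CI (fun s => (F (x', s) - F (x, y))%C) y y' + CI (fun t => (F (t, y) - F (x, y))%C) x x')%C.
  2:{ rewrite !CI_minus, !CI_const; auto using ex_CI_const.
      apply Ceq; simpl; ring. }
  eapply Rle_trans; [apply Cmod_triangle|]. rewrite Cmod_mult, Cmod_Ci, Rmult_1_l.
  assert (B1 : Cmod (CI (fun s => (F (x', s) - F (x, y))%C) y y') <= 2 * (eps / 4) * Rabs (y' - y)).
  { apply CI_bound. apply ex_CI_minus; auto using ex_CI_const.
    intros t Ht. apply near. unfold a, Cminus, Cplus, Copp; simpl. apply Cmod_mono; [lra|].
    revert Ht; unfold Rmin, Rmax, Rabs; destruct (Rle_dec y y'), (Rcase_abs (t + - y)), (Rcase_abs (y' + - y)); lra. }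
  assert (B2 : Cmod (CI (fun t => (F (t, y) - F (x, y))%C) x x') <= 2 * (eps / 4) * Rabs (x' - x)).
  { apply CI_bound. apply ex_CI_minus; auto using ex_CI_const.
    intros t Ht. apply near. unfold a, Cminus, Cplus, Copp; simpl. apply Cmod_mono.
    revert Ht; unfold Rmin, Rmax, Rabs; destruct (Rle_dec x x'), (Rcase_abs (t + - x)), (Rcase_abs (x' + - x)); lra.
    rewrite Rplus_opp_r, Rabs_R0; apply Rabs_pos. }
  nra.
Qed.

Definition rcd (g : R -> C) (t : R) (l : C) : Prop :=
  is_derive (fun t => fst (g t)) t (fst l) /\ is_derive (fun t => snd (g t)) t (snd l).

Lemma rcd_eq (g : R -> C) (t : R) (l m : C) : l = m -> rcd g t l -> rcd g t m.
Proof. intros ->; auto. Qed.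

Lemma rcd_const (c : C) (t : R) : rcd (fun _ => c) t 0.
Proof. split; simpl; auto_derive; auto. Qed.

Lemma rcd_plus (f g : R -> C) (t : R) (l m : C) : rcd f t l -> rcd g t m ->
  rcd (fun t => (f t + g t)%C) t (l + m).
Proof.
  intros [H1 H2] [H3 H4]; split; simpl.
  - exact (is_derive_plus _ _ _ _ _ H1 H3).
  - exact (is_derive_plus _ _ _ _ _ H2 H4).
Qed.

Lemma is_derive_Rmult (f g : R -> R) (t l m : R) : is_derive f t l -> is_derive g t m ->
  is_derive (fun t => f t * g t) t (l * g t + f t * m).
Proof.
  intros H1 H2. exact (is_derive_mult f g t l m H1 H2 Rmult_comm).
Qed.

Lemma rcd_mult (f g : R -> C) (t : R) (l m : C) : rcd f t l -> rcd g t m ->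
  rcd (fun t => (f t * g t)%C) t (l * g t + f t * m).
Proof.
  intros [H1 H2] [H3 H4]; split; simpl.
  - replace (fst l * fst (g t) - snd l * snd (g t) + (fst (f t) * fst m - snd (f t) * snd m)) with
     ((fst l * fst (g t) + fst (f t) * fst m) - (snd l * snd (g t) + snd (f t) * snd m)) by ring.
    exact (is_derive_minus _ _ _ _ _ (is_derive_Rmult _ _ _ _ _ H1 H3) (is_derive_Rmult _ _ _ _ _ H2 H4)).
  - replace (fst l * snd (g t) + snd l * fst (g t) + (fst (f t) * snd m + snd (f t) * fst m)) with
     ((fst l * snd (g t) + fst (f t) * snd m) + (snd l * fst (g t) + snd (f t) * fst m)) by ring.
    exact (is_derive_plus _ _ _ _ _ (is_derive_Rmult _ _ _ _ _ H1 H4) (is_derive_Rmult _ _ _ _ _ H2 H3)).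
Qed.

Lemma rcd_scal (c : C) (g : R -> C) (t : R) (l : C) : rcd g t l ->
  rcd (fun t => (c * g t)%C) t (c * l).
Proof.
  intros H. eapply rcd_eq; [|apply rcd_mult; [apply rcd_const|exact H]]. cbv beta; ring.
Qed.

Lemma is_derive_eps (f : R -> R) (t l : R) : is_derive f t l <->
  forall eps, 0 < eps -> exists d, 0 < d /\ forall s, Rabs (s - t) < d ->
    Rabs (f s - f t - l * (s - t)) <= eps * Rabs (s - t).
Proof.
  rewrite is_derive_Reals. split.
  - intros H eps He. destruct (H eps He) as [d Hd]. exists d; split; [apply cond_pos|].
    intros s Hs. destruct (Req_dec s t) as [->|Hst].
    { rewrite !Rminus_diag, Rmult_0_r, Rminus_0_r, Rabs_R0. lra. }
    specialize (Hd (s - t) ltac:(lra) Hs).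
    replace (t + (s - t)) with s in Hd by ring.
    replace (f s - f t - l * (s - t)) with (((f s - f t) / (s - t) - l) * (s - t)) by (field; lra).
    rewrite Rabs_mult. apply Rmult_le_compat_r; [apply Rabs_pos|lra].
  - intros H eps He. destruct (H (eps / 2)) as [d [Hd Hs]]; [lra|].
    exists (mkposreal d Hd). intros h Hh Hhd. simpl in Hhd.
    specialize (Hs (t + h)). replace (t + h - t) with h in Hs by ring.
    specialize (Hs Hhd).
    replace ((f (t + h) - f t) / h - l) with ((f (t + h) - f t - l * h) / h) by (field; auto).
    unfold Rdiv; rewrite Rabs_mult, Rabs_inv.
    pose proof (Rabs_pos_lt h Hh).
    apply Rle_lt_trans with (eps / 2 * Rabs h * / Rabs h).
    apply Rmult_le_compat_r; [apply Rlt_le, Rinv_0_lt_compat; auto|auto].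
    replace (eps / 2 * Rabs h * / Rabs h) with (eps / 2) by (field; lra). lra.
Qed.

Lemma rcd_eps (g : R -> C) (t : R) (l : C) : rcd g t l <->
  forall eps, 0 < eps -> exists d, 0 < d /\ forall s, Rabs (s - t) < d ->
    Cmod (g s - g t - l * (s - t)) <= eps * Rabs (s - t).
Proof.
  split.
  - intros [H1 H2] eps He.
    destruct (proj1 (is_derive_eps _ _ _) H1 (eps / 2)) as [d1 [Hd1 K1]]; [lra|].
    destruct (proj1 (is_derive_eps _ _ _) H2 (eps / 2)) as [d2 [Hd2 K2]]; [lra|].
    exists (Rmin d1 d2); split; [apply Rmin_pos; auto|]. intros s Hs.
    pose proof (Rmin_l d1 d2); pose proof (Rmin_r d1 d2).
    specialize (K1 s ltac:(lra)); specialize (K2 s ltac:(lra)).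
    eapply Rle_trans; [apply Cmod_le_parts|]. simpl.
    replace (fst (g s) + - fst (g t) + - (fst l * (s + - t) - snd l * (0 + - 0))) with
      (fst (g s) - fst (g t) - fst l * (s - t)) by ring.
    replace (snd (g s) + - snd (g t) + - (fst l * (0 + - 0) + snd l * (s + - t))) with
      (snd (g s) - snd (g t) - snd l * (s - t)) by ring.
    lra.
  - intros H; split; apply is_derive_eps; intros eps He;
      destruct (H eps He) as [d [Hd K]]; exists d; split; auto; intros s Hs;
      specialize (K s Hs); eapply Rle_trans; [|exact K| |exact K].
    + eapply Rle_trans; [|apply Cmod_fst]. simpl. right; f_equal; ring.
    + eapply Rle_trans; [|apply Cmod_snd]. simpl. right; f_equal; ring.
Qed.

Lemma rcd_comp (F : C -> C) (g : R -> C) (t : R) (l m : C) : rcd g t l -> cdiff F (g t) m ->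
  rcd (fun s => F (g s)) t (m * l).
Proof.
  intros Hg HF. apply rcd_eps. pose proof (proj1 (rcd_eps _ _ _) Hg) as Hg'.
  intros eps He. pose proof (Cmod_ge_0 l); pose proof (Cmod_ge_0 m).
  destruct (HF (eps / 2 / (Cmod l + 1))) as [d1 [Hd1 K1]]; [repeat apply Rdiv_lt_0_compat; lra|].
  destruct (Hg' (Rmin 1 (eps / 2 / (Cmod m + 1)))) as [d2 [Hd2 K2]].
  { apply Rmin_pos; repeat apply Rdiv_lt_0_compat; lra. }
  exists (Rmin d2 (d1 / (Cmod l + 1))).
  split; [apply Rmin_pos; [auto|apply Rdiv_lt_0_compat; lra]|].
  intros s Hs.
  pose proof (Rmin_l d2 (d1 / (Cmod l + 1))); pose proof (Rmin_r d2 (d1 / (Cmod l + 1))).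
  pose proof (Rmin_l 1 (eps / 2 / (Cmod m + 1))); pose proof (Rmin_r 1 (eps / 2 / (Cmod m + 1))).
  specialize (K2 s ltac:(lra)).
  pose proof (Rabs_pos (s - t)).
  assert (L : Cmod (g s - g t) <= (Cmod l + 1) * Rabs (s - t)).
  { replace (g s - g t)%C with ((g s - g t - l * (s - t)) + l * (s - t))%C by ring.
    eapply Rle_trans; [apply Cmod_triangle|]. rewrite Cmod_mult, <- RtoC_minus, Cmod_R. rewrite <- RtoC_minus in K2. nra. }
  assert (L2 : Cmod (g s - g t) < d1).
  { eapply Rle_lt_trans; [exact L|].
    apply Rlt_le_trans with ((Cmod l + 1) * (d1 / (Cmod l + 1))).
    apply Rmult_lt_compat_l; lra. right; field; lra. }
  specialize (K1 _ L2).
  replace (F (g s) - F (g t) - m * l * (s - t))%C with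
    ((F (g s) - F (g t) - m * (g s - g t)) + m * (g s - g t - l * (s - t)))%C by ring.
  eapply Rle_trans; [apply Cmod_triangle|]. rewrite (Cmod_mult m).
  assert (eps / 2 / (Cmod l + 1) * Cmod (g s - g t) <= eps / 2 * Rabs (s - t)).
  { apply Rle_trans with (eps / 2 / (Cmod l + 1) * ((Cmod l + 1) * Rabs (s - t))).
    apply Rmult_le_compat_l; auto. apply Rlt_le; repeat apply Rdiv_lt_0_compat; lra.
    right; field; lra. }
  assert (Cmod m * Cmod (g s - g t - l * (s - t)) <= eps / 2 * Rabs (s - t)).
  { apply Rle_trans with ((Cmod m + 1) * (eps / 2 / (Cmod m + 1) * Rabs (s - t))).
    apply Rmult_le_compat; try apply Cmod_ge_0; try lra.
    eapply Rle_trans; [exact K2|]. apply Rmult_le_compat_r; lra.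
    right; field; lra. }
  lra.
Qed.

Lemma is_derive_cpt (f : R -> R) (t l : R) : is_derive f t l -> continuity_pt f t.
Proof.
  intros H. apply continuity_pt_filterlim.
  apply (ex_derive_continuous (K := R_AbsRing) (V := R_NormedModule)). exists l; exact H.
Qed.

Lemma rcd_ccurve (g : R -> C) (t : R) (l : C) : rcd g t l -> ccurve g t.
Proof. intros [H1 H2]; split; eapply is_derive_cpt; eauto. Qed.

(** * Joint continuity in two real variables and differentiation under the integral *)

Definition c2d (P : R -> R -> C) (x y : R) : Prop :=
  continuity_2d_pt (fun x y => fst (P x y)) x y /\
  continuity_2d_pt (fun x y => snd (P x y)) x y.

Lemma c2d_const (c : C) (x y : R) : c2d (fun _ _ => c) x y.
Proof. split; apply continuity_2d_pt_const. Qed.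

Lemma c2d_plus (P Q : R -> R -> C) (x y : R) : c2d P x y -> c2d Q x y ->
  c2d (fun x y => (P x y + Q x y)%C) x y.
Proof. intros [H1 H2] [H3 H4]; split; apply continuity_2d_pt_plus; auto. Qed.

Lemma c2d_minus (P Q : R -> R -> C) (x y : R) : c2d P x y -> c2d Q x y ->
  c2d (fun x y => (P x y - Q x y)%C) x y.
Proof. intros [H1 H2] [H3 H4]; split; apply continuity_2d_pt_minus; auto. Qed.

Lemma c2d_mult (P Q : R -> R -> C) (x y : R) : c2d P x y -> c2d Q x y ->
  c2d (fun x y => (P x y * Q x y)%C) x y.
Proof.
  intros [H1 H2] [H3 H4]; split; simpl.
  - apply continuity_2d_pt_minus; apply continuity_2d_pt_mult; auto.
  - apply continuity_2d_pt_plus; apply continuity_2d_pt_mult; auto.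
Qed.

Lemma rcont_c2d (u : C -> R) (P : R -> R -> C) (x y : R) : rcont u (P x y) -> c2d P x y ->
  continuity_2d_pt (fun x y => u (P x y)) x y.
Proof.
  intros Hu [H1 H2].
  apply (continuity_2d_pt_ext (fun x y => u (fst (P x y), snd (P x y)))).
  - intros s t. destruct (P s t); auto.
  - apply (rcont_2d u (fun x y => fst (P x y)) (fun x y => snd (P x y))); auto.
    destruct (P x y); auto.
Qed.

Lemma ccont_c2d (F : C -> C) (P : R -> R -> C) (x y : R) : ccont F (P x y) -> c2d P x y ->
  c2d (fun x y => F (P x y)) x y.
Proof.
  intros HF HP; split.
  - apply (rcont_c2d (fun z => fst (F z))); auto. apply ccont_fst, HF.
  - apply (rcont_c2d (fun z => snd (F z))); auto. apply ccont_snd, HF.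
Qed.

Lemma c2d_snd (g : R -> C) (x y : R) : ccurve g y -> c2d (fun _ t => g t) x y.
Proof.
  intros [H1 H2]; split.
  - apply (continuity_1d_2d_snd (fun t => fst (g t))), H1.
  - apply (continuity_1d_2d_snd (fun t => snd (g t))), H2.
Qed.

Lemma c2d_fst (g : R -> C) (x y : R) : ccurve g x -> c2d (fun t _ => g t) x y.
Proof.
  intros [H1 H2]; split.
  - apply (continuity_1d_2d_fst (fun t => fst (g t))), H1.
  - apply (continuity_1d_2d_fst (fun t => snd (g t))), H2.
Qed.

Lemma c2d_ccurve (P : R -> R -> C) (x y : R) : c2d P x y -> ccurve (P x) y.
Proof.
  intros [H1 H2]; split.
  - apply (continuity_2d_1d_snd (fun x y => fst (P x y))), H1.
  - apply (continuity_2d_1d_snd (fun x y => snd (P x y))), H2.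
Qed.

Lemma ccurve_comp (F : C -> C) (g : R -> C) (t : R) : ccont F (g t) -> ccurve g t ->
  ccurve (fun t => F (g t)) t.
Proof.
  intros HF Hg. apply (c2d_ccurve (fun _ t => F (g t)) 0).
  apply (ccont_c2d F (fun _ t => g t)); auto. apply c2d_snd, Hg.
Qed.

Lemma ccurve_mult (f g : R -> C) (t : R) : ccurve f t -> ccurve g t ->
  ccurve (fun t => (f t * g t)%C) t.
Proof.
  intros Hf Hg. apply (c2d_ccurve (fun _ t => (f t * g t)%C) 0).
  apply c2d_mult; apply c2d_snd; auto.
Qed.

Lemma rcont_ccurve (u : C -> R) (g : R -> C) (t : R) : rcont u (g t) -> ccurve g t ->
  continuity_pt (fun t => u (g t)) t.
Proof.
  intros Hu Hg. apply (continuity_2d_1d_snd (fun _ t => u (g t)) 0).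
  apply (rcont_c2d u (fun _ t => g t)); auto. apply c2d_snd, Hg.
Qed.

Lemma RInt_param_derive (f df : R -> R -> R) (a b x d : R) : 0 < d ->
  (forall u t, Rabs (u - x) < d -> is_derive (fun u => f u t) u (df u t)) ->
  (forall t, continuity_2d_pt df x t) ->
  (forall u, Rabs (u - x) < d -> ex_RInt (f u) a b) ->
  is_derive (fun u => RInt (f u) a b) x (RInt (df x) a b).
Proof.
  intros Hd H1 H2 H3.
  rewrite (RInt_ext (df x) (fun t => Derive (fun u => f u t) x)).
  2:{ intros t _. symmetry. apply is_derive_unique, H1. rewrite Rminus_diag, Rabs_R0; auto. }
  apply is_derive_RInt_param.
  - exists (mkposreal d Hd). intros u Hu t _. exists (df u t). apply H1, Hu.
  - intros t _. apply (continuity_2d_pt_ext_loc df); auto.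
    exists (mkposreal d Hd). intros u v Hu Hv. symmetry. apply is_derive_unique, H1, Hu.
  - exists (mkposreal d Hd). intros u Hu. apply H3, Hu.
Qed.

Lemma CI_param_derive (P dP : R -> R -> C) (a b x d : R) : 0 < d ->
  (forall u t, Rabs (u - x) < d -> rcd (fun u => P u t) u (dP u t)) ->
  (forall t, c2d dP x t) ->
  (forall u, Rabs (u - x) < d -> ex_CI (P u) a b) ->
  rcd (fun u => CI (P u) a b) x (CI (dP x) a b).
Proof.
  intros Hd H1 H2 H3. split; simpl.
  - apply (RInt_param_derive (fun u t => fst (P u t)) (fun u t => fst (dP u t)) a b x d); auto.
    intros u t Hu; exact (proj1 (H1 u t Hu)). intros t; exact (proj1 (H2 t)). intros u Hu; exact (proj1 (H3 u Hu)).
  - apply (RInt_param_derive (fun u t => snd (P u t)) (fun u t => snd (dP u t)) a b x d); auto.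
    intros u t Hu; exact (proj2 (H1 u t Hu)). intros t; exact (proj2 (H2 t)). intros u Hu; exact (proj2 (H3 u Hu)).
Qed.

Lemma rcd_zero_const (g : R -> C) (a b : R) : a < b ->
  (forall t, a <= t <= b -> rcd g t 0) -> g a = g b.
Proof.
  intros Hab H. apply Ceq.
  - apply (eq_is_derive (fun t => fst (g t))); auto. intros t Ht; apply H, Ht.
  - apply (eq_is_derive (fun t => snd (g t))); auto. intros t Ht; apply H, Ht.
Qed.

(** * Cauchy's formula *)

Definition cpt (r t : R) : C := (r * cos t, r * sin t).

Lemma Cmod_cpt (r t : R) : 0 <= r -> Cmod (cpt r t) = r.
Proof.
  intros Hr. unfold cpt, Cmod; simpl fst; simpl snd.
  replace ((r * cos t) ^ 2 + (r * sin t) ^ 2) with (r ^ 2 * (Rsqr (sin t) + Rsqr (cos t))) by (unfold Rsqr; ring).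
  rewrite sin2_cos2, Rmult_1_r. apply sqrt_pow2, Hr.
Qed.

Lemma rcd_cpt (r t : R) : rcd (cpt r) t (Ci * cpt r t).
Proof. split; unfold cpt; simpl; auto_derive; auto; ring. Qed.

Lemma ccurve_cpt (r t : R) : ccurve (cpt r) t.
Proof. eapply rcd_ccurve, rcd_cpt. Qed.

Lemma cpt_2PI (r : R) : cpt r (2 * PI) = cpt r 0.
Proof. unfold cpt. rewrite cos_2PI, sin_2PI, cos_0, sin_0; auto. Qed.

Lemma cpt_neq (r t : R) (z : C) : 0 <= r -> Cmod z < r -> (cpt r t - z)%C <> 0.
Proof.
  intros Hr Hz H. assert (cpt r t = z) by (replace z with (cpt r t - (cpt r t - z))%C by ring; rewrite H; ring).
  apply f_equal with (f := Cmod) in H0. rewrite Cmod_cpt in H0; lra.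
Qed.

Lemma CI_cpt (r : R) : CI (cpt r) 0 (2 * PI) = 0%C.
Proof.
  rewrite (CI_FTC (fun t => (- Ci * cpt r t)%C)).
  - rewrite cpt_2PI; ring.
  - intros t _. apply (rcd_eq _ _ (- Ci * (Ci * cpt r t))).
    apply Ceq; simpl; ring. apply rcd_scal, rcd_cpt.
  - intros; apply ccurve_cpt.
Qed.

Lemma C_2PI_neq : RtoC (2 * PI) <> 0.
Proof. apply Cmod_neq0. rewrite Cmod_R. pose proof PI_RGT_0. rewrite Rabs_pos_eq; lra. Qed.

Lemma Ci_neq : Ci <> 0.
Proof. apply Cmod_neq0. rewrite Cmod_Ci; lra. Qed.

Lemma Cmult_eq_0_l (a b : C) : a <> 0 -> (a * b)%C = 0 -> b = 0.
Proof.
  intros Ha H. replace b with (/ a * (a * b))%C by (field; auto). rewrite H; ring.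
Qed.

Lemma rcd_Cinv (g : R -> C) (t : R) (l : C) : g t <> 0 -> rcd g t l ->
  rcd (fun t => (/ g t)%C) t (- / (g t * g t) * l).
Proof. intros Hg H. apply (rcd_comp Cinv); auto. apply cdiff_inv, Hg. Qed.

Lemma ccont_Cinv (z : C) : z <> 0 -> ccont Cinv z.
Proof. intros; eapply cdiff_ccont, cdiff_inv; auto. Qed.

Lemma rcd_RtoC (t : R) : rcd RtoC t 1.
Proof. split; simpl; auto_derive; auto. Qed.

Lemma rcd_minus (f g : R -> C) (t : R) (l m : C) : rcd f t l -> rcd g t m ->
  rcd (fun t => (f t - g t)%C) t (l - m).
Proof.
  intros [H1 H2] [H3 H4]; split; simpl.
  - exact (is_derive_minus _ _ _ _ _ H1 H3).
  - exact (is_derive_minus _ _ _ _ _ H2 H4).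
Qed.

(* The mean of [ζ / (ζ - s z)] does not depend on [s] in [0, 1]. *)
Lemma cauchy_kernel_mean (r : R) (z : C) : Cmod z < r ->
  CI (fun t => (cpt r t / (cpt r t - z))%C) 0 (2 * PI) = RtoC (2 * PI).
Proof.
  intros Hz. pose proof (Cmod_ge_0 z) as Hz0. pose proof PI_RGT_0.
  set (d := (r - Cmod z) / (Cmod z + 1)).
  assert (Hd : 0 < d) by (apply Rdiv_lt_0_compat; lra).
  assert (Hsz : forall s : R, Rabs s < 1 + d -> Cmod (s * z) < r).
  { intros s Hs. rewrite Cmod_mult, Cmod_R.
    apply Rle_lt_trans with ((1 + d) * Cmod z). apply Rmult_le_compat_r; lra.
    assert (d * (Cmod z + 1) = r - Cmod z) by (unfold d; field; lra). nra. }
  assert (Hn : forall (s : R) t, Rabs s < 1 + d -> (cpt r t - s * z)%C <> 0).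
  { intros s t Hs. apply cpt_neq; [lra|auto]. }
  pose (J := fun s : R => CI (fun t => (cpt r t * / (cpt r t - s * z))%C) 0 (2 * PI)).
  assert (E : J 0 = J 1).
  { apply rcd_zero_const; [lra|]. intros s Hs.
    apply (rcd_eq _ _ (CI (fun t => (cpt r t * (z * / ((cpt r t - s * z) * (cpt r t - s * z))))%C) 0 (2 * PI))).
    (* The derivative in [s] is the integral of [ζ z / (ζ - s z)^2], which is the [t]-derivative of
       [i z / (ζ - s z)]; this function has equal values at 0 and [2 * PI]. *)
    - rewrite (CI_FTC (fun t => (Ci * z * / (cpt r t - s * z))%C)).
      + rewrite cpt_2PI; ring.
      + intros t _. assert (Hnt := Hn s t ltac:(apply Rabs_def1; lra)).
        apply (rcd_eq _ _ (Ci * z * (- / ((cpt r t - s * z) * (cpt r t - s * z)) * (Ci * cpt r t - 0)))).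
        * replace Ci with ((0, 1) : C) by auto. 
          match goal with |- (_ * ?k)%C = _ => set (K := k) end.
          transitivity (- (Ci * Ci) * (cpt r t * (z * / ((cpt r t - s * z) * (cpt r t - s * z)))))%C.
          unfold K. change ((0, 1) : C) with Ci. ring.
          replace (Ci * Ci)%C with (- (1))%C by (apply Ceq; simpl; ring). ring.
        * apply rcd_scal, rcd_Cinv; auto. apply rcd_minus; [apply rcd_cpt|apply rcd_const].
      + intros t _. assert (Hnt := Hn s t ltac:(apply Rabs_def1; lra)).
        apply (ccurve_comp (fun w => (w * (z * / ((w - s * z) * (w - s * z))))%C) (cpt r)); [|apply ccurve_cpt].
        apply ccont_mult; [apply ccont_id|]. apply ccont_scal.
        apply (cdiff_ccont _ _ _ (cdiff_comp (fun w => ((w - s * z) * (w - s * z))%C) Cinv _ _ _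
          (cdiff_mult _ _ _ _ _ (cdiff_plus _ _ _ _ _ (cdiff_id _) (cdiff_const (- (s * z)) _))
            (cdiff_plus _ _ _ _ _ (cdiff_id _) (cdiff_const (- (s * z)) _)))
           (cdiff_inv _ (Cmult_neq_0 _ _ Hnt Hnt)))).
    - assert (Hnb : forall u t, Rabs (u - s) < d -> (cpt r t - u * z)%C <> 0).
      { intros u t Hu. apply Hn. pose proof (Rabs_triang (u - s) s).
        replace (u - s + s) with u in H0 by ring. rewrite (Rabs_pos_eq s) in H0 by lra. lra. }
      apply (CI_param_derive (fun u t => (cpt r t * / (cpt r t - u * z))%C)
        (fun u t => (cpt r t * (z * / ((cpt r t - u * z) * (cpt r t - u * z))))%C) _ _ _ d Hd).
      + intros u t Hu.
        eapply rcd_eq; [|apply rcd_scal, rcd_Cinv; [apply (Hnb u t Hu)|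
           apply rcd_minus; [apply rcd_const|apply rcd_mult; [apply rcd_RtoC|apply rcd_const]]]].
        cbv beta; ring.
      + intros t.
        assert (HK : c2d (fun u t => (cpt r t - u * z)%C) s t).
        { apply c2d_minus. apply c2d_snd, ccurve_cpt. apply c2d_mult; [|apply c2d_const].
          apply c2d_fst. eapply rcd_ccurve, rcd_RtoC. }
        apply c2d_mult. apply c2d_snd, ccurve_cpt.
        apply c2d_mult; [apply c2d_const|].
        apply (ccont_c2d Cinv (fun u t => ((cpt r t - u * z) * (cpt r t - u * z))%C)).
        apply ccont_Cinv, Cmult_neq_0; apply Hnb; rewrite Rminus_diag, Rabs_R0; auto.
        apply c2d_mult; auto.
      + intros u Hu. apply ex_CI_curve. intros t _. apply ccurve_mult. apply ccurve_cpt.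
        eapply rcd_ccurve, rcd_Cinv; [apply Hnb, Hu|]. apply rcd_minus; [apply rcd_cpt|apply rcd_const]. }
  transitivity (J 1).
  { apply CI_ext; intros t _. unfold Cdiv. rewrite Cmult_1_l; auto. }
  rewrite <- E. unfold J.
  rewrite (CI_ext _ (fun _ => RtoC 1)).
  - rewrite CI_const. rewrite <- RtoC_minus, Cmult_1_l. f_equal; ring.
  - intros t _. assert (Hnt := Hn 0 t ltac:(rewrite Rabs_R0; lra)).
    replace (cpt r t - 0 * z)%C with (cpt r t) in * by ring. apply Cinv_r, Hnt.
Qed.

Lemma Cmod_convex (z w : C) (s : R) : 0 <= s <= 1 ->
  Cmod (z + s * (w - z)) <= Rmax (Cmod z) (Cmod w).
Proof.
  intros Hs. replace (z + s * (w - z))%C with ((1 - s) * z + s * w)%C by ring.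
  eapply Rle_trans; [apply Cmod_triangle|].
  rewrite !Cmod_mult, <- RtoC_minus, !Cmod_R, !Rabs_pos_eq by lra.
  pose proof (Rmax_l (Cmod z) (Cmod w)); pose proof (Rmax_r (Cmod z) (Cmod w)). nra.
Qed.

(** Cauchy's formula for a function [H] with continuous derivative [F], by contracting the circle to
    [z]. The integral of [H(z + s (ζ - z)) ζ / (ζ - z)] has [s]-derivative equal to the integral of
    [ζ F(z + s (ζ - z))], and [i s] times that integrand is the [t]-derivative of
    [H(z + s (ζ - z))]. Differentiating under the integral uses the continuity of [F]; hence the
    detour through a primitive. *)
Lemma cauchy_primitive (rho r : R) (F H : C -> C) (z : C) : Cmod z < r -> r < rho ->
  (forall w, Cmod w < rho -> cdiff H w (F w)) ->
  (forall w, Cmod w < rho -> ccont F w) ->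
  CI (fun t => (H (cpt r t) * (cpt r t / (cpt r t - z)))%C) 0 (2 * PI) = (2 * PI * H z)%C.
Proof.
  intros Hz Hr HH HF. pose proof (Cmod_ge_0 z) as Hz0. pose proof PI_RGT_0.
  set (g := fun (s : R) t => (z + s * (cpt r t - z))%C).
  (* The margin by which [s] may leave [[0, 1]] with the contracted circle still inside the disc of
     radius [rho], since [|ζ - z|] is at most [2 * r]. *)
  set (d := (rho - r) / (2 * r)).
  assert (Hd : 0 < d) by (apply Rdiv_lt_0_compat; lra).
  assert (Hg : forall s u t, 0 <= s <= 1 -> Rabs (u - s) < d -> Cmod (g u t) < rho).
  { intros s u t Hs Hu.
    replace (g u t) with ((z + s * (cpt r t - z)) + (u - s) * (cpt r t - z))%C by (unfold g; ring).
    eapply Rle_lt_trans; [apply Cmod_triangle|].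
    rewrite Cmod_mult, <- RtoC_minus, Cmod_R.
    pose proof (Cmod_convex z (cpt r t) s Hs) as K. rewrite Cmod_cpt, Rmax_right in K by lra.
    pose proof (Cmod_triangle (cpt r t) (- z)) as T. rewrite Cmod_opp, Cmod_cpt in T by lra.
    assert (Rabs (u - s) * Cmod (cpt r t - z) < rho - r).
    { apply Rle_lt_trans with (Rabs (u - s) * (2 * r)).
      apply Rmult_le_compat_l; [apply Rabs_pos|]. unfold Cminus; lra.
      replace (rho - r) with (d * (2 * r)) by (unfold d; field; lra).
      apply Rmult_lt_compat_r; lra. }
    lra. }
  assert (Hg' : forall s t, 0 <= s <= 1 -> Cmod (g s t) < rho).
  { intros s t Hs; apply (Hg s s t Hs). rewrite Rminus_diag, Rabs_R0; auto. }
  assert (Hn : forall t, (cpt r t - z)%C <> 0) by (intros; apply cpt_neq; lra).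
  pose (k := fun t => (cpt r t * / (cpt r t - z))%C).
  assert (Hk : forall t, ccurve k t).
  { intros t. apply ccurve_mult; [apply ccurve_cpt|].
    eapply rcd_ccurve, rcd_Cinv; [apply Hn|]. apply rcd_minus; [apply rcd_cpt|apply rcd_const]. }
  assert (Hgt : forall s t, rcd (g s) t (s * (Ci * cpt r t))).
  { intros s t. eapply rcd_eq; [|apply rcd_plus; [apply rcd_const|apply rcd_scal, rcd_minus; [apply rcd_cpt|apply rcd_const]]].
    ring. }
  pose (I := fun s : R => CI (fun t => (k t * H (g s t))%C) 0 (2 * PI)).
  assert (E : I 0 = I 1).
  { apply rcd_zero_const; [lra|]. intros s Hs.
    apply (rcd_eq _ _ (CI (fun t => (cpt r t * F (g s t))%C) 0 (2 * PI))).
    (* The total derivative argument divides by [s]. At [s = 0] the integrand is a constant times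
       [ζ], whose integral over the circle vanishes. *)
    - destruct (Req_dec s 0) as [->|Hs0].
      { rewrite (CI_ext _ (fun t => (F z * cpt r t)%C)).
        rewrite CI_scal, CI_cpt. ring.
        apply ex_CI_curve; intros; apply ccurve_cpt.
        intros t _. unfold g. replace (z + 0 * (cpt r t - z))%C with z by ring. ring. }
      assert (Hs1 : (s * Ci)%C <> 0).
      { apply Cmult_neq_0; [|apply Ci_neq]. apply Cmod_neq0. rewrite Cmod_R. apply Rabs_pos_lt, Hs0. }
      apply (Cmult_eq_0_l _ _ Hs1).
      assert (Cc : forall t, ccurve (fun t => (cpt r t * F (g s t))%C) t).
      { intros t. apply ccurve_mult; [apply ccurve_cpt|]. apply (ccurve_comp F (g s)).
        apply HF, Hg', Hs. eapply rcd_ccurve, Hgt. }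
      rewrite <- CI_scal by (apply ex_CI_curve; intros; apply Cc).
      rewrite (CI_FTC (fun t => H (g s t))).
      + unfold g; rewrite cpt_2PI; ring.
      + intros t _. apply (rcd_eq _ _ (F (g s t) * (s * (Ci * cpt r t)))). ring.
        apply rcd_comp. apply Hgt. apply HH, Hg', Hs.
      + intros t _. apply (ccurve_mult (fun _ => (s * Ci)%C)); [|apply Cc].
        eapply rcd_ccurve, rcd_const.
    - apply (CI_param_derive (fun u t => (k t * H (g u t))%C) (fun u t => (cpt r t * F (g u t))%C) _ _ _ d Hd).
      + intros u t Hu. apply (rcd_eq _ _ (k t * (F (g u t) * (0 + (1 * (cpt r t - z) + u * 0))))).
        unfold k. field. apply Hn.
        apply rcd_scal, rcd_comp; [|apply HH, (Hg s); auto].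
        unfold g. apply rcd_plus; [apply rcd_const|]. 
        apply (rcd_mult RtoC (fun _ => (cpt r t - z)%C)); [apply rcd_RtoC|apply rcd_const].
      + intros t. apply c2d_mult; [apply c2d_snd, ccurve_cpt|].
        apply ccont_c2d. apply HF, Hg', Hs. unfold g.
        apply c2d_plus; [apply c2d_const|]. apply c2d_mult.
        apply c2d_fst; eapply rcd_ccurve, rcd_RtoC.
        apply c2d_minus; [apply c2d_snd, ccurve_cpt|apply c2d_const].
      + intros u Hu. apply ex_CI_curve; intros t _. apply ccurve_mult; [apply Hk|].
        apply ccurve_comp. eapply cdiff_ccont, HH, (Hg s); auto. eapply rcd_ccurve, Hgt. }
  transitivity (I 1).
  { apply CI_ext; intros t _. unfold k, g.
    replace (z + 1 * (cpt r t - z))%C with (cpt r t) by ring. unfold Cdiv; ring. }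
  rewrite <- E. unfold I.
  rewrite (CI_ext _ (fun t => (H z * k t)%C)).
  - rewrite CI_scal by (apply ex_CI_curve; intros; apply Hk).
    unfold k. pose proof (cauchy_kernel_mean r z Hz) as K. unfold Cdiv in K. rewrite K.
    rewrite RtoC_mult. ring.
  - intros t _. unfold g. replace (z + 0 * (cpt r t - z))%C with z by ring. ring.
Qed.

Lemma continuity_bounded (f : R -> R) (a b : R) : a <= b ->
  (forall t, a <= t <= b -> continuity_pt f t) ->
  exists M, forall t, a <= t <= b -> Rabs (f t) <= M.
Proof.
  intros Hab H.
  destruct (continuity_ab_maj (fun t => Rabs (f t)) a b Hab) as [x [Hx _]].
  - intros t Ht. apply (continuity_pt_comp f Rabs); [apply H, Ht|apply Rcontinuity_abs].
  - exists (Rabs (f x)). exact Hx.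
Qed.

Lemma ccurve_bounded (g : R -> C) (a b : R) : a <= b ->
  (forall t, a <= t <= b -> ccurve g t) ->
  exists M, 0 <= M /\ forall t, a <= t <= b -> Cmod (g t) <= M.
Proof.
  intros Hab H.
  destruct (continuity_bounded (fun t => fst (g t)) a b Hab) as [M1 K1]; [intros; apply H; auto|].
  destruct (continuity_bounded (fun t => snd (g t)) a b Hab) as [M2 K2]; [intros; apply H; auto|].
  exists (M1 + M2). assert (B : forall t, a <= t <= b -> Cmod (g t) <= M1 + M2).
  { intros t Ht. eapply Rle_trans; [apply Cmod_le_parts|]. apply Rplus_le_compat; auto. }
  split; auto. apply Rle_trans with (Cmod (g a)); [apply Cmod_ge_0|apply B; lra].
Qed.

(** Cauchy-type integrals of an arbitrary density. The factor [i ζ] of [dζ] is not included, so it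
    has to be put into [psi]. *)
Definition CK (r : R) (psi : R -> C) (n : nat) (z : C) : C :=
  CI (fun t => (psi t * (/ (cpt r t - z)) ^ n)%C) 0 (2 * PI).

Lemma ccurve_kernel (r t : R) (z : C) : 0 <= r -> Cmod z < r ->
  ccurve (fun t => (/ (cpt r t - z))%C) t.
Proof.
  intros Hr Hz. eapply rcd_ccurve, rcd_Cinv; [apply cpt_neq; auto|].
  apply rcd_minus; [apply rcd_cpt|apply rcd_const].
Qed.

Lemma ccurve_const (c : C) (t : R) : ccurve (fun _ => c) t.
Proof. eapply rcd_ccurve, rcd_const. Qed.

Lemma ccurve_pow (g : R -> C) (n : nat) (t : R) : ccurve g t -> ccurve (fun t => (g t ^ n)%C) t.
Proof.
  intros H; induction n; simpl. apply ccurve_const. apply ccurve_mult; auto.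
Qed.

Lemma ccurve_CK (r : R) (psi : R -> C) (n : nat) (z : C) (t : R) : 0 <= r -> Cmod z < r ->
  (forall t, ccurve psi t) -> ccurve (fun t => (psi t * (/ (cpt r t - z)) ^ n)%C) t.
Proof.
  intros Hr Hz Hp. apply ccurve_mult; auto. apply ccurve_pow, ccurve_kernel; auto.
Qed.

(* With [u = 1/(ζ-z)] and [u' = 1/(ζ-w)] one has [u' - u = (w-z) u u'], hence both
   remainders below equal [(w-z)^2] times a polynomial in [u, u']. *)
Lemma CK_cdiff (r : R) (psi : R -> C) (z : C) : Cmod z < r -> (forall t, ccurve psi t) ->
  cdiff (CK r psi 1) z (CK r psi 2 z) /\ cdiff (CK r psi 2) z (2 * CK r psi 3 z).
Proof.
  intros Hz Hp. pose proof (Cmod_ge_0 z). pose proof PI_RGT_0.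
  destruct (ccurve_bounded psi 0 (2 * PI)) as [M [HM0 HM]]; [lra|auto|].
  set (d := (r - Cmod z) / 2). assert (Hd : 0 < d) by (unfold d; lra).
  assert (Hu : forall w t, Cmod (w - z) < d -> (cpt r t - w)%C <> 0 /\ Cmod (/ (cpt r t - w)) <= / d).
  { intros w t Hw.
    assert (d <= Cmod (cpt r t - w)).
    { pose proof (Cmod_triangle_sub (cpt r t) w) as T1. rewrite Cmod_cpt in T1 by lra.
      pose proof (Cmod_triangle_sub w z). unfold d in *. lra. }
    assert ((cpt r t - w)%C <> 0) by (apply Cmod_neq0; lra).
    split; auto. rewrite Cmod_inv by auto. apply Rinv_le_contravar; lra. }
  assert (Hzz : Cmod (z - z) < d) by (replace (z - z)%C with (RtoC 0) by ring; rewrite Cmod_0; auto).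
  assert (Hwr : forall w, Cmod (w - z) < d -> Cmod w < r).
  { intros w Hw. pose proof (Cmod_triangle_sub w z). unfold d in *; lra. }
  assert (Hd' : 0 < / d) by (apply Rinv_0_lt_compat; auto).
  assert (Ex : forall w n, Cmod (w - z) < d -> ex_CI (fun t => (psi t * (/ (cpt r t - w)) ^ n)%C) 0 (2 * PI)).
  { intros w n Hw. apply ex_CI_curve; intros t _. apply ccurve_CK; auto. lra. }
  split.
  - apply (cdiff_quad _ _ _ (2 * (M * (/ d) ^ 3) * (2 * PI)) d Hd). intros w Hw.
    unfold CK. rewrite <- CI_minus by (apply Ex; auto).
    rewrite (Cmult_comm _ (w - z)), <- CI_scal by (apply Ex; auto).
    rewrite <- CI_minus; [|apply ex_CI_minus; apply Ex; auto|apply ex_CI_scal, Ex; auto].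
    replace (2 * (M * (/ d) ^ 3) * (2 * PI) * Cmod (w - z) ^ 2) with
      (2 * (M * (/ d) ^ 3 * Cmod (w - z) ^ 2) * Rabs (2 * PI - 0)) by (rewrite Rabs_pos_eq by lra; ring).
    apply CI_bound.
    { apply ex_CI_minus; [apply ex_CI_minus; apply Ex; auto|apply ex_CI_scal, Ex; auto]. }
    intros t Ht. rewrite Rmin_left, Rmax_right in Ht by lra.
    destruct (Hu w t Hw) as [N1 B1]. destruct (Hu z t Hzz) as [N2 B2].
    set (u := (/ (cpt r t - z))%C) in *. set (u' := (/ (cpt r t - w))%C) in *.
    replace (psi t * u' ^ 1 - psi t * u ^ 1 - (w - z) * (psi t * u ^ 2))%C with
      (psi t * (u * (u * u')) * ((w - z) * (w - z)))%C by (unfold u, u'; field; auto).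
    rewrite !Cmod_mult.
    replace (M * (/ d) ^ 3 * Cmod (w - z) ^ 2) with (M * (/ d * (/ d * / d)) * (Cmod (w - z) * Cmod (w - z))) by (field; lra).
    apply Rmult_le_compat_r; [apply Rmult_le_pos; apply Cmod_ge_0|].
    pose proof (Cmod_ge_0 u); pose proof (Cmod_ge_0 u').
    apply Rmult_le_compat; auto using Cmod_ge_0.
    repeat apply Rmult_le_pos; auto.
    apply Rmult_le_compat; auto. apply Rmult_le_pos; auto.
    apply Rmult_le_compat; auto.
  - apply (cdiff_quad _ _ _ (2 * (3 * M * (/ d) ^ 4) * (2 * PI)) d Hd). intros w Hw.
    unfold CK. rewrite <- CI_minus by (apply Ex; auto).
    rewrite (Cmult_comm _ (w - z)), Cmult_assoc, <- CI_scal by (apply Ex; auto).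
    rewrite <- CI_minus; [|apply ex_CI_minus; apply Ex; auto|apply ex_CI_scal, Ex; auto].
    replace (2 * (3 * M * (/ d) ^ 4) * (2 * PI) * Cmod (w - z) ^ 2) with
      (2 * (3 * M * (/ d) ^ 4 * Cmod (w - z) ^ 2) * Rabs (2 * PI - 0)) by (rewrite Rabs_pos_eq by lra; ring).
    apply CI_bound.
    { apply ex_CI_minus; [apply ex_CI_minus; apply Ex; auto|apply ex_CI_scal, Ex; auto]. }
    intros t Ht. rewrite Rmin_left, Rmax_right in Ht by lra.
    destruct (Hu w t Hw) as [N1 B1]. destruct (Hu z t Hzz) as [N2 B2].
    set (u := (/ (cpt r t - z))%C) in *. set (u' := (/ (cpt r t - w))%C) in *.
    replace (psi t * u' ^ 2 - psi t * u ^ 2 - (w - z) * 2 * (psi t * u ^ 3))%C with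
      (psi t * (u * (u * (u' * (u' + 2 * u)))) * ((w - z) * (w - z)))%C by (unfold u, u'; field; auto).
    rewrite !Cmod_mult.
    replace (3 * M * (/ d) ^ 4 * Cmod (w - z) ^ 2) with (M * (/ d * (/ d * (/ d * (3 * / d)))) * (Cmod (w - z) * Cmod (w - z))) by (field; lra).
    apply Rmult_le_compat_r; [apply Rmult_le_pos; apply Cmod_ge_0|].
    pose proof (Cmod_ge_0 u); pose proof (Cmod_ge_0 u').
    assert (Cmod (u' + 2 * u) <= 3 * / d).
    { eapply Rle_trans; [apply Cmod_triangle|]. rewrite Cmod_mult, Cmod_R, Rabs_pos_eq by lra. lra. }
    pose proof (Cmod_ge_0 (u' + 2 * u)).
    apply Rmult_le_compat; auto using Cmod_ge_0.
    repeat apply Rmult_le_pos; auto.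
    apply Rmult_le_compat; auto. repeat apply Rmult_le_pos; auto.
    apply Rmult_le_compat; auto. repeat apply Rmult_le_pos; auto.
    apply Rmult_le_compat; auto.
Qed.

Lemma cdiff_disc_ext (F G : C -> C) (z l : C) (r : R) : Cmod z < r ->
  (forall w, Cmod w < r -> F w = G w) -> cdiff F z l -> cdiff G z l.
Proof.
  intros Hz H. apply (cdiff_ext_loc _ _ _ _ (r - Cmod z)); [lra|].
  intros w Hw. apply H. pose proof (Cmod_triangle_sub w z); lra.
Qed.

(** The formula is known for a primitive [H] of [F]. Differentiating it in [z] represents [2 π F(z)]
    as the integral of [H(ζ) ζ / (ζ - z)^2], and an integration by parts in [t] moves the derivative
    from the kernel to [H]. *)
Lemma cauchy_formula (rho r : R) (F : C -> C) (z : C) : adisc rho F -> Cmod z < r -> r < rho ->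
  CI (fun t => (F (cpt r t) * (cpt r t / (cpt r t - z)))%C) 0 (2 * PI) = (2 * PI * F z)%C.
Proof.
  intros HF Hz Hr. destruct (primitive_exists rho F HF) as [H HH].
  pose proof (Cmod_ge_0 z). assert (Hr0 : 0 <= r) by lra.
  assert (HC : forall w, Cmod w < rho -> ccont F w) by (intros; eapply adisc_ccont; eauto).
  assert (Hin : forall t, Cmod (cpt r t) < rho) by (intros; rewrite Cmod_cpt; lra).
  set (psi := fun t => (H (cpt r t) * cpt r t)%C).
  assert (Hpsi : forall t, ccurve psi t).
  { intros t. apply ccurve_mult; [|apply ccurve_cpt]. apply ccurve_comp; [|apply ccurve_cpt].
    eapply cdiff_ccont, HH, Hin. }
  assert (E : forall w, Cmod w < r -> (CK r psi 1 w)%C = (2 * PI * H w)%C).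
  { intros w Hw. rewrite <- (cauchy_primitive rho r F H w Hw Hr HH HC).
    apply CI_ext. intros t _. unfold psi, Cdiv. simpl; ring. }
  assert (D : CK r psi 2 z = (2 * PI * F z)%C).
  { apply (cdiff_unique (fun w => (2 * PI * H w)%C) z).
    - apply (cdiff_disc_ext (CK r psi 1) _ _ _ r); auto. exact (proj1 (CK_cdiff r psi z Hz Hpsi)).
    - apply cdiff_scal, HH; lra. }
  rewrite <- D. unfold CK.
  assert (Hn : forall t, (cpt r t - z)%C <> 0) by (intros; apply cpt_neq; auto).
  assert (C1 : forall t, ccurve (fun t => (F (cpt r t) * (cpt r t / (cpt r t - z)))%C) t).
  { intros t. apply ccurve_mult. apply ccurve_comp; [|apply ccurve_cpt]. apply HC, Hin.
    apply ccurve_mult; [apply ccurve_cpt|apply ccurve_kernel; auto]. }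
  assert (C2 : forall t, ccurve (fun t => (psi t * (/ (cpt r t - z)) ^ 2)%C) t).
  { intros t. apply ccurve_CK; auto. }
  match goal with |- ?A = ?B => assert (Z : (A - B)%C = 0); [|replace A with ((A - B) + B)%C by ring; rewrite Z; ring] end.
  rewrite <- CI_minus by (apply ex_CI_curve; intros; auto).
  apply (Cmult_eq_0_l Ci); [apply Ci_neq|].
  rewrite <- CI_scal by (apply ex_CI_minus; apply ex_CI_curve; intros; auto).
  (* The integration by parts: the [t]-derivative of [H(ζ) / (ζ - z)] is [i] times the difference of
     the two integrands. *)
  rewrite (CI_FTC (fun t => (H (cpt r t) * / (cpt r t - z))%C)).
  - rewrite cpt_2PI; ring.
  - intros t _.
    eapply rcd_eq; [|apply rcd_mult; [apply rcd_comp; [apply rcd_cpt|apply HH, Hin]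
       |apply rcd_Cinv; [apply Hn|apply rcd_minus; [apply rcd_cpt|apply rcd_const]]]].
    unfold psi; cbv beta. simpl. field. apply Hn.
  - intros t _. apply (ccurve_mult (fun _ => Ci)); [apply ccurve_const|].
    apply (c2d_ccurve (fun _ t => (F (cpt r t) * (cpt r t / (cpt r t - z)) - psi t * (/ (cpt r t - z)) ^ 2)%C) 0).
    apply c2d_minus; apply c2d_snd; auto.
Qed.

(** Near [z] the function is a Cauchy-type integral over a larger circle, and such integrals can be
    differentiated twice. *)
Lemma analytic_derivative (rho : R) (F : C -> C) : adisc rho F ->
  exists F', adisc rho F' /\ forall z, Cmod z < rho -> cdiff F z (F' z).
Proof.
  intros HF. set (F' := fun z => epsilon (inhabits (RtoC 0)) (fun l => cdiff F z l)).
  assert (HF' : forall z, Cmod z < rho -> cdiff F z (F' z)).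
  { intros z Hz. apply epsilon_spec, HF, Hz. }
  exists F'. split; auto. intros z Hz. pose proof (Cmod_ge_0 z).
  set (r := (Cmod z + rho) / 2).
  assert (Hin : forall t, Cmod (cpt r t) < rho) by (intros; rewrite Cmod_cpt; unfold r; lra).
  set (psi := fun t => (F (cpt r t) * cpt r t)%C).
  assert (Hpsi : forall t, ccurve psi t).
  { intros t. apply ccurve_mult; [|apply ccurve_cpt]. apply ccurve_comp; [|apply ccurve_cpt].
    eapply adisc_ccont; eauto. }
  assert (E : forall w, Cmod w < r -> (/ (2 * PI) * CK r psi 1 w)%C = F w).
  { intros w Hw. replace (CK r psi 1 w) with (2 * PI * F w)%C.
    rewrite <- RtoC_mult. field. apply C_2PI_neq.
    rewrite <- (cauchy_formula rho r F w HF Hw ltac:(unfold r; lra)).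
    apply CI_ext. intros t _. unfold psi, Cdiv. simpl; ring. }
  assert (E' : forall w, Cmod w < r -> (/ (2 * PI) * CK r psi 2 w)%C = F' w).
  { intros w Hw. apply (cdiff_unique F w).
    - apply (cdiff_disc_ext (fun w => (/ (2 * PI) * CK r psi 1 w)%C) _ _ _ r); auto.
      apply cdiff_scal. exact (proj1 (CK_cdiff r psi w Hw Hpsi)).
    - apply HF'. unfold r in Hw; lra. }
  exists (/ (2 * PI) * (2 * CK r psi 3 z))%C.
  assert (Cmod z < r) by (unfold r; lra).
  apply (cdiff_disc_ext (fun w => (/ (2 * PI) * CK r psi 2 w)%C) _ _ _ r); auto.
  apply cdiff_scal. exact (proj2 (CK_cdiff r psi z H0 Hpsi)).
Qed.

(** * Subharmonicity in logarithmic polar coordinates *)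

(* [RInt] states equalities in the carrier of a Coquelicot structure, where [ring] fails. *)
Ltac eqR := match goal with |- @eq _ ?a ?b => change (@eq R a b) end.

Lemma RInt_Rext (f g : R -> R) (a b : R) : (forall t, f t = g t) -> RInt f a b = RInt g a b.
Proof. intros H; apply RInt_ext; intros t _; apply H. Qed.

Lemma ex_RInt_Rplus (f g : R -> R) (a b : R) : ex_RInt f a b -> ex_RInt g a b ->
  ex_RInt (fun t => f t + g t) a b.
Proof. intros Hf Hg; exact (ex_RInt_plus f g a b Hf Hg). Qed.

Lemma ex_RInt_Rminus (f g : R -> R) (a b : R) : ex_RInt f a b -> ex_RInt g a b ->
  ex_RInt (fun t => f t - g t) a b.
Proof. intros Hf Hg; exact (ex_RInt_minus f g a b Hf Hg). Qed.

Lemma ex_RInt_Rscal (f : R -> R) (a b c : R) : ex_RInt f a b ->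
  ex_RInt (fun t => c * f t) a b.
Proof. intros Hf; exact (ex_RInt_scal f a b c Hf). Qed.

Lemma RInt_Rplus (f g : R -> R) (a b : R) : ex_RInt f a b -> ex_RInt g a b ->
  RInt (fun t => f t + g t) a b = RInt f a b + RInt g a b.
Proof. intros Hf Hg; exact (RInt_plus f g a b Hf Hg). Qed.

Lemma RInt_Rminus (f g : R -> R) (a b : R) : ex_RInt f a b -> ex_RInt g a b ->
  RInt (fun t => f t - g t) a b = RInt f a b - RInt g a b.
Proof. intros Hf Hg; exact (RInt_minus f g a b Hf Hg). Qed.

Lemma RInt_Rscal (f : R -> R) (a b c : R) : ex_RInt f a b ->
  RInt (fun t => c * f t) a b = c * RInt f a b.
Proof. intros Hf; exact (RInt_scal f a b c Hf). Qed.

Lemma RInt_Rconst (a b c : R) : RInt (fun _ => c) a b = (b - a) * c.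
Proof. exact (RInt_const a b c). Qed.

(* A function of [z = e^{x+iy}], read in the coordinates [(x, y)], with its partial derivatives
   of orders 0, [x], [y], [xx], [yy]; a holomorphic [F] satisfies [F_x = z F'], [F_y = i z F']. *)
Record jet := Jet { j0 : R -> R -> R; j1 : R -> R -> R; j2 : R -> R -> R;
                    j11 : R -> R -> R; j22 : R -> R -> R }.

(** The half plane [x < X] covers the punctured disc of radius [e^X]. The mixed derivative is not
    recorded because neither the Laplacian nor the gradient contains it. The periodicity of [j2] is
    what makes the integral of [j22] over a circle vanish. *)
Record wfjet (X : R) (J : jet) : Prop := {
  wf_1 : forall x y, x < X -> is_derive (fun x => j0 J x y) x (j1 J x y);
  wf_2 : forall x y, x < X -> is_derive (j0 J x) y (j2 J x y);
  wf_11 : forall x y, x < X -> is_derive (fun x => j1 J x y) x (j11 J x y);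
  wf_22 : forall x y, x < X -> is_derive (j2 J x) y (j22 J x y);
  wf_c0 : forall x y, x < X -> continuity_2d_pt (j0 J) x y;
  wf_c1 : forall x y, x < X -> continuity_2d_pt (j1 J) x y;
  wf_c2 : forall x y, x < X -> continuity_2d_pt (j2 J) x y;
  wf_c11 : forall x y, x < X -> continuity_2d_pt (j11 J) x y;
  wf_c22 : forall x y, x < X -> continuity_2d_pt (j22 J) x y;
  wf_p0 : forall x, x < X -> j0 J x (2 * PI) = j0 J x 0;
  wf_p2 : forall x, x < X -> j2 J x (2 * PI) = j2 J x 0 }.

(** In the coordinates [(x, y)] this is [|z|^2] times the Euclidean Laplacian, and [grad2] is
    [|z|^2] times the squared Euclidean gradient; inequalities that are linear in the two carry over
    unchanged. *)
Definition lap (J : jet) (x y : R) : R := j11 J x y + j22 J x y.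
Definition grad2 (J : jet) (x y : R) : R := j1 J x y ^ 2 + j2 J x y ^ 2.

Definition jconst (c : R) : jet :=
  Jet (fun _ _ => c) (fun _ _ => 0) (fun _ _ => 0) (fun _ _ => 0) (fun _ _ => 0).
Definition jplus (J K : jet) : jet :=
  Jet (fun x y => j0 J x y + j0 K x y) (fun x y => j1 J x y + j1 K x y)
      (fun x y => j2 J x y + j2 K x y) (fun x y => j11 J x y + j11 K x y)
      (fun x y => j22 J x y + j22 K x y).
Definition jcomp (f df ddf : R -> R) (J : jet) : jet :=
  Jet (fun x y => f (j0 J x y))
      (fun x y => df (j0 J x y) * j1 J x y)
      (fun x y => df (j0 J x y) * j2 J x y)
      (fun x y => ddf (j0 J x y) * (j1 J x y * j1 J x y) + df (j0 J x y) * j11 J x y)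
      (fun x y => ddf (j0 J x y) * (j2 J x y * j2 J x y) + df (j0 J x y) * j22 J x y).

Definition jscal (c : R) : jet -> jet := jcomp (fun u => c * u) (fun _ => c) (fun _ => 0).
Definition jsqr : jet -> jet := jcomp (fun u => u * u) (fun u => 2 * u) (fun _ => 2).
Definition jexp : jet -> jet := jcomp exp exp exp.
Definition jln : jet -> jet := jcomp ln Rinv (fun u => - / (u * u)).

Lemma wf_const (X c : R) : wfjet X (jconst c).
Proof.
  constructor; simpl; intros; auto using continuity_2d_pt_const; auto_derive; auto.
Qed.

Lemma wf_plus (X : R) (J K : jet) : wfjet X J -> wfjet X K -> wfjet X (jplus J K).
Proof.
  intros HJ HK. constructor; simpl; intros.
  - exact (is_derive_plus _ _ _ _ _ (wf_1 _ _ HJ x y H) (wf_1 _ _ HK x y H)).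
  - exact (is_derive_plus _ _ _ _ _ (wf_2 _ _ HJ x y H) (wf_2 _ _ HK x y H)).
  - exact (is_derive_plus _ _ _ _ _ (wf_11 _ _ HJ x y H) (wf_11 _ _ HK x y H)).
  - exact (is_derive_plus _ _ _ _ _ (wf_22 _ _ HJ x y H) (wf_22 _ _ HK x y H)).
  - apply continuity_2d_pt_plus; [exact (wf_c0 _ _ HJ x y H)|exact (wf_c0 _ _ HK x y H)].
  - apply continuity_2d_pt_plus; [exact (wf_c1 _ _ HJ x y H)|exact (wf_c1 _ _ HK x y H)].
  - apply continuity_2d_pt_plus; [exact (wf_c2 _ _ HJ x y H)|exact (wf_c2 _ _ HK x y H)].
  - apply continuity_2d_pt_plus; [exact (wf_c11 _ _ HJ x y H)|exact (wf_c11 _ _ HK x y H)].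
  - apply continuity_2d_pt_plus; [exact (wf_c22 _ _ HJ x y H)|exact (wf_c22 _ _ HK x y H)].
  - rewrite (wf_p0 _ _ HJ x H), (wf_p0 _ _ HK x H); auto.
  - rewrite (wf_p2 _ _ HJ x H), (wf_p2 _ _ HK x H); auto.
Qed.

Lemma is_derive_Rcomp (f g : R -> R) (t l m : R) : is_derive f (g t) l -> is_derive g t m ->
  is_derive (fun t => f (g t)) t (l * m).
Proof.
  intros H1 H2. rewrite Rmult_comm. exact (is_derive_comp f g t l m H1 H2).
Qed.

Lemma wf_comp (X : R) (f df ddf : R -> R) (J : jet) : wfjet X J ->
  (forall x y, x < X -> is_derive f (j0 J x y) (df (j0 J x y)) /\
     is_derive df (j0 J x y) (ddf (j0 J x y)) /\ continuity_pt ddf (j0 J x y)) ->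
  wfjet X (jcomp f df ddf J).
Proof.
  intros HJ Hf.
  assert (C1 : forall x y, x < X -> continuity_2d_pt (fun x y => df (j0 J x y)) x y).
  { intros x y Hx. apply continuity_1d_2d_pt_comp; [|exact (wf_c0 _ _ HJ x y Hx)].
    eapply is_derive_cpt, (proj1 (proj2 (Hf x y Hx))). }
  assert (C2 : forall x y, x < X -> continuity_2d_pt (fun x y => ddf (j0 J x y)) x y).
  { intros x y Hx. apply continuity_1d_2d_pt_comp; [|exact (wf_c0 _ _ HJ x y Hx)].
    exact (proj2 (proj2 (Hf x y Hx))). }
  constructor; simpl; intros x y Hx || intros x Hx.
  - exact (is_derive_Rcomp f (fun x => j0 J x y) x _ _ (proj1 (Hf x y Hx)) (wf_1 _ _ HJ x y Hx)).
  - exact (is_derive_Rcomp f (j0 J x) y _ _ (proj1 (Hf x y Hx)) (wf_2 _ _ HJ x y Hx)).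
  - rewrite <- Rmult_assoc.
    exact (is_derive_Rmult (fun x => df (j0 J x y)) (fun x => j1 J x y) x _ _
      (is_derive_Rcomp df (fun x => j0 J x y) x _ _ (proj1 (proj2 (Hf x y Hx))) (wf_1 _ _ HJ x y Hx))
      (wf_11 _ _ HJ x y Hx)).
  - rewrite <- Rmult_assoc.
    exact (is_derive_Rmult (fun y => df (j0 J x y)) (j2 J x) y _ _
      (is_derive_Rcomp df (j0 J x) y _ _ (proj1 (proj2 (Hf x y Hx))) (wf_2 _ _ HJ x y Hx))
      (wf_22 _ _ HJ x y Hx)).
  - apply continuity_1d_2d_pt_comp; [|exact (wf_c0 _ _ HJ x y Hx)].
    eapply is_derive_cpt, (proj1 (Hf x y Hx)).
  - apply continuity_2d_pt_mult; [exact (C1 x y Hx)|exact (wf_c1 _ _ HJ x y Hx)].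
  - apply continuity_2d_pt_mult; [exact (C1 x y Hx)|exact (wf_c2 _ _ HJ x y Hx)].
  - apply continuity_2d_pt_plus; apply continuity_2d_pt_mult; auto;
      try apply continuity_2d_pt_mult; first [exact (wf_c1 _ _ HJ x y Hx)|exact (wf_c11 _ _ HJ x y Hx)].
  - apply continuity_2d_pt_plus; apply continuity_2d_pt_mult; auto;
      try apply continuity_2d_pt_mult; first [exact (wf_c2 _ _ HJ x y Hx)|exact (wf_c22 _ _ HJ x y Hx)].
  - rewrite (wf_p0 _ _ HJ x Hx); auto.
  - rewrite (wf_p0 _ _ HJ x Hx), (wf_p2 _ _ HJ x Hx); auto.
Qed.

Lemma derive_cpt (f : R -> R) (t : R) : ex_derive f t -> continuity_pt f t.
Proof. intros [l H]; eapply is_derive_cpt, H. Qed.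

Lemma wf_scal (X c : R) (J : jet) : wfjet X J -> wfjet X (jscal c J).
Proof.
  intros H; apply wf_comp; auto. intros x y Hx; split; [|split].
  auto_derive; auto; ring. auto_derive; auto. apply derive_cpt; auto_derive; auto.
Qed.

Lemma wf_sqr (X : R) (J : jet) : wfjet X J -> wfjet X (jsqr J).
Proof.
  intros H; apply wf_comp; auto. intros x y Hx; split; [|split].
  auto_derive; auto; ring. auto_derive; auto; ring. apply derive_cpt; auto_derive; auto.
Qed.

Lemma wf_exp (X : R) (J : jet) : wfjet X J -> wfjet X (jexp J).
Proof.
  intros H; apply wf_comp; auto. intros x y Hx; split; [|split].
  apply is_derive_exp. apply is_derive_exp. eapply is_derive_cpt, is_derive_exp.
Qed.

Lemma wf_ln (X : R) (J : jet) : wfjet X J -> (forall x y, x < X -> 0 < j0 J x y) ->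
  wfjet X (jln J).
Proof.
  intros H Hp; apply wf_comp; auto. intros x y Hx. pose proof (Hp x y Hx) as P.
  split; [|split].
  - apply is_derive_ln; auto.
  - auto_derive; [lra|]. field; lra.
  - apply derive_cpt; auto_derive. apply Rgt_not_eq; nra.
Qed.

Lemma lap_plus (J K : jet) (x y : R) : lap (jplus J K) x y = lap J x y + lap K x y.
Proof. unfold lap; simpl; ring. Qed.

Lemma lap_scal (c : R) (J : jet) (x y : R) : lap (jscal c J) x y = c * lap J x y.
Proof. unfold lap; simpl; ring. Qed.

Lemma lap_comp (f df ddf : R -> R) (J : jet) (x y : R) :
  lap (jcomp f df ddf J) x y = df (j0 J x y) * lap J x y + ddf (j0 J x y) * grad2 J x y.
Proof. unfold lap, grad2; simpl; ring. Qed.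

Lemma grad2_comp (f df ddf : R -> R) (J : jet) (x y : R) :
  grad2 (jcomp f df ddf J) x y = df (j0 J x y) ^ 2 * grad2 J x y.
Proof. unfold grad2; simpl; ring. Qed.

Lemma grad2_ge0 (J : jet) (x y : R) : 0 <= grad2 J x y.
Proof. unfold grad2; nra. Qed.

Lemma lap_exp (J : jet) (x y : R) :
  lap (jexp J) x y = exp (j0 J x y) * (lap J x y + grad2 J x y).
Proof. unfold jexp; rewrite lap_comp; ring. Qed.

Lemma lap_ln (J : jet) (x y : R) : 0 < j0 J x y ->
  lap (jln J) x y = lap J x y / j0 J x y - grad2 J x y / j0 J x y ^ 2.
Proof. intros; unfold jln; rewrite lap_comp; field; lra. Qed.

Lemma grad2_ln (J : jet) (x y : R) : 0 < j0 J x y ->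
  grad2 (jln J) x y = grad2 J x y / j0 J x y ^ 2.
Proof. intros; unfold jln; rewrite grad2_comp; field; lra. Qed.

Lemma grad2_scal (c : R) (J : jet) (x y : R) : grad2 (jscal c J) x y = c ^ 2 * grad2 J x y.
Proof. unfold jscal; rewrite grad2_comp; ring. Qed.

Lemma nondecr_of_derive (f df : R -> R) (a b : R) : a <= b ->
  (forall t, a <= t <= b -> is_derive f t (df t)) ->
  (forall t, a <= t <= b -> 0 <= df t) -> f a <= f b.
Proof.
  intros Hab H1 H2. destruct (MVT_gen f a b df) as [c [Hc E]].
  - intros t Ht. rewrite Rmin_left, Rmax_right in Ht by lra. apply H1; lra.
  - intros t Ht. rewrite Rmin_left, Rmax_right in Ht by lra. eapply is_derive_cpt, H1; lra.
  - rewrite Rmin_left, Rmax_right in Hc by lra. specialize (H2 c Hc).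
    assert (0 <= df c * (b - a)) by (apply Rmult_le_pos; lra). lra.
Qed.

(** Not normalised, hence the factors [2 * PI] wherever means are compared with point values or with
    [Mp]. *)
Definition circ (V : C -> R) (r : R) : R := RInt (fun t => V (cpt r t)) 0 (2 * PI).

Definition jetof (X : R) (V : C -> R) (J : jet) : Prop :=
  wfjet X J /\ forall x y, x < X -> j0 J x y = V (cpt (exp x) y).

Lemma ex_RInt_jet (X : R) (J : jet) (x a b : R) : wfjet X J -> x < X -> ex_RInt (j0 J x) a b.
Proof.
  intros HJ Hx. apply ex_RInt_cpt. intros t _.
  apply (continuity_2d_1d_snd (j0 J)), (wf_c0 _ _ HJ x t Hx).
Qed.

(* In logarithmic polar coordinates the circular mean of a subharmonic function is a convex
   function of [x = ln r], bounded near [-oo]; hence it is nondecreasing. *)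
Lemma jet_mean_mono (X : R) (V : C -> R) (J : jet) : jetof X V J -> rcont V 0 ->
  (forall x y, x < X -> 0 <= lap J x y) ->
  (forall x x', x <= x' -> x' < X -> circ V (exp x) <= circ V (exp x')) /\
  (forall x, x < X -> 2 * PI * V 0 <= circ V (exp x)).
Proof.
  intros [HJ HV] HV0 HL. pose proof PI_RGT_0 as HPI.
  set (m := fun x => RInt (j0 J x) 0 (2 * PI)).
  set (n := fun x => RInt (j1 J x) 0 (2 * PI)).
  assert (Em : forall x, x < X -> circ V (exp x) = m x).
  { intros x Hx; apply RInt_ext; intros t _; symmetry; apply HV, Hx. }
  assert (Nb : forall x u, x < X -> Rabs (u - x) < X - x -> u < X).
  { intros x u Hx Hu. apply Rabs_def2 in Hu. lra. }
  assert (Dm : forall x, x < X -> is_derive m x (n x)).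
  { intros x Hx. apply (RInt_param_derive (j0 J) (j1 J) 0 (2 * PI) x (X - x)); [lra| | |].
    - intros u t Hu; apply (wf_1 _ _ HJ); eapply Nb; eauto.
    - intros t; apply (wf_c1 _ _ HJ); auto.
    - intros u Hu; eapply ex_RInt_jet; eauto. }
  assert (Dn : forall x, x < X -> is_derive n x (RInt (j11 J x) 0 (2 * PI))).
  { intros x Hx. apply (RInt_param_derive (j1 J) (j11 J) 0 (2 * PI) x (X - x)); [lra| | |].
    - intros u t Hu; apply (wf_11 _ _ HJ); eapply Nb; eauto.
    - intros t; apply (wf_c11 _ _ HJ); auto.
    - intros u Hu. apply ex_RInt_cpt. intros t _.
      apply (continuity_2d_1d_snd (j1 J)), (wf_c1 _ _ HJ). eapply Nb; eauto. }
  (* Convexity: the second derivative of the mean is the integral of [j11], and adding [j22], which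
     integrates to 0 by periodicity, turns it into the integral of the Laplacian. *)
  assert (Dn0 : forall x, x < X -> 0 <= RInt (j11 J x) 0 (2 * PI)).
  { intros x Hx.
    assert (C11 : ex_RInt (j11 J x) 0 (2 * PI)).
    { apply ex_RInt_cpt; intros t _. apply (continuity_2d_1d_snd (j11 J)), (wf_c11 _ _ HJ); auto. }
    assert (C22 : ex_RInt (j22 J x) 0 (2 * PI)).
    { apply ex_RInt_cpt; intros t _. apply (continuity_2d_1d_snd (j22 J)), (wf_c22 _ _ HJ); auto. }
    assert (Z : RInt (j22 J x) 0 (2 * PI) = 0).
    { apply is_RInt_unique. replace 0 with (minus (j2 J x (2 * PI)) (j2 J x 0)) at 2.
      - apply (is_RInt_derive (j2 J x) (j22 J x)); intros t _.
        apply (wf_22 _ _ HJ); auto.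
        apply continuity_pt_filterlim, (continuity_2d_1d_snd (j22 J)), (wf_c22 _ _ HJ); auto.
      - rewrite (wf_p2 _ _ HJ) by auto. unfold minus, plus, opp; simpl; ring. }
    assert (P : 0 <= RInt (fun t => j11 J x t + j22 J x t) 0 (2 * PI)).
    { apply RInt_ge_0; [lra| |]. apply (ex_RInt_plus _ _ _ _ C11 C22).
      intros t _; apply (HL x t Hx). }
    rewrite (RInt_Rplus _ _ _ _ C11 C22), Z in P. lra. }
  assert (Mn : forall x x', x <= x' -> x' < X -> n x <= n x').
  { intros x x' Hxx Hx'. apply (nondecr_of_derive n (fun x => RInt (j11 J x) 0 (2 * PI))); auto.
    intros; apply Dn; lra. intros; apply Dn0; lra. }
  assert (Near : forall eps, 0 < eps -> exists x0, forall x, x <= x0 -> x < X ->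
     Rabs (m x - 2 * PI * V 0) <= 2 * PI * eps).
  { intros eps He. destruct (HV0 eps He) as [d [Hd Hd']].
    exists (ln (d / 2)). intros x Hx HxX.
    assert (He' : exp x <= d / 2).
    { rewrite <- (exp_ln (d / 2)) by lra. destruct Hx as [Hx| ->]; [left; apply exp_increasing, Hx|right; auto]. }
    pose proof (exp_pos x).
    assert (E0 : 2 * PI * V 0 = RInt (fun _ : R => V 0) 0 (2 * PI)) by (rewrite RInt_Rconst; ring).
    rewrite E0.
    unfold m. pose proof (ex_RInt_jet X J x 0 (2 * PI) HJ HxX) as E1.
    assert (E2 : ex_RInt (fun _ : R => V 0) 0 (2 * PI)) by apply ex_RInt_const.
    rewrite <- (RInt_Rminus _ _ _ _ E1 E2).
    replace (2 * PI * eps) with ((2 * PI - 0) * eps) by ring.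
    apply abs_RInt_le_const; [lra| |].
    - exact (ex_RInt_minus _ _ _ _ E1 E2).
    - intros t _. left. rewrite HV by auto. apply Hd'.
      replace (cpt (exp x) t - 0)%C with (cpt (exp x) t) by ring.
      rewrite Cmod_cpt by lra. lra. }
  assert (N0 : forall x, x < X -> 0 <= n x).
  { intros x Hx. apply Rnot_lt_le; intros Hneg.
    destruct (Near 1 Rlt_0_1) as [x0 Hx0].
    set (B := 2 * PI * V 0 + 2 * PI * 1).
    (* If the slope at [x] were negative, convexity would keep the slope at most [n x] on all of
       [[y, x]]; [y] lies so far to the left that this forces [m y] above the bound [B] valid near
       the centre. *)
    set (y := Rmin (Rmin x x0) (x - (Rabs (B - m x) + 1) / - n x)).
    assert (Hy1 : y <= x) by (unfold y; eapply Rle_trans; [apply Rmin_l|apply Rmin_l]).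
    assert (Hy2 : y <= x0) by (unfold y; eapply Rle_trans; [apply Rmin_l|apply Rmin_r]).
    assert (Hy3 : y <= x - (Rabs (B - m x) + 1) / - n x) by apply Rmin_r.
    specialize (Hx0 y Hy2 ltac:(lra)).
    destruct (MVT_gen m y x n) as [c [Hc E]].
    { intros t Ht. rewrite Rmin_left, Rmax_right in Ht by lra. apply Dm; lra. }
    { intros t Ht. rewrite Rmin_left, Rmax_right in Ht by lra. eapply is_derive_cpt, Dm; lra. }
    rewrite Rmin_left, Rmax_right in Hc by lra.
    pose proof (Mn c x ltac:(lra) Hx).
    assert (Rabs (B - m x) + 1 <= - n x * (x - y)).
    { apply Rle_trans with (- n x * ((Rabs (B - m x) + 1) / - n x)).
      right; field; lra. apply Rmult_le_compat_l; lra. }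
    assert (n c * (x - y) <= n x * (x - y)) by (apply Rmult_le_compat_r; lra).
    pose proof (Rle_abs (B - m x)). apply Rabs_le_between in Hx0. unfold B in *. lra. }
  assert (MM : forall x x', x <= x' -> x' < X -> m x <= m x').
  { intros x x' Hxx Hx'. apply (nondecr_of_derive m n); auto.
    intros; apply Dm; lra. intros; apply N0; lra. }
  split.
  - intros x x' Hxx Hx'. rewrite !Em by lra. apply MM; auto.
  - intros x Hx. rewrite Em by auto. apply Rle_plus_epsilon.
    intros eps He. destruct (Near (eps / (2 * PI))) as [x0 Hx0]; [apply Rdiv_lt_0_compat; lra|].
    specialize (Hx0 (Rmin x x0) (Rmin_r _ _)). pose proof (Rmin_l x x0).
    specialize (Hx0 ltac:(lra)). pose proof (MM (Rmin x x0) x ltac:(auto) Hx).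
    apply Rabs_le_between in Hx0.
    replace (2 * PI * (eps / (2 * PI))) with eps in Hx0 by (field; lra). lra.
Qed.

Lemma circ_0 (V : C -> R) : circ V 0 = 2 * PI * V 0.
Proof.
  unfold circ. rewrite (RInt_ext _ (fun _ => V 0)).
  - rewrite RInt_const. unfold scal; simpl; unfold mult; simpl; ring.
  - intros t _. f_equal. unfold cpt. apply Ceq; simpl; ring.
Qed.

(** The radius 0, invisible in logarithmic coordinates, is included; there the mean is the value at
    the centre, reached by continuity of [V]. *)
Lemma circ_mono (rho r s : R) (V : C -> R) (J : jet) : jetof (ln rho) V J -> rcont V 0 ->
  (forall x y, x < ln rho -> 0 <= lap J x y) -> 0 <= r <= s -> s < rho ->
  circ V r <= circ V s.
Proof.
  intros HJ HV HL Hr Hs.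
  destruct (jet_mean_mono _ _ _ HJ HV HL) as [M1 M2].
  destruct (Req_dec r 0) as [->|Hr0].
  - rewrite circ_0. destruct (Req_dec s 0) as [->|Hs0]; [rewrite circ_0; lra|].
    rewrite <- (exp_ln s) by lra. apply M2. apply ln_increasing; lra.
  - rewrite <- (exp_ln s), <- (exp_ln r) by lra. apply M1.
    + destruct (proj2 Hr) as [Hrs| ->]; [left; apply ln_increasing; lra|right; auto].
    + apply ln_increasing; lra.
Qed.

(** * Jets of analytic functions *)

Definition Dz (rho : R) (F F1 : C -> C) : Prop :=
  forall z, Cmod z < rho -> exists l, cdiff F z l /\ F1 z = (z * l)%C.

Lemma Dz_exists (rho : R) (F : C -> C) : adisc rho F -> exists F1, adisc rho F1 /\ Dz rho F F1.
Proof.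
  intros HF. destruct (analytic_derivative _ _ HF) as [F' [A H]].
  exists (fun z => (z * F' z)%C). split.
  - intros z Hz. destruct (A z Hz) as [l Hl].
    exists (1 * F' z + z * l)%C. exact (cdiff_mult _ _ _ _ _ (cdiff_id z) Hl).
  - intros z Hz. exists (F' z). auto.
Qed.

Lemma rcd_cpt_exp (x y : R) : rcd (fun x => cpt (exp x) y) x (cpt (exp x) y).
Proof. split; unfold cpt; simpl; auto_derive; auto; ring. Qed.

Lemma c2d_cpt_exp (x y : R) : c2d (fun x y => cpt (exp x) y) x y.
Proof.
  split; unfold cpt; simpl; apply continuity_2d_pt_mult.
  - apply (continuity_1d_2d_fst exp). apply derive_cpt; auto_derive; auto.
  - apply (continuity_1d_2d_snd cos). apply derive_cpt; auto_derive; auto.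
  - apply (continuity_1d_2d_fst exp). apply derive_cpt; auto_derive; auto.
  - apply (continuity_1d_2d_snd sin). apply derive_cpt; auto_derive; auto.
Qed.

Lemma Dz_rcd_x (rho : R) (F F1 : C -> C) (x y : R) : Dz rho F F1 -> exp x < rho ->
  rcd (fun x => F (cpt (exp x) y)) x (F1 (cpt (exp x) y)).
Proof.
  intros H Hx. pose proof (exp_pos x). destruct (H (cpt (exp x) y)) as [l [Hl E]].
  rewrite Cmod_cpt; lra.
  rewrite E. eapply rcd_eq; [|apply (rcd_comp F); [apply rcd_cpt_exp|exact Hl]]. ring.
Qed.

Lemma Dz_rcd_y (rho : R) (F F1 : C -> C) (x y : R) : Dz rho F F1 -> exp x < rho ->
  rcd (fun y => F (cpt (exp x) y)) y (Ci * F1 (cpt (exp x) y)).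
Proof.
  intros H Hx. pose proof (exp_pos x). destruct (H (cpt (exp x) y)) as [l [Hl E]].
  rewrite Cmod_cpt; lra.
  rewrite E. eapply rcd_eq; [|apply (rcd_comp F); [apply rcd_cpt|exact Hl]]. ring.
Qed.

Definition jre (F F1 F2 : C -> C) : jet :=
  Jet (fun x y => fst (F (cpt (exp x) y))) (fun x y => fst (F1 (cpt (exp x) y)))
      (fun x y => - snd (F1 (cpt (exp x) y))) (fun x y => fst (F2 (cpt (exp x) y)))
      (fun x y => - fst (F2 (cpt (exp x) y))).
Definition jim (F F1 F2 : C -> C) : jet :=
  Jet (fun x y => snd (F (cpt (exp x) y))) (fun x y => snd (F1 (cpt (exp x) y)))
      (fun x y => fst (F1 (cpt (exp x) y))) (fun x y => snd (F2 (cpt (exp x) y)))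
      (fun x y => - snd (F2 (cpt (exp x) y))).

Lemma exp_lt_of_ln (x rho : R) : 0 < rho -> x < ln rho -> exp x < rho.
Proof. intros Hr Hx. rewrite <- (exp_ln rho) by auto. apply exp_increasing, Hx. Qed.

Lemma c2d_analytic (rho : R) (F : C -> C) (x y : R) : adisc rho F -> exp x < rho ->
  c2d (fun x y => F (cpt (exp x) y)) x y.
Proof.
  intros H Hx. apply ccont_c2d; [|apply c2d_cpt_exp]. eapply adisc_ccont; eauto.
  rewrite Cmod_cpt; auto. left; apply exp_pos.
Qed.

Lemma wf_re_im (rho : R) (F F1 F2 : C -> C) : 0 < rho -> adisc rho F -> adisc rho F1 ->
  adisc rho F2 -> Dz rho F F1 -> Dz rho F1 F2 ->
  wfjet (ln rho) (jre F F1 F2) /\ wfjet (ln rho) (jim F F1 F2).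
Proof.
  intros Hr A A1 A2 D D1.
  assert (Hx : forall x, x < ln rho -> exp x < rho) by (intros; apply exp_lt_of_ln; auto).
  split; constructor; simpl; intros; try rewrite cpt_2PI; auto;
    try (specialize (Hx x H)).
  - exact (proj1 (Dz_rcd_x rho F F1 x y D Hx)).
  - replace (- snd (F1 (cpt (exp x) y))) with (fst (Ci * F1 (cpt (exp x) y))%C) by (simpl; ring).
    exact (proj1 (Dz_rcd_y rho F F1 x y D Hx)).
  - exact (proj1 (Dz_rcd_x rho F1 F2 x y D1 Hx)).
  - replace (fst (F2 (cpt (exp x) y))) with (snd (Ci * F2 (cpt (exp x) y))%C) by (simpl; ring).
    exact (is_derive_opp _ _ _ (proj2 (Dz_rcd_y rho F1 F2 x y D1 Hx))).
  - exact (proj1 (c2d_analytic rho F x y A Hx)).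
  - exact (proj1 (c2d_analytic rho F1 x y A1 Hx)).
  - apply continuity_2d_pt_opp. exact (proj2 (c2d_analytic rho F1 x y A1 Hx)).
  - exact (proj1 (c2d_analytic rho F2 x y A2 Hx)).
  - apply continuity_2d_pt_opp. exact (proj1 (c2d_analytic rho F2 x y A2 Hx)).
  - exact (proj2 (Dz_rcd_x rho F F1 x y D Hx)).
  - replace (fst (F1 (cpt (exp x) y))) with (snd (Ci * F1 (cpt (exp x) y))%C) by (simpl; ring).
    exact (proj2 (Dz_rcd_y rho F F1 x y D Hx)).
  - exact (proj2 (Dz_rcd_x rho F1 F2 x y D1 Hx)).
  - replace (- snd (F2 (cpt (exp x) y))) with (fst (Ci * F2 (cpt (exp x) y))%C) by (simpl; ring).
    exact (proj1 (Dz_rcd_y rho F1 F2 x y D1 Hx)).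
  - exact (proj2 (c2d_analytic rho F x y A Hx)).
  - exact (proj2 (c2d_analytic rho F1 x y A1 Hx)).
  - exact (proj1 (c2d_analytic rho F1 x y A1 Hx)).
  - exact (proj2 (c2d_analytic rho F2 x y A2 Hx)).
  - apply continuity_2d_pt_opp. exact (proj2 (c2d_analytic rho F2 x y A2 Hx)).
Qed.

(** The function [|F|^2 + e]. For [e > 0] it has no zeros, so its real powers are smooth across the
    zeros of [F]. *)
Definition jmod2 (e : R) (F F1 F2 : C -> C) : jet :=
  jplus (jplus (jsqr (jre F F1 F2)) (jsqr (jim F F1 F2))) (jconst e).

Lemma lap_mod2 (e : R) (F F1 F2 : C -> C) (x y : R) :
  lap (jmod2 e F F1 F2) x y = 4 * Cmod (F1 (cpt (exp x) y)) ^ 2.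
Proof. rewrite Cmod_sqr. unfold lap; simpl; ring. Qed.

Lemma grad2_mod2 (e : R) (F F1 F2 : C -> C) (x y : R) :
  grad2 (jmod2 e F F1 F2) x y =
  4 * Cmod (F (cpt (exp x) y)) ^ 2 * Cmod (F1 (cpt (exp x) y)) ^ 2.
Proof. rewrite !Cmod_sqr. unfold grad2; simpl; ring. Qed.

Lemma j0_mod2 (e : R) (F F1 F2 : C -> C) (x y : R) :
  j0 (jmod2 e F F1 F2) x y = Cmod (F (cpt (exp x) y)) ^ 2 + e.
Proof. rewrite !Cmod_sqr. simpl; ring. Qed.

Lemma adisc_jets (rho : R) (F : C -> C) : 0 < rho -> adisc rho F ->
  exists F1 F2, Dz rho F F1 /\
   wfjet (ln rho) (jre F F1 F2) /\ forall e, wfjet (ln rho) (jmod2 e F F1 F2).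
Proof.
  intros Hr HF.
  destruct (Dz_exists _ _ HF) as [F1 [A1 D1]].
  destruct (Dz_exists _ _ A1) as [F2 [A2 D2]].
  destruct (wf_re_im rho F F1 F2) as [W1 W2]; auto.
  exists F1, F2. split; [auto|split; [exact W1|]]. intros e.
  apply wf_plus; [apply wf_plus; apply wf_sqr; auto|apply wf_const].
Qed.

(** * The Poisson formula and the potential of a BMOA function *)

Lemma rcont_Cmod (F : C -> C) (z : C) : ccont F z -> rcont (fun w => Cmod (F w)) z.
Proof.
  intros H eps He. destruct (H eps He) as [d [Hd K]]. exists d; split; auto.
  intros w Hw. specialize (K w Hw).
  pose proof (Cmod_triangle_sub (F w) (F z)). pose proof (Cmod_triangle_sub (F z) (F w)) as T.
  rewrite Cmod_minus_sym in T. apply Rabs_def1; lra.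
Qed.

Lemma rcont_comp (f : R -> R) (u : C -> R) (z : C) : continuity_pt f (u z) -> rcont u z ->
  rcont (fun w => f (u w)) z.
Proof.
  intros Hf Hu eps He.
  destruct (proj1 (continuity_pt_locally f (u z)) Hf (mkposreal eps He)) as [d Hd].
  destruct (Hu d (cond_pos d)) as [e [He' K]]. exists e; split; auto.
  intros w Hw. apply (Hd (u w)). apply K, Hw.
Qed.

Lemma continuity_sqr (x : R) : continuity_pt (fun u => u ^ 2) x.
Proof. apply derive_cpt; auto_derive; auto. Qed.

Lemma rcont_Cmod2 (F : C -> C) (z : C) : ccont F z -> rcont (fun w => Cmod (F w) ^ 2) z.
Proof.
  intros H. apply (rcont_comp (fun u => u ^ 2)); [apply continuity_sqr|apply rcont_Cmod, H].
Qed.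

Lemma adisc_mult (rho : R) (F G : C -> C) : adisc rho F -> adisc rho G ->
  adisc rho (fun z => (F z * G z)%C).
Proof.
  intros HF HG z Hz. destruct (HF z Hz) as [l Hl], (HG z Hz) as [m Hm].
  eexists; apply cdiff_mult; eauto.
Qed.

Lemma adisc_plus (rho : R) (F G : C -> C) : adisc rho F -> adisc rho G ->
  adisc rho (fun z => (F z + G z)%C).
Proof.
  intros HF HG z Hz. destruct (HF z Hz) as [l Hl], (HG z Hz) as [m Hm].
  eexists; apply cdiff_plus; eauto.
Qed.

Lemma adisc_const (rho : R) (c : C) : adisc rho (fun _ => c).
Proof. intros z _; eexists; apply cdiff_const. Qed.

Lemma adisc_scal (rho : R) (c : C) (F : C -> C) : adisc rho F -> adisc rho (fun z => (c * F z)%C).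
Proof. intros H; apply adisc_mult; auto; apply adisc_const. Qed.

Lemma adisc_id (rho : R) : adisc rho (fun z => z).
Proof. intros z _; eexists; apply cdiff_id. Qed.

Lemma adisc_inv (rho : R) (F : C -> C) : adisc rho F -> (forall z, Cmod z < rho -> F z <> 0) ->
  adisc rho (fun z => (/ F z)%C).
Proof.
  intros HF H0 z Hz. destruct (HF z Hz) as [l Hl].
  eexists; apply (cdiff_comp F Cinv); [exact Hl|apply cdiff_inv, H0, Hz].
Qed.

Lemma adisc_le (rho rho' : R) (F : C -> C) : rho' <= rho -> adisc rho F -> adisc rho' F.
Proof. intros Hr H z Hz; apply H; lra. Qed.

Lemma adisc_ext (rho : R) (F G : C -> C) : (forall z, F z = G z) -> adisc rho F -> adisc rho G.
Proof.
  intros E H z Hz. destruct (H z Hz) as [l Hl]. exists l.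
  apply (cdiff_ext_loc F _ _ _ 1 Rlt_0_1); auto.
Qed.

Definition poisson (r : R) (z : C) (t : R) : R :=
  fst ((cpt r t + z) / (cpt r t - z))%C.

Lemma poisson_eq (r : R) (z : C) (t : R) : 0 <= r -> Cmod z < r ->
  poisson r z t = (r ^ 2 - Cmod z ^ 2) / Cmod (cpt r t - z) ^ 2.
Proof.
  intros Hr Hz. pose proof (cpt_neq r t z Hr Hz) as Hn. apply Cmod_pos in Hn.
  assert (Hp : 0 < Cmod (cpt r t - z) ^ 2) by (apply pow_lt; auto).
  assert (E : r ^ 2 = Cmod (cpt r t) ^ 2) by (rewrite Cmod_cpt; auto).
  rewrite E. unfold poisson. rewrite Cmod_sqr in Hp. rewrite !Cmod_sqr.
  unfold Cdiv, Cmult, Cinv; simpl fst in *; simpl snd in *.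
  field. simpl in Hp. lra.
Qed.

Lemma poisson_pos (r : R) (z : C) (t : R) : 0 <= r -> Cmod z < r -> 0 < poisson r z t.
Proof.
  intros Hr Hz. rewrite poisson_eq by auto. pose proof (Cmod_ge_0 z).
  apply Rdiv_lt_0_compat. nra. apply pow_lt, Cmod_pos, cpt_neq; auto.
Qed.

Lemma ccurve_plus (f g : R -> C) (t : R) : ccurve f t -> ccurve g t ->
  ccurve (fun t => (f t + g t)%C) t.
Proof.
  intros Hf Hg. apply (c2d_ccurve (fun _ t => (f t + g t)%C) 0).
  apply c2d_plus; apply c2d_snd; auto.
Qed.

Lemma ccurve_schwarz (r : R) (z : C) (t : R) : 0 <= r -> Cmod z < r ->
  ccurve (fun t => ((cpt r t + z) / (cpt r t - z))%C) t.
Proof.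
  intros Hr Hz. apply ccurve_mult; [|apply ccurve_kernel; auto].
  apply ccurve_plus; [apply ccurve_cpt|apply ccurve_const].
Qed.

Lemma poisson_cont (r : R) (z : C) (t : R) : 0 <= r -> Cmod z < r -> continuity_pt (poisson r z) t.
Proof. intros Hr Hz. exact (proj1 (ccurve_schwarz r z t Hr Hz)). Qed.

Lemma ccurve_RtoC (f : R -> R) (t : R) : continuity_pt f t -> ccurve (fun t => RtoC (f t)) t.
Proof. intros H; split; simpl; auto. apply continuity_pt_const; intros ? ?; auto. Qed.

(** On the circle the Poisson kernel is [ζ / (ζ - z)] plus [z' ζ / (r^2 - z' ζ)], with [z'] the
    conjugate of [z]. The first part is Cauchy's formula at [z]. The second is Cauchy's formula at 0
    for the function [G], which absorbs the factor and vanishes at 0. *)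
Lemma poisson_analytic (rho r : R) (F : C -> C) (z : C) : adisc rho F -> Cmod z < r -> r < rho ->
  CI (fun t => (F (cpt r t) * poisson r z t)%C) 0 (2 * PI) = (2 * PI * F z)%C.
Proof.
  intros HF Hz Hr. pose proof (Cmod_ge_0 z). assert (Hr0 : 0 <= r) by lra.
  assert (Hrp : 0 < r) by lra.
  (* The harmonic mean of [r] and [r^2 / |z|], the modulus of the pole of [G], written without
     division by [|z|]: the factor added to [F] is analytic up to this radius, beyond the circle. *)
  set (m := 2 * r ^ 2 / (r + Cmod z)).
  assert (Hm1 : r < m).
  { unfold m. apply Rmult_lt_reg_r with (r + Cmod z); [lra|].
    replace (2 * r ^ 2 / (r + Cmod z) * (r + Cmod z)) with (2 * r ^ 2) by (field; lra). nra. }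
  assert (Hm2 : Cmod z * m < r ^ 2).
  { unfold m. apply Rmult_lt_reg_r with (r + Cmod z); [lra|].
    replace (Cmod z * (2 * r ^ 2 / (r + Cmod z)) * (r + Cmod z)) with (Cmod z * (2 * r ^ 2)) by (field; lra).
    assert (0 < r ^ 2 * (r - Cmod z)) by (apply Rmult_lt_0_compat; [apply pow_lt|]; lra). nra. }
  set (rho' := Rmin rho m). pose proof (Rmin_l rho m); pose proof (Rmin_r rho m).
  assert (Hrr : r < rho') by (apply Rmin_glb_lt; auto).
  set (D := fun w => (RtoC (r ^ 2) - Cconj z * w)%C).
  assert (HD : forall w, Cmod w < rho' -> D w <> 0).
  { intros w Hw E. assert (E2 : (Cconj z * w)%C = RtoC (r ^ 2)).
    { replace (Cconj z * w)%C with (RtoC (r ^ 2) - D w)%C by (unfold D; ring). rewrite E; ring. }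
    apply f_equal with (f := Cmod) in E2. rewrite Cmod_mult, Cmod_conj, Cmod_R, Rabs_pos_eq in E2 by nra.
    assert (Cmod z * Cmod w <= Cmod z * m) by (apply Rmult_le_compat_l; unfold rho' in *; lra). lra. }
  set (G := fun w => (F w * (Cconj z * w * / D w))%C).
  assert (HG : adisc rho' G).
  { apply adisc_mult. apply (adisc_le rho); auto.
    apply adisc_mult. apply adisc_scal, adisc_id. apply adisc_inv; auto.
    apply (adisc_ext _ (fun w => (RtoC (r ^ 2) + - Cconj z * w)%C)). intros; unfold D; ring.
    apply adisc_plus; [apply adisc_const|apply adisc_scal, adisc_id]. }
  assert (Hin : forall t, Cmod (cpt r t) < rho) by (intros; rewrite Cmod_cpt; auto).
  assert (Hin' : forall t, Cmod (cpt r t) < rho') by (intros; rewrite Cmod_cpt; auto).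
  assert (H00 : Cmod 0 < r) by (rewrite Cmod_0; auto).
  pose proof (cauchy_formula rho r F z HF Hz Hr) as K1.
  pose proof (cauchy_formula rho' r G 0 HG H00 Hrr) as K2.
  replace (G 0) with (RtoC 0) in K2.
  2:{ unfold G. field. apply HD. rewrite Cmod_0; lra. }
  rewrite Cmult_0_r in K2.
  replace (2 * PI * F z)%C with (2 * PI * F z + 0)%C by ring.
  rewrite <- K1, <- K2, <- CI_plus.
  - apply CI_ext. intros t _.
    pose proof (cpt_neq r t z Hr0 Hz) as N1. pose proof (cpt_neq r t 0 Hr0 H00) as N2.
    pose proof (HD _ (Hin' t)) as N3.
    assert (E : RtoC (poisson r z t) = (cpt r t / (cpt r t - z) + Cconj z * cpt r t * / D (cpt r t))%C).
    { assert (E1 : RtoC (r ^ 2) = (cpt r t * Cconj (cpt r t))%C).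
      { rewrite <- Cmod2_conj, Cmod_cpt by auto. rewrite RtoC_pow. reflexivity. }
      assert (N4 : (Cconj (cpt r t) - Cconj z)%C <> 0).
      { intros E2. apply N1. apply (f_equal Cconj) in E2.
        rewrite Cminus_conj, !Cconj_conj in E2. rewrite E2. apply Ceq; simpl; ring. }
      assert (N5 : cpt r t <> 0) by (intros E2; apply N2; rewrite E2; ring).
      assert (ED : D (cpt r t) = (cpt r t * (Cconj (cpt r t) - Cconj z))%C) by (unfold D; rewrite E1; ring).
      rewrite ED.
      replace (Cconj z * cpt r t * / (cpt r t * (Cconj (cpt r t) - Cconj z)))%C with
        (Cconj (z / (cpt r t - z)))%C.
      - unfold poisson. replace ((cpt r t + z) / (cpt r t - z))%C with
          (cpt r t / (cpt r t - z) + z / (cpt r t - z))%C by (field; auto).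
        assert (E6 : (cpt r t / (cpt r t - z) = 1 + z / (cpt r t - z))%C) by (field; auto).
        rewrite E6. apply Ceq; simpl; ring.
      - unfold Cdiv. rewrite Cmult_conj, Cinv_conj, Cminus_conj by auto. field. auto. }
    rewrite E. unfold G.
    assert (N5 : cpt r t <> 0) by (intros E2; apply N2; rewrite E2; ring).
    field. auto.
  - apply ex_CI_curve; intros t _. apply ccurve_mult. apply ccurve_comp; [|apply ccurve_cpt].
    eapply adisc_ccont; eauto. apply ccurve_mult; [apply ccurve_cpt|apply ccurve_kernel; auto].
  - apply ex_CI_curve; intros t _. apply ccurve_mult. apply ccurve_comp; [|apply ccurve_cpt].
    eapply adisc_ccont; eauto. apply ccurve_mult; [apply ccurve_cpt|apply ccurve_kernel; auto].
Qed.

Lemma poisson_analytic_re (rho r : R) (F : C -> C) (z : C) : adisc rho F -> Cmod z < r -> r < rho ->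
  RInt (fun t => fst (F (cpt r t)) * poisson r z t) 0 (2 * PI) = 2 * PI * fst (F z).
Proof.
  intros HF Hz Hr. pose proof (poisson_analytic rho r F z HF Hz Hr) as K.
  apply (f_equal fst) in K. simpl in K.
  rewrite (RInt_Rext _ (fun t => fst (F (cpt r t)) * poisson r z t - snd (F (cpt r t)) * 0)).
  rewrite K; eqR; ring. intros; ring.
Qed.

Lemma poisson_one (r : R) (z : C) : Cmod z < r -> RInt (poisson r z) 0 (2 * PI) = 2 * PI.
Proof.
  intros Hz. pose proof (poisson_analytic_re (r + 1) r (fun _ => RtoC 1) z (adisc_const _ _) Hz ltac:(lra)) as K.
  simpl in K. rewrite Rmult_1_r in K. eapply eq_trans; [|exact K]. apply RInt_Rext; intros; ring.
Qed.

(** Expand [|F(ζ)|^2] around [F(z)]; the mixed term is the real part of an analytic function of [ζ],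
    hence reproduced by the Poisson kernel. *)
Lemma poisson_variance (rho r : R) (F : C -> C) (z : C) : adisc rho F -> Cmod z < r -> r < rho ->
  RInt (fun t => Cmod (F (cpt r t)) ^ 2 * poisson r z t) 0 (2 * PI) =
  RInt (fun t => Cmod (F (cpt r t) - F z) ^ 2 * poisson r z t) 0 (2 * PI) + 2 * PI * Cmod (F z) ^ 2.
Proof.
  intros HF Hz Hr. pose proof (Cmod_ge_0 z). assert (Hr0 : 0 <= r) by lra.
  pose proof (poisson_analytic_re rho r (fun w => (Cconj (F z) * F w)%C) z (adisc_scal _ _ _ HF) Hz Hr) as K.
  pose proof (poisson_one r z Hz) as K1.
  assert (Cp : forall t, continuity_pt (poisson r z) t) by (intros; apply poisson_cont; auto).
  assert (CF : forall t, ccont F (cpt r t)).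
  { intros t. eapply adisc_ccont; eauto. rewrite Cmod_cpt; auto. }
  assert (Ep : ex_RInt (poisson r z) 0 (2 * PI)) by (apply ex_RInt_cpt; auto).
  assert (E1 : ex_RInt (fun t => fst (Cconj (F z) * F (cpt r t))%C * poisson r z t) 0 (2 * PI)).
  { apply ex_RInt_cpt. intros t _. apply continuity_pt_mult; auto.
    apply (rcont_ccurve (fun w => fst (Cconj (F z) * F w)%C) (cpt r)); [|apply ccurve_cpt].
    apply ccont_fst, ccont_scal; auto. }
  assert (E2 : ex_RInt (fun t => Cmod (F (cpt r t) - F z) ^ 2 * poisson r z t) 0 (2 * PI)).
  { apply ex_RInt_cpt. intros t _. apply continuity_pt_mult; auto.
    apply (rcont_ccurve (fun w => Cmod (F w - F z) ^ 2) (cpt r)); [|apply ccurve_cpt].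
    apply (rcont_Cmod2 (fun w => (F w - F z)%C)). apply ccont_minus; auto. apply ccont_const. }
  rewrite (RInt_Rext _ (fun t => (Cmod (F (cpt r t) - F z) ^ 2 * poisson r z t +
     2 * (fst (Cconj (F z) * F (cpt r t))%C * poisson r z t)) + - Cmod (F z) ^ 2 * poisson r z t)).
  2:{ intros t. rewrite !Cmod_sqr. simpl; ring. }
  assert (E3 := ex_RInt_Rscal _ _ _ 2 E1). assert (E4 := ex_RInt_Rscal _ _ _ (- Cmod (F z) ^ 2) Ep).
  assert (E5 := ex_RInt_Rplus _ _ _ _ E2 E3).
  rewrite (RInt_Rplus _ _ _ _ E5 E4), (RInt_Rplus _ _ _ _ E2 E3), !RInt_Rscal, K, K1 by auto.
  rewrite !Cmod_sqr; simpl; ring.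
Qed.

(** An analytic function with the Poisson integral of [psi] as its real part. Harmonic functions
    occur only in this form, so that the jets of analytic functions apply to them. *)
Definition schwarz (r : R) (psi : R -> R) (z : C) : C :=
  (/ (2 * PI) * CI (fun t => (psi t * ((cpt r t + z) / (cpt r t - z)))%C) 0 (2 * PI))%C.

Lemma schwarz_re (r : R) (psi : R -> R) (z : C) :
  fst (schwarz r psi z) = / (2 * PI) * RInt (fun t => psi t * poisson r z t) 0 (2 * PI).
Proof.
  unfold schwarz, CI. pose proof PI_RGT_0.
  rewrite <- RtoC_mult, <- RtoC_inv by lra. simpl fst.
  rewrite (RInt_Rext (fun t => psi t * poisson r z t)
    (fun t => psi t * fst ((cpt r t + z) / (cpt r t - z))%C - 0 * snd ((cpt r t + z) / (cpt r t - z))%C)).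
  simpl. ring.
  intros t; unfold poisson; ring.
Qed.

(** Since [(ζ + z) / (ζ - z) = 2 ζ / (ζ - z) - 1], this is a Cauchy-type integral up to a
    constant. *)
Lemma schwarz_adisc (r : R) (psi : R -> R) : (forall t, continuity_pt psi t) -> adisc r (schwarz r psi).
Proof.
  intros Hpsi z Hz. pose proof (Cmod_ge_0 z).
  set (q := fun t => (RtoC (psi t) * cpt r t)%C).
  assert (Hp : forall t, ccurve (fun t => RtoC (psi t)) t) by (intros; apply ccurve_RtoC; auto).
  assert (Hq : forall t, ccurve q t) by (intros; apply ccurve_mult; auto; apply ccurve_cpt).
  pose proof (proj1 (CK_cdiff r q z Hz Hq)) as D.
  eexists. apply (cdiff_disc_ext (fun w => (/ (2 * PI) * (2 * CK r q 1 w + - CI (fun t => RtoC (psi t)) 0 (2 * PI)))%C) _ _ _ r Hz).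
  2:{ apply cdiff_scal, cdiff_plus; [apply cdiff_scal, D|apply cdiff_const]. }
  intros w Hw. unfold schwarz. f_equal. unfold CK.
  assert (E1 : ex_CI (fun t => (q t * (/ (cpt r t - w)) ^ 1)%C) 0 (2 * PI)).
  { apply ex_CI_curve; intros; apply ccurve_CK; auto. lra. }
  rewrite <- CI_scal by auto.
  match goal with |- (?a + - ?b)%C = _ => change (a + - b)%C with (a - b)%C end.
  rewrite <- CI_minus; [|apply ex_CI_scal; auto|apply ex_CI_curve; auto].
  apply CI_ext. intros t _. unfold q. simpl. field. apply cpt_neq; lra.
Qed.

Lemma sqr_le_schwarz (rho r : R) (F : C -> C) (z : C) : adisc rho F -> Cmod z < r -> r < rho ->
  fst (schwarz r (fun t => Cmod (F (cpt r t)) ^ 2) z) =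
  / (2 * PI) * RInt (fun t => Cmod (F (cpt r t) - F z) ^ 2 * poisson r z t) 0 (2 * PI) + Cmod (F z) ^ 2 /\
  Cmod (F z) ^ 2 <= fst (schwarz r (fun t => Cmod (F (cpt r t)) ^ 2) z).
Proof.
  intros HF Hz Hr. pose proof PI_RGT_0. pose proof (Cmod_ge_0 z).
  rewrite schwarz_re, (poisson_variance rho r F z HF Hz Hr).
  assert (P : 0 <= RInt (fun t => Cmod (F (cpt r t) - F z) ^ 2 * poisson r z t) 0 (2 * PI)).
  { apply RInt_ge_0; [lra| |].
    - apply ex_RInt_cpt. intros t _. apply continuity_pt_mult.
      apply (rcont_ccurve (fun w => Cmod (F w - F z) ^ 2) (cpt r)); [|apply ccurve_cpt].
      apply (rcont_Cmod2 (fun w => (F w - F z)%C)). apply ccont_minus; [|apply ccont_const].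
      eapply adisc_ccont; eauto. rewrite Cmod_cpt; lra.
      apply poisson_cont; lra.
    - intros t _. apply Rmult_le_pos; [apply pow2_ge_0|]. left; apply poisson_pos; lra. }
  split; [field; lra|].
  rewrite Rmult_plus_distr_l. replace (/ (2 * PI) * (2 * PI * Cmod (F z) ^ 2)) with (Cmod (F z) ^ 2) by (field; lra).
  assert (0 <= / (2 * PI)) by (left; apply Rinv_0_lt_compat; lra).
  pose proof (Rmult_le_pos _ _ H1 P). lra.
Qed.

(** * Disc automorphisms and harmonic majorants *)

Definition moebius (a z : C) : C := ((a - z) / (1 - Cconj a * z))%C.

Lemma moebius_den (a z : C) : Cmod a < 1 -> Cmod z < 1 -> (1 - Cconj a * z)%C <> 0.
Proof.
  intros Ha Hz E.
  assert (E2 : (Cconj a * z)%C = 1) by (replace (Cconj a * z)%C with (1 - (1 - Cconj a * z))%C by ring; rewrite E; ring).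
  apply (f_equal Cmod) in E2. rewrite Cmod_mult, Cmod_conj, Cmod_1 in E2.
  pose proof (Cmod_ge_0 a); pose proof (Cmod_ge_0 z). nra.
Qed.

(** From [1 - |σ_a(z)|^2 = (1 - |a|^2)(1 - |z|^2) / D^2] with [D <= 2]. The quantitative form
    provides one radius below 1 for the image of a whole disc. *)
Lemma moebius_mod (a z : C) : Cmod a < 1 -> Cmod z < 1 ->
  Cmod (moebius a z) ^ 2 <= 1 - (1 - Cmod a ^ 2) * (1 - Cmod z ^ 2) / 4.
Proof.
  intros Ha Hz. pose proof (moebius_den a z Ha Hz) as Hn.
  unfold moebius. rewrite Cmod_div by auto.
  set (D := Cmod (1 - Cconj a * z)). assert (HD : 0 < D) by (apply Cmod_pos; auto).
  assert (HD2 : D <= 2).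
  { unfold D. pose proof (Cmod_triangle 1 (- (Cconj a * z))) as T.
    rewrite Cmod_opp, Cmod_mult, Cmod_conj, Cmod_1 in T. unfold Cminus.
    pose proof (Cmod_ge_0 a); pose proof (Cmod_ge_0 z). nra. }
  assert (E : Cmod (a - z) ^ 2 = D ^ 2 - (1 - Cmod a ^ 2) * (1 - Cmod z ^ 2)).
  { unfold D. rewrite !Cmod_sqr. simpl; ring. }
  replace ((Cmod (a - z) / D) ^ 2) with (Cmod (a - z) ^ 2 / D ^ 2) by (field; lra).
  rewrite E.
  replace ((D ^ 2 - (1 - Cmod a ^ 2) * (1 - Cmod z ^ 2)) / D ^ 2) with
    (1 - ((1 - Cmod a ^ 2) * (1 - Cmod z ^ 2)) * / D ^ 2) by (field; lra).
  assert (/ 4 <= / D ^ 2) by (apply Rinv_le_contravar; nra).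
  pose proof (Cmod_ge_0 a); pose proof (Cmod_ge_0 z).
  assert (0 <= (1 - Cmod a ^ 2) * (1 - Cmod z ^ 2)) by (apply Rmult_le_pos; nra).
  unfold Rdiv. nra.
Qed.

Lemma moebius_lt1 (a z : C) : Cmod a < 1 -> Cmod z < 1 -> Cmod (moebius a z) < 1.
Proof.
  intros Ha Hz. pose proof (moebius_mod a z Ha Hz).
  pose proof (Cmod_ge_0 a); pose proof (Cmod_ge_0 z); pose proof (Cmod_ge_0 (moebius a z)).
  assert (0 < (1 - Cmod a ^ 2) * (1 - Cmod z ^ 2)) by (apply Rmult_lt_0_compat; nra). nra.
Qed.

Lemma moebius_invol (a z : C) : Cmod a < 1 -> Cmod z < 1 -> moebius a (moebius a z) = z.
Proof.
  intros Ha Hz. pose proof (moebius_den a z Ha Hz) as N1.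
  pose proof (moebius_den a _ Ha (moebius_lt1 a z Ha Hz)) as N2.
  pose proof (moebius_den a a Ha Ha) as N3.
  unfold moebius. field. split; [exact N1|].
  intros E; apply N3. rewrite <- E; ring.
Qed.

Lemma moebius_adisc (a : C) : Cmod a < 1 -> adisc 1 (moebius a).
Proof.
  intros Ha. apply adisc_mult.
  - apply (adisc_ext _ (fun z => (a + - (1) * z)%C)). intros; ring.
    apply adisc_plus; [apply adisc_const|apply adisc_scal, adisc_id].
  - apply adisc_inv; [|intros z Hz; apply moebius_den; auto].
    apply (adisc_ext _ (fun z => (1 + - Cconj a * z)%C)). intros; ring.
    apply adisc_plus; [apply adisc_const|apply adisc_scal, adisc_id].
Qed.

(* The least harmonic majorant of [|g|^2] on [|z| < r] exceeds [|g|^2] at [a] by at most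
   the squared norm of [g ∘ σ_a - g(a)]. *)
Lemma bmoa_potential (g : C -> C) (r B : R) : adisc 1 g -> 0 < r < 1 ->
  (forall a, Cmod a < 1 -> adisc 1 (fun z => (g (moebius a z) - g a)%C) /\
     forall s, 0 <= s < 1 -> circ (fun z => Cmod (g (moebius a z) - g a) ^ 2) s <= 2 * PI * B) ->
  exists S, adisc r S /\ forall z, Cmod z < r -> 0 <= fst (S z) - Cmod (g z) ^ 2 <= B.
Proof.
  intros Hg Hr HB. pose proof PI_RGT_0.
  exists (schwarz r (fun t => Cmod (g (cpt r t)) ^ 2)). split.
  { apply schwarz_adisc. intros t.
    apply (rcont_ccurve (fun w => Cmod (g w) ^ 2) (cpt r)); [|apply ccurve_cpt].
    apply rcont_Cmod2. eapply adisc_ccont; eauto. rewrite Cmod_cpt; lra. }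
  intros a Ha. destruct (sqr_le_schwarz 1 r g a Hg Ha ltac:(lra)) as [E L].
  split; [lra|]. rewrite E. replace (_ + _ - _) with
    (/ (2 * PI) * RInt (fun t => Cmod (g (cpt r t) - g a) ^ 2 * poisson r a t) 0 (2 * PI)) by ring.
  assert (Ha1 : Cmod a < 1) by lra.
  destruct (HB a Ha1) as [Hk HkB].
  set (k := fun z => (g (moebius a z) - g a)%C) in *.
  set (r' := (1 + r) / 2).
  (* A bound for [|σ_a|^2] on the disc of radius [r']. The radius [s = (1 + m) / 2] below exceeds
     the square root of [m], because [s^2 - m = (1 - m)^2 / 4]. *)
  set (m := 1 - (1 - Cmod a ^ 2) * (1 - r' ^ 2) / 4).
  pose proof (Cmod_ge_0 a).
  assert (Hmp : 0 < (1 - Cmod a ^ 2) * (1 - r' ^ 2)) by (apply Rmult_lt_0_compat; unfold r'; nra).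
  assert (Hm1 : m < 1) by (unfold m; lra).
  assert (Hm0 : 0 < m).
  { assert ((1 - Cmod a ^ 2) * (1 - r' ^ 2) <= 1 * 1) by (apply Rmult_le_compat; unfold r'; nra). unfold m; lra. }
  set (s := (1 + m) / 2).
  assert (Hs : forall w, Cmod w < r' -> Cmod (moebius a w) < s).
  { intros w Hw. pose proof (Cmod_ge_0 w).
    assert (Cmod w < 1) by (unfold r' in Hw; lra).
    pose proof (moebius_mod a w Ha1 H2).
    assert (Cmod (moebius a w) ^ 2 <= m).
    { eapply Rle_trans; [exact H3|]. unfold m.
      assert (Cmod w ^ 2 <= r' ^ 2) by (apply pow_incr; lra).
      assert (0 < 1 - Cmod a ^ 2) by nra. nra. }
    apply Rnot_le_lt; intros Hge.
    assert (s ^ 2 <= Cmod (moebius a w) ^ 2) by (apply pow_incr; split; [unfold s; lra|exact Hge]).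
    assert (0 < (1 - m) ^ 2) by (apply pow_lt; lra).
    unfold s in *. nra. }
  (* The real part of [U] majorises [|k|^2] on the disc of radius [s], so that of [U ∘ σ_a]
     majorises [|g - g(a)|^2] on the circle of radius [r]. Being harmonic, it has at [a] the Poisson
     integral [Re U(0)], which is the mean of [|k|^2] over the circle of radius [s]. *)
  set (U := schwarz s (fun t => Cmod (k (cpt s t)) ^ 2)).
  assert (Ks : forall t, continuity_pt (fun t => Cmod (k (cpt s t)) ^ 2) t).
  { intros t. apply (rcont_ccurve (fun w => Cmod (k w) ^ 2) (cpt s)); [|apply ccurve_cpt].
    apply rcont_Cmod2. eapply adisc_ccont; [exact Hk|]. rewrite Cmod_cpt; unfold s; lra. }
  assert (HU : adisc s U) by (apply schwarz_adisc; auto).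
  assert (HT : adisc r' (fun w => U (moebius a w))).
  { intros w Hw. destruct (moebius_adisc a Ha1 w ltac:(unfold r' in Hw; lra)) as [l Hl].
    destruct (HU _ (Hs w Hw)) as [l' Hl']. eexists. apply (cdiff_comp (moebius a) U); eauto. }
  assert (Hrr : r < r') by (unfold r'; lra).
  pose proof (poisson_analytic_re r' r _ a HT Ha Hrr) as KT. cbv beta in KT.
  assert (Zero : moebius a a = 0).
  { unfold moebius. field. apply (moebius_den a a); auto. }
  rewrite Zero in KT.
  assert (U0 : fst (U 0) = / (2 * PI) * circ (fun z => Cmod (k z) ^ 2) s).
  { unfold U. rewrite schwarz_re. f_equal. apply RInt_Rext. intros t.
    rewrite poisson_eq; rewrite ?Cmod_0; try (unfold s; lra).
    replace (cpt s t - 0)%C with (cpt s t) by ring. rewrite Cmod_cpt by (unfold s; lra).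
    field. unfold s; lra. }
  assert (U0B : fst (U 0) <= B).
  { rewrite U0. apply Rmult_le_reg_l with (2 * PI); [lra|].
    rewrite <- Rmult_assoc, Rinv_r, Rmult_1_l by lra. apply HkB. unfold s; lra. }
  assert (In : RInt (fun t => Cmod (g (cpt r t) - g a) ^ 2 * poisson r a t) 0 (2 * PI)
    <= RInt (fun t => fst (U (moebius a (cpt r t))) * poisson r a t) 0 (2 * PI)).
  { apply RInt_le; [lra| | |].
    - apply ex_RInt_cpt. intros t _. apply continuity_pt_mult; [|apply poisson_cont; lra].
      apply (rcont_ccurve (fun w => Cmod (g w - g a) ^ 2) (cpt r)); [|apply ccurve_cpt].
      apply (rcont_Cmod2 (fun w => (g w - g a)%C)). apply ccont_minus; [|apply ccont_const].
      eapply adisc_ccont; eauto. rewrite Cmod_cpt; lra.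
    - apply ex_RInt_cpt. intros t _. apply continuity_pt_mult; [|apply poisson_cont; lra].
      apply (rcont_ccurve (fun w => fst (U (moebius a w))) (cpt r)); [|apply ccurve_cpt].
      apply (ccont_fst (fun w => U (moebius a w))). eapply adisc_ccont; [exact HT|]. rewrite Cmod_cpt; lra.
    - intros t _. apply Rmult_le_compat_r; [left; apply poisson_pos; lra|].
      assert (Hin : Cmod (cpt r t) < 1) by (rewrite Cmod_cpt; lra).
      replace (g (cpt r t) - g a)%C with (k (moebius a (cpt r t))).
      2:{ unfold k. rewrite moebius_invol; auto. }
      refine (proj2 (sqr_le_schwarz 1 s k _ Hk (Hs _ _) _)). rewrite Cmod_cpt; lra. unfold s; lra. }
  rewrite KT in In.
  apply Rmult_le_reg_l with (2 * PI); [lra|].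
  rewrite <- Rmult_assoc, Rinv_r, Rmult_1_l by lra.
  assert (2 * PI * fst (U 0) <= 2 * PI * B) by (apply Rmult_le_compat_l; lra). lra.
Qed.

(** * Powers and integral means *)

Lemma rpow_pos_eq (x q : R) : 0 < x -> rpow x q = Rpower x q.
Proof. intros H; unfold rpow. destruct (Rle_dec x 0); [lra|auto]. Qed.

Lemma rpow_0 (q : R) : rpow 0 q = 0.
Proof. unfold rpow. destruct (Rle_dec 0 0); [auto|lra]. Qed.

Lemma Rpower_pos (x q : R) : 0 < Rpower x q.
Proof. apply exp_pos. Qed.

Lemma rpow_ge0 (x q : R) : 0 <= rpow x q.
Proof. unfold rpow. destruct (Rle_dec x 0); [lra|left; apply Rpower_pos]. Qed.

Lemma rpow_pos (x q : R) : 0 < x -> 0 < rpow x q.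
Proof. intros; rewrite rpow_pos_eq; auto; apply Rpower_pos. Qed.

Lemma rpow_mono (x y q : R) : 0 < q -> 0 <= x <= y -> rpow x q <= rpow y q.
Proof.
  intros Hq [Hx Hxy]. destruct (Req_dec x 0) as [->|Hx0].
  - rewrite rpow_0; apply rpow_ge0.
  - rewrite !rpow_pos_eq by lra. apply Rle_Rpower_l; lra.
Qed.

Lemma rpow_mult (x y q : R) : 0 <= x -> 0 <= y -> rpow (x * y) q = rpow x q * rpow y q.
Proof.
  intros Hx Hy. destruct (Req_dec x 0) as [->|Hx0].
  { rewrite Rmult_0_l, !rpow_0; ring. }
  destruct (Req_dec y 0) as [->|Hy0].
  { rewrite Rmult_0_r, !rpow_0; ring. }
  rewrite !rpow_pos_eq by (try apply Rmult_lt_0_compat; lra).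
  symmetry; apply Rpower_mult_distr; lra.
Qed.

Lemma rpow_plus (x a b : R) : 0 <= x -> rpow x (a + b) = rpow x a * rpow x b.
Proof.
  intros Hx. destruct (Req_dec x 0) as [->|Hx0]; [rewrite !rpow_0; ring|].
  rewrite !rpow_pos_eq by lra. apply Rpower_plus.
Qed.

Lemma rpow_rpow (x a b : R) : 0 <= x -> rpow (rpow x a) b = rpow x (a * b).
Proof.
  intros Hx. destruct (Req_dec x 0) as [->|Hx0]; [rewrite !rpow_0; auto|].
  rewrite (rpow_pos_eq x) by lra. rewrite rpow_pos_eq by apply Rpower_pos.
  rewrite rpow_pos_eq by lra. apply Rpower_mult.
Qed.

Lemma rpow_1 (x : R) : 0 <= x -> rpow x 1 = x.
Proof.
  intros Hx. destruct (Req_dec x 0) as [->|Hx0]; [apply rpow_0|].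
  rewrite rpow_pos_eq by lra. apply Rpower_1; lra.
Qed.

Lemma rpow_2 (x : R) : 0 <= x -> rpow x 2 = x ^ 2.
Proof.
  intros Hx. replace 2 with (1 + 1) at 1 by ring. rewrite rpow_plus, rpow_1; auto. ring.
Qed.

Lemma rpow_one (q : R) : rpow 1 q = 1.
Proof. rewrite rpow_pos_eq by lra. unfold Rpower. rewrite ln_1, Rmult_0_r. apply exp_0. Qed.

Lemma rpow_sqr (x q : R) : 0 <= x -> rpow (x ^ 2) q = rpow x (2 * q).
Proof. intros Hx. rewrite <- rpow_2, rpow_rpow; auto. Qed.

Lemma rpow_exp_mono (x a b : R) : 1 <= x -> a <= b -> rpow x a <= rpow x b.
Proof. intros Hx Hab. rewrite !rpow_pos_eq by lra. apply Rle_Rpower; auto. Qed.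

Lemma rpow_cont (q x : R) : 0 < q -> continuity_pt (fun x => rpow x q) x.
Proof.
  intros Hq. destruct (Rlt_le_dec 0 x) as [Hx|Hx].
  - apply (continuity_pt_ext_loc (fun x => Rpower x q)).
    + exists (mkposreal x Hx). intros y Hy. simpl in Hy. change (Rabs (y - x) < x) in Hy.
      apply Rabs_def2 in Hy. rewrite rpow_pos_eq; auto; lra.
    + unfold Rpower. apply derive_cpt. auto_derive. auto.
  - apply continuity_pt_locally. intros eps.
    assert (E0 : rpow x q = 0) by (unfold rpow; destruct (Rle_dec x 0); lra).
    pose proof (rpow_pos (eps / 2) (/ q) ltac:(pose proof (cond_pos eps); lra)) as Hd.
    exists (mkposreal _ Hd). intros y Hy. change (Rabs (y - x) < rpow (eps / 2) (/ q)) in Hy.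
    apply Rabs_def2 in Hy. rewrite E0, Rminus_0_r, Rabs_pos_eq by apply rpow_ge0.
    pose proof (cond_pos eps).
    destruct (Rle_lt_dec y 0) as [Hy0|Hy0].
    { unfold rpow; destruct (Rle_dec y 0); lra. }
    apply Rle_lt_trans with (rpow (rpow (eps / 2) (/ q)) q).
    apply rpow_mono; auto. lra.
    rewrite rpow_rpow, Rinv_l, rpow_1 by lra. lra.
Qed.

Lemma rpow_add_le (a b q : R) : 0 < q -> 0 <= a -> 0 <= b ->
  rpow (a + b) q <= rpow 2 q * (rpow a q + rpow b q).
Proof.
  intros Hq Ha Hb. pose proof (rpow_ge0 a q); pose proof (rpow_ge0 b q); pose proof (rpow_ge0 2 q).
  destruct (Rle_dec a b).
  - apply Rle_trans with (rpow (2 * b) q). apply rpow_mono; lra.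
    rewrite rpow_mult by lra. apply Rmult_le_compat_l; lra.
  - apply Rle_trans with (rpow (2 * a) q). apply rpow_mono; lra.
    rewrite rpow_mult by lra. apply Rmult_le_compat_l; lra.
Qed.

(** Where [x^2 >= eta], adding [eta^2] costs at most the factor [1 + eta]; elsewhere the whole power
    is at most the small additive term. This treats [q] below and above 1 alike. *)
Lemma rpow_reg (x eta q : R) : 0 < q -> 0 <= x -> 0 < eta ->
  rpow (x ^ 2 + eta ^ 2) q <= rpow (1 + eta) q * rpow x (2 * q) + rpow (eta + eta ^ 2) q.
Proof.
  intros Hq Hx He. pose proof (rpow_ge0 (eta + eta ^ 2) q).
  pose proof (rpow_ge0 (1 + eta) q). pose proof (rpow_ge0 x (2 * q)).
  destruct (Rle_dec eta (x ^ 2)) as [H2|H2].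
  - apply Rle_trans with (rpow ((1 + eta) * x ^ 2) q).
    + apply rpow_mono; auto. split; nra.
    + rewrite rpow_mult, rpow_sqr by nra. lra.
  - apply Rle_trans with (rpow (eta + eta ^ 2) q); [apply rpow_mono; nra|].
    pose proof (Rmult_le_pos _ _ H0 H1). lra.
Qed.

(** The limit that removes the smoothing: each comparison of regularised means is brought into this
    form. *)
Lemma rpow_reg_limit (Y c1 c2 q : R) : 0 < q ->
  (forall eta, 0 < eta -> Y <= rpow (1 + eta) q * c1 + c2 * rpow (eta + eta ^ 2) q) -> Y <= c1.
Proof.
  intros Hq H.
  set (F := fun eta => rpow (1 + eta) q * c1 + c2 * rpow (eta + eta ^ 2) q).
  assert (HF : continuity_pt F 0).
  { apply continuity_pt_plus; apply continuity_pt_mult.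
    - apply (continuity_pt_comp (fun e => 1 + e) (fun x => rpow x q)).
      apply derive_cpt; auto_derive; auto. apply rpow_cont; auto.
    - apply continuity_pt_const; intros ? ?; auto.
    - apply continuity_pt_const; intros ? ?; auto.
    - apply (continuity_pt_comp (fun e => e + e ^ 2) (fun x => rpow x q)).
      apply derive_cpt; auto_derive; auto. apply rpow_cont; auto. }
  assert (F0 : F 0 = c1).
  { unfold F. replace (0 + 0 ^ 2) with 0 by ring. rewrite Rplus_0_r, rpow_0, rpow_one; ring. }
  apply Rle_plus_epsilon. intros eps He.
  destruct (proj1 (continuity_pt_locally F 0) HF (mkposreal eps He)) as [d Hd].
  pose proof (cond_pos d).
  specialize (Hd (d / 2)). rewrite F0 in Hd.
  assert (K : Rabs (F (d / 2) - c1) < eps).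
  { apply Hd. change (Rabs (d / 2 - 0) < d). rewrite Rminus_0_r, Rabs_pos_eq; lra. }
  apply Rabs_def2 in K. specialize (H (d / 2) ltac:(lra)). fold (F (d / 2)) in H. lra.
Qed.

(** * Calculus of means over circles *)

Definition excirc (V : C -> R) (r : R) : Prop := ex_RInt (fun t => V (cpt r t)) 0 (2 * PI).

Lemma excirc_rcont (V : C -> R) (r : R) : 0 <= r -> (forall z, Cmod z = r -> rcont V z) -> excirc V r.
Proof.
  intros Hr H. apply ex_RInt_cpt. intros t _. apply (rcont_ccurve V (cpt r)); [|apply ccurve_cpt].
  apply H, Cmod_cpt, Hr.
Qed.

Lemma circ_le (V W : C -> R) (r : R) : 0 <= r -> excirc V r -> excirc W r ->
  (forall z, Cmod z = r -> V z <= W z) -> circ V r <= circ W r.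
Proof.
  intros Hr HV HW H. pose proof PI_RGT_0. apply RInt_le; auto; try lra.
  intros t _. apply H, Cmod_cpt, Hr.
Qed.

Lemma circ_ext (V W : C -> R) (r : R) : (forall z, V z = W z) -> circ V r = circ W r.
Proof. intros H; apply RInt_Rext; intros; apply H. Qed.

Lemma circ_plus (V W : C -> R) (r : R) : excirc V r -> excirc W r ->
  circ (fun z => V z + W z) r = circ V r + circ W r.
Proof. intros HV HW; exact (RInt_Rplus _ _ _ _ HV HW). Qed.

Lemma circ_minus (V W : C -> R) (r : R) : excirc V r -> excirc W r ->
  circ (fun z => V z - W z) r = circ V r - circ W r.
Proof. intros HV HW; exact (RInt_Rminus _ _ _ _ HV HW). Qed.

Lemma circ_scal (c : R) (V : C -> R) (r : R) : excirc V r ->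
  circ (fun z => c * V z) r = c * circ V r.
Proof. intros HV; exact (RInt_Rscal _ _ _ c HV). Qed.

Lemma circ_const (c r : R) : circ (fun _ => c) r = 2 * PI * c.
Proof. unfold circ. pose proof (RInt_Rconst 0 (2 * PI) c) as E. rewrite Rminus_0_r in E. exact E. Qed.

Lemma excirc_plus (V W : C -> R) (r : R) : excirc V r -> excirc W r ->
  excirc (fun z => V z + W z) r.
Proof. intros HV HW; exact (ex_RInt_Rplus _ _ _ _ HV HW). Qed.

Lemma excirc_minus (V W : C -> R) (r : R) : excirc V r -> excirc W r ->
  excirc (fun z => V z - W z) r.
Proof. intros HV HW; exact (ex_RInt_Rminus _ _ _ _ HV HW). Qed.

Lemma excirc_scal (c : R) (V : C -> R) (r : R) : excirc V r -> excirc (fun z => c * V z) r.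
Proof. intros HV; exact (ex_RInt_Rscal _ _ _ c HV). Qed.

Lemma excirc_const (c r : R) : excirc (fun _ => c) r.
Proof. exact (ex_RInt_const 0 (2 * PI) c). Qed.

Lemma circ_ge0 (V : C -> R) (r : R) : 0 <= r -> excirc V r -> (forall z, Cmod z = r -> 0 <= V z) ->
  0 <= circ V r.
Proof.
  intros Hr HV H. pose proof PI_RGT_0. apply RInt_ge_0; auto; [lra|].
  intros t _. apply H, Cmod_cpt, Hr.
Qed.

Lemma rcont_rpow (F : C -> C) (q : R) (z : C) : 0 < q -> ccont F z ->
  rcont (fun w => rpow (Cmod (F w)) q) z.
Proof.
  intros Hq H. apply (rcont_comp (fun x => rpow x q)); [apply rpow_cont, Hq|apply rcont_Cmod, H].
Qed.

Lemma rcont_plus (u v : C -> R) (z : C) : rcont u z -> rcont v z -> rcont (fun w => u w + v w) z.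
Proof.
  intros Hu Hv eps He.
  destruct (Hu (eps / 2)) as [d1 [Hd1 K1]]; [lra|].
  destruct (Hv (eps / 2)) as [d2 [Hd2 K2]]; [lra|].
  exists (Rmin d1 d2); split; [apply Rmin_pos; auto|]. intros w Hw.
  pose proof (Rmin_l d1 d2); pose proof (Rmin_r d1 d2).
  specialize (K1 w ltac:(lra)); specialize (K2 w ltac:(lra)).
  apply Rabs_def2 in K1; apply Rabs_def2 in K2. apply Rabs_def1; lra.
Qed.

Lemma rcont_scal (c : R) (u : C -> R) (z : C) : rcont u z -> rcont (fun w => c * u w) z.
Proof.
  intros H. apply (rcont_comp (fun x => c * x)); auto. apply derive_cpt; auto_derive; auto.
Qed.

Lemma rcont_const (c : R) (z : C) : rcont (fun _ => c) z.
Proof. intros eps He. exists 1; split; [lra|]. intros. rewrite Rminus_diag, Rabs_R0; auto. Qed.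

Lemma rcont_ext (u v : C -> R) (z : C) : (forall w, u w = v w) -> rcont u z -> rcont v z.
Proof.
  intros E H eps He. destruct (H eps He) as [d [Hd K]]. exists d; split; auto.
  intros w Hw. rewrite <- !E. auto.
Qed.

Lemma rcont_mult (u v : C -> R) (z : C) : rcont u z -> rcont v z -> rcont (fun w => u w * v w) z.
Proof.
  intros Hu Hv.
  pose proof (ccont_fst _ _ (ccont_mult (fun w => RtoC (u w)) (fun w => RtoC (v w)) z
    (rcont_ccont (fun w => RtoC (u w)) _ Hu (rcont_const 0 z)) (rcont_ccont (fun w => RtoC (v w)) _ Hv (rcont_const 0 z)))) as K.
  refine (rcont_ext _ _ _ _ K). intros w; simpl; ring.
Qed.

(** * Powers and exponential weights of positive jets *)

Definition jpow (q : R) (J : jet) : jet := jexp (jscal q (jln J)).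

Lemma wf_pow (X q : R) (J : jet) : wfjet X J -> (forall x y, x < X -> 0 < j0 J x y) ->
  wfjet X (jpow q J).
Proof. intros H Hp. apply wf_exp, wf_scal, wf_ln; auto. Qed.

Lemma j0_pow (q : R) (J : jet) (x y : R) : 0 < j0 J x y -> j0 (jpow q J) x y = rpow (j0 J x y) q.
Proof. intros H. rewrite rpow_pos_eq by auto. reflexivity. Qed.

Lemma lap_pow (q : R) (J : jet) (x y : R) : 0 < j0 J x y ->
  lap (jpow q J) x y = rpow (j0 J x y) q *
    (q * (lap J x y / j0 J x y) + (q ^ 2 - q) * (grad2 J x y / j0 J x y ^ 2)).
Proof.
  intros H. rewrite rpow_pos_eq by auto. unfold jpow.
  rewrite lap_exp, lap_scal, grad2_scal, lap_ln, grad2_ln by auto. unfold Rpower. simpl j0.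
  field. lra.
Qed.

(* Equivalent to [0 <= lap (jln J) x y]. *)
Definition logsub (J : jet) (x y : R) : Prop :=
  0 < j0 J x y /\ grad2 J x y <= j0 J x y * lap J x y.

Lemma logsub_quot (J : jet) (x y : R) : logsub J x y ->
  0 <= grad2 J x y / j0 J x y ^ 2 <= lap J x y / j0 J x y.
Proof.
  intros [H1 H2]. pose proof (grad2_ge0 J x y).
  assert (0 < / j0 J x y ^ 2) by (apply Rinv_0_lt_compat, pow_lt; auto).
  split; [apply Rmult_le_pos; lra|].
  replace (lap J x y / j0 J x y) with (j0 J x y * lap J x y / j0 J x y ^ 2) by (field; lra).
  unfold Rdiv. apply Rmult_le_compat_r; lra.
Qed.

(** Put [a = ΔJ / J] and [b = |∇J|^2 / J^2], so [0 <= b <= a]. The Laplacian of [J^q] is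
    [J^q (q a + (q^2 - q) b)], smallest at [b = 0] if [q >= 1] and at [b = a] if [q < 1]; this is
    the origin of the minimum. *)
Lemma lap_pow_lower (q : R) (J : jet) (x y : R) : 0 < q -> logsub J x y ->
  Rmin q (q ^ 2) * (rpow (j0 J x y) q * (lap J x y / j0 J x y)) <= lap (jpow q J) x y.
Proof.
  intros Hq HJ. pose proof (logsub_quot _ _ _ HJ) as [G1 G2]. destruct HJ as [Hp _].
  rewrite lap_pow by auto. pose proof (rpow_ge0 (j0 J x y) q).
  replace (Rmin q (q ^ 2) * (rpow (j0 J x y) q * (lap J x y / j0 J x y))) with
    (rpow (j0 J x y) q * (Rmin q (q ^ 2) * (lap J x y / j0 J x y))) by ring.
  apply Rmult_le_compat_l; auto.
  set (a := lap J x y / j0 J x y) in *. set (b := grad2 J x y / j0 J x y ^ 2) in *.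
  destruct (Rle_dec 1 q).
  - rewrite Rmin_left by nra. assert (0 <= (q ^ 2 - q) * b) by (apply Rmult_le_pos; nra). lra.
  - rewrite Rmin_right by nra. assert ((q - q ^ 2) * b <= (q - q ^ 2) * a) by (apply Rmult_le_compat_l; nra). lra.
Qed.

Lemma lap_pow_upper_ge1 (q : R) (J : jet) (x y : R) : 1 <= q -> logsub J x y ->
  lap (jpow q J) x y <= q ^ 2 * (rpow (j0 J x y) q * (lap J x y / j0 J x y)).
Proof.
  intros Hq HJ. pose proof (logsub_quot _ _ _ HJ) as [G1 G2]. destruct HJ as [Hp _].
  rewrite lap_pow by auto. pose proof (rpow_ge0 (j0 J x y) q).
  replace (q ^ 2 * (rpow (j0 J x y) q * (lap J x y / j0 J x y))) with
    (rpow (j0 J x y) q * (q ^ 2 * (lap J x y / j0 J x y))) by ring.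
  apply Rmult_le_compat_l; auto.
  set (a := lap J x y / j0 J x y) in *. set (b := grad2 J x y / j0 J x y ^ 2) in *.
  assert ((q ^ 2 - q) * b <= (q ^ 2 - q) * a) by (apply Rmult_le_compat_l; nra). lra.
Qed.

Lemma lap_pow_upper_le1 (q : R) (J : jet) (x y : R) : 0 < q <= 1 -> 0 < j0 J x y ->
  lap (jpow q J) x y <= q * (rpow (j0 J x y) q / j0 J x y * lap J x y).
Proof.
  intros Hq Hp. rewrite lap_pow by auto. pose proof (rpow_ge0 (j0 J x y) q).
  replace (q * (rpow (j0 J x y) q / j0 J x y * lap J x y)) with
    (rpow (j0 J x y) q * (q * (lap J x y / j0 J x y))) by (field; lra).
  apply Rmult_le_compat_l; auto.
  assert (0 <= grad2 J x y / j0 J x y ^ 2).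
  { apply Rmult_le_pos; [apply grad2_ge0|]. left; apply Rinv_0_lt_compat, pow_lt; auto. }
  assert (0 <= (q - q ^ 2) * (grad2 J x y / j0 J x y ^ 2)) by (apply Rmult_le_pos; nra). lra.
Qed.

Lemma logsub_mod2 (e : R) (F F1 F2 : C -> C) (x y : R) : 0 < e -> logsub (jmod2 e F F1 F2) x y.
Proof.
  intros He. unfold logsub. rewrite j0_mod2, lap_mod2, grad2_mod2.
  set (a := Cmod (F (cpt (exp x) y))). set (b := Cmod (F1 (cpt (exp x) y))).
  assert (0 <= a ^ 2) by apply pow2_ge_0. assert (0 <= b ^ 2) by apply pow2_ge_0.
  split; nra.
Qed.

Definition jweight (q : R) (J P : jet) : jet := jexp (jplus (jscal q (jln J)) (jscal (-1) P)).

Lemma wf_weight (X q : R) (J P : jet) : wfjet X J -> wfjet X P ->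
  (forall x y, x < X -> 0 < j0 J x y) -> wfjet X (jweight q J P).
Proof. intros HJ HP Hp. apply wf_exp, wf_plus; apply wf_scal; auto; apply wf_ln; auto. Qed.

Lemma j0_weight (q : R) (J P : jet) (x y : R) : 0 < j0 J x y ->
  j0 (jweight q J P) x y = rpow (j0 J x y) q * exp (- j0 P x y).
Proof.
  intros H. rewrite rpow_pos_eq by auto. unfold Rpower. rewrite <- exp_plus. simpl. f_equal; ring.
Qed.

(** For [u = q ln J - P] one has [Δ e^u >= e^u Δu], and [Δ ln J >= 0]; only [- ΔP] survives. *)
Lemma lap_weight (q : R) (J P : jet) (x y : R) : 0 < q -> logsub J x y ->
  rpow (j0 J x y) q * exp (- j0 P x y) * - lap P x y <= lap (jweight q J P) x y.
Proof.
  intros Hq HJ. pose proof (logsub_quot _ _ _ HJ) as [G1 G2]. destruct HJ as [Hp _].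
  rewrite <- j0_weight by auto. unfold jweight at 2. rewrite lap_exp.
  apply Rmult_le_compat_l; [left; apply exp_pos|].
  rewrite lap_plus, !lap_scal, lap_ln by auto.
  pose proof (grad2_ge0 (jplus (jscal q (jln J)) (jscal (-1) P)) x y).
  assert (0 <= q * (lap J x y / j0 J x y - grad2 J x y / j0 J x y ^ 2)) by (apply Rmult_le_pos; lra).
  lra.
Qed.

(** * Integral means of Volterra transforms *)

Definition reg (e q : R) (F : C -> C) (z : C) : R := rpow (Cmod (F z) ^ 2 + e) q.

Lemma rcont_reg (e q : R) (F : C -> C) (z : C) : 0 < q -> ccont F z -> rcont (reg e q F) z.
Proof.
  intros Hq H. apply (rcont_comp (fun x => rpow x q)); [apply rpow_cont, Hq|].
  apply rcont_plus; [apply rcont_Cmod2, H|apply rcont_const].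
Qed.

Lemma excirc_reg (e q r : R) (F : C -> C) : 0 < q -> adisc 1 F -> 0 <= r < 1 -> excirc (reg e q F) r.
Proof.
  intros Hq HF Hr. apply excirc_rcont; [lra|]. intros z Hz. apply rcont_reg; auto.
  eapply adisc_ccont; eauto; lra.
Qed.

Lemma excirc_rpow (q r : R) (F : C -> C) : 0 < q -> adisc 1 F -> 0 <= r < 1 ->
  excirc (fun z => rpow (Cmod (F z)) q) r.
Proof.
  intros Hq HF Hr. apply excirc_rcont; [lra|]. intros z Hz. apply rcont_rpow; auto.
  eapply adisc_ccont; eauto; lra.
Qed.

Lemma circ_reg_upper (eta q r : R) (F : C -> C) : 0 < q -> 0 < eta -> adisc 1 F -> 0 <= r < 1 ->
  circ (reg (eta ^ 2) q F) r <=
  rpow (1 + eta) q * circ (fun z => rpow (Cmod (F z)) (2 * q)) r + 2 * PI * rpow (eta + eta ^ 2) q.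
Proof.
  intros Hq He HF Hr.
  assert (E1 := excirc_rpow (2 * q) r F ltac:(lra) HF Hr).
  rewrite <- (circ_scal _ _ _ E1), <- (circ_const (rpow (eta + eta ^ 2) q) r), <- circ_plus;
    [|apply excirc_scal, E1|apply excirc_const].
  apply circ_le; [lra|apply excirc_reg; auto|apply excirc_plus; [apply excirc_scal, E1|apply excirc_const]|].
  intros z Hz. apply rpow_reg; auto. apply Cmod_ge_0.
Qed.

Lemma circ_reg_lower (e q r : R) (F : C -> C) : 0 < q -> 0 <= e -> adisc 1 F -> 0 <= r < 1 ->
  circ (fun z => rpow (Cmod (F z)) (2 * q)) r <= circ (reg e q F) r.
Proof.
  intros Hq He HF Hr.
  apply circ_le; [lra|apply excirc_rpow; auto; lra|apply excirc_reg; auto|].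
  intros z Hz. rewrite <- rpow_sqr by apply Cmod_ge_0. apply rpow_mono; auto.
  split; [apply pow2_ge_0|lra].
Qed.

Lemma jet_reg (rho e q : R) (F F1 F2 : C -> C) : 0 < e -> wfjet (ln rho) (jmod2 e F F1 F2) ->
  jetof (ln rho) (reg e q F) (jpow q (jmod2 e F F1 F2)).
Proof.
  intros He HW. assert (Hp : forall x y, 0 < j0 (jmod2 e F F1 F2) x y).
  { intros x y; apply (logsub_mod2 e F F1 F2 x y He). }
  split; [apply wf_pow; auto|]. intros x y _. rewrite j0_pow, j0_mod2 by auto. reflexivity.
Qed.

(** Hardy's monotonicity theorem: [(|F|^2 + eta^2)^(p/2)] is subharmonic, and then [eta] tends to
    0. *)
Lemma mean_mono (p r s : R) (F : C -> C) : 0 < p -> adisc 1 F -> 0 <= r <= s -> s < 1 ->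
  circ (fun z => rpow (Cmod (F z)) p) r <= circ (fun z => rpow (Cmod (F z)) p) s.
Proof.
  intros Hp HF Hr Hs. destruct (adisc_jets 1 F Rlt_0_1 HF) as (F1 & F2 & D & _ & W).
  set (q := p / 2). assert (Hq : 0 < q) by (unfold q; lra).
  replace p with (2 * q) by (unfold q; field).
  apply (rpow_reg_limit _ _ (2 * PI) q Hq). intros eta He.
  eapply Rle_trans; [|apply circ_reg_upper; auto; lra].
  eapply Rle_trans; [apply (circ_reg_lower (eta ^ 2)); auto; nra|].
  assert (He2 : 0 < eta ^ 2) by (apply pow_lt; auto).
  apply (circ_mono 1 r s _ (jpow q (jmod2 (eta ^ 2) F F1 F2))); auto.
  - apply jet_reg; auto.
  - apply rcont_reg; auto. eapply adisc_ccont; eauto. rewrite Cmod_0; lra.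
  - intros x y _. pose proof (logsub_mod2 (eta ^ 2) F F1 F2 x y He2) as L.
    eapply Rle_trans; [|apply lap_pow_lower; auto].
    apply Rmult_le_pos; [left; apply Rmin_pos; nra|]. apply Rmult_le_pos; [apply rpow_ge0|].
    pose proof (logsub_quot _ _ _ L); lra.
Qed.

(** A relation instead of the operator: the estimates use nothing but [h' = f g'] and [h(0) = 0],
    and the relation persists when [g] and [h] are multiplied by the same constant. *)
Definition volterra (g f h : C -> C) : Prop :=
  adisc 1 g /\ adisc 1 f /\ adisc 1 h /\ h 0 = 0 /\
  forall z, Cmod z < 1 -> exists l, cdiff g z l /\ cdiff h z (f z * l).

Lemma volterra_Dz (rho : R) (g f h g1 h1 : C -> C) (z : C) : volterra g f h -> rho <= 1 ->
  Dz rho g g1 -> Dz rho h h1 -> Cmod z < rho -> h1 z = (f z * g1 z)%C.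
Proof.
  intros (_ & _ & _ & _ & H) Hr Dg Dh Hz.
  destruct (H z) as (l & Hg & Hh); [lra|].
  destruct (Dg z Hz) as (lg & Hlg & ->). destruct (Dh z Hz) as (lh & Hlh & ->).
  rewrite (cdiff_unique _ _ _ _ Hlg Hg), (cdiff_unique _ _ _ _ Hlh Hh). ring.
Qed.

(** The quotient is [1 / x^(1 - s)], which does not increase. It permits dropping [|h|^2] from the
    Laplacian of a power of a sum. *)
Lemma rpow_le_div (s a b : R) : 0 < s <= 1 -> 0 < a <= b -> rpow b s / b <= rpow a s / a.
Proof.
  intros Hs Hab.
  assert (E : forall x, 0 < x -> rpow x s / x = / rpow x (1 - s)).
  { intros x Hx. pose proof (rpow_pos x (1 - s) Hx).
    assert (K : rpow x s * rpow x (1 - s) = x).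
    { rewrite <- rpow_plus by lra. replace (s + (1 - s)) with 1 by ring. apply rpow_1; lra. }
    rewrite <- K at 2. field. split; [lra|]. apply Rgt_not_eq, rpow_pos, Hx. }
  rewrite !E by lra. apply Rinv_le_contravar; [apply rpow_pos; lra|].
  destruct (Req_dec s 1) as [->|H1].
  - rewrite Rminus_diag. rewrite !rpow_pos_eq, !Rpower_O by lra. lra.
  - apply rpow_mono; lra.
Qed.

(** [P] is the potential [Re S - |g|^2]. Its first summand is harmonic by construction: the entries
    [j11] and [j22] of [jre] are opposite. *)
Lemma potential_jet (rho : R) (g S : C -> C) : 0 < rho <= 1 -> adisc 1 g -> adisc rho S ->
  exists g1 g2 P, Dz rho g g1 /\ wfjet (ln rho) (jmod2 0 g g1 g2) /\ wfjet (ln rho) P /\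
   (forall x y, j0 P x y = fst (S (cpt (exp x) y)) - Cmod (g (cpt (exp x) y)) ^ 2) /\
   (forall x y, lap P x y = - (4 * Cmod (g1 (cpt (exp x) y)) ^ 2)).
Proof.
  intros Hr Hg HS.
  destruct (adisc_jets rho g ltac:(lra) (adisc_le 1 rho g ltac:(lra) Hg)) as (g1 & g2 & Dg & _ & Wg).
  destruct (adisc_jets rho S ltac:(lra) HS) as (S1 & S2 & DS & WS & _).
  exists g1, g2, (jplus (jre S S1 S2) (jscal (-1) (jmod2 0 g g1 g2))).
  split; [auto|split; [apply Wg|split; [apply wf_plus; [auto|apply wf_scal, Wg]|split]]].
  - intros x y.
    change (fst (S (cpt (exp x) y)) + -1 * j0 (jmod2 0 g g1 g2) x y =
            fst (S (cpt (exp x) y)) - Cmod (g (cpt (exp x) y)) ^ 2).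
    rewrite j0_mod2. ring.
  - intros x y. rewrite lap_plus, lap_scal, lap_mod2. unfold lap; simpl; ring.
Qed.

(** The harmonic majorant may change with the disc; only the bound [B] is uniform. *)
Definition has_potential (g : C -> C) (B : R) : Prop :=
  forall r, 0 < r < 1 -> exists S, adisc r S /\
    forall z, Cmod z < r -> 0 <= fst (S z) - Cmod (g z) ^ 2 <= B.

Lemma exp_opp_bounds (x B : R) : 0 <= x <= B -> exp (- B) <= exp (- x) <= 1.
Proof.
  intros [H1 H2]. split.
  - destruct H2 as [H2| ->]; [left; apply exp_increasing; lra|right; auto].
  - rewrite <- exp_0. destruct H1 as [H1| <-]; [left; apply exp_increasing; lra|right; f_equal; ring].
Qed.

Lemma jet_weight_bounds (rho B e q : R) (g S F F1 F2 : C -> C) (P : jet) : 0 < rho -> 0 < e -> 0 < q ->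
  (forall z, Cmod z < rho -> 0 <= fst (S z) - Cmod (g z) ^ 2 <= B) ->
  (forall x y, j0 P x y = fst (S (cpt (exp x) y)) - Cmod (g (cpt (exp x) y)) ^ 2) ->
  forall x y, x < ln rho -> 0 <= - lap P x y ->
  exp (- B) * reg e q F (cpt (exp x) y) * - lap P x y <= lap (jweight q (jmod2 e F F1 F2) P) x y.
Proof.
  intros Hr He Hq HB HP x y Hx HL.
  eapply Rle_trans; [|apply lap_weight; [auto|apply logsub_mod2; auto]].
  rewrite j0_mod2. apply Rmult_le_compat_r; [auto|].
  change (rpow (Cmod (F (cpt (exp x) y)) ^ 2 + e) q) with (reg e q F (cpt (exp x) y)).
  rewrite Rmult_comm. apply Rmult_le_compat_l; [apply rpow_ge0|].
  rewrite HP. apply exp_opp_bounds, HB. rewrite Cmod_cpt by (left; apply exp_pos).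
  apply exp_lt_of_ln; auto.
Qed.

(* With [s = |f|^2 + e], the function [s^q / q + e^B s^q e^{-phi} - (|h|^2 + s)^q] is subharmonic. *)
Lemma volterra_bounded_le2 (q B : R) (g f h : C -> C) (r : R) : 0 < q <= 1 -> 0 <= B ->
  volterra g f h -> has_potential g B -> 0 <= r < 1 ->
  circ (fun z => rpow (Cmod (h z)) (2 * q)) r <=
  (/ q + exp B) * circ (fun z => rpow (Cmod (f z)) (2 * q)) r.
Proof.
  intros Hq HB HV HP Hr. pose proof HV as (Ag & Af & Ah & Hh0 & _).
  assert (Hq0 : 0 < q) by lra.
  pose proof (exp_pos B) as HeB. pose proof PI_RGT_0.
  assert (HK : 0 < / q) by (apply Rinv_0_lt_compat; auto).
  set (rho := (1 + r) / 2). assert (Hrho : r < rho < 1) by (unfold rho; lra).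
  destruct (HP rho ltac:(lra)) as (S & AS & HS).
  destruct (potential_jet rho g S ltac:(lra) Ag AS) as (g1 & g2 & P & Dg & _ & WP & P0 & PL).
  destruct (adisc_jets rho f ltac:(lra) (adisc_le 1 rho f ltac:(lra) Af)) as (f1 & f2 & Df & _ & Wf).
  destruct (adisc_jets rho h ltac:(lra) (adisc_le 1 rho h ltac:(lra) Ah)) as (h1 & h2 & Dh & _ & Wh).
  apply (rpow_reg_limit _ _ ((/ q + exp B) * (2 * PI)) q Hq0). intros eta He.
  set (e := eta ^ 2). assert (He2 : 0 < e) by (apply pow_lt; auto).
  set (W := fun z => rpow (Cmod (h z) ^ 2 + (Cmod (f z) ^ 2 + e)) q).
  set (E := fun z => reg e q f z * exp (- (fst (S z) - Cmod (g z) ^ 2))).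
  (* With [s = |f|^2 + e], the Laplacian of [W] is at most [q s^(q-1) (s gam + lf)], where [gam]
     comes from [g'] and [lf] from [f']. The term [s^q / q] pays for [lf], and [e^B s^q e^(-phi)]
     pays for [gam] because [e^(-phi) >= e^(-B)]. *)
  set (V := fun z => (/ q * reg e q f z + exp B * E z) + -1 * W z).
  assert (CS : forall z, Cmod z < rho -> ccont S z) by (intros; eapply adisc_ccont; eauto).
  assert (Cf : forall z, Cmod z < rho -> ccont f z) by (intros; apply (adisc_ccont 1); auto; lra).
  assert (Cg : forall z, Cmod z < rho -> ccont g z) by (intros; apply (adisc_ccont 1); auto; lra).
  assert (Ch : forall z, Cmod z < rho -> ccont h z) by (intros; apply (adisc_ccont 1); auto; lra).
  assert (RW : forall z, Cmod z < rho -> rcont W z).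
  { intros z Hz. apply (rcont_comp (fun x => rpow x q)); [apply rpow_cont; auto|].
    apply rcont_plus; [apply rcont_Cmod2; auto|apply rcont_plus; [apply rcont_Cmod2; auto|apply rcont_const]]. }
  assert (Rf : forall z, Cmod z < rho -> rcont (reg e q f) z) by (intros; apply rcont_reg; auto).
  assert (RE : forall z, Cmod z < rho -> rcont E z).
  { intros z Hz. apply rcont_mult; auto.
    apply (rcont_comp (fun x => exp (- x)) (fun z => fst (S z) - Cmod (g z) ^ 2)); [apply derive_cpt; auto_derive; auto|].
    apply (rcont_ext (fun z => fst (S z) + -1 * Cmod (g z) ^ 2)); [intros; ring|].
    apply rcont_plus; [apply ccont_fst; auto|apply rcont_scal, rcont_Cmod2; auto]. }
  set (JW := jpow q (jplus (jmod2 0 h h1 h2) (jmod2 e f f1 f2))).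
  assert (HT : forall x y, 0 < j0 (jplus (jmod2 0 h h1 h2) (jmod2 e f f1 f2)) x y).
  { intros x y. change (0 < j0 (jmod2 0 h h1 h2) x y + j0 (jmod2 e f f1 f2) x y).
    rewrite !j0_mod2. pose proof (pow2_ge_0 (Cmod (h (cpt (exp x) y)))).
    pose proof (pow2_ge_0 (Cmod (f (cpt (exp x) y)))). lra. }
  assert (Hpf : forall x y, 0 < j0 (jmod2 e f f1 f2) x y) by (intros x y; apply (logsub_mod2 e f f1 f2 x y He2)).
  set (J := jplus (jplus (jscal (/ q) (jpow q (jmod2 e f f1 f2)))
                         (jscal (exp B) (jweight q (jmod2 e f f1 f2) P))) (jscal (-1) JW)).
  assert (HJ : jetof (ln rho) V J).
  { split.
    - apply wf_plus; [apply wf_plus|]; apply wf_scal.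
      apply wf_pow; auto. apply wf_weight; auto. apply wf_pow; auto. apply wf_plus; auto.
    - intros x y Hx.
      change (j0 J x y) with ((/ q * j0 (jpow q (jmod2 e f f1 f2)) x y
        + exp B * j0 (jweight q (jmod2 e f f1 f2) P) x y) + -1 * j0 JW x y).
      unfold JW. rewrite !j0_pow, j0_weight, P0 by auto.
      change (j0 (jplus (jmod2 0 h h1 h2) (jmod2 e f f1 f2)) x y) with
        (j0 (jmod2 0 h h1 h2) x y + j0 (jmod2 e f f1 f2) x y).
      rewrite !j0_mod2, Rplus_0_r. reflexivity. }
  assert (HL : forall x y, x < ln rho -> 0 <= lap J x y).
  { intros x y Hx. set (z := cpt (exp x) y).
    assert (Hz : Cmod z < rho).
    { unfold z. rewrite Cmod_cpt by (left; apply exp_pos). apply exp_lt_of_ln; lra. }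
    pose proof (volterra_Dz rho g f h g1 h1 z HV ltac:(lra) Dg Dh Hz) as Ehz.
    unfold J. rewrite !lap_plus, !lap_scal.
    pose proof (logsub_mod2 e f f1 f2 x y He2) as Lf.
    pose proof (lap_pow_lower q _ x y Hq0 Lf) as L1. rewrite Rmin_right in L1 by nra.
    pose proof (pow2_ge_0 (Cmod (g1 z))) as G0.
    assert (L2 := jet_weight_bounds rho B e q g S f f1 f2 P ltac:(lra) He2 Hq0 HS P0 x y Hx).
    rewrite PL in L2. fold z in L2. specialize (L2 ltac:(lra)).
    pose proof (lap_pow_upper_le1 q _ x y Hq (HT x y)) as L3. fold JW in L3.
    change (j0 (jplus (jmod2 0 h h1 h2) (jmod2 e f f1 f2)) x y) with
        (j0 (jmod2 0 h h1 h2) x y + j0 (jmod2 e f f1 f2) x y) in L3.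
    rewrite lap_plus, !j0_mod2, !lap_mod2 in L3. rewrite j0_mod2, lap_mod2 in L1.
    fold z in L1, L3. rewrite Ehz, Cmod_mult in L3.
    unfold reg in L2. set (s := Cmod (f z) ^ 2 + e) in *.
    set (gam := 4 * Cmod (g1 z) ^ 2) in *.
    set (lf := 4 * Cmod (f1 z) ^ 2) in *.
    pose proof (pow2_ge_0 (Cmod (f z))) as F0. pose proof (pow2_ge_0 (Cmod (f1 z))) as F10.
    pose proof (pow2_ge_0 (Cmod (h z))) as H0.
    assert (Hs : 0 < s) by (unfold s; lra).
    assert (Hlf : 0 <= lf) by (unfold lf; lra). assert (Hgam : 0 <= gam) by (unfold gam; lra).
    pose proof (rpow_pos s q Hs) as Rs. set (R_ := rpow s q) in *.
    assert (Q : rpow (Cmod (h z) ^ 2 + 0 + s) q / (Cmod (h z) ^ 2 + 0 + s) <= R_ / s).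
    { apply rpow_le_div; lra. }
    assert (L4 : lap JW x y <= q * (R_ / s * (s * gam + lf))).
    { eapply Rle_trans; [exact L3|]. apply Rmult_le_compat_l; [lra|].
      replace (4 * (Cmod (f z) * Cmod (g1 z)) ^ 2 + lf) with (Cmod (f z) ^ 2 * gam + lf) by (unfold gam; ring).
      assert (0 <= Cmod (f z) ^ 2 * gam) by (apply Rmult_le_pos; lra).
      apply Rle_trans with (R_ / s * (Cmod (f z) ^ 2 * gam + lf)).
      apply Rmult_le_compat_r; [lra|auto].
      apply Rmult_le_compat_l; [left; apply Rdiv_lt_0_compat; auto|].
      apply Rplus_le_compat_r, Rmult_le_compat_r; unfold s; lra. }
    replace (q * (R_ / s * (s * gam + lf))) with (q * R_ * gam + q * (R_ * (lf / s))) in L4 by (field; lra).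
    replace (- - gam) with gam in L2 by ring.
    assert (L2' : R_ * gam <= exp B * lap (jweight q (jmod2 e f f1 f2) P) x y).
    { replace (R_ * gam) with (exp B * (exp (- B) * R_ * gam)).
      apply Rmult_le_compat_l; lra.
      rewrite <- !Rmult_assoc, <- exp_plus, Rplus_opp_r, exp_0; ring. }
    assert (L1' : q * (R_ * (lf / s)) <= / q * lap (jpow q (jmod2 e f f1 f2)) x y).
    { replace (q * (R_ * (lf / s))) with (/ q * (q ^ 2 * (R_ * (lf / s)))) by (field; lra).
      apply Rmult_le_compat_l; lra. }
    assert (q * R_ * gam <= R_ * gam) by (rewrite Rmult_assoc; assert (0 <= R_ * gam) by (apply Rmult_le_pos; lra); nra).
    lra. }
  assert (XW : excirc W r) by (apply excirc_rcont; [lra|]; intros; apply RW; lra).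
  assert (Xf : excirc (reg e q f) r) by (apply excirc_reg; auto).
  assert (XE : excirc E r) by (apply excirc_rcont; [lra|]; intros; apply RE; lra).
  assert (M : 2 * PI * V 0 <= circ V r).
  { rewrite <- circ_0. apply (circ_mono rho 0 r V J); auto; [|lra|lra].
    apply rcont_plus; [apply rcont_plus|]; apply rcont_scal; auto; try apply Rf; try apply RE; try apply RW;
      rewrite Cmod_0; lra. }
  (* As [h(0) = 0], [W(0)] equals the regularised power of [f] at 0, and its coefficient [1 / q] is
     at least 1. *)
  assert (V0 : 0 <= V 0).
  { unfold V, W, E. rewrite Hh0, Cmod_0.
    replace (0 ^ 2 + (Cmod (f 0) ^ 2 + e)) with (Cmod (f 0) ^ 2 + e) by ring.
    fold (reg e q f 0). assert (0 <= reg e q f 0) by apply rpow_ge0.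
    assert (1 <= / q) by (rewrite <- Rinv_1; apply Rinv_le_contravar; lra).
    assert (0 <= exp B * (reg e q f 0 * exp (- (fst (S 0) - Cmod (g 0) ^ 2)))).
    { repeat apply Rmult_le_pos; auto; left; apply exp_pos. }
    nra. }
  assert (M0 : 0 <= circ V r) by (apply Rle_trans with (2 * PI * V 0); [apply Rmult_le_pos; lra|exact M]).
  unfold V in M0. rewrite circ_plus, circ_plus, !circ_scal in M0; auto using excirc_scal, excirc_plus.
  assert (ME : circ E r <= circ (reg e q f) r).
  { apply circ_le; auto; [lra|]. intros z Hz. unfold E.
    pose proof (rpow_ge0 (Cmod (f z) ^ 2 + e) q) as K. fold (reg e q f z) in K.
    pose proof (exp_opp_bounds _ _ (HS z ltac:(lra))). nra. }
  assert (MW : circ (fun z => rpow (Cmod (h z)) (2 * q)) r <= circ W r).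
  { apply circ_le; auto; [lra|apply excirc_rpow; auto; lra|]. intros z Hz. unfold W.
    rewrite <- rpow_sqr by apply Cmod_ge_0. apply rpow_mono; auto.
    pose proof (pow2_ge_0 (Cmod (f z))). split; [apply pow2_ge_0|lra]. }
  assert (U : circ (reg e q f) r <= rpow (1 + eta) q * circ (fun z : C => rpow (Cmod (f z)) (2 * q)) r
    + 2 * PI * rpow (eta + eta ^ 2) q) by exact (circ_reg_upper eta q r f Hq0 He Af Hr).
  assert (exp B * circ E r <= exp B * circ (reg e q f) r) by (apply Rmult_le_compat_l; lra).
  assert ((/ q + exp B) * circ (reg e q f) r <= (/ q + exp B) *
    (rpow (1 + eta) q * circ (fun z : C => rpow (Cmod (f z)) (2 * q)) r + 2 * PI * rpow (eta + eta ^ 2) q))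
    by (apply Rmult_le_compat_l; lra).
  unfold e; lra.
Qed.

Lemma rpow_minus_1 (x q : R) : 0 < x -> rpow x q = rpow x (q - 1) * x.
Proof.
  intros Hx. rewrite <- (rpow_1 x) at 3 by lra. rewrite <- rpow_plus by lra. f_equal; ring.
Qed.

(** If [s <= th t], the first summand suffices; otherwise [t <= s / th] and the second does. *)
Lemma young_rpow (q th s t : R) : 1 <= q -> 0 < th <= 1 -> 0 < s -> 0 < t ->
  rpow t (q - 1) * s <= th * rpow t q + rpow (/ th) (q - 1) * rpow s q.
Proof.
  intros Hq Hth Hs Ht. rewrite (rpow_minus_1 t q), (rpow_minus_1 s q) by auto.
  pose proof (rpow_ge0 t (q - 1)) as K1. pose proof (rpow_ge0 s (q - 1)) as K2.
  pose proof (rpow_ge0 (/ th) (q - 1)) as K3.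
  assert (Hi : 0 < / th) by (apply Rinv_0_lt_compat; lra).
  destruct (Rle_dec s (th * t)) as [H|H].
  - assert (rpow t (q - 1) * s <= rpow t (q - 1) * (th * t)) by (apply Rmult_le_compat_l; auto).
    assert (0 <= rpow (/ th) (q - 1) * (rpow s (q - 1) * s)) by (repeat apply Rmult_le_pos; lra). lra.
  - assert (Hts : t <= / th * s).
    { apply Rmult_le_reg_l with th; [lra|]. rewrite <- Rmult_assoc, Rinv_r by lra. lra. }
    assert (rpow t (q - 1) <= rpow (/ th) (q - 1) * rpow s (q - 1)).
    { rewrite <- rpow_mult by lra. destruct (Req_dec q 1) as [->|Hq1].
      - rewrite Rminus_diag, !rpow_pos_eq, !Rpower_O by (try apply Rmult_lt_0_compat; lra). lra.
      - apply rpow_mono; lra. }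
    assert (rpow t (q - 1) * s <= rpow (/ th) (q - 1) * rpow s (q - 1) * s) by (apply Rmult_le_compat_r; lra).
    assert (0 <= th * (rpow t (q - 1) * t)) by (repeat apply Rmult_le_pos; lra). lra.
Qed.

(* With [s = |f|^2 + e] and [t = |h|^2 + e], the function [K s^q e^{-phi} + t^q e^{-phi} / 2 - t^q]
   is subharmonic for large [K], by Young's inequality for [t^{q-1} s]. *)
Lemma volterra_bounded_ge2 (q B : R) : 1 <= q -> 0 <= B -> exists Cst, 0 <= Cst /\
  forall g f h r, volterra g f h -> has_potential g B -> 0 <= r < 1 ->
  circ (fun z => rpow (Cmod (h z)) (2 * q)) r <=
  Cst * circ (fun z => rpow (Cmod (f z)) (2 * q)) r.
Proof.
  intros Hq HB. assert (Hq0 : 0 < q) by lra. pose proof PI_RGT_0.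
  (* Chosen so that [q^2 th = e^(-B) / 2]: the [t^q] part of Young's bound is then absorbed by half
     of the weighted power of [h]. The constant [K] does the same for the [s^q] part. *)
  set (th := / 2 * exp (- B) / q ^ 2).
  pose proof (exp_pos (- B)) as HeB. pose proof (exp_pos B) as HeB'.
  assert (HBB : exp B * exp (- B) = 1) by (rewrite <- exp_plus, Rplus_opp_r; apply exp_0).
  assert (Hq2 : 1 <= q ^ 2) by nra.
  assert (Hth : 0 < th <= 1).
  { split. apply Rdiv_lt_0_compat; lra.
    unfold th. apply Rmult_le_reg_r with (q ^ 2); [lra|].
    replace (/ 2 * exp (- B) / q ^ 2 * q ^ 2) with (/ 2 * exp (- B)) by (field; lra).
    pose proof (exp_opp_bounds B B ltac:(lra)). lra. }
  set (K := exp B * (q ^ 2 * rpow (/ th) (q - 1))).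
  assert (HK : 0 <= K).
  { apply Rmult_le_pos; [lra|]. apply Rmult_le_pos; [lra|apply rpow_ge0]. }
  (* Moving half of the mean of [t^q] to the left doubles [K]; the extra 2 accommodates the errors
     of the regularisation, among them the value [e^q] of [t^q] at the origin. *)
  exists (2 * K + 2). split; [lra|].
  intros g f h r HV HP Hr. pose proof HV as (Ag & Af & Ah & Hh0 & _).
  set (rho := (1 + r) / 2). assert (Hrho : r < rho < 1) by (unfold rho; lra).
  destruct (HP rho ltac:(lra)) as (S & AS & HS).
  destruct (potential_jet rho g S ltac:(lra) Ag AS) as (g1 & g2 & P & Dg & _ & WP & P0 & PL).
  destruct (adisc_jets rho f ltac:(lra) (adisc_le 1 rho f ltac:(lra) Af)) as (f1 & f2 & Df & _ & Wf).
  destruct (adisc_jets rho h ltac:(lra) (adisc_le 1 rho h ltac:(lra) Ah)) as (h1 & h2 & Dh & _ & Wh).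
  apply (rpow_reg_limit _ _ ((2 * K + 2) * (2 * PI)) q Hq0). intros eta He.
  pose (e := eta ^ 2). assert (He2 : 0 < e) by (apply pow_lt; auto).
  set (phi := fun z => fst (S z) - Cmod (g z) ^ 2).
  set (Ef := fun z => reg e q f z * exp (- phi z)).
  set (Eh := fun z => reg e q h z * exp (- phi z)).
  set (V := fun z => (K * Ef z + / 2 * Eh z) + -1 * reg e q h z).
  assert (CS : forall z, Cmod z < rho -> ccont S z) by (intros; eapply adisc_ccont; eauto).
  assert (Cf : forall z, Cmod z < rho -> ccont f z) by (intros; apply (adisc_ccont 1); auto; lra).
  assert (Cg : forall z, Cmod z < rho -> ccont g z) by (intros; apply (adisc_ccont 1); auto; lra).
  assert (Ch : forall z, Cmod z < rho -> ccont h z) by (intros; apply (adisc_ccont 1); auto; lra).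
  assert (Rf : forall z, Cmod z < rho -> rcont (reg e q f) z) by (intros; apply rcont_reg; auto).
  assert (Rh : forall z, Cmod z < rho -> rcont (reg e q h) z) by (intros; apply rcont_reg; auto).
  assert (Rphi : forall z, Cmod z < rho -> rcont (fun z => exp (- phi z)) z).
  { intros z Hz. apply (rcont_comp (fun x => exp (- x)) phi); [apply derive_cpt; auto_derive; auto|].
    apply (rcont_ext (fun z => fst (S z) + -1 * Cmod (g z) ^ 2)); [intros; unfold phi; ring|].
    apply rcont_plus; [apply ccont_fst; auto|apply rcont_scal, rcont_Cmod2; auto]. }
  assert (REf : forall z, Cmod z < rho -> rcont Ef z) by (intros; apply rcont_mult; auto).
  assert (REh : forall z, Cmod z < rho -> rcont Eh z) by (intros; apply rcont_mult; auto).
  assert (Hpf : forall x y, 0 < j0 (jmod2 e f f1 f2) x y) by (intros x y; apply (logsub_mod2 e f f1 f2 x y He2)).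
  assert (Hph : forall x y, 0 < j0 (jmod2 e h h1 h2) x y) by (intros x y; apply (logsub_mod2 e h h1 h2 x y He2)).
  set (J := jplus (jplus (jscal K (jweight q (jmod2 e f f1 f2) P))
                         (jscal (/ 2) (jweight q (jmod2 e h h1 h2) P)))
                  (jscal (-1) (jpow q (jmod2 e h h1 h2)))).
  assert (HJ : jetof (ln rho) V J).
  { split.
    - apply wf_plus; [apply wf_plus|]; apply wf_scal.
      apply wf_weight; auto. apply wf_weight; auto. apply wf_pow; auto.
    - intros x y Hx.
      change (j0 J x y) with ((K * j0 (jweight q (jmod2 e f f1 f2) P) x y
        + / 2 * j0 (jweight q (jmod2 e h h1 h2) P) x y) + -1 * j0 (jpow q (jmod2 e h h1 h2)) x y).
      rewrite !j0_pow, !j0_weight, P0 by auto. rewrite !j0_mod2. reflexivity. }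
  assert (HL : forall x y, x < ln rho -> 0 <= lap J x y).
  { intros x y Hx. set (z := cpt (exp x) y).
    assert (Hz : Cmod z < rho).
    { unfold z. rewrite Cmod_cpt by (left; apply exp_pos). apply exp_lt_of_ln; lra. }
    pose proof (volterra_Dz rho g f h g1 h1 z HV ltac:(lra) Dg Dh Hz) as Ehz.
    unfold J. rewrite !lap_plus, !lap_scal.
    pose proof (pow2_ge_0 (Cmod (g1 z))) as G0.
    assert (L1 := jet_weight_bounds rho B e q g S f f1 f2 P ltac:(lra) He2 Hq0 HS P0 x y Hx).
    assert (L2 := jet_weight_bounds rho B e q g S h h1 h2 P ltac:(lra) He2 Hq0 HS P0 x y Hx).
    rewrite PL in L1, L2. fold z in L1, L2. specialize (L1 ltac:(lra)). specialize (L2 ltac:(lra)).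
    pose proof (lap_pow_upper_ge1 q _ x y Hq (logsub_mod2 e h h1 h2 x y He2)) as L3.
    rewrite j0_mod2, lap_mod2 in L3. fold z in L3. rewrite Ehz, Cmod_mult in L3.
    unfold reg in L1, L2.
    set (s := Cmod (f z) ^ 2 + e) in *. set (t := Cmod (h z) ^ 2 + e) in *.
    set (gam := 4 * Cmod (g1 z) ^ 2) in *.
    pose proof (pow2_ge_0 (Cmod (f z))) as F0. pose proof (pow2_ge_0 (Cmod (h z))) as H0.
    assert (Hs : 0 < s) by (unfold s; lra). assert (Ht : 0 < t) by (unfold t; lra).
    assert (Hgam : 0 <= gam) by (unfold gam; lra).
    replace (- - gam) with gam in * by ring.
    pose proof (young_rpow q th s t Hq Hth Hs Ht) as Y.
    pose proof (rpow_ge0 t (q - 1)) as T0.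
    assert (L4 : lap (jpow q (jmod2 e h h1 h2)) x y <= q ^ 2 * (rpow t (q - 1) * s) * gam).
    { eapply Rle_trans; [exact L3|]. rewrite (rpow_minus_1 t q) by auto.
      replace (rpow t (q - 1) * t * (4 * (Cmod (f z) * Cmod (g1 z)) ^ 2 / t)) with
        (rpow t (q - 1) * (Cmod (f z) ^ 2 * gam)) by (unfold gam; field; lra).
      replace (q ^ 2 * (rpow t (q - 1) * s) * gam) with (q ^ 2 * (rpow t (q - 1) * (s * gam))) by ring.
      apply Rmult_le_compat_l; [lra|]. apply Rmult_le_compat_l; auto.
      apply Rmult_le_compat_r; unfold s; lra. }
    assert (L5 : q ^ 2 * (rpow t (q - 1) * s) * gam <=
       / 2 * (exp (- B) * rpow t q * gam) + K * (exp (- B) * rpow s q * gam)).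
    { replace (/ 2 * (exp (- B) * rpow t q * gam) + K * (exp (- B) * rpow s q * gam)) with
        (q ^ 2 * (th * rpow t q + rpow (/ th) (q - 1) * rpow s q) * gam).
      apply Rmult_le_compat_r; auto. apply Rmult_le_compat_l; lra.
      unfold K. replace (exp B * (q ^ 2 * rpow (/ th) (q - 1)) * (exp (- B) * rpow s q * gam)) with
        (exp B * exp (- B) * (q ^ 2 * rpow (/ th) (q - 1) * rpow s q * gam)) by ring.
      rewrite HBB. unfold th at 1. field. lra. }
    assert (K * (exp (- B) * rpow s q * gam) <= K * lap (jweight q (jmod2 e f f1 f2) P) x y) by
      (apply Rmult_le_compat_l; lra).
    lra. }
  assert (Xf : excirc (reg e q f) r) by (apply excirc_reg; auto).
  assert (Xh : excirc (reg e q h) r) by (apply excirc_reg; auto).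
  assert (XEf : excirc Ef r) by (apply excirc_rcont; [lra|]; intros; apply REf; lra).
  assert (XEh : excirc Eh r) by (apply excirc_rcont; [lra|]; intros; apply REh; lra).
  assert (M : 2 * PI * V 0 <= circ V r).
  { rewrite <- circ_0. apply (circ_mono rho 0 r V J); auto; [|lra|lra].
    apply rcont_plus; [apply rcont_plus|]; apply rcont_scal; auto; try apply REf; try apply REh; try apply Rh;
      rewrite Cmod_0; lra. }
  assert (Ee : rpow e q <= rpow (eta + eta ^ 2) q).
  { apply rpow_mono; auto. unfold e in *; lra. }
  assert (V0 : - rpow (eta + eta ^ 2) q <= V 0).
  { unfold V, Ef, Eh.
    assert (Eh0 : reg e q h 0 = rpow e q).
    { unfold reg. rewrite Hh0, Cmod_0. f_equal; ring. }
    pose proof (rpow_ge0 (Cmod (f 0) ^ 2 + e) q) as K1. fold (reg e q f 0) in K1.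
    pose proof (rpow_ge0 e q) as Re0. pose proof (exp_pos (- phi 0)) as Ep0.
    assert (0 <= K * (reg e q f 0 * exp (- phi 0))) by
      (apply Rmult_le_pos; [exact HK|apply Rmult_le_pos; lra]).
    rewrite Eh0. assert (0 <= rpow e q * exp (- phi 0)) by (apply Rmult_le_pos; lra). lra. }
  assert (M0 : - (2 * PI) * rpow (eta + eta ^ 2) q <= circ V r).
  { eapply Rle_trans; [|exact M].
    replace (- (2 * PI) * rpow (eta + eta ^ 2) q) with (2 * PI * - rpow (eta + eta ^ 2) q) by ring.
    apply Rmult_le_compat_l; lra. }
  unfold V in M0. rewrite circ_plus, circ_plus, !circ_scal in M0; auto using excirc_scal, excirc_plus.
  assert (MEf : circ Ef r <= circ (reg e q f) r).
  { apply circ_le; auto; [lra|]. intros z Hz. unfold Ef.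
    pose proof (rpow_ge0 (Cmod (f z) ^ 2 + e) q) as K1. fold (reg e q f z) in K1.
    pose proof (exp_opp_bounds _ _ (HS z ltac:(lra))) as K2. fold (phi z) in K2. nra. }
  assert (MEh : circ Eh r <= circ (reg e q h) r).
  { apply circ_le; auto; [lra|]. intros z Hz. unfold Eh.
    pose proof (rpow_ge0 (Cmod (h z) ^ 2 + e) q) as K1. fold (reg e q h z) in K1.
    pose proof (exp_opp_bounds _ _ (HS z ltac:(lra))) as K2. fold (phi z) in K2. nra. }
  pose proof (circ_reg_lower e q r h Hq0 ltac:(lra) Ah Hr) as MW.
  assert (U : circ (reg e q f) r <= rpow (1 + eta) q * circ (fun z : C => rpow (Cmod (f z)) (2 * q)) r
    + 2 * PI * rpow (eta + eta ^ 2) q) by exact (circ_reg_upper eta q r f Hq0 He Af Hr).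
  assert (X0 : 0 <= circ (reg e q f) r) by (apply circ_ge0; auto; [lra|intros; apply rpow_ge0]).
  assert (Y1 : K * circ Ef r <= K * circ (reg e q f) r) by (apply Rmult_le_compat_l; lra).
  assert (Y2 : (2 * K + 2) * circ (reg e q f) r <= (2 * K + 2) *
    (rpow (1 + eta) q * circ (fun z : C => rpow (Cmod (f z)) (2 * q)) r + 2 * PI * rpow (eta + eta ^ 2) q))
    by (apply Rmult_le_compat_l; lra).
  assert (Y3 : 0 <= circ (fun z : C => rpow (Cmod (f z)) (2 * q)) r).
  { apply circ_ge0; [lra|apply excirc_rpow; auto; lra|intros; apply rpow_ge0]. }
  assert (Y4 : circ (reg e q h) r <= 2 * K * circ (reg e q f) r + 2 * (2 * PI * rpow (eta + eta ^ 2) q)) by lra.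
  assert (Y5 : 2 * K * circ (reg e q f) r <= 2 * K * (rpow (1 + eta) q * circ (fun z : C => rpow (Cmod (f z)) (2 * q)) r + 2 * PI * rpow (eta + eta ^ 2) q))
    by (apply Rmult_le_compat_l; lra).
  assert (Y6 : 0 <= rpow (1 + eta) q * circ (fun z : C => rpow (Cmod (f z)) (2 * q)) r) by (apply Rmult_le_pos; [apply rpow_ge0|auto]).
  lra.
Qed.

Lemma volterra_bounded (p B : R) : 0 < p -> 0 <= B -> exists Cst, 0 <= Cst /\
  forall g f h r, volterra g f h -> has_potential g B -> 0 <= r < 1 ->
  circ (fun z => rpow (Cmod (h z)) p) r <= Cst * circ (fun z => rpow (Cmod (f z)) p) r.
Proof.
  intros Hp HB. replace p with (2 * (p / 2)) by field.
  destruct (Rle_dec 1 (p / 2)) as [H|H].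
  - apply volterra_bounded_ge2; auto.
  - exists (/ (p / 2) + exp B). split.
    + pose proof (exp_pos B). assert (0 < / (p / 2)) by (apply Rinv_0_lt_compat; lra). lra.
    + intros g f h r HV HP Hr. apply (volterra_bounded_le2 (p / 2) B g); auto. lra.
Qed.

(* The exponent [q] solves [1/q = 1/p + 1/2]. With [s = |f|^2 + e], the function
   [K s^{p/2} + K |g|^2 - (|h|^2 + s^{(p+2)/2})^{q/2}] is subharmonic. *)
Lemma volterra_q_bound (p : R) : 0 < p -> exists K, 0 <= K /\
  forall g f h R_ r, volterra g f h -> 0 <= R_ <= r -> r < 1 ->
  circ (fun z => rpow (Cmod (h z)) (2 * p / (p + 2))) r <=
  K * circ (fun z => rpow (Cmod (f z)) p) r
  + K * (circ (fun z => Cmod (g z) ^ 2) r - circ (fun z => Cmod (g z) ^ 2) R_)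
  + 2 * (circ (fun z => rpow (Cmod (h z)) (2 * p / (p + 2))) R_
         + circ (fun z => rpow (Cmod (f z)) p) R_).
Proof.
  (* From here [q] is [p / 2], and the exponent with [1/q = 1/p + 1/2] is [2 * s]. The relation
     [m * s = q] gives the summand of [W] coming from [f] the size of [|f|^p]. *)
  intros Hp. set (q := p / 2). set (m := q + 1). set (s := p / (p + 2)). pose proof PI_RGT_0.
  assert (Hq : 0 < q) by (unfold q; lra). assert (Hm : 1 <= m) by (unfold m; lra).
  assert (Hs : 0 < s <= 1).
  { unfold s; split; [apply Rdiv_lt_0_compat; lra|]. apply Rmult_le_reg_r with (p + 2); [lra|].
    replace (p / (p + 2) * (p + 2)) with p by (field; lra). lra. }
  assert (Hms : m * s = q) by (unfold m, s, q; field; lra).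
  replace (2 * p / (p + 2)) with (2 * s) by (unfold s; field; lra).
  assert (Hmin : 0 < Rmin q (q ^ 2)) by (apply Rmin_pos; [auto|apply pow_lt; auto]).
  set (K1 := s * m ^ 2 / Rmin q (q ^ 2)).
  assert (HK1 : 0 < K1).
  { apply Rdiv_lt_0_compat; auto. apply Rmult_lt_0_compat; [lra|apply pow_lt; lra]. }
  (* [s] pays for the part of the Laplacian of [W] that contains [g']. [K1] pays for the part with
     [f']: it compares the upper bound [m^2] for the [m]-th power with the lower bound
     [Rmin q (q^2)] for the [q]-th. *)
  set (K := K1 + s). assert (HK : 0 < K) by (unfold K; lra).
  exists K. split; [lra|].
  intros g f h R_ r HV HR Hr. pose proof HV as (Ag & Af & Ah & Hh0 & _).
  destruct (adisc_jets 1 g Rlt_0_1 Ag) as (g1 & g2 & Dg & _ & Wg).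
  destruct (adisc_jets 1 f Rlt_0_1 Af) as (f1 & f2 & Df & _ & Wf).
  destruct (adisc_jets 1 h Rlt_0_1 Ah) as (h1 & h2 & Dh & _ & Wh).
  set (X_ := K * circ (fun z => rpow (Cmod (f z)) p) r + 2 * circ (fun z => rpow (Cmod (f z)) p) R_).
  set (D_ := K * (circ (fun z => Cmod (g z) ^ 2) r - circ (fun z => Cmod (g z) ^ 2) R_)
    + 2 * circ (fun z => rpow (Cmod (h z)) (2 * s)) R_).
  cut (circ (fun z => rpow (Cmod (h z)) (2 * s)) r - D_ <= X_); [unfold X_, D_; lra|].
  apply (rpow_reg_limit _ _ ((K + 2) * (2 * PI)) q Hq). intros eta He.
  pose (e := eta ^ 2). assert (He2 : 0 < e) by (apply pow_lt; auto).
  set (W := fun z => rpow (Cmod (h z) ^ 2 + reg e m f z) s).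
  set (V := fun z => (K * reg e q f z + K * Cmod (g z) ^ 2) + -1 * W z).
  assert (Cf : forall z, Cmod z < 1 -> ccont f z) by (intros; apply (adisc_ccont 1); auto; lra).
  assert (Cg : forall z, Cmod z < 1 -> ccont g z) by (intros; apply (adisc_ccont 1); auto; lra).
  assert (Ch : forall z, Cmod z < 1 -> ccont h z) by (intros; apply (adisc_ccont 1); auto; lra).
  assert (Rf : forall z, Cmod z < 1 -> rcont (reg e q f) z) by (intros; apply rcont_reg; auto).
  assert (Rg : forall z, Cmod z < 1 -> rcont (fun z => Cmod (g z) ^ 2) z) by (intros; apply rcont_Cmod2; auto).
  assert (RW : forall z, Cmod z < 1 -> rcont W z).
  { intros z Hz. apply (rcont_comp (fun x => rpow x s)); [apply rpow_cont; lra|].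
    apply rcont_plus; [apply rcont_Cmod2; auto|apply rcont_reg; auto; lra]. }
  assert (Hpf : forall x y, 0 < j0 (jmod2 e f f1 f2) x y) by (intros x y; apply (logsub_mod2 e f f1 f2 x y He2)).
  set (JT := jplus (jmod2 0 h h1 h2) (jpow m (jmod2 e f f1 f2))).
  assert (ET : forall x y, j0 JT x y = Cmod (h (cpt (exp x) y)) ^ 2 + reg e m f (cpt (exp x) y)).
  { intros x y. change (j0 JT x y) with (j0 (jmod2 0 h h1 h2) x y + j0 (jpow m (jmod2 e f f1 f2)) x y).
    rewrite j0_pow, !j0_mod2, Rplus_0_r by auto. reflexivity. }
  assert (HT : forall x y, 0 < j0 JT x y).
  { intros x y. rewrite ET. pose proof (pow2_ge_0 (Cmod (h (cpt (exp x) y)))).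
    assert (0 < reg e m f (cpt (exp x) y)).
    { apply rpow_pos. pose proof (pow2_ge_0 (Cmod (f (cpt (exp x) y)))). lra. } lra. }
  set (J := jplus (jplus (jscal K (jpow q (jmod2 e f f1 f2))) (jscal K (jmod2 0 g g1 g2)))
                  (jscal (-1) (jpow s JT))).
  assert (HJ : jetof (ln 1) V J).
  { split.
    - apply wf_plus; [apply wf_plus|]; apply wf_scal.
      apply wf_pow; auto. auto. apply wf_pow; auto. apply wf_plus; auto. apply wf_pow; auto.
    - intros x y Hx.
      change (j0 J x y) with ((K * j0 (jpow q (jmod2 e f f1 f2)) x y
        + K * j0 (jmod2 0 g g1 g2) x y) + -1 * j0 (jpow s JT) x y).
      rewrite !j0_pow, ET, !j0_mod2, Rplus_0_r by auto. reflexivity. }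
  assert (HL : forall x y, x < ln 1 -> 0 <= lap J x y).
  { intros x y Hx. set (z := cpt (exp x) y).
    assert (Hz : Cmod z < 1).
    { unfold z. rewrite Cmod_cpt by (left; apply exp_pos). apply exp_lt_of_ln; lra. }
    pose proof (volterra_Dz 1 g f h g1 h1 z HV ltac:(lra) Dg Dh Hz) as Ehz.
    unfold J. rewrite !lap_plus, !lap_scal.
    pose proof (logsub_mod2 e f f1 f2 x y He2) as Lf.
    pose proof (lap_pow_lower q _ x y Hq Lf) as L1.
    pose proof (lap_pow_upper_ge1 m _ x y Hm Lf) as L2.
    pose proof (lap_pow_lower m _ x y ltac:(lra) Lf) as L2'.
    pose proof (lap_pow_upper_le1 s _ x y Hs (HT x y)) as L3.
    rewrite ET in L3. unfold JT at 2 in L3. rewrite lap_plus, !lap_mod2 in L3.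
    rewrite j0_mod2, !lap_mod2 in L1, L2, L2'. rewrite lap_mod2.
    fold z in L1, L2, L2', L3. fold z. rewrite Ehz, Cmod_mult in L3.
    unfold reg in L3. set (a := Cmod (f z) ^ 2 + e) in *.
    set (gam := 4 * Cmod (g1 z) ^ 2) in *. set (lf := 4 * Cmod (f1 z) ^ 2) in *.
    pose proof (pow2_ge_0 (Cmod (f z))) as F0. pose proof (pow2_ge_0 (Cmod (f1 z))) as F10.
    pose proof (pow2_ge_0 (Cmod (h z))) as H0. pose proof (pow2_ge_0 (Cmod (g1 z))) as G0.
    assert (Ha : 0 < a) by (unfold a; lra).
    assert (Hlf : 0 <= lf) by (unfold lf; lra). assert (Hgam : 0 <= gam) by (unfold gam; lra).
    pose proof (rpow_pos a q Ha) as Rq. pose proof (rpow_pos a m Ha) as Rm.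
    assert (Em : rpow a m = rpow a q * a) by (unfold m; rewrite rpow_plus, rpow_1; lra).
    assert (Q : rpow (Cmod (h z) ^ 2 + rpow a m) s / (Cmod (h z) ^ 2 + rpow a m) <= / a).
    { eapply Rle_trans; [apply (rpow_le_div s (rpow a m)); [auto|lra]|].
      rewrite rpow_rpow, Hms, Em by lra. right; field; lra. }
    set (lY := lap (jpow m (jmod2 e f f1 f2)) x y) in *.
    assert (HlY : 0 <= lY).
    { eapply Rle_trans; [|exact L2']. apply Rmult_le_pos. left; apply Rmin_pos; [lra|apply pow_lt; lra].
      apply Rmult_le_pos; [lra|]. apply Rmult_le_pos; [auto|left; apply Rinv_0_lt_compat; auto]. }
    assert (L4 : lap (jpow s JT) x y <= s * (/ a * (a * gam + lY))).
    { eapply Rle_trans; [exact L3|]. apply Rmult_le_compat_l; [lra|].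
      replace (4 * (Cmod (f z) * Cmod (g1 z)) ^ 2) with (Cmod (f z) ^ 2 * gam) by (unfold gam; ring).
      assert (0 <= Cmod (f z) ^ 2 * gam) by (apply Rmult_le_pos; lra).
      apply Rle_trans with (/ a * (Cmod (f z) ^ 2 * gam + lY)).
      apply Rmult_le_compat_r; [lra|auto].
      apply Rmult_le_compat_l; [left; apply Rinv_0_lt_compat; auto|].
      apply Rplus_le_compat_r, Rmult_le_compat_r; unfold a; lra. }
    assert (L5 : s * (/ a * (a * gam + lY)) <= s * gam + s * (m ^ 2 * (rpow a q * (lf / a)))).
    { replace (s * (/ a * (a * gam + lY))) with (s * gam + s * (/ a * lY)) by (field; lra).
      apply Rplus_le_compat_l. apply Rmult_le_compat_l; [lra|].
      replace (m ^ 2 * (rpow a q * (lf / a))) with (/ a * (m ^ 2 * (rpow a m * (lf / a)))).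
      apply Rmult_le_compat_l; [left; apply Rinv_0_lt_compat|]; auto.
      rewrite Em. field; lra. }
    assert (L6 : s * (m ^ 2 * (rpow a q * (lf / a))) <= K1 * lap (jpow q (jmod2 e f f1 f2)) x y).
    { replace (s * (m ^ 2 * (rpow a q * (lf / a)))) with (K1 * (Rmin q (q ^ 2) * (rpow a q * (lf / a)))).
      apply Rmult_le_compat_l; lra.
      unfold K1. field. lra. }
    assert (L7 : 0 <= lap (jpow q (jmod2 e f f1 f2)) x y).
    { eapply Rle_trans; [|exact L1]. apply Rmult_le_pos; [lra|].
      apply Rmult_le_pos; [lra|]. apply Rmult_le_pos; [auto|left; apply Rinv_0_lt_compat; auto]. }
    assert (0 <= s * lap (jpow q (jmod2 e f f1 f2)) x y) by (apply Rmult_le_pos; lra).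
    assert (0 <= K1 * gam) by (apply Rmult_le_pos; lra).
    unfold K. lra. }
  assert (XW : forall t, 0 <= t < 1 -> excirc W t) by (intros t Ht; apply excirc_rcont; [lra|]; intros; apply RW; lra).
  assert (Xf : forall t, 0 <= t < 1 -> excirc (reg e q f) t) by (intros; apply excirc_reg; auto).
  assert (Xg : forall t, 0 <= t < 1 -> excirc (fun z => Cmod (g z) ^ 2) t) by
    (intros t Ht; apply excirc_rcont; [lra|]; intros; apply Rg; lra).
  assert (M : circ V R_ <= circ V r).
  { apply (circ_mono 1 R_ r V J); auto.
    apply rcont_plus; [apply rcont_plus|]; apply rcont_scal; auto; try apply Rf; try apply Rg; try apply RW;
      rewrite Cmod_0; lra. }
  assert (EV : forall t, 0 <= t < 1 -> circ V t = K * circ (reg e q f) t + K * circ (fun z => Cmod (g z) ^ 2) t - circ W t).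
  { intros t Ht. unfold V. specialize (XW t Ht). specialize (Xf t Ht). specialize (Xg t Ht).
    rewrite circ_plus, circ_plus, !circ_scal; auto using excirc_scal, excirc_plus. ring. }
  rewrite !EV in M by lra.
  assert (MW : circ (fun z => rpow (Cmod (h z)) (2 * s)) r <= circ W r).
  { apply circ_le; [lra|apply excirc_rpow; auto; lra|apply XW; lra|]. intros z Hz. unfold W.
    rewrite <- rpow_sqr by apply Cmod_ge_0. apply rpow_mono; [lra|].
    pose proof (rpow_ge0 (Cmod (f z) ^ 2 + e) m) as K2. fold (reg e m f z) in K2.
    split; [apply pow2_ge_0|lra]. }
  assert (Xh : excirc (fun z => rpow (Cmod (h z)) (2 * s)) R_) by (apply excirc_rpow; auto; lra).
  assert (MR : circ W R_ <= 2 * (circ (fun z => rpow (Cmod (h z)) (2 * s)) R_ + circ (reg e q f) R_)).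
  { rewrite <- circ_plus, <- circ_scal; [|apply excirc_plus|auto|apply Xf; lra]; [|auto|apply Xf; lra].
    apply circ_le; [lra|apply XW; lra|apply excirc_scal, excirc_plus; [auto|apply Xf; lra]|].
    intros z Hz. unfold W.
    eapply Rle_trans; [apply rpow_add_le; [lra|apply pow2_ge_0|apply rpow_ge0]|].
    unfold reg at 1. pose proof (pow2_ge_0 (Cmod (f z))).
    rewrite rpow_rpow, Hms, rpow_sqr by (try apply Cmod_ge_0; lra).
    fold (reg e q f z). apply Rmult_le_compat_r.
    apply Rplus_le_le_0_compat; apply rpow_ge0.
    rewrite <- (rpow_1 2) at 2 by lra. apply rpow_exp_mono; lra. }
  assert (U : forall t, 0 <= t < 1 -> circ (reg e q f) t <= rpow (1 + eta) q * circ (fun z : C => rpow (Cmod (f z)) p) t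
    + 2 * PI * rpow (eta + eta ^ 2) q).
  { intros t Ht. replace p with (2 * q) by (unfold q; field). exact (circ_reg_upper eta q t f Hq He Af Ht). }
  pose proof (U r ltac:(lra)) as U1. pose proof (U R_ ltac:(lra)) as U2.
  assert (Y1 : K * circ (reg e q f) r <= K * (rpow (1 + eta) q * circ (fun z : C => rpow (Cmod (f z)) p) r
    + 2 * PI * rpow (eta + eta ^ 2) q)) by (apply Rmult_le_compat_l; lra).
  assert (Y2 : 0 <= circ (reg e q f) R_).
  { apply circ_ge0; [lra|apply Xf; lra|intros; apply rpow_ge0]. }
  assert (Y3 : 0 <= K * circ (reg e q f) R_) by (apply Rmult_le_pos; lra).
  unfold X_, D_. lra.
Qed.

(** * Decay of the lower integral means *)

(** [F] is bounded on a slightly larger circle by compactness, and the Poisson integral of [|F|^2]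
    carries the bound inside. *)
Lemma adisc_bounded (rho r : R) (F : C -> C) : adisc rho F -> 0 <= r < rho ->
  exists M, 0 <= M /\ forall z, Cmod z <= r -> Cmod (F z) <= M.
Proof.
  intros HF Hr. pose proof PI_RGT_0. set (s := (r + rho) / 2).
  assert (Hs : r < s < rho) by (unfold s; lra).
  assert (Hin : forall t, Cmod (cpt s t) < rho) by (intros; rewrite Cmod_cpt; lra).
  destruct (ccurve_bounded (fun t => F (cpt s t)) 0 (2 * PI)) as [M [HM0 HM]]; [lra| |].
  { intros t _. apply ccurve_comp; [|apply ccurve_cpt]. eapply adisc_ccont; eauto. }
  exists M. split; auto. intros z Hz. pose proof (Cmod_ge_0 z). assert (Hzs : Cmod z < s) by lra.
  assert (L := proj2 (sqr_le_schwarz rho s F z HF Hzs ltac:(lra))).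
  rewrite schwarz_re in L.
  assert (B : RInt (fun t => Cmod (F (cpt s t)) ^ 2 * poisson s z t) 0 (2 * PI) <=
              RInt (fun t => M ^ 2 * poisson s z t) 0 (2 * PI)).
  { apply RInt_le; [lra| | |].
    - apply ex_RInt_cpt. intros t _. apply continuity_pt_mult; [|apply poisson_cont; lra].
      apply (rcont_ccurve (fun w => Cmod (F w) ^ 2) (cpt s)); [|apply ccurve_cpt].
      apply rcont_Cmod2. eapply adisc_ccont; eauto.
    - apply ex_RInt_Rscal, ex_RInt_cpt. intros t _. apply poisson_cont; lra.
    - intros t Ht. apply Rmult_le_compat_r; [left; apply poisson_pos; lra|].
      apply pow_incr. split; [apply Cmod_ge_0|apply HM; lra]. }
  rewrite RInt_Rscal, poisson_one in B; auto.
  2:{ apply ex_RInt_cpt. intros t _. apply poisson_cont; lra. }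
  assert (Cmod (F z) ^ 2 <= M ^ 2).
  { eapply Rle_trans; [exact L|]. replace (M ^ 2) with (/ (2 * PI) * (M ^ 2 * (2 * PI))) by (field; lra).
    apply Rmult_le_compat_l; [left; apply Rinv_0_lt_compat; lra|exact B]. }
  apply Rnot_lt_le; intros Hlt.
  assert (M ^ 2 < Cmod (F z) ^ 2) by nra. lra.
Qed.

(** Integrate [f g'] along the radius. The constant depends on [g] and [r] only and so serves a
    whole sequence. *)
Lemma volterra_small (g : C -> C) (r : R) : adisc 1 g -> 0 <= r < 1 ->
  exists M, 0 <= M /\ forall f h e, volterra g f h -> 0 <= e ->
    (forall z, Cmod z <= r -> Cmod (f z) <= e) -> forall z, Cmod z <= r -> Cmod (h z) <= M * e.
Proof.
  intros Hg Hr. destruct (analytic_derivative 1 g Hg) as (g' & Ag' & Hg').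
  destruct (adisc_bounded 1 r g' Ag' Hr) as [M [HM0 HM]].
  exists (2 * M). split; [lra|]. intros f h e (_ & Af & Ah & Hh0 & HV) He Hf z Hz.
  pose proof (Cmod_ge_0 z).
  assert (Hin : forall t : R, 0 <= t <= 1 -> Cmod (t * z) <= r).
  { intros t Ht. rewrite Cmod_mult, Cmod_R, Rabs_pos_eq by lra. nra. }
  assert (Rt : forall t, rcd (fun t => (t * z)%C) t z).
  { intros t. eapply rcd_eq; [|apply (rcd_mult RtoC (fun _ => z)); [apply rcd_RtoC|apply rcd_const]].
    cbv beta; ring. }
  assert (Hc : forall t, 0 <= t <= 1 -> ccurve (fun t => (f (t * z) * g' (t * z) * z)%C) t).
  { intros t Ht. pose proof (Hin t Ht).
    apply (ccurve_comp (fun w => (f w * g' w * z)%C) (fun t => (t * z)%C)); [|eapply rcd_ccurve, Rt].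
    apply ccont_mult; [|apply ccont_const].
    apply ccont_mult; eapply adisc_ccont; eauto; lra. }
  assert (E : h z = CI (fun t => (f (t * z) * g' (t * z) * z)%C) 0 1).
  { rewrite (CI_FTC (fun t => h (t * z)%C)).
    - rewrite Cmult_1_l, Cmult_0_l, Hh0. ring.
    - intros t Ht. rewrite Rmin_left, Rmax_right in Ht by lra. pose proof (Hin t Ht).
      destruct (HV (t * z)%C) as (l & Hl1 & Hl2); [lra|].
      rewrite (cdiff_unique _ _ _ _ (Hg' (t * z)%C ltac:(lra)) Hl1).
      apply (rcd_comp h (fun t => (t * z)%C)); auto.
    - intros t Ht. rewrite Rmin_left, Rmax_right in Ht by lra. auto. }
  rewrite E. replace (2 * M * e) with (2 * (M * e) * Rabs (1 - 0)) by (rewrite Rabs_pos_eq; lra).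
  apply CI_bound.
  - apply ex_CI_curve. intros t Ht. rewrite Rmin_left, Rmax_right in Ht by lra. auto.
  - intros t Ht. rewrite Rmin_left, Rmax_right in Ht by lra. pose proof (Hin t Ht).
    rewrite !Cmod_mult. specialize (Hf _ H0). specialize (HM _ H0).
    pose proof (Cmod_ge_0 (f (t * z)%C)); pose proof (Cmod_ge_0 (g' (t * z)%C)).
    assert (Cmod (f (t * z)%C) * Cmod (g' (t * z)%C) <= e * M) by (apply Rmult_le_compat; auto).
    assert (0 <= Cmod (f (t * z)%C) * Cmod (g' (t * z)%C)) by (apply Rmult_le_pos; auto).
    nra.
Qed.

Definition uoc0 (f : nat -> C -> C) : Prop :=
  forall r, 0 <= r < 1 -> forall eps, 0 < eps -> exists N, forall n, (N <= n)%nat ->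
    forall z, Cmod z <= r -> Cmod (f n z) < eps.

Lemma volterra_uoc0 (g : C -> C) (f h : nat -> C -> C) : adisc 1 g ->
  (forall n, volterra g (f n) (h n)) -> uoc0 f -> uoc0 h.
Proof.
  intros Hg HV Hf r Hr eps He.
  destruct (volterra_small g r Hg Hr) as [M [HM0 HM]].
  destruct (Hf r Hr (eps / (2 * (M + 1)))) as [N HN]; [apply Rdiv_lt_0_compat; lra|].
  exists N. intros n Hn z Hz.
  assert (He' : 0 < eps / (2 * (M + 1))) by (apply Rdiv_lt_0_compat; lra).
  apply Rle_lt_trans with (M * (eps / (2 * (M + 1)))).
  - apply (HM (f n) (h n)); auto; [lra|]. intros w Hw. left; apply HN; auto.
  - assert ((M + 1) * (eps / (2 * (M + 1))) = eps / 2) by (field; lra). nra.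
Qed.

(** The threshold precedes the radius: the decay is uniform up to the boundary, in contrast to
    [uoc0]. *)
Definition means_to0 (q : R) (h : nat -> C -> C) : Prop :=
  forall eta, 0 < eta -> exists N, forall n, (N <= n)%nat -> forall r, 0 <= r < 1 ->
    circ (fun z => rpow (Cmod (h n z)) q) r <= eta.

(** Turns boundedness of monotone means into smallness of their increments near the boundary. It is
    applied to the square means of [g] and to the [p]-th means of a fixed function. *)
Lemma sup_attained (T : R -> R) (L0 eps : R) : 0 < eps ->
  (forall r s, 0 <= r <= s -> s < 1 -> T r <= T s) -> (forall r, 0 <= r < 1 -> T r <= L0) ->
  exists s, 0 <= s < 1 /\ forall r, s <= r < 1 -> T r <= T s + eps.
Proof.
  intros He Hm HL.
  destruct (completeness (fun x => exists r, 0 <= r < 1 /\ x = T r)) as [L [H1 H2]].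
  - exists L0. intros x (r & Hr & ->); auto.
  - exists (T 0), 0. split; [lra|auto].
  - assert (exists s, 0 <= s < 1 /\ L - eps < T s) as (s & Hs & HLs).
    { apply Classical_Prop.NNPP. intros Hn.
      assert (L <= L - eps); [|lra]. apply H2. intros x (r & Hr & ->).
      apply Rnot_lt_le. intros Hlt. apply Hn. exists r; auto. }
    exists s. split; auto. intros r Hr.
    assert (T r <= L) by (apply H1; exists r; split; [lra|auto]). lra.
Qed.

Lemma circ_small (F : C -> C) (q r e : R) : 0 < q -> adisc 1 F -> 0 <= r < 1 -> 0 <= e ->
  (forall z, Cmod z <= r -> Cmod (F z) <= e) ->
  circ (fun z => rpow (Cmod (F z)) q) r <= 2 * PI * rpow e q.
Proof.
  intros Hq HF Hr He H. rewrite <- (circ_const (rpow e q) r).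
  apply circ_le; [lra|apply excirc_rpow; auto|apply excirc_const|].
  intros z Hz. apply rpow_mono; auto. split; [apply Cmod_ge_0|apply H; lra].
Qed.

Lemma rpow_inv_q (x q : R) : 0 < q -> 0 <= x -> rpow (rpow x (/ q)) q = x.
Proof. intros Hq Hx. rewrite rpow_rpow, Rinv_l, rpow_1; lra. Qed.

Lemma volterra_scal (g f h : C -> C) (c : C) : volterra g f h ->
  volterra (fun z => (c * g z)%C) f (fun z => (c * h z)%C).
Proof.
  intros (Ag & Af & Ah & Hh0 & H). split; [apply adisc_scal; auto|split; [auto|split]].
  apply adisc_scal; auto. split; [rewrite Hh0; ring|].
  intros z Hz. destruct (H z Hz) as (l & H1 & H2). exists (c * l)%C. split.
  apply cdiff_scal; auto. replace (f z * (c * l))%C with (c * (f z * l))%C by ring.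
  apply cdiff_scal; auto.
Qed.

Lemma circ_rpow_scal (F : C -> C) (c : C) (q r : R) : 0 < q -> adisc 1 F -> 0 <= r < 1 ->
  circ (fun z => rpow (Cmod (c * F z)) q) r = rpow (Cmod c) q * circ (fun z => rpow (Cmod (F z)) q) r.
Proof.
  intros Hq HF Hr. rewrite <- circ_scal by (apply excirc_rpow; auto).
  apply circ_ext. intros z. rewrite Cmod_mult, rpow_mult; auto; apply Cmod_ge_0.
Qed.

(** In [volterra_q_bound] the means of [f] on the right are bounded but not small. Scaling [g] and
    [h] by [lam] leaves them alone, multiplies the left side by [a = lam^q] and the increments of
    [g] by [lam^2]. A large [lam] makes the [f]-term negligible relative to [a]; after that the
    inner radius [R_] is taken so close to 1 that the scaled increments are small too. *)
Lemma volterra_means_q (p G Cf : R) (g : C -> C) (f h : nat -> C -> C) : 0 < p ->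
  (forall n, volterra g (f n) (h n)) -> uoc0 f ->
  (forall r, 0 <= r < 1 -> circ (fun z => Cmod (g z) ^ 2) r <= G) ->
  (forall n r, 0 <= r < 1 -> circ (fun z => rpow (Cmod (f n z)) p) r <= Cf) ->
  means_to0 (2 * p / (p + 2)) h.
Proof.
  intros Hp HV Hf HG HCf eta He. pose proof PI_RGT_0.
  pose proof (HV O) as (Ag & _ & _).
  pose proof (volterra_uoc0 g f h Ag HV Hf) as Hh.
  destruct (volterra_q_bound p Hp) as [K [HK0 HK]].
  set (q := 2 * p / (p + 2)) in *. assert (Hq : 0 < q) by (apply Rdiv_lt_0_compat; lra).
  (* Large enough that [K * |Cf|] is at most [a * eta / 8], and at least 1. *)
  set (a := (K * Rabs Cf + 1) * 8 / eta + 1).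
  pose proof (Rabs_pos Cf) as HCf0. assert (HKC : 0 <= K * Rabs Cf) by (apply Rmult_le_pos; auto).
  assert (Ha : 1 <= a).
  { unfold a. assert (0 < (K * Rabs Cf + 1) * 8 / eta) by (apply Rdiv_lt_0_compat; lra). lra. }
  assert (HaK : K * Rabs Cf <= a * (eta / 8)).
  { unfold a. replace (((K * Rabs Cf + 1) * 8 / eta + 1) * (eta / 8)) with (K * Rabs Cf + 1 + eta / 8) by (field; lra). lra. }
  set (lam := rpow a (/ q)).
  assert (Hlam : 0 < lam) by (apply rpow_pos; lra).
  assert (Elam : rpow lam q = a) by (apply rpow_inv_q; lra).
  (* The admissible increment of the square mean of [g]: after scaling it also contributes at most
     [a * eta / 8]. *)
  set (eps := a * (eta / 8) / ((K + 1) * lam ^ 2)).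
  assert (Hl2 : 0 < lam ^ 2) by (apply pow_lt; auto).
  assert (Heps : 0 < eps).
  { apply Rdiv_lt_0_compat; [|apply Rmult_lt_0_compat; lra]. apply Rmult_lt_0_compat; lra. }
  assert (Mg : forall r s, 0 <= r <= s -> s < 1 ->
     circ (fun z => Cmod (g z) ^ 2) r <= circ (fun z => Cmod (g z) ^ 2) s).
  { intros r s Hr Hs. pose proof (mean_mono 2 r s g ltac:(lra) Ag Hr Hs) as M.
    rewrite !(circ_ext (fun z => rpow (Cmod (g z)) 2) (fun z => Cmod (g z) ^ 2)) in M; auto;
      intros; apply rpow_2, Cmod_ge_0. }
  destruct (sup_attained (circ (fun z => Cmod (g z) ^ 2)) G eps Heps Mg HG) as (R_ & HR & HRs).
  set (d1 := rpow (eta / (16 * (2 * PI))) (/ q)). set (d2 := rpow (eta / (16 * (2 * PI))) (/ p)).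
  assert (Hpos : 0 < eta / (16 * (2 * PI))) by (apply Rdiv_lt_0_compat; lra).
  destruct (Hh R_ HR d1) as [N1 HN1]; [apply rpow_pos; auto|].
  destruct (Hf R_ HR d2) as [N2 HN2]; [apply rpow_pos; auto|].
  exists (max N1 N2). intros n Hn.
  pose proof (HV n) as (_ & Af & Ah & _).
  assert (YR : circ (fun z => rpow (Cmod (h n z)) q) R_ <= eta / 16).
  { eapply Rle_trans; [apply (circ_small _ q R_ d1); auto; [left; apply rpow_pos; auto|]|].
    intros z Hz; left; apply HN1; auto; lia.
    unfold d1. rewrite rpow_inv_q by lra. right; field; lra. }
  assert (XR : circ (fun z => rpow (Cmod (f n z)) p) R_ <= eta / 16).
  { eapply Rle_trans; [apply (circ_small _ p R_ d2); auto; [left; apply rpow_pos; auto|]|].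
    intros z Hz; left; apply HN2; auto; lia.
    unfold d2. rewrite rpow_inv_q by lra. right; field; lra. }
  assert (Big : forall r, R_ <= r < 1 -> circ (fun z => rpow (Cmod (h n z)) q) r <= eta).
  { intros r Hr.
    pose proof (HK _ _ _ R_ r (volterra_scal _ _ _ (RtoC lam) (HV n)) ltac:(lra) ltac:(lra)) as B.
    rewrite !(circ_rpow_scal (h n) (RtoC lam) q) in B by (auto; lra).
    assert (Eg : forall s, 0 <= s < 1 -> circ (fun z => Cmod (lam * g z) ^ 2) s = lam ^ 2 * circ (fun z => Cmod (g z) ^ 2) s).
    { intros s Hs. rewrite <- circ_scal. apply circ_ext; intros z.
      rewrite Cmod_mult, Cmod_R, Rabs_pos_eq by lra. ring.
      apply excirc_rcont; [lra|]. intros z Hz. apply rcont_Cmod2. eapply adisc_ccont; eauto; lra. }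
    rewrite !Eg, Cmod_R, Rabs_pos_eq, Elam in B by lra.
    specialize (HRs r Hr). specialize (HCf n r ltac:(lra)).
    assert (B1 : K * circ (fun z => rpow (Cmod (f n z)) p) r <= a * (eta / 8)).
    { eapply Rle_trans; [|exact HaK]. apply Rmult_le_compat_l; auto. pose proof (Rle_abs Cf); lra. }
    assert (B2 : K * (lam ^ 2 * circ (fun z => Cmod (g z) ^ 2) r - lam ^ 2 * circ (fun z => Cmod (g z) ^ 2) R_) <= a * (eta / 8)).
    { replace (K * (lam ^ 2 * circ (fun z => Cmod (g z) ^ 2) r - lam ^ 2 * circ (fun z => Cmod (g z) ^ 2) R_)) with
       (K * lam ^ 2 * (circ (fun z => Cmod (g z) ^ 2) r - circ (fun z => Cmod (g z) ^ 2) R_)) by ring.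
      apply Rle_trans with (K * lam ^ 2 * eps).
      apply Rmult_le_compat_l; [apply Rmult_le_pos; lra|lra].
      apply Rle_trans with ((K + 1) * lam ^ 2 * eps).
      apply Rmult_le_compat_r; [lra|]. apply Rmult_le_compat_r; lra.
      right; unfold eps; field; lra. }
    apply Rmult_le_reg_l with a; [lra|].
    assert (a * circ (fun z => rpow (Cmod (h n z)) q) R_ <= a * (eta / 16)) by (apply Rmult_le_compat_l; lra).
    assert (eta / 16 <= a * (eta / 16)) by nra. nra. }
  intros r Hr. destruct (Rle_dec R_ r); [apply Big; lra|].
  eapply Rle_trans; [|apply (Big R_); lra]. apply mean_mono; auto; lra.
Qed.

(** Three ranges: for small [x] the constant [eta] is enough, for large [x] the [p]-th power wins,
    and in between [x^(p/2)] is at most [1 / eta] while [x^q] is bounded below. No order between [q]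
    and [p] enters. *)
Lemma rpow_interp (p q eta : R) : 0 < p -> 0 < q -> 0 < eta -> exists K, 0 <= K /\
  forall x, 0 <= x -> rpow x (p / 2) <= eta * (1 + rpow x p) + K * rpow x q.
Proof.
  intros Hp Hq He. set (x0 := rpow eta (/ (p / 2))). set (x1 := rpow (/ eta) (/ (p / 2))).
  assert (Hi : 0 < / eta) by (apply Rinv_0_lt_compat; auto).
  assert (Hx0 : 0 < x0) by (apply rpow_pos; auto). assert (Hx1 : 0 < x1) by (apply rpow_pos; auto).
  assert (E0 : rpow x0 (p / 2) = eta) by (apply rpow_inv_q; lra).
  assert (E1 : rpow x1 (p / 2) = / eta) by (apply rpow_inv_q; lra).
  pose proof (rpow_pos x0 q Hx0) as Hx0q.
  assert (HK : 0 < / eta / rpow x0 q) by (apply Rdiv_lt_0_compat; auto).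
  exists (/ eta / rpow x0 q). split; [lra|]. intros x Hx.
  pose proof (rpow_ge0 x p); pose proof (rpow_ge0 x q); pose proof (rpow_ge0 x (p / 2)).
  assert (0 <= / eta / rpow x0 q * rpow x q) by (apply Rmult_le_pos; lra).
  assert (0 <= eta * rpow x p) by (apply Rmult_le_pos; lra).
  destruct (Rle_dec x x0) as [H4|H4].
  - assert (rpow x (p / 2) <= eta) by (rewrite <- E0; apply rpow_mono; lra). lra.
  - destruct (Rle_dec x1 x) as [H5|H5].
    + assert (/ eta <= rpow x (p / 2)) by (rewrite <- E1; apply rpow_mono; lra).
      assert (E : rpow x p = rpow x (p / 2) * rpow x (p / 2)) by (rewrite <- rpow_plus by auto; f_equal; field).
      assert (rpow x (p / 2) = eta * (rpow x (p / 2) * / eta)) by (field; lra).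
      assert (eta * (rpow x (p / 2) * / eta) <= eta * rpow x p).
      { rewrite E. apply Rmult_le_compat_l; [lra|]. apply Rmult_le_compat_l; auto. }
      lra.
    + assert (rpow x (p / 2) <= / eta) by (rewrite <- E1; apply rpow_mono; lra).
      assert (rpow x0 q <= rpow x q) by (apply rpow_mono; lra).
      assert (/ eta <= / eta / rpow x0 q * rpow x q).
      { replace (/ eta) with (/ eta / rpow x0 q * rpow x0 q) at 1 by (field; lra).
        apply Rmult_le_compat_l; lra. }
      lra.
Qed.

(** Passes to the exponent [p / 2] used for products; the bounded [p]-th means control the large
    values. *)
Lemma means_half (p q Ch : R) (h : nat -> C -> C) : 0 < p -> 0 < q -> (forall n, adisc 1 (h n)) ->
  (forall n r, 0 <= r < 1 -> circ (fun z => rpow (Cmod (h n z)) p) r <= Ch) ->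
  means_to0 q h -> means_to0 (p / 2) h.
Proof.
  intros Hp Hq HA HC Hm eta He. pose proof PI_RGT_0. pose proof (Rabs_pos Ch) as Ch0.
  set (e := eta / (2 * (2 * PI + Rabs Ch))).
  assert (He' : 0 < e) by (apply Rdiv_lt_0_compat; lra).
  destruct (rpow_interp p q e Hp Hq He') as [K [HK0 HK]].
  destruct (Hm (eta / (2 * (K + 1)))) as [N HN]; [apply Rdiv_lt_0_compat; lra|].
  exists N. intros n Hn r Hr. specialize (HN n Hn r Hr). specialize (HC n r Hr).
  assert (X1 : excirc (fun z => rpow (Cmod (h n z)) p) r) by (apply excirc_rpow; auto).
  assert (X2 : excirc (fun z => rpow (Cmod (h n z)) q) r) by (apply excirc_rpow; auto).
  assert (X3 : excirc (fun _ => 1) r) by apply excirc_const.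
  apply Rle_trans with (circ (fun z => e * (1 + rpow (Cmod (h n z)) p) + K * rpow (Cmod (h n z)) q) r).
  - apply circ_le; [lra|apply excirc_rpow; auto; lra| |].
    apply excirc_plus; apply excirc_scal; auto. apply excirc_plus; auto.
    intros z _. apply HK, Cmod_ge_0.
  - rewrite circ_plus, !circ_scal, circ_plus, circ_const by (auto using excirc_scal, excirc_plus).
    pose proof (Rle_abs Ch).
    assert (e * (2 * PI * 1 + circ (fun z => rpow (Cmod (h n z)) p) r) <= eta / 2).
    { apply Rle_trans with (e * (2 * PI + Rabs Ch)). apply Rmult_le_compat_l; lra.
      right; unfold e; field; lra. }
    assert (K * circ (fun z => rpow (Cmod (h n z)) q) r <= eta / 2).
    { apply Rle_trans with (K * (eta / (2 * (K + 1)))). apply Rmult_le_compat_l; lra.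
      assert ((K + 1) * (eta / (2 * (K + 1))) = eta / 2) by (field; lra).
      assert (0 < eta / (2 * (K + 1))) by (apply Rdiv_lt_0_compat; lra). nra. }
    lra.
Qed.

(** * Asymptotic orthogonality *)

Lemma RInt_shift (u : R -> R) (tau : R) : (forall t, continuity_pt u t) ->
  (forall t, u (t + 2 * PI) = u t) ->
  RInt (fun t => u (t + tau)) 0 (2 * PI) = RInt u 0 (2 * PI).
Proof.
  intros Hc Hp.
  assert (Ex : forall a b, ex_RInt u a b) by (intros; apply ex_RInt_cpt; auto).
  assert (Sh : forall v a b, RInt (fun t => u (t + v)) a b = RInt u (a + v) (b + v)).
  { intros v a b. pose proof (RInt_comp_lin u 1 v a b (Ex _ _)) as K.
    rewrite !Rmult_1_l in K. eapply eq_trans; [|exact K]. apply RInt_Rext. intros t.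
    unfold scal; simpl; unfold mult; simpl. rewrite !Rmult_1_l; auto. }
  rewrite Sh. pose proof (Sh (2 * PI) 0 tau) as S2.
  rewrite (RInt_Rext (fun t => u (t + 2 * PI)) u) in S2 by auto.
  pose proof (RInt_Chasles u 0 (0 + 2 * PI) (tau + 2 * PI) (Ex _ _) (Ex _ _)) as C1.
  pose proof (RInt_Chasles u 0 (0 + tau) (2 * PI + tau) (Ex _ _) (Ex _ _)) as C2.
  unfold plus in C1, C2; simpl in C1, C2.
  rewrite !Rplus_0_l in *. rewrite (Rplus_comm (2 * PI) tau) in *. rewrite <- S2 in C1. lra.
Qed.

(* Averaging over the rotation angle; the mean value theorem replaces Fubini. *)
Lemma rotation_average (v w : R -> R) (d : R) : 0 < d <= 2 * PI ->
  (forall t, continuity_pt v t) -> (forall t, continuity_pt w t) ->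
  (forall t, 0 <= v t) -> (forall t, 0 <= w t) -> (forall t, v (t + 2 * PI) = v t) ->
  exists tau, 0 <= tau <= d /\
    RInt (fun t => v (t + tau) * w t) 0 (2 * PI) <= / d * (RInt v 0 (2 * PI) * RInt w 0 (2 * PI)).
Proof.
  intros Hd Cv Cw Pv Pw Per. pose proof PI_RGT_0.
  assert (Ex : forall a b, ex_RInt v a b) by (intros; apply ex_RInt_cpt; auto).
  set (P := fun y => RInt v 0 y).
  assert (DP : forall y, is_derive P y (v y)).
  { intros y. apply (is_derive_RInt (V := R_NormedModule) v P 0 y).
    - exists (mkposreal 1 Rlt_0_1). intros z _. apply (RInt_correct v), Ex.
    - apply continuity_pt_filterlim, Cv. }
  assert (CP : forall y, continuity_pt P y) by (intros; eapply is_derive_cpt, DP).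
  assert (Cs : forall (f : R -> R) x t, (forall y, continuity_pt f y) -> continuity_pt (fun t => f (t + x)) t).
  { intros f x t Hf. apply (continuity_pt_comp (fun t => t + x) f); auto.
    apply derive_cpt; auto_derive; auto. }
  (* The integral of [w(t)] times the integral of [v] over [[t, t + x]]. Its derivative at [x] is
     the product integral with [v] rotated by [x], so some [tau] realises the average [Psi d / d];
     and [Psi d] is at most the product of the two integrals because [d <= 2 * PI]. *)
  set (Psi := fun x => RInt (fun t => w t * (P (t + x) - P t)) 0 (2 * PI)).
  set (dPsi := fun x => RInt (fun t => w t * v (t + x)) 0 (2 * PI)).
  assert (DPsi : forall x, is_derive Psi x (dPsi x)).
  { intros x. apply (RInt_param_derive (fun x t => w t * (P (t + x) - P t)) (fun x t => w t * v (t + x)) 0 (2 * PI) x 1 Rlt_0_1).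
    - intros u t _.
      assert (D1 : is_derive (fun u => t + u) u 1) by (auto_derive; auto).
      pose proof (is_derive_Rcomp P (fun u => t + u) u _ _ (DP (t + u)) D1) as D2.
      pose proof (is_derive_minus _ _ _ _ _ D2 (is_derive_const (P t) u)) as D3.
      pose proof (is_derive_scal _ u (w t) _ D3) as D4.
      replace (w t * v (t + u)) with (w t * minus (v (t + u) * 1) zero). exact D4.
      unfold minus, plus, opp, zero; simpl; ring.
    - intros t. apply continuity_2d_pt_mult; [apply continuity_1d_2d_snd; auto|].
      apply (continuity_1d_2d_pt_comp v (fun u v => v + u)); auto.
      apply continuity_2d_pt_plus; [apply continuity_2d_pt_id2|apply continuity_2d_pt_id1].
    - intros u _. apply ex_RInt_cpt. intros t _. apply continuity_pt_mult; auto.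
      apply continuity_pt_minus; auto. }
  destruct (MVT_gen Psi 0 d dPsi) as (tau & Ht & E).
  { intros; apply DPsi. } { intros; eapply is_derive_cpt, DPsi. }
  rewrite Rmin_left, Rmax_right in Ht by lra. exists tau. split; auto.
  assert (Psi0 : Psi 0 = 0).
  { unfold Psi. rewrite (RInt_Rext _ (fun _ => 0)). rewrite RInt_Rconst. eqR; ring.
    intros t. rewrite Rplus_0_r; ring. }
  assert (Psid : Psi d <= RInt v 0 (2 * PI) * RInt w 0 (2 * PI)).
  { unfold Psi. rewrite <- RInt_Rscal by (apply ex_RInt_cpt; auto).
    apply RInt_le; [lra| | |].
    - apply ex_RInt_cpt. intros t _. apply continuity_pt_mult; auto. apply continuity_pt_minus; auto.
    - apply ex_RInt_Rscal, ex_RInt_cpt; auto.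
    - intros t _. rewrite Rmult_comm. apply Rmult_le_compat_r; auto.
      unfold P.
      assert (E2 : RInt v t (t + 2 * PI) = RInt v 0 (2 * PI)).
      { rewrite <- (RInt_shift v t Cv Per).
        pose proof (RInt_comp_lin v 1 t 0 (2 * PI) (Ex _ _)) as K.
        rewrite !Rmult_1_l, Rplus_0_l, (Rplus_comm (2 * PI)) in K. rewrite <- K.
        apply RInt_Rext. intros s. unfold scal; simpl; unfold mult; simpl. rewrite !Rmult_1_l; auto. }
      rewrite <- E2.
      pose proof (RInt_Chasles v 0 t (t + d) (Ex _ _) (Ex _ _)) as C1.
      pose proof (RInt_Chasles v t (t + d) (t + 2 * PI) (Ex _ _) (Ex _ _)) as C2.
      unfold plus in C1, C2; simpl in C1, C2.
      assert (0 <= RInt v (t + d) (t + 2 * PI)) by (apply RInt_ge_0; auto; lra). lra. }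
  rewrite (RInt_Rext _ (fun t => w t * v (t + tau))) by (intros; ring).
  fold (dPsi tau). apply Rmult_le_reg_l with d; [lra|].
  rewrite <- Rmult_assoc, Rinv_r, Rmult_1_l by lra.
  rewrite Psi0, !Rminus_0_r in E.
  apply Rle_trans with (Psi d); [right; rewrite Rmult_comm; symmetry; exact E|exact Psid].
Qed.

Lemma cpt_add (r s t : R) : cpt r (t + s) = (cpt 1 s * cpt r t)%C.
Proof. unfold cpt. rewrite cos_plus, sin_plus. apply Ceq; simpl; ring. Qed.

Lemma cpt_period (r t : R) : cpt r (t + 2 * PI) = cpt r t.
Proof. unfold cpt. rewrite cos_plus, sin_plus, cos_2PI, sin_2PI. f_equal; ring. Qed.

(* For [v = |k|^{p/2}] the autocorrelations [∫ v(t) v(t + τ) dt] increase with the radius,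
   being means of powers of the modulus of the analytic function [k(z) k(e^{iτ} z)]; as
   they are continuous at [τ = 0], the traces of [v] are equicontinuous in [L^2]. *)
Lemma autocorrelation (p Ck eps : R) (k : C -> C) : 0 < p -> adisc 1 k -> 0 < eps ->
  (forall r, 0 <= r < 1 -> circ (fun z => rpow (Cmod (k z)) p) r <= Ck) ->
  exists s d, 0 <= s < 1 /\ 0 < d /\ forall tau r, 0 <= tau <= d -> s <= r < 1 ->
    RInt (fun t => (rpow (Cmod (k (cpt r (t + tau)))) (p / 2) - rpow (Cmod (k (cpt r t))) (p / 2)) ^ 2)
      0 (2 * PI) <= eps.
Proof.
  intros Hp Ak He HC. pose proof PI_RGT_0.
  set (v := fun r t => rpow (Cmod (k (cpt r t))) (p / 2)).
  assert (Hvv : forall r t, v r t * v r t = rpow (Cmod (k (cpt r t))) p).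
  { intros r t. unfold v. rewrite <- rpow_plus by apply Cmod_ge_0. f_equal; field. }
  assert (Cv : forall r t, 0 <= r < 1 -> continuity_pt (v r) t).
  { intros r t Hr. apply (rcont_ccurve (fun z => rpow (Cmod (k z)) (p / 2)) (cpt r)); [|apply ccurve_cpt].
    apply rcont_rpow; [lra|]. eapply adisc_ccont; eauto. rewrite Cmod_cpt; lra. }
  assert (Cvs : forall r tau t, 0 <= r < 1 -> continuity_pt (fun t => v r (t + tau)) t).
  { intros r tau t Hr. apply (continuity_pt_comp (fun t => t + tau) (v r)); auto.
    apply derive_cpt; auto_derive; auto. }
  assert (Vper : forall r t, v r (t + 2 * PI) = v r t) by (intros; unfold v; rewrite cpt_period; auto).
  set (A := fun tau r => RInt (fun t => v r t * v r (t + tau)) 0 (2 * PI)).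
  assert (A0 : forall r, A 0 r = circ (fun z => rpow (Cmod (k z)) p) r).
  { intros r. apply RInt_Rext. intros t. rewrite Rplus_0_r. apply Hvv. }
  assert (AM : forall tau r s, 0 <= r <= s -> s < 1 -> A tau r <= A tau s).
  { intros tau r s Hr Hs. set (G := fun z => (k z * k (cpt 1 tau * z))%C).
    assert (AG : adisc 1 G).
    { apply adisc_mult; auto. intros z Hz.
      destruct (Ak (cpt 1 tau * z)%C) as [l Hl].
      { rewrite Cmod_mult, Cmod_cpt by lra. lra. }
      eexists. apply (cdiff_comp (fun z => (cpt 1 tau * z)%C) k); [apply cdiff_scal, cdiff_id|exact Hl]. }
    assert (E : forall r, A tau r = circ (fun z => rpow (Cmod (G z)) (p / 2)) r).
    { intros r'. apply RInt_Rext. intros t. unfold v, G. rewrite <- cpt_add, Cmod_mult, rpow_mult; auto using Cmod_ge_0. }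
    rewrite !E. apply mean_mono; auto. lra. }
  (* The quantity to bound is [2 (A 0 r - A tau r)]. Beyond [s] the first term gains at most
     [eps / 4] and the second does not decrease, so only the difference at the fixed radius [s]
     remains, small for small [tau] by continuity. *)
  destruct (sup_attained (A 0) Ck (eps / 4)) as (s & Hs & HsA); [lra|intros; apply AM; auto| |].
  { intros r Hr. rewrite A0; auto. }
  destruct (uniform_continuity_2d_1d' (fun tau t => v s t * v s (t + tau)) 0 (2 * PI) 0) with
    (eps := mkposreal (eps / (8 * (2 * PI))) ltac:(apply Rdiv_lt_0_compat; lra)) as [d Hd].
  { intros t Ht. apply continuity_2d_pt_mult; [apply continuity_1d_2d_snd; auto|].
    apply (continuity_1d_2d_pt_comp (v s) (fun tau t => t + tau)); auto.
    apply continuity_2d_pt_plus; [apply continuity_2d_pt_id2|apply continuity_2d_pt_id1]. }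
  pose proof (cond_pos d) as Hdp.
  exists s, d. split; auto. split; auto. intros tau r Ht Hr.
  assert (ExA : forall tau r, 0 <= r < 1 -> ex_RInt (fun t => v r t * v r (t + tau)) 0 (2 * PI)).
  { intros tau' r' Hr'. apply ex_RInt_cpt. intros t _. apply continuity_pt_mult; auto. }
  assert (AA : A 0 s - A tau s <= eps / 8).
  { unfold A. rewrite <- RInt_Rminus by (apply ExA; auto).
    eapply Rle_trans; [apply Rle_abs|].
    replace (eps / 8) with ((2 * PI - 0) * (eps / (8 * (2 * PI)))) by (field; lra).
    apply abs_RInt_le_const; [lra|apply ex_RInt_Rminus; apply ExA; auto|].
    intros t Htt. left. apply (Hd t tau t 0); try lra. rewrite Rminus_diag, Rabs_R0; auto. }
  assert (Hr1 : 0 <= r < 1) by lra.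
  specialize (HsA r Hr). pose proof (AM tau s r ltac:(lra) ltac:(lra)) as Am.
  fold (v r). 
  assert (Ev : ex_RInt (fun t => v r t * v r t) 0 (2 * PI)) by (apply ex_RInt_cpt; intros; apply continuity_pt_mult; auto).
  assert (Es : ex_RInt (fun t => v r (t + tau) * v r (t + tau)) 0 (2 * PI)) by
    (apply ex_RInt_cpt; intros; apply continuity_pt_mult; auto).
  assert (I1 : RInt (fun t => v r t * v r t) 0 (2 * PI) = A 0 r).
  { apply RInt_Rext; intros; rewrite Rplus_0_r; auto. }
  assert (I2 : RInt (fun t => v r (t + tau) * v r (t + tau)) 0 (2 * PI) = A 0 r).
  { rewrite (RInt_shift (fun t => v r t * v r t)); auto.
    intros; apply continuity_pt_mult; auto. intros; rewrite Vper; auto. }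
  rewrite (RInt_Rext _ (fun t => (v r (t + tau) * v r (t + tau) + v r t * v r t) - 2 * (v r t * v r (t + tau)))).
  2:{ intros t. unfold v. ring. }
  rewrite RInt_Rminus, RInt_Rplus, RInt_Rscal, I1, I2; auto using ex_RInt_Rplus, ex_RInt_Rscal.
  fold (A tau r). lra.
Qed.

(** Replace [v = |k|^(p/2)] by a small rotation of it. By [rotation_average] some rotation makes the
    product with [w = |h_n|^(p/2)] at most a constant times the mean of [w], which tends to 0. The
    error is controlled by the [L^2] equicontinuity of [v] and the bounded [L^2] norm of [w]. All
    constants depend on the fixed [k]. *)
Lemma cross_means (p Ck Ch : R) (k : C -> C) (h : nat -> C -> C) : 0 < p -> adisc 1 k ->
  (forall n, adisc 1 (h n)) ->
  (forall r, 0 <= r < 1 -> circ (fun z => rpow (Cmod (k z)) p) r <= Ck) ->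
  (forall n r, 0 <= r < 1 -> circ (fun z => rpow (Cmod (h n z)) p) r <= Ch) ->
  means_to0 (p / 2) h -> means_to0 (p / 2) (fun n z => (k z * h n z)%C).
Proof.
  intros Hp Ak Ah HCk HCh Hm eta He. pose proof PI_RGT_0.
  pose proof (Rabs_pos Ck) as Ck0. pose proof (Rabs_pos Ch) as Ch0.
  (* The weight in the inequality [x y <= x^2 / (2 kap) + kap y^2 / 2] for the rotation error: with
     this [kap] the term in [w], and with the next [eps] the term in [v], is at most [eta / 4]. *)
  set (kap := eta / (2 * (Rabs Ch + 1))). assert (Hkap : 0 < kap) by (apply Rdiv_lt_0_compat; lra).
  set (eps := kap * eta / 2). assert (Heps : 0 < eps) by (unfold eps; apply Rdiv_lt_0_compat; [apply Rmult_lt_0_compat; auto|lra]).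
  destruct (autocorrelation p Ck eps k Hp Ak Heps HCk) as (s & d0 & Hs & Hd0 & HA).
  set (d := Rmin d0 (2 * PI)).
  assert (Hd : 0 < d <= 2 * PI) by (unfold d; split; [apply Rmin_pos; lra|apply Rmin_r]).
  assert (Hdd : d <= d0) by apply Rmin_l.
  set (B := 2 * PI + Rabs Ck). assert (HB : 0 < B) by (unfold B; lra).
  destruct (Hm (eta * d / (4 * B))) as [N HN].
  { apply Rdiv_lt_0_compat; [apply Rmult_lt_0_compat; lra|lra]. }
  exists N. intros n Hn.
  assert (Big : forall r, s <= r < 1 -> circ (fun z => rpow (Cmod (k z * h n z)) (p / 2)) r <= eta).
  { intros r Hr. assert (Hr1 : 0 <= r < 1) by lra. specialize (HN n Hn r Hr1).
    set (v := fun t => rpow (Cmod (k (cpt r t))) (p / 2)).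
    set (w := fun t => rpow (Cmod (h n (cpt r t))) (p / 2)).
    assert (Cc : forall F, adisc 1 F -> forall t, continuity_pt (fun t => rpow (Cmod (F (cpt r t))) (p / 2)) t).
    { intros F HF t. apply (rcont_ccurve (fun z => rpow (Cmod (F z)) (p / 2)) (cpt r)); [|apply ccurve_cpt].
      apply rcont_rpow; [lra|]. eapply adisc_ccont; eauto. rewrite Cmod_cpt; lra. }
    assert (Cv : forall t, continuity_pt v t) by (apply Cc; auto).
    assert (Cw : forall t, continuity_pt w t) by (apply (Cc (h n)); auto).
    assert (Cvs : forall tau t, continuity_pt (fun t => v (t + tau)) t).
    { intros tau t. apply (continuity_pt_comp (fun t => t + tau) v); auto.
      apply derive_cpt; auto_derive; auto. }
    destruct (rotation_average v w d Hd Cv Cw) as (tau & Ht & Hav).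
    { intros; apply rpow_ge0. } { intros; apply rpow_ge0. }
    { intros; unfold v; rewrite cpt_period; auto. }
    specialize (HA tau r ltac:(lra) Hr). fold (v) in HA.
    assert (Iw : RInt w 0 (2 * PI) = circ (fun z => rpow (Cmod (h n z)) (p / 2)) r) by reflexivity.
    assert (Iv : RInt v 0 (2 * PI) <= B).
    { change (circ (fun z => rpow (Cmod (k z)) (p / 2)) r <= B).
      assert (X1 : excirc (fun z => rpow (Cmod (k z)) p) r) by (apply excirc_rpow; auto).
      apply Rle_trans with (circ (fun z => 1 + rpow (Cmod (k z)) p) r).
      - apply circ_le; [lra|apply excirc_rpow; auto; lra|apply excirc_plus; [apply excirc_const|auto]|].
        intros z _. pose proof (rpow_ge0 (Cmod (k z)) p).
        assert (E : rpow (Cmod (k z)) p = rpow (Cmod (k z)) (p / 2) * rpow (Cmod (k z)) (p / 2)) by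
          (rewrite <- rpow_plus by apply Cmod_ge_0; f_equal; field).
        rewrite E. pose proof (rpow_ge0 (Cmod (k z)) (p / 2)).
        set (x := rpow (Cmod (k z)) (p / 2)) in *. pose proof (pow2_ge_0 (x - 1)). nra.
      - rewrite circ_plus, circ_const; [|apply excirc_const|auto].
        pose proof (HCk r Hr1). pose proof (Rle_abs Ck). unfold B; lra. }
    assert (Iw0 : 0 <= RInt w 0 (2 * PI)).
    { apply RInt_ge_0; [lra|apply ex_RInt_cpt; auto|intros; apply rpow_ge0]. }
    assert (T1 : / d * (RInt v 0 (2 * PI) * RInt w 0 (2 * PI)) <= eta / 4).
    { apply Rle_trans with (/ d * (B * (eta * d / (4 * B)))).
      apply Rmult_le_compat_l; [left; apply Rinv_0_lt_compat; lra|].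
      apply Rle_trans with (B * RInt w 0 (2 * PI)).
      apply Rmult_le_compat_r; auto. apply Rmult_le_compat_l; [lra|]. rewrite Iw; auto.
      right; field; lra. }
    assert (Iww : RInt (fun t => w t * w t) 0 (2 * PI) <= Rabs Ch).
    { rewrite (RInt_Rext _ (fun t => rpow (Cmod (h n (cpt r t))) p)).
      - pose proof (HCh n r Hr1). pose proof (Rle_abs Ch). unfold circ in *. lra.
      - intros t. unfold w. rewrite <- rpow_plus by apply Cmod_ge_0. f_equal; field. }
    assert (E1 : ex_RInt (fun t => v (t + tau) * w t) 0 (2 * PI)) by (apply ex_RInt_cpt; intros; apply continuity_pt_mult; auto).
    assert (E2 : ex_RInt (fun t => (v (t + tau) - v t) ^ 2) 0 (2 * PI)).
    { apply ex_RInt_cpt. intros t _. apply (continuity_pt_comp (fun t => v (t + tau) - v t) (fun x => x ^ 2)).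
      apply continuity_pt_minus; auto. apply continuity_sqr. }
    assert (E3 : ex_RInt (fun t => w t * w t) 0 (2 * PI)) by (apply ex_RInt_cpt; intros; apply continuity_pt_mult; auto).
    assert (S1 := ex_RInt_Rscal _ _ _ (/ (2 * kap)) E2). assert (S2 := ex_RInt_Rscal _ _ _ (kap / 2) E3).
    assert (L : circ (fun z => rpow (Cmod (k z * h n z)) (p / 2)) r <=
      RInt (fun t => v (t + tau) * w t + (/ (2 * kap) * (v (t + tau) - v t) ^ 2 + kap / 2 * (w t * w t))) 0 (2 * PI)).
    { apply RInt_le; [lra| |apply ex_RInt_Rplus; auto; apply ex_RInt_Rplus; auto|].
      apply (excirc_rpow (p / 2) r (fun z => (k z * h n z)%C)); auto. lra. apply adisc_mult; auto.
      intros t _. rewrite Cmod_mult, rpow_mult by apply Cmod_ge_0. fold (v t) (w t).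
      assert (Q : 0 <= / (2 * kap) * (v (t + tau) - v t + kap * w t) ^ 2).
      { apply Rmult_le_pos; [left; apply Rinv_0_lt_compat; lra|apply pow2_ge_0]. }
      replace (/ (2 * kap) * (v (t + tau) - v t + kap * w t) ^ 2) with
        (/ (2 * kap) * (v (t + tau) - v t) ^ 2 + (v (t + tau) - v t) * w t + kap / 2 * (w t * w t)) in Q by (field; lra).
      lra. }
    rewrite RInt_Rplus, RInt_Rplus, !RInt_Rscal in L; auto; [|apply ex_RInt_Rplus; auto].
    assert (T2 : / (2 * kap) * RInt (fun t => (v (t + tau) - v t) ^ 2) 0 (2 * PI) <= eta / 4).
    { apply Rle_trans with (/ (2 * kap) * eps).
      apply Rmult_le_compat_l; [left; apply Rinv_0_lt_compat; lra|exact HA].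
      right; unfold eps; field; lra. }
    assert (T3 : kap / 2 * RInt (fun t => w t * w t) 0 (2 * PI) <= eta / 4).
    { apply Rle_trans with (kap / 2 * (Rabs Ch + 1)).
      apply Rmult_le_compat_l; lra. right; unfold kap; field; lra. }
    lra. }
  intros r Hr. destruct (Rle_dec s r); [apply Big; lra|].
  eapply Rle_trans; [|apply (Big s); lra].
  apply (mean_mono (p / 2) r s (fun z => (k z * h n z)%C)); try lra. apply adisc_mult; auto.
Qed.

(** * Selection of an almost disjoint subsequence *)

Lemma rpow_halves (x p : R) : 0 <= x -> rpow x p = rpow x (p / 2) * rpow x (p / 2).
Proof. intros Hx. rewrite <- rpow_plus by auto. f_equal; field. Qed.

(** If [b] is at most a small multiple [th] of [a], then [c / a] is near 1 and continuity of the
    power gives an error [eta a^p]. Otherwise [a] and [b] are comparable, and all three powers are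
    bounded by a multiple of [a^(p/2) b^(p/2)]. *)
Lemma pow_ineq_aux (p eta : R) : 0 < p -> 0 < eta -> exists K, 0 <= K /\
  forall a b c, 0 <= b <= a -> 0 <= c -> Rabs (c - a) <= b ->
  Rabs (rpow c p - rpow a p - rpow b p) <= eta * rpow a p + K * (rpow a (p / 2) * rpow b (p / 2)).
Proof.
  intros Hp He.
  destruct (proj1 (continuity_pt_locally _ _) (rpow_cont p 1 Hp) (mkposreal (eta / 2) ltac:(lra))) as [d1 Hd1].
  pose proof (cond_pos d1) as Hd1p. simpl in Hd1. rewrite rpow_one in Hd1.
  pose proof (rpow_pos (eta / 2) (/ p) ltac:(lra)) as Hx0.
  set (th := Rmin (d1 / 2) (Rmin (/ 2) (rpow (eta / 2) (/ p)))).
  assert (Hth : 0 < th) by (unfold th; repeat apply Rmin_pos; lra).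
  assert (T1 : th <= d1 / 2) by apply Rmin_l.
  assert (T2 : th <= / 2) by (unfold th; eapply Rle_trans; [apply Rmin_r|apply Rmin_l]).
  assert (T3 : th <= rpow (eta / 2) (/ p)) by (unfold th; eapply Rle_trans; [apply Rmin_r|apply Rmin_r]).
  assert (T4 : rpow th p <= eta / 2).
  { rewrite <- (rpow_inv_q (eta / 2) p) by lra. apply rpow_mono; lra. }
  assert (Hi : 0 < / th) by (apply Rinv_0_lt_compat; auto).
  pose proof (rpow_ge0 2 p) as R2. pose proof (rpow_ge0 (/ th) (p / 2)) as R3.
  exists ((rpow 2 p + 2) * rpow (/ th) (p / 2)). split; [apply Rmult_le_pos; lra|].
  intros a b c Hb Hc Hca. apply Rabs_le_between in Hca.
  destruct (Req_dec a 0) as [->|Ha0].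
  { replace b with 0 by lra. replace c with 0 by lra. rewrite !rpow_0.
    rewrite !Rminus_0_r, Rabs_R0. lra. }
  assert (Ha : 0 < a) by lra.
  pose proof (rpow_pos a p Ha) as Rap. pose proof (rpow_ge0 b p) as Rbp. pose proof (rpow_ge0 c p) as Rcp.
  pose proof (rpow_ge0 a (p / 2)) as Raq. pose proof (rpow_ge0 b (p / 2)) as Rbq.
  destruct (Rle_dec b (th * a)) as [Hba|Hba].
  - assert (Q : Rabs (rpow (c / a) p - 1) < eta / 2).
    { apply Hd1. change (Rabs (c / a - 1) < d1).
      replace (c / a - 1) with ((c - a) / a) by (field; lra).
      unfold Rdiv; rewrite Rabs_mult, Rabs_inv, (Rabs_pos_eq a) by lra.
      apply Rle_lt_trans with (th * a * / a).
      apply Rmult_le_compat_r; [left; apply Rinv_0_lt_compat; auto|]. apply Rabs_le; lra.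
      rewrite Rmult_assoc, Rinv_r by lra. lra. }
    assert (Ec : rpow c p = rpow a p * rpow (c / a) p).
    { rewrite <- rpow_mult; [|lra|apply Rmult_le_pos; [lra|left; apply Rinv_0_lt_compat; auto]].
      f_equal. field; lra. }
    assert (Eb : rpow b p <= rpow a p * (eta / 2)).
    { apply Rle_trans with (rpow (th * a) p). apply rpow_mono; lra. rewrite rpow_mult by lra. nra. }
    apply Rabs_def2 in Q. 
    assert (0 <= (rpow 2 p + 2) * rpow (/ th) (p / 2) * (rpow a (p / 2) * rpow b (p / 2))) by
      (repeat apply Rmult_le_pos; lra).
    apply Rabs_le. rewrite Ec. nra.
  - assert (Hab : a <= / th * b).
    { apply Rmult_le_reg_l with th; auto. rewrite <- Rmult_assoc, Rinv_r by lra. lra. }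
    assert (E1 : rpow a p <= rpow (/ th) (p / 2) * (rpow a (p / 2) * rpow b (p / 2))).
    { rewrite (rpow_halves a) by lra.
      assert (rpow a (p / 2) <= rpow (/ th) (p / 2) * rpow b (p / 2)).
      { rewrite <- rpow_mult by lra. apply rpow_mono; lra. }
      replace (rpow (/ th) (p / 2) * (rpow a (p / 2) * rpow b (p / 2))) with
        (rpow a (p / 2) * (rpow (/ th) (p / 2) * rpow b (p / 2))) by ring.
      apply Rmult_le_compat_l; auto. }
    assert (E2 : rpow c p <= rpow 2 p * rpow a p) by (rewrite <- rpow_mult by lra; apply rpow_mono; lra).
    assert (E3 : rpow b p <= rpow a p) by (apply rpow_mono; lra).
    assert (E4 : (rpow 2 p + 2) * rpow a p <=
      (rpow 2 p + 2) * (rpow (/ th) (p / 2) * (rpow a (p / 2) * rpow b (p / 2)))) by (apply Rmult_le_compat_l; lra).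
    assert (0 <= eta * rpow a p) by (apply Rmult_le_pos; lra).
    assert (0 <= rpow 2 p * rpow a p) by (apply Rmult_le_pos; lra).
    apply Rabs_le. lra.
Qed.

Lemma pow_ineq (p eta : R) : 0 < p -> 0 < eta -> exists K, 0 <= K /\ forall x y : C,
  Rabs (rpow (Cmod (x + y)) p - rpow (Cmod x) p - rpow (Cmod y) p) <=
  eta * (rpow (Cmod x) p + rpow (Cmod y) p) + K * rpow (Cmod (x * y)) (p / 2).
Proof.
  intros Hp He. destruct (pow_ineq_aux p eta Hp He) as [K [HK0 HK]]. exists K. split; auto.
  intros x y. pose proof (Cmod_ge_0 x); pose proof (Cmod_ge_0 y); pose proof (Cmod_ge_0 (x + y)).
  pose proof (rpow_ge0 (Cmod x) p); pose proof (rpow_ge0 (Cmod y) p).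
  rewrite Cmod_mult, rpow_mult by auto.
  assert (Tr : forall u v : C, Rabs (Cmod (u + v) - Cmod u) <= Cmod v).
  { intros u v. pose proof (Cmod_triangle u v). pose proof (Cmod_triangle_sub u (u + v)) as T.
    replace (u - (u + v))%C with (- v)%C in T by ring. rewrite Cmod_opp in T. apply Rabs_le; lra. }
  destruct (Rle_dec (Cmod y) (Cmod x)).
  - assert (0 <= eta * rpow (Cmod y) p) by (apply Rmult_le_pos; lra).
    eapply Rle_trans; [apply (HK (Cmod x) (Cmod y)); auto; lra|]. lra.
  - assert (0 <= eta * rpow (Cmod x) p) by (apply Rmult_le_pos; lra).
    pose proof (HK (Cmod y) (Cmod x) (Cmod (x + y)) ltac:(lra) H1) as Q.
    specialize (Q ltac:(rewrite Cplus_comm; apply Tr)).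
    replace (rpow (Cmod (x + y)) p - rpow (Cmod x) p - rpow (Cmod y) p) with
      (rpow (Cmod (x + y)) p - rpow (Cmod y) p - rpow (Cmod x) p) by ring.
    lra.
Qed.

Lemma circ_abs_le (U V : C -> R) (r : R) : 0 <= r -> excirc U r -> excirc V r ->
  (forall z, Cmod z = r -> Rabs (U z) <= V z) -> Rabs (circ U r) <= circ V r.
Proof.
  intros Hr HU HV H. apply Rabs_le. split.
  - replace (- circ V r) with (circ (fun z => -1 * V z) r) by (rewrite circ_scal by auto; ring).
    apply circ_le; auto; [apply excirc_scal; auto|].
    intros z Hz. specialize (H z Hz). apply Rabs_le_between in H. lra.
  - apply circ_le; auto. intros z Hz. specialize (H z Hz). apply Rabs_le_between in H. lra.
Qed.

Lemma circ_pow_ineq (p eta : R) : 0 < p -> 0 < eta -> exists K, 0 <= K /\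
  forall F G r, adisc 1 F -> adisc 1 G -> 0 <= r < 1 ->
  Rabs (circ (fun z => rpow (Cmod (F z + G z)) p) r - circ (fun z => rpow (Cmod (F z)) p) r
        - circ (fun z => rpow (Cmod (G z)) p) r) <=
  eta * (circ (fun z => rpow (Cmod (F z)) p) r + circ (fun z => rpow (Cmod (G z)) p) r)
  + K * circ (fun z => rpow (Cmod (F z * G z)) (p / 2)) r.
Proof.
  intros Hp He. destruct (pow_ineq p eta Hp He) as [K [HK0 HK]]. exists K. split; auto.
  intros F G r HF HG Hr.
  assert (X1 : excirc (fun z => rpow (Cmod (F z + G z)) p) r) by
    (apply (excirc_rpow p r (fun z => (F z + G z)%C)); auto; apply adisc_plus; auto).
  assert (X2 : excirc (fun z => rpow (Cmod (F z)) p) r) by (apply excirc_rpow; auto).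
  assert (X3 : excirc (fun z => rpow (Cmod (G z)) p) r) by (apply excirc_rpow; auto).
  assert (X4 : excirc (fun z => rpow (Cmod (F z * G z)) (p / 2)) r) by
    (apply (excirc_rpow (p / 2) r (fun z => (F z * G z)%C)); auto; [lra|apply adisc_mult; auto]).
  rewrite <- circ_minus, <- circ_minus, <- circ_plus, <- !circ_scal, <- circ_plus;
    auto using excirc_minus, excirc_plus, excirc_scal.
  apply circ_abs_le; [lra| | |]; auto using excirc_minus, excirc_plus, excirc_scal.
Qed.

(** Convertible with the combination used in the statement of the theorem, so that the final proof
    passes between the two by [change]. *)
Fixpoint lincomb (alpha : nat -> C) (h : nat -> C -> C) (N : nat) (z : C) : C :=
  match N with
  | O => RtoC 0
  | S N' => (lincomb alpha h N' z + alpha N' * h N' z)%C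
  end.

Fixpoint rsum (f : nat -> R) (N : nat) : R :=
  match N with O => 0 | S N' => rsum f N' + f N' end.

Lemma adisc_lincomb (alpha : nat -> C) (h : nat -> C -> C) (N : nat) :
  (forall j, adisc 1 (h j)) -> adisc 1 (lincomb alpha h N).
Proof.
  intros H. induction N; simpl. apply adisc_const. apply adisc_plus; auto. apply adisc_scal; auto.
Qed.

Lemma circ_sum_le (q : R) (F G : C -> C) (r : R) : 0 < q -> adisc 1 F -> adisc 1 G -> 0 <= r < 1 ->
  circ (fun z => rpow (Cmod (F z + G z)) q) r <=
  rpow 2 q * (circ (fun z => rpow (Cmod (F z)) q) r + circ (fun z => rpow (Cmod (G z)) q) r).
Proof.
  intros Hq HF HG Hr.
  assert (X2 : excirc (fun z => rpow (Cmod (F z)) q) r) by (apply excirc_rpow; auto).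
  assert (X3 : excirc (fun z => rpow (Cmod (G z)) q) r) by (apply excirc_rpow; auto).
  rewrite <- circ_plus, <- circ_scal; auto using excirc_plus.
  apply circ_le; [lra| |auto using excirc_plus, excirc_scal|].
  { apply (excirc_rpow q r (fun z => (F z + G z)%C)); auto; apply adisc_plus; auto. }
  intros z _. eapply Rle_trans; [|apply rpow_add_le; auto; apply Cmod_ge_0].
  apply rpow_mono; auto. split; [apply Cmod_ge_0|apply Cmod_triangle].
Qed.

Definition pmean (p r : R) (F : C -> C) : R := circ (fun z => rpow (Cmod (F z)) p) r.

Lemma pmean_ext (p r : R) (F G : C -> C) : (forall z, F z = G z) -> pmean p r F = pmean p r G.
Proof. intros H. apply circ_ext; intros; rewrite H; auto. Qed.

Lemma pmean_ge0 (p r : R) (F : C -> C) : 0 < p -> adisc 1 F -> 0 <= r < 1 -> 0 <= pmean p r F.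
Proof. intros Hp HF Hr. apply circ_ge0; [lra|apply excirc_rpow; auto|intros; apply rpow_ge0]. Qed.

Lemma pmean_scal (p r : R) (c : C) (F : C -> C) : 0 < p -> adisc 1 F -> 0 <= r < 1 ->
  pmean p r (fun z => (c * F z)%C) = rpow (Cmod c) p * pmean p r F.
Proof. intros. apply circ_rpow_scal; auto. Qed.

Lemma pmean_0 (p r : R) : pmean p r (fun _ => RtoC 0) = 0.
Proof. unfold pmean. rewrite Cmod_0, rpow_0, circ_const. ring. Qed.

(** The constant produced by using the quasi-triangle inequality [N] times. Its exponential growth
    is harmless because the tolerance of each step is chosen afterwards. *)
Fixpoint grow (c a : R) (N : nat) : R :=
  match N with O => 0 | S N' => c * (grow c a N' + a) end.

Lemma grow_ge0 (c a : R) (N : nat) : 0 <= c -> 0 <= a -> 0 <= grow c a N.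
Proof. intros Hc Ha. induction N; simpl; [lra|]. apply Rmult_le_pos; lra. Qed.

Lemma pmean_lincomb_le (p C1 Bp r : R) (alpha : nat -> C) (k : nat -> C -> C) (J : nat) : 0 < p ->
  0 <= C1 -> (forall j, adisc 1 (k j)) -> 0 <= r < 1 -> (forall j, pmean p r (k j) <= C1) ->
  (forall j, rpow (Cmod (alpha j)) p <= Bp) ->
  pmean p r (lincomb alpha k J) <= grow (rpow 2 p) C1 J * Bp.
Proof.
  intros Hp HC1 Hk Hr HC HB. induction J.
  - change (lincomb alpha k 0) with (fun _ : C => RtoC 0). rewrite pmean_0. simpl. lra.
  - simpl. eapply Rle_trans; [apply circ_sum_le; auto; [apply adisc_lincomb; auto|apply adisc_scal; auto]|].
    rewrite Rmult_assoc. apply Rmult_le_compat_l; [apply rpow_ge0|].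
    fold (pmean p r (lincomb alpha k J)). fold (pmean p r (fun z => (alpha J * k J z)%C)).
    rewrite pmean_scal by auto.
    assert (rpow (Cmod (alpha J)) p * pmean p r (k J) <= Bp * C1).
    { apply Rmult_le_compat; auto; [apply rpow_ge0|apply pmean_ge0; auto]. }
    lra.
Qed.

Lemma cross_lincomb_le (q e b r : R) (alpha : nat -> C) (k : nat -> C -> C) (m : C -> C) (J : nat) : 0 < q ->
  0 <= e -> (forall j, adisc 1 (k j)) -> adisc 1 m -> 0 <= r < 1 ->
  (forall j, (j < J)%nat -> pmean q r (fun z => (k j z * m z)%C) <= e) ->
  (forall j, rpow (Cmod (alpha j)) q <= b) ->
  pmean q r (fun z => (lincomb alpha k J z * m z)%C) <= grow (rpow 2 q) e J * b.
Proof.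
  intros Hq He Hk Hm Hr. induction J; intros HC HB.
  - simpl. rewrite (pmean_ext q r _ (fun _ => RtoC 0)), pmean_0 by (intros; ring). lra.
  - assert (A1 : adisc 1 (fun z => (lincomb alpha k J z * m z)%C)) by (apply adisc_mult; auto; apply adisc_lincomb; auto).
    assert (A2 : adisc 1 (fun z => (k J z * m z)%C)) by (apply adisc_mult; auto).
    rewrite (pmean_ext q r _ (fun z => (lincomb alpha k J z * m z + alpha J * (k J z * m z))%C)) by (intros; simpl; ring).
    eapply Rle_trans; [apply (circ_sum_le q (fun z => (lincomb alpha k J z * m z)%C) (fun z => (alpha J * (k J z * m z))%C)); auto; apply adisc_scal; auto|].
    simpl. rewrite Rmult_assoc. apply Rmult_le_compat_l; [apply rpow_ge0|].
    fold (pmean q r (fun z => (lincomb alpha k J z * m z)%C)).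
    fold (pmean q r (fun z => (alpha J * (k J z * m z))%C)).
    rewrite pmean_scal by auto.
    assert (rpow (Cmod (alpha J)) q * pmean q r (fun z => (k J z * m z)%C) <= b * e).
    { apply Rmult_le_compat; auto; [apply rpow_ge0|apply pmean_ge0; auto]. }
    specialize (IHJ ltac:(intros; apply HC; lia) HB). lra.
Qed.

Lemma grow_scale (c a : R) (N : nat) : grow c a N = grow c 1 N * a.
Proof. induction N; simpl; [ring|]. rewrite IHN; ring. Qed.

(** The tolerance [e] is fixed before the functions, the coefficients and the radius; this is what
    makes an inductive selection possible. The new term is added by [circ_pow_ineq], the partial sum
    being controlled by the crude bounds of [grow]. *)
Lemma lincomb_step (p C1 : R) (J : nat) (eps : R) : 0 < p -> 0 <= C1 -> 0 < eps ->
  exists e, 0 < e /\ forall k : nat -> C -> C, (forall j, adisc 1 (k j)) ->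
   (forall j r, 0 <= r < 1 -> pmean p r (k j) <= C1) ->
   (forall j r, (j < J)%nat -> 0 <= r < 1 -> pmean (p / 2) r (fun z => (k j z * k J z)%C) <= e) ->
   forall (alpha : nat -> C) (Bp r : R), 0 <= r < 1 -> (forall j, rpow (Cmod (alpha j)) p <= Bp) ->
   Rabs (pmean p r (lincomb alpha k (S J)) - pmean p r (lincomb alpha k J)
         - rpow (Cmod (alpha J)) p * pmean p r (k J)) <= eps * Bp.
Proof.
  intros Hp HC1 He.
  set (E := grow (rpow 2 p) C1 J). set (G := grow (rpow 2 (p / 2)) 1 J).
  assert (HE : 0 <= E) by (apply grow_ge0; auto; apply rpow_ge0).
  assert (HG : 0 <= G) by (apply grow_ge0; [apply rpow_ge0|lra]).
  (* Half of [eps] goes to the [eta]-term, since the partial sum and the new term have [p]-th means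
     at most [E * Bp] and [C1 * Bp]; the other half goes to the product term through [e]. *)
  set (eta := eps / (2 * (E + C1 + 1))).
  assert (Heta : 0 < eta) by (apply Rdiv_lt_0_compat; lra).
  destruct (circ_pow_ineq p eta Hp Heta) as [K [HK0 HK]].
  set (e := eps / (2 * (K * G + 1))).
  assert (HKG : 0 <= K * G) by (apply Rmult_le_pos; auto).
  assert (He' : 0 < e) by (apply Rdiv_lt_0_compat; lra).
  exists e. split; auto. intros k Hk HC Hx alpha Bp r Hr HB.
  assert (HBp : 0 <= Bp) by (eapply Rle_trans; [apply rpow_ge0|apply (HB O)]).
  pose proof (adisc_lincomb alpha k J Hk) as AS. pose proof (adisc_scal 1 (alpha J) (k J) (Hk J)) as AJ.
  pose proof (HK (lincomb alpha k J) (fun z => (alpha J * k J z)%C) r AS AJ Hr) as Q. cbv beta in Q.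
  change (circ (fun z => rpow (Cmod (lincomb alpha k J z + alpha J * k J z)) p) r) with
    (pmean p r (lincomb alpha k (S J))) in Q.
  fold (pmean p r (lincomb alpha k J)) in Q. fold (pmean p r (fun z => (alpha J * k J z)%C)) in Q.
  fold (pmean (p / 2) r (fun z => (lincomb alpha k J z * (alpha J * k J z))%C)) in Q.
  rewrite (pmean_scal p r (alpha J)) in Q by auto.
  eapply Rle_trans; [exact Q|].
  pose proof (pmean_lincomb_le p C1 Bp r alpha k J Hp HC1 Hk Hr (fun j => HC j r Hr) HB) as L1. fold E in L1.
  assert (L2 : rpow (Cmod (alpha J)) p * pmean p r (k J) <= Bp * C1).
  { apply Rmult_le_compat; auto; [apply rpow_ge0|apply pmean_ge0; auto]. }
  (* The product carries two coefficients, each to the power [p / 2] and hence at most [b]; together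
     they give [b * b = Bp]. *)
  set (b := rpow Bp (/ 2)).
  assert (Hb : forall j, rpow (Cmod (alpha j)) (p / 2) <= b).
  { intros j. unfold b. replace (p / 2) with (p * / 2) by field. rewrite <- rpow_rpow by apply Cmod_ge_0.
    apply rpow_mono; [lra|]. split; [apply rpow_ge0|auto]. }
  assert (Hbb : b * b = Bp).
  { unfold b. rewrite <- rpow_plus by auto. replace (/ 2 + / 2) with 1 by field. apply rpow_1; auto. }
  assert (Hb0 : 0 <= b) by apply rpow_ge0.
  assert (L3 : pmean (p / 2) r (fun z => (lincomb alpha k J z * (alpha J * k J z))%C) <= G * e * Bp).
  { rewrite (pmean_ext _ _ _ (fun z => (alpha J * (lincomb alpha k J z * k J z))%C)) by (intros; ring).
    rewrite pmean_scal; [|lra|apply adisc_mult; auto|auto].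
    pose proof (cross_lincomb_le (p / 2) e b r alpha k (k J) J ltac:(lra) ltac:(lra) Hk (Hk J) Hr
      (fun j Hj => Hx j r Hj Hr) Hb) as L. rewrite grow_scale in L. fold G in L.
    replace (G * e * Bp) with (b * (G * e * b)) by (rewrite <- Hbb; ring).
    apply Rmult_le_compat; auto; [apply rpow_ge0|].
    apply pmean_ge0; auto; [lra|apply adisc_mult; auto]. }
  assert (M1 : eta * (pmean p r (lincomb alpha k J) + rpow (Cmod (alpha J)) p * pmean p r (k J)) <= eps / 2 * Bp).
  { apply Rle_trans with (eta * ((E + C1 + 1) * Bp)). apply Rmult_le_compat_l; lra.
    right; unfold eta; field; lra. }
  assert (M2 : K * pmean (p / 2) r (fun z => (lincomb alpha k J z * (alpha J * k J z))%C) <= eps / 2 * Bp).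
  { apply Rle_trans with (K * (G * e * Bp)). apply Rmult_le_compat_l; auto.
    apply Rle_trans with ((K * G + 1) * e * Bp).
    replace (K * (G * e * Bp)) with (K * G * e * Bp) by ring.
    apply Rmult_le_compat_r; auto. apply Rmult_le_compat_r; lra.
    right; unfold e; field; lra. }
  lra.
Qed.

Lemma rsum_le (f g : nat -> R) (N : nat) : (forall j, (j < N)%nat -> f j <= g j) -> rsum f N <= rsum g N.
Proof.
  intros H. induction N; simpl; [lra|]. apply Rplus_le_compat; [apply IHN; intros; apply H; lia|apply H; lia].
Qed.

Lemma rsum_scal (c : R) (f : nat -> R) (N : nat) : rsum (fun j => c * f j) N = c * rsum f N.
Proof. induction N; simpl; [ring|]. rewrite IHN; ring. Qed.

Lemma rsum_geom (kap : R) (N : nat) : 0 <= kap -> rsum (fun j => kap / 2 ^ S j) N <= kap.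
Proof.
  intros Hk. assert (E : rsum (fun j => kap / 2 ^ S j) N = kap - kap / 2 ^ N).
  { induction N; [simpl; field|]. cbn [rsum]. rewrite IHN. simpl. field. apply pow_nonzero; lra. }
  rewrite E. assert (0 <= kap / 2 ^ N).
  { apply Rmult_le_pos; auto. left; apply Rinv_0_lt_compat, pow_lt; lra. } lra.
Qed.

(** The error is measured against a bound for the single [|alpha_j|^p], not for their sum. For the
    tail of an [l^p] sequence the sum of the tail can be used as [Bp], so the error is small
    relative to the tail itself. *)
Definition almost_disjoint (p kap : R) (k : nat -> C -> C) : Prop :=
  forall (alpha : nat -> C) (Bp r : R) (N : nat), 0 <= r < 1 ->
    (forall j, rpow (Cmod (alpha j)) p <= Bp) ->
    Rabs (pmean p r (lincomb alpha k N) - rsum (fun j => rpow (Cmod (alpha j)) p * pmean p r (k j)) N)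
    <= kap * Bp.

Lemma almost_disjoint_intro (p kap : R) (k : nat -> C -> C) : 0 < p -> 0 <= kap ->
  (forall J alpha Bp r, 0 <= r < 1 -> (forall j, rpow (Cmod (alpha j)) p <= Bp) ->
     Rabs (pmean p r (lincomb alpha k (S J)) - pmean p r (lincomb alpha k J)
         - rpow (Cmod (alpha J)) p * pmean p r (k J)) <= kap / 2 ^ S J * Bp) ->
  almost_disjoint p kap k.
Proof.
  intros Hp Hk H alpha Bp r N Hr HB.
  assert (HBp : 0 <= Bp) by (eapply Rle_trans; [apply rpow_ge0|apply (HB O)]).
  apply Rle_trans with (rsum (fun j => kap / 2 ^ S j) N * Bp).
  2:{ apply Rmult_le_compat_r; auto. apply rsum_geom; auto. }
  induction N.
  - change (lincomb alpha k 0) with (fun _ : C => RtoC 0). rewrite pmean_0. simpl rsum.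
    rewrite Rminus_0_r, Rabs_R0. lra.
  - specialize (H N alpha Bp r Hr HB). cbn [rsum].
    replace (pmean p r (lincomb alpha k (S N)) - (rsum (fun j => rpow (Cmod (alpha j)) p * pmean p r (k j)) N
        + rpow (Cmod (alpha N)) p * pmean p r (k N))) with
      ((pmean p r (lincomb alpha k (S N)) - pmean p r (lincomb alpha k N) - rpow (Cmod (alpha N)) p * pmean p r (k N))
      + (pmean p r (lincomb alpha k N) - rsum (fun j => rpow (Cmod (alpha j)) p * pmean p r (k j)) N)) by ring.
    eapply Rle_trans; [apply Rabs_triang|]. lra.
Qed.

Lemma uniform_in_first (Q : nat -> nat -> Prop) :
  (forall n, exists M, forall m, (M <= m)%nat -> Q n m) ->
  forall k, exists M, forall n m, (n <= k)%nat -> (M <= m)%nat -> Q n m.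
Proof.
  intros H. induction k.
  - destruct (H O) as [M HM]. exists M. intros n m Hn Hm. replace n with O by lia. auto.
  - destruct IHk as [M1 H1]. destruct (H (S k)) as [M2 H2]. exists (max M1 M2).
    intros n m Hn Hm. destruct (Nat.eq_dec n (S k)) as [->|Hne].
    apply H2; lia. apply H1; lia.
Qed.

(** The condition on the next index sees only the previous one; requirements relative to all earlier
    terms must be stated for every [n] up to [k]. *)
Lemma subsequence_choice (P : nat -> nat -> nat -> Prop) :
  (forall j k, exists M, forall m, (M <= m)%nat -> P j k m) ->
  exists nj : nat -> nat, (forall j, (nj j < nj (S j))%nat) /\ P O O (nj O) /\
    forall j, P (S j) (nj j) (nj (S j)).
Proof.
  intros H.
  assert (H' : forall j k, exists m, (k < m)%nat /\ P j k m).
  { intros j k. destruct (H j k) as [M HM]. exists (max M (S k)). split; [lia|apply HM; lia]. }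
  set (ch := fun j k => epsilon (inhabits O) (fun m => (k < m)%nat /\ P j k m)).
  assert (Hch : forall j k, (k < ch j k)%nat /\ P j k (ch j k)).
  { intros j k. apply (epsilon_spec (inhabits O) (fun m => (k < m)%nat /\ P j k m)), H'. }
  exists (fix nj j := match j with O => ch O O | S j' => ch (S j') (nj j') end).
  split; [|split].
  - intros j. apply Hch.
  - apply Hch.
  - intros j. apply Hch.
Qed.

(** The [J]-th step is allowed an error [kap / 2^(J+1)], so that the total is at most [kap]. The
    last clause makes every series with bounded coefficients converge locally uniformly. *)
Lemma select_subsequence (p C1 kap : R) (N0 : nat) (h : nat -> C -> C) : 0 < p -> 0 <= C1 -> 0 < kap ->
  (forall n, adisc 1 (h n)) -> (forall n r, 0 <= r < 1 -> pmean p r (h n) <= C1) ->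
  uoc0 h -> (forall n, means_to0 (p / 2) (fun m z => (h n z * h m z)%C)) ->
  exists nj : nat -> nat, (forall j, (nj j < nj (S j))%nat) /\ (forall j, (N0 <= nj j)%nat) /\
    almost_disjoint p kap (fun j => h (nj j)) /\
    forall j z, Cmod z <= 1 - (/ 2) ^ j -> Cmod (h (nj j) z) <= (/ 2) ^ j.
Proof.
  intros Hp HC1 Hk Ah HC Hu Hx.
  assert (He : forall J, exists e, 0 < e /\ forall k : nat -> C -> C, (forall j, adisc 1 (k j)) ->
   (forall j r, 0 <= r < 1 -> pmean p r (k j) <= C1) ->
   (forall j r, (j < J)%nat -> 0 <= r < 1 -> pmean (p / 2) r (fun z => (k j z * k J z)%C) <= e) ->
   forall (alpha : nat -> C) (Bp r : R), 0 <= r < 1 -> (forall j, rpow (Cmod (alpha j)) p <= Bp) ->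
   Rabs (pmean p r (lincomb alpha k (S J)) - pmean p r (lincomb alpha k J)
         - rpow (Cmod (alpha J)) p * pmean p r (k J)) <= kap / 2 ^ S J * Bp).
  { intros J. apply lincomb_step; auto. apply Rdiv_lt_0_compat; auto. apply pow_lt; lra. }
  set (ee := fun J => epsilon (inhabits 0) (fun e => 0 < e /\ forall k : nat -> C -> C, (forall j, adisc 1 (k j)) ->
   (forall j r, 0 <= r < 1 -> pmean p r (k j) <= C1) ->
   (forall j r, (j < J)%nat -> 0 <= r < 1 -> pmean (p / 2) r (fun z => (k j z * k J z)%C) <= e) ->
   forall (alpha : nat -> C) (Bp r : R), 0 <= r < 1 -> (forall j, rpow (Cmod (alpha j)) p <= Bp) ->
   Rabs (pmean p r (lincomb alpha k (S J)) - pmean p r (lincomb alpha k J)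
         - rpow (Cmod (alpha J)) p * pmean p r (k J)) <= kap / 2 ^ S J * Bp)).
  assert (Hee := fun J => epsilon_spec (inhabits 0) _ (He J)). fold ee in Hee.
  change (forall J, 0 < ee J /\ forall k : nat -> C -> C, (forall j, adisc 1 (k j)) ->
   (forall j r, 0 <= r < 1 -> pmean p r (k j) <= C1) ->
   (forall j r, (j < J)%nat -> 0 <= r < 1 -> pmean (p / 2) r (fun z => (k j z * k J z)%C) <= ee J) ->
   forall (alpha : nat -> C) (Bp r : R), 0 <= r < 1 -> (forall j, rpow (Cmod (alpha j)) p <= Bp) ->
   Rabs (pmean p r (lincomb alpha k (S J)) - pmean p r (lincomb alpha k J)
         - rpow (Cmod (alpha J)) p * pmean p r (k J)) <= kap / 2 ^ S J * Bp) in Hee.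
  assert (H2 : forall j, 0 < (/ 2) ^ j <= 1).
  { intros j. split; [apply pow_lt; lra|]. rewrite <- (pow1 j). apply pow_incr; lra. }
  (* The product condition is imposed for all [n <= k]; since the selected indices increase, this
     covers all those chosen before. *)
  destruct (subsequence_choice (fun j k m => (N0 <= m)%nat /\
     (forall n, (n <= k)%nat -> forall r, 0 <= r < 1 -> pmean (p / 2) r (fun z => (h n z * h m z)%C) <= ee j) /\
     forall z, Cmod z <= 1 - (/ 2) ^ j -> Cmod (h m z) <= (/ 2) ^ j)) as (nj & Hinc & P0 & PS).
  { intros j k.
    destruct (uniform_in_first (fun n m => forall r, 0 <= r < 1 -> pmean (p / 2) r (fun z => (h n z * h m z)%C) <= ee j)) with (k := k) as [M1 HM1].
    { intros n. exact (Hx n (ee j) (proj1 (Hee j))). }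
    destruct (Hu (1 - (/ 2) ^ j) ltac:(specialize (H2 j); lra) ((/ 2) ^ j) ltac:(apply H2)) as [M2 HM2].
    exists (max N0 (max M1 M2)). intros m Hm. split; [lia|split].
    - intros n Hn. apply HM1; auto; lia.
    - intros z Hz. left. apply HM2; auto; lia. }
  exists nj. split; [auto|].
  assert (Hmono : forall i j, (i <= j)%nat -> (nj i <= nj j)%nat).
  { intros i j Hij. induction Hij; auto. specialize (Hinc m). lia. }
  split; [|split].
  - intros [|j]; [apply P0|apply PS].
  - apply almost_disjoint_intro; [auto|lra|]. intros J.
    apply (proj2 (Hee J) (fun j => h (nj j))); auto.
    intros j r Hj Hr. destruct J as [|J]; [lia|]. apply (PS J); auto. apply Hmono; lia.
  - intros [|j]; [apply P0|apply PS].
Qed.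

(** * Summation *)

Definition uoc_lim (S : nat -> C -> C) (F : C -> C) : Prop :=
  forall r, 0 <= r < 1 -> forall eps, 0 < eps -> exists N, forall n, (N <= n)%nat ->
    forall z, Cmod z <= r -> Cmod (S n z - F z) <= eps.

Lemma uoc_lim_ccont (S : nat -> C -> C) (F : C -> C) (z : C) : (forall n, adisc 1 (S n)) ->
  uoc_lim S F -> Cmod z < 1 -> ccont F z.
Proof.
  intros HS HL Hz eps He. pose proof (Cmod_ge_0 z).
  set (r := (1 + Cmod z) / 2).
  destruct (HL r ltac:(unfold r; lra) (eps / 4) ltac:(lra)) as [N HN].
  specialize (HN N (le_n N)).
  destruct (adisc_ccont 1 (S N) z (HS N) Hz (eps / 4)) as [d [Hd Hc]]; [lra|].
  exists (Rmin d ((1 - Cmod z) / 2)). split; [apply Rmin_pos; lra|]. intros w Hw.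
  pose proof (Rmin_l d ((1 - Cmod z) / 2)); pose proof (Rmin_r d ((1 - Cmod z) / 2)).
  specialize (Hc w ltac:(lra)).
  pose proof (Cmod_triangle_sub w z).
  pose proof (HN w ltac:(unfold r; lra)) as N1. pose proof (HN z ltac:(unfold r; lra)) as N2.
  rewrite Cmod_minus_sym in N1.
  replace (F w - F z)%C with ((F w - S N w) + (S N w - S N z) + (S N z - F z))%C by ring.
  pose proof (Cmod_triangle3 (F w - S N w) (S N w - S N z) (S N z - F z)). lra.
Qed.

(** Weierstrass' theorem: Cauchy's formula passes to the uniform limit on a circle, and a
    Cauchy-type integral of a continuous density is analytic. *)
Lemma adisc_limit (S : nat -> C -> C) (F : C -> C) : (forall n, adisc 1 (S n)) ->
  uoc_lim S F -> adisc 1 F.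
Proof.
  intros HS HL z Hz. pose proof (Cmod_ge_0 z). pose proof PI_RGT_0.
  set (r := (1 + Cmod z) / 2). assert (Hr : Cmod z < r < 1) by (unfold r; lra).
  assert (Hin : forall t, Cmod (cpt r t) = r) by (intros; rewrite Cmod_cpt; lra).
  assert (CF : forall t, ccurve (fun t => F (cpt r t)) t).
  { intros t. apply ccurve_comp; [|apply ccurve_cpt]. apply (uoc_lim_ccont S); auto. rewrite Hin; lra. }
  assert (CS : forall n t, ccurve (fun t => S n (cpt r t)) t).
  { intros n t. apply ccurve_comp; [|apply ccurve_cpt]. eapply adisc_ccont; [apply HS|]. rewrite Hin; lra. }
  assert (E : forall w, Cmod w < r ->
     CI (fun t => (F (cpt r t) * (cpt r t / (cpt r t - w)))%C) 0 (2 * PI) = (2 * PI * F w)%C).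
  { intros w Hw. pose proof (Cmod_ge_0 w).
    assert (CK1 : forall t, ccurve (fun t => (cpt r t / (cpt r t - w))%C) t).
    { intros t. apply ccurve_mult; [apply ccurve_cpt|apply ccurve_kernel; lra]. }
    assert (Bk : forall t, Cmod (cpt r t / (cpt r t - w)) <= r / (r - Cmod w)).
    { intros t. rewrite Cmod_div by (apply cpt_neq; lra). rewrite Hin.
      apply Rmult_le_compat_l; [lra|]. apply Rinv_le_contravar; [lra|].
      pose proof (Cmod_triangle_sub (cpt r t) w) as T. rewrite Hin in T. lra. }
    set (b := r / (r - Cmod w)) in *. assert (Hb : 0 < b) by (apply Rdiv_lt_0_compat; lra).
    match goal with |- ?A = ?B => set (a1 := A); set (a2 := B);
      assert (Z : Cmod (a1 - a2) = 0) end.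
    { apply Rle_antisym; [|apply Cmod_ge_0]. apply Rle_plus_epsilon. intros eps He.
      set (e := eps / (2 * (2 * b * (2 * PI) + 2 * PI))).
      assert (Hbp : 0 < b * PI) by (apply Rmult_lt_0_compat; lra).
      assert (He' : 0 < e) by (apply Rdiv_lt_0_compat; lra).
      destruct (HL r ltac:(lra) e He') as [N HN]. specialize (HN N (le_n N)).
      pose proof (cauchy_formula 1 r (S N) w (HS N) Hw ltac:(lra)) as K.
      replace (a1 - a2)%C with
        ((a1 - CI (fun t => (S N (cpt r t) * (cpt r t / (cpt r t - w)))%C) 0 (2 * PI)) + 2 * PI * (S N w - F w))%C
        by (rewrite K; unfold a2; ring).
      eapply Rle_trans; [apply Cmod_triangle|].
      assert (M1 : Cmod (2 * PI * (S N w - F w)) <= 2 * PI * e).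
      { rewrite <- RtoC_mult, Cmod_mult, Cmod_R, Rabs_pos_eq by lra.
        apply Rmult_le_compat_l; [lra|]. apply HN; lra. }
      assert (M2 : Cmod (a1 - CI (fun t => (S N (cpt r t) * (cpt r t / (cpt r t - w)))%C) 0 (2 * PI)) <= 2 * (e * b) * Rabs (2 * PI - 0)).
      { unfold a1. rewrite <- CI_minus by (apply ex_CI_curve; intros t _; apply ccurve_mult; auto).
        apply CI_bound; [apply ex_CI_minus; apply ex_CI_curve; intros t _; apply ccurve_mult; auto|].
        intros t _.
        replace (F (cpt r t) * (cpt r t / (cpt r t - w)) - S N (cpt r t) * (cpt r t / (cpt r t - w)))%C with
          (- (S N (cpt r t) - F (cpt r t)) * (cpt r t / (cpt r t - w)))%C by (unfold Cdiv; ring).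
        rewrite Cmod_mult, Cmod_opp. apply Rmult_le_compat; auto using Cmod_ge_0.
        apply HN. rewrite Hin; lra. }
      rewrite Rminus_0_r, Rabs_pos_eq in M2 by lra.
      assert (e * (2 * (2 * b * (2 * PI) + 2 * PI)) = eps) by (unfold e; field; lra). nra. }
    apply Cmod_eq_0 in Z. replace a1 with ((a1 - a2) + a2)%C by ring. rewrite Z; ring. }
  set (psi := fun t => (F (cpt r t) * cpt r t)%C).
  assert (Cp : forall t, ccurve psi t) by (intros; apply ccurve_mult; auto; apply ccurve_cpt).
  eexists. apply (cdiff_disc_ext (fun w => (/ (2 * PI) * CK r psi 1 w)%C) _ _ _ r); [lra| |].
  2:{ apply cdiff_scal. exact (proj1 (CK_cdiff r psi z (proj1 Hr) Cp)). }
  intros w Hw. replace (CK r psi 1 w) with (2 * PI * F w)%C.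
  rewrite <- RtoC_mult. field. apply C_2PI_neq.
  rewrite <- (E w Hw). apply CI_ext. intros t _. unfold psi, Cdiv. simpl; ring.
Qed.

Lemma adisc_minus (rho : R) (F G : C -> C) : adisc rho F -> adisc rho G ->
  adisc rho (fun z => (F z - G z)%C).
Proof.
  intros HF HG. apply (adisc_ext _ (fun z => (F z + - (1) * G z)%C)). intros; ring.
  apply adisc_plus; auto. apply adisc_scal; auto.
Qed.

(** Write [S n = F + G] with [G] uniformly small on the circle. In [circ_pow_ineq] the term
    [eta |F|^p] is made small by [eta], and the remaining terms by the size of [G]. *)
Lemma pmean_limit (p r eps : R) (S : nat -> C -> C) (F : C -> C) : 0 < p -> 0 <= r < 1 -> 0 < eps ->
  (forall n, adisc 1 (S n)) -> uoc_lim S F ->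
  exists N, forall n, (N <= n)%nat -> Rabs (pmean p r (S n) - pmean p r F) <= eps.
Proof.
  intros Hp Hr He HS HL. pose proof (adisc_limit S F HS HL) as HF. pose proof PI_RGT_0.
  set (X := pmean p r F). assert (HX : 0 <= X) by (apply pmean_ge0; auto).
  set (eta := Rmin 1 (eps / (4 * (X + 1)))).
  assert (Heta : 0 < eta) by (apply Rmin_pos; [lra|apply Rdiv_lt_0_compat; lra]).
  assert (Heta1 : eta <= 1) by apply Rmin_l.
  assert (HetaX : eta * X <= eps / 4).
  { apply Rle_trans with (eps / (4 * (X + 1)) * (X + 1)).
    apply Rmult_le_compat; try lra. apply Rmin_r. right; field; lra. }
  destruct (circ_pow_ineq p eta Hp Heta) as [K [HK0 HK]].
  destruct (adisc_bounded 1 r F HF Hr) as [M [HM0 HM]].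
  assert (P1 : 0 < eps / (8 * (2 * PI))) by (apply Rdiv_lt_0_compat; lra).
  assert (P2 : 0 < eps / (4 * (2 * PI) * (K + 1))) by (apply Rdiv_lt_0_compat; [lra|apply Rmult_lt_0_compat; lra]).
  pose proof (rpow_pos _ (/ p) P1) as Q1. pose proof (rpow_pos _ (/ (p / 2)) P2) as Q2.
  set (s2 := rpow (eps / (4 * (2 * PI) * (K + 1))) (/ (p / 2)) / (M + 1)).
  set (s := Rmin (rpow (eps / (8 * (2 * PI))) (/ p)) s2).
  assert (Hs2 : 0 < s2) by (apply Rdiv_lt_0_compat; lra).
  assert (Hs : 0 < s) by (apply Rmin_pos; auto).
  assert (S1 : rpow s p <= eps / (8 * (2 * PI))).
  { rewrite <- (rpow_inv_q (eps / (8 * (2 * PI))) p) by lra. apply rpow_mono; auto.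
    split; [lra|apply Rmin_l]. }
  assert (S2 : rpow (M * s) (p / 2) <= eps / (4 * (2 * PI) * (K + 1))).
  { rewrite <- (rpow_inv_q (eps / (4 * (2 * PI) * (K + 1))) (p / 2)) by lra.
    apply rpow_mono; [lra|]. split; [apply Rmult_le_pos; lra|].
    apply Rle_trans with ((M + 1) * s2).
    apply Rmult_le_compat; try lra. apply Rmin_r. right; unfold s2; field; lra. }
  destruct (HL r Hr s Hs) as [N HN]. exists N. intros n Hn. specialize (HN n Hn).
  set (G := fun z => (S n z - F z)%C).
  assert (HG : adisc 1 G) by (apply adisc_minus; auto).
  pose proof (HK F G r HF HG Hr) as Q.
  rewrite (circ_ext (fun z => rpow (Cmod (F z + G z)) p) (fun z => rpow (Cmod (S n z)) p)) in Q
    by (intros z; do 2 f_equal; unfold G; ring).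
  fold (pmean p r F) (pmean p r G) (pmean p r (S n)) in Q. fold X in Q. fold X.
  assert (G1 : pmean p r G <= eps / 8).
  { eapply Rle_trans; [apply (circ_small G p r s); auto; lra|].
    apply Rle_trans with (2 * PI * (eps / (8 * (2 * PI)))). apply Rmult_le_compat_l; lra. right; field; lra. }
  assert (G0 : 0 <= pmean p r G) by (apply pmean_ge0; auto).
  assert (G2 : circ (fun z => rpow (Cmod (F z * G z)) (p / 2)) r <= 2 * PI * (eps / (4 * (2 * PI) * (K + 1)))).
  { eapply Rle_trans; [apply (circ_small (fun z => (F z * G z)%C) (p / 2) r (M * s)); auto; [lra|apply adisc_mult; auto|apply Rmult_le_pos; lra|]|].
    intros z Hz. rewrite Cmod_mult.
    apply Rmult_le_compat; [apply Cmod_ge_0|apply Cmod_ge_0|apply HM; auto|apply HN; auto].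
    apply Rmult_le_compat_l; [lra|exact S2]. }
  assert (G3 : K * circ (fun z => rpow (Cmod (F z * G z)) (p / 2)) r <= eps / 4).
  { set (y := 2 * PI * (eps / (4 * (2 * PI) * (K + 1)))) in *.
    assert (Y0 : 0 <= y) by (apply Rmult_le_pos; lra).
    assert (Y1 : (K + 1) * y = eps / 4) by (unfold y; field; lra).
    assert (K * circ (fun z => rpow (Cmod (F z * G z)) (p / 2)) r <= K * y) by (apply Rmult_le_compat_l; auto).
    lra. }
  assert (eta * pmean p r G <= 1 * pmean p r G) by (apply Rmult_le_compat_r; lra).
  apply Rabs_le_between in Q. apply Rabs_le. lra.
Qed.

Lemma geometric_limit (u : nat -> R) (J : nat) (c : R) : 0 <= c ->
  (forall n, (J <= n)%nat -> Rabs (u (S n) - u n) <= c * (/ 2) ^ n) ->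
  exists X, forall n, (J <= n)%nat -> Rabs (u n - X) <= 2 * c * (/ 2) ^ n.
Proof.
  intros Hc H.
  (* The interval around [u n] has as half-length [2 c / 2^n], the sum of all later increments. *)
  destruct (nested_intervals (fun n => u (J + n)%nat - 2 * c * (/ 2) ^ (J + n)) (fun n => 4 * c * (/ 2) ^ (J + n))) as [X HX].
  - intros n. apply Rmult_le_pos; [lra|]. apply pow_le; lra.
  - intros n. specialize (H (J + n)%nat ltac:(lia)). rewrite Nat.add_succ_r.
    apply Rabs_le_between in H. simpl. lra.
  - exists X. intros n Hn. specialize (HX (n - J)%nat).
    replace (J + (n - J))%nat with n in HX by lia. apply Rabs_le. lra.
Qed.

Lemma half_pow_small (c eps : R) : 0 <= c -> 0 < eps -> exists N, forall n, (N <= n)%nat -> c * (/ 2) ^ n <= eps.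
Proof.
  intros Hc He. destruct (pow_lt_1_zero (/ 2)) with (y := eps / (c + 1)) as [N HN].
  rewrite Rabs_pos_eq; lra. apply Rdiv_lt_0_compat; lra.
  exists N. intros n Hn. specialize (HN n Hn). rewrite Rabs_pos_eq in HN by (apply pow_le; lra).
  apply Rle_trans with ((c + 1) * (/ 2) ^ n).
  apply Rmult_le_compat_r; [apply pow_le; lra|lra].
  apply Rle_trans with ((c + 1) * (eps / (c + 1))). apply Rmult_le_compat_l; lra. right; field; lra.
Qed.

(** At a point [z] the geometric bound holds only from an index [J] with [|z| <= 1 - 2^(-J)]. The
    limit is therefore defined by [Q] with some [J], and [Uq] shows that the choice of [J] does not
    affect it. The factor 4 combines two coordinates with the 2 of [geometric_limit]. *)
Lemma lincomb_converges (alpha : nat -> C) (k : nat -> C -> C) (b : R) : 0 <= b ->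
  (forall j, Cmod (alpha j) <= b) ->
  (forall j z, Cmod z <= 1 - (/ 2) ^ j -> Cmod (k j z) <= (/ 2) ^ j) ->
  exists F, uoc_lim (lincomb alpha k) F.
Proof.
  intros Hb Ha Hk.
  set (Q := fun z J w => forall n, (J <= n)%nat -> Cmod (lincomb alpha k n z - w) <= 4 * b * (/ 2) ^ n).
  assert (Ex : forall z J, Cmod z <= 1 - (/ 2) ^ J -> exists w, Q z J w).
  { intros z J Hz.
    assert (D : forall n, (J <= n)%nat -> Cmod (lincomb alpha k (S n) z - lincomb alpha k n z) <= b * (/ 2) ^ n).
    { intros n Hn. replace (lincomb alpha k (S n) z - lincomb alpha k n z)%C with (alpha n * k n z)%C by (simpl; ring).
      rewrite Cmod_mult. apply Rmult_le_compat; auto using Cmod_ge_0. apply Hk.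
      assert ((/ 2) ^ n <= (/ 2) ^ J); [|lra].
      rewrite !pow_inv. apply Rinv_le_contravar; [apply pow_lt; lra|]. apply Rle_pow; [lra|auto]. }
    destruct (geometric_limit (fun n => fst (lincomb alpha k n z)) J b Hb) as [X HX].
    { intros n Hn. eapply Rle_trans; [|apply (D n Hn)]. apply (Cmod_fst (lincomb alpha k (S n) z - lincomb alpha k n z)). }
    destruct (geometric_limit (fun n => snd (lincomb alpha k n z)) J b Hb) as [Y HY].
    { intros n Hn. eapply Rle_trans; [|apply (D n Hn)]. apply (Cmod_snd (lincomb alpha k (S n) z - lincomb alpha k n z)). }
    exists (X, Y). intros n Hn. specialize (HX n Hn). specialize (HY n Hn).
    eapply Rle_trans; [apply Cmod_le_parts|].
    change (Rabs (fst (lincomb alpha k n z) - X) + Rabs (snd (lincomb alpha k n z) - Y) <= 4 * b * (/ 2) ^ n). lra. }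
  assert (Uq : forall z J J' w w', Q z J w -> Q z J' w' -> w = w').
  { intros z J J' w w' H1 H2. assert (Z : Cmod (w - w') = 0).
    { apply Rle_antisym; [|apply Cmod_ge_0]. apply Rle_plus_epsilon. intros eps He.
      destruct (half_pow_small (8 * b) eps ltac:(lra) He) as [N HN].
      set (n := max N (max J J')). specialize (HN n ltac:(lia)).
      specialize (H1 n ltac:(lia)). specialize (H2 n ltac:(lia)). rewrite Cmod_minus_sym in H1.
      replace (w - w')%C with ((w - lincomb alpha k n z) + (lincomb alpha k n z - w'))%C by ring.
      eapply Rle_trans; [apply Cmod_triangle|]. lra. }
    apply Cmod_eq_0 in Z. replace w with ((w - w') + w')%C by ring. rewrite Z; ring. }
  exists (fun z => epsilon (inhabits (RtoC 0)) (fun w => exists J, Q z J w)).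
  intros r Hr eps He.
  destruct (half_pow_small 1 (1 - r)) as [J HJ]; [lra|lra|].
  destruct (half_pow_small (4 * b) eps ltac:(lra) He) as [N HN].
  exists (max N J). intros n Hn z Hz.
  specialize (HJ J (le_n J)).
  destruct (Ex z J ltac:(lra)) as [w Hw].
  assert (E : exists w J, Q z J w) by (exists w, J; auto).
  pose proof (epsilon_spec (inhabits (RtoC 0)) _ E) as [J' HJ'].
  rewrite (Uq z J' J _ w HJ' Hw).
  eapply Rle_trans; [apply Hw; lia|]. apply HN; lia.
Qed.

Lemma rsum_partial (f : nat -> R) (N M : nat) : (forall j, 0 <= f j) -> (N <= M)%nat -> rsum f N <= rsum f M.
Proof. intros Hf H. induction H; [lra|]. simpl. specialize (Hf m). lra. Qed.

(** [sum_f_R0] includes its last index, [rsum] stops before it. *)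
Lemma rsum_sum_f_R0 (f : nat -> R) (n : nat) : sum_f_R0 f n = rsum f (S n).
Proof. induction n; simpl; [ring|]. rewrite IHn; simpl; ring. Qed.

Lemma infinite_sum_rsum (f : nat -> R) (A : R) : (forall j, 0 <= f j) -> infinite_sum f A ->
  (forall N, rsum f N <= A) /\ forall eps, 0 < eps -> exists N, forall n, (N <= n)%nat -> A - rsum f n < eps.
Proof.
  intros Hf H.
  assert (T : forall eps, 0 < eps -> exists N, forall n, (N <= n)%nat -> Rabs (rsum f n - A) < eps).
  { intros eps He. destruct (H eps He) as [N HN]. exists (S N). intros [|n] Hn; [lia|].
    rewrite <- rsum_sum_f_R0. apply HN; lia. }
  split.
  - intros N. apply Rle_plus_epsilon. intros eps He. destruct (T eps He) as [M HM].
    specialize (HM (max N M) ltac:(lia)). apply Rabs_def2 in HM.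
    pose proof (rsum_partial f N (max N M) Hf ltac:(lia)). lra.
  - intros eps He. destruct (T eps He) as [M HM]. exists M. intros n Hn.
    specialize (HM n Hn). apply Rabs_def2 in HM. lra.
Qed.

(** Tails are written as combinations with the first [N] coefficients set to 0, so that
    [almost_disjoint] applies to them without reindexing the functions. *)
Lemma lincomb_tail (alpha : nat -> C) (k : nat -> C -> C) (N M : nat) (z : C) : (N <= M)%nat ->
  lincomb (fun j => if Nat.ltb j N then RtoC 0 else alpha j) k M z =
  (lincomb alpha k M z - lincomb alpha k N z)%C.
Proof.
  intros H. induction H.
  - assert (Z : forall i, (i <= N)%nat -> lincomb (fun j => if Nat.ltb j N then RtoC 0 else alpha j) k i z = 0%C).
    { induction i; intros Hi; [auto|]. simpl. rewrite IHi by lia.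
      rewrite (proj2 (Nat.ltb_lt i N)) by lia. ring. }
    rewrite Z by auto. ring.
  - simpl. rewrite IHle. rewrite (proj2 (Nat.ltb_ge m N)) by lia. ring.
Qed.

Lemma rsum_tail (f : nat -> R) (N M : nat) : (N <= M)%nat ->
  rsum (fun j => if Nat.ltb j N then 0 else f j) M = rsum f M - rsum f N.
Proof.
  intros H. induction H.
  - assert (Z : forall i, (i <= N)%nat -> rsum (fun j => if Nat.ltb j N then 0 else f j) i = 0).
    { induction i; intros Hi; [auto|]. simpl. rewrite IHi by lia.
      rewrite (proj2 (Nat.ltb_lt i N)) by lia. ring. }
    rewrite Z by auto. ring.
  - simpl. rewrite IHle. rewrite (proj2 (Nat.ltb_ge m N)) by lia. ring.
Qed.

Lemma common_radius (p d0 : R) (k : nat -> C -> C) (N : nat) : 0 < p -> (forall j, adisc 1 (k j)) ->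
  (forall j, exists r, 0 <= r < 1 /\ d0 <= pmean p r (k j)) ->
  exists r, 0 <= r < 1 /\ forall j, (j < N)%nat -> d0 <= pmean p r (k j).
Proof.
  intros Hp Hk H. induction N.
  - exists 0. split; [lra|]. intros; lia.
  - destruct IHN as (r1 & H1 & K1). destruct (H N) as (r2 & H2 & K2).
    pose proof (Rmax_l r1 r2); pose proof (Rmax_r r1 r2).
    assert (Rmax r1 r2 < 1) by (apply Rmax_lub_lt; lra).
    exists (Rmax r1 r2). split; [lra|]. intros j Hj.
    destruct (Nat.eq_dec j N) as [->|Hne].
    + eapply Rle_trans; [exact K2|]. apply mean_mono; auto; lra.
    + eapply Rle_trans; [apply (K1 j); lia|]. apply mean_mono; auto; lra.
Qed.

(** The tail estimate serves twice: [N = 0] bounds [F] itself, large [N] gives convergence in norm.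
    The lower estimate holds only up to [eps], since just finitely many terms can be brought to mean
    at least [d0] on a common circle. *)
Lemma lp_sum (p C1 kap d0 : R) (k : nat -> C -> C) : 0 < p -> 0 <= C1 -> 0 < kap -> 0 <= d0 ->
  (forall j, adisc 1 (k j)) -> (forall j r, 0 <= r < 1 -> pmean p r (k j) <= C1) ->
  (forall j, exists r, 0 <= r < 1 /\ d0 <= pmean p r (k j)) ->
  almost_disjoint p kap k ->
  (forall j z, Cmod z <= 1 - (/ 2) ^ j -> Cmod (k j z) <= (/ 2) ^ j) ->
  forall (alpha : nat -> C) (A : R), infinite_sum (fun j => rpow (Cmod (alpha j)) p) A ->
  exists F, adisc 1 F /\
   (forall N r, 0 <= r < 1 -> pmean p r (fun z => (F z - lincomb alpha k N z)%C) <=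
      (C1 + kap) * (A - rsum (fun j => rpow (Cmod (alpha j)) p) N)) /\
   (forall eps, 0 < eps -> exists r, 0 <= r < 1 /\ (d0 - kap) * A - eps <= pmean p r F).
Proof.
  intros Hp HC1 Hkap Hd0 Hk HC Hd HAD Hsm alpha A HA.
  set (a := fun j => rpow (Cmod (alpha j)) p) in *.
  assert (Ha0 : forall j, 0 <= a j) by (intros; apply rpow_ge0).
  destruct (infinite_sum_rsum a A Ha0 HA) as [HA1 HA2].
  assert (HA0 : 0 <= A) by (apply (Rle_trans _ (rsum a 0)); [simpl; lra|apply HA1]).
  assert (Hterm : forall N j, (N <= j)%nat -> a j <= A - rsum a N).
  { intros N j Hj. pose proof (HA1 (S j)) as T. simpl in T. pose proof (rsum_partial a N j Ha0 Hj). lra. }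
  set (b := rpow A (/ p)).
  assert (Hb : forall j, Cmod (alpha j) <= b).
  { intros j. unfold b. replace (Cmod (alpha j)) with (rpow (a j) (/ p)).
    - apply rpow_mono; [apply Rinv_0_lt_compat; auto|]. split; auto.
      pose proof (Hterm O j ltac:(lia)) as T. simpl in T. lra.
    - unfold a. rewrite rpow_rpow, Rinv_r, rpow_1; auto using Cmod_ge_0; lra. }
  destruct (lincomb_converges alpha k b (rpow_ge0 _ _) Hb Hsm) as [F HF].
  assert (AS : forall N, adisc 1 (lincomb alpha k N)) by (intros; apply adisc_lincomb; auto).
  assert (AF : adisc 1 F) by (apply (adisc_limit (lincomb alpha k)); auto).
  exists F. split; auto. split.
  - intros N r Hr. set (tail := A - rsum a N).
    assert (Htail : 0 <= tail) by (unfold tail; specialize (HA1 N); lra).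
    set (al := fun j => if Nat.ltb j N then RtoC 0 else alpha j).
    assert (Hal : forall j, rpow (Cmod (al j)) p = if Nat.ltb j N then 0 else a j).
    { intros j. unfold al. destruct (Nat.ltb j N); auto. rewrite Cmod_0; apply rpow_0. }
    assert (Hal2 : forall j, rpow (Cmod (al j)) p <= tail).
    { intros j. rewrite Hal. destruct (Nat.ltb j N) eqn:E; auto. apply Hterm. apply Nat.ltb_ge; auto. }
    apply Rle_plus_epsilon. intros eps He.
    set (T := fun M z => (lincomb alpha k (M + N)%nat z - lincomb alpha k N z)%C).
    assert (HT : uoc_lim T (fun z => (F z - lincomb alpha k N z)%C)).
    { intros s Hs e He'. destruct (HF s Hs e He') as [N1 HN1]. exists N1. intros n Hn z Hz.
      unfold T. replace (lincomb alpha k (n + N) z - lincomb alpha k N z - (F z - lincomb alpha k N z))%C with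
       (lincomb alpha k (n + N) z - F z)%C by ring. apply HN1; auto; lia. }
    assert (AT : forall n, adisc 1 (T n)) by (intros; apply adisc_minus; auto).
    destruct (pmean_limit p r eps T _ Hp Hr He AT HT) as [M HM].
    specialize (HM M (le_n M)). apply Rabs_le_between in HM.
    assert (E : pmean p r (T M) = pmean p r (lincomb al k (M + N))).
    { apply pmean_ext. intros z. unfold T, al. rewrite lincomb_tail by lia. auto. }
    pose proof (HAD al tail r (M + N)%nat Hr Hal2) as Q. apply Rabs_le_between in Q.
    assert (S1 : rsum (fun j => rpow (Cmod (al j)) p * pmean p r (k j)) (M + N) <= C1 * tail).
    { apply Rle_trans with (rsum (fun j => C1 * (if Nat.ltb j N then 0 else a j)) (M + N)).
      - apply rsum_le. intros j _. rewrite Hal, Rmult_comm. apply Rmult_le_compat_r; auto.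
        destruct (Nat.ltb j N); [lra|auto].
      - rewrite rsum_scal, rsum_tail by lia. apply Rmult_le_compat_l; auto.
        unfold tail. specialize (HA1 (M + N)%nat). lra. }
    lra.
  - intros eps He.
    destruct (HA2 (eps / (2 * (d0 + 1)))) as [N HN]; [apply Rdiv_lt_0_compat; lra|].
    specialize (HN N (le_n N)).
    (* The first [N] coefficients carry almost all of [A]; the terms after them contribute
       nonnegatively to the sum and are dropped. *)
    destruct (common_radius p d0 k N Hp Hk Hd) as (r & Hr & Hrj). exists r. split; auto.
    destruct (pmean_limit p r (eps / 2) (lincomb alpha k) F Hp Hr ltac:(lra) AS HF) as [M HM].
    specialize (HM (max M N) ltac:(lia)). apply Rabs_le_between in HM.
    assert (HB : forall j, rpow (Cmod (alpha j)) p <= A).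
    { intros j. pose proof (Hterm O j ltac:(lia)) as T. simpl in T. unfold a in T. lra. }
    pose proof (HAD alpha A r (max M N) Hr HB) as Q. apply Rabs_le_between in Q.
    assert (S1 : rsum (fun j => rpow (Cmod (alpha j)) p * pmean p r (k j)) N <=
      rsum (fun j => rpow (Cmod (alpha j)) p * pmean p r (k j)) (max M N)).
    { apply rsum_partial; [|lia]. intros j. apply Rmult_le_pos; [apply rpow_ge0|apply pmean_ge0; auto]. }
    assert (S2 : d0 * rsum a N <= rsum (fun j => rpow (Cmod (alpha j)) p * pmean p r (k j)) N).
    { rewrite <- rsum_scal. apply rsum_le. intros j Hj. rewrite (Rmult_comm d0).
      apply Rmult_le_compat_l; [apply Ha0|apply Hrj; auto]. }
    assert (S3 : d0 * (A - rsum a N) <= eps / 2).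
    { apply Rle_trans with ((d0 + 1) * (eps / (2 * (d0 + 1)))).
      apply Rmult_le_compat; try lra. specialize (HA1 N); lra. right; field; lra. }
    lra.
Qed.

(** * Hardy norms, BMOA and the Volterra operator *)

(** The increment form avoids division and, its inequality being non-strict, includes the point [z];
    this keeps products and compositions free of case distinctions. *)
Lemma has_cderiv_cdiff (f : C -> C) (z l : C) : Defs.has_cderiv f z l <-> cdiff f z l.
Proof.
  assert (E : forall h : C, h <> 0 -> Cmod (f (z + h)%C - f z - l * h) = Cmod ((f (z + h)%C - f z) / h - l) * Cmod h).
  { intros h Hh. rewrite <- Cmod_mult. f_equal. field; auto. }
  split.
  - intros H eps He. destruct (H eps He) as [d [Hd K]]. exists d; split; auto. intros w Hw.
    assert (Ew : w = (z + (w - z))%C) by ring.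
    destruct (Req_dec (Cmod (w - z)) 0) as [H0|H0].
    + apply Cmod_eq_0 in H0. rewrite Ew, H0.
      replace (f (z + 0)%C) with (f z) by (f_equal; ring).
      replace (z + 0 - z)%C with (RtoC 0) by ring.
      replace (f z - f z - l * 0)%C with (RtoC 0) by ring. rewrite Cmod_0; lra.
    + assert (Hn : (w - z)%C <> 0) by (intros E0; apply H0; rewrite E0; apply Cmod_0).
      rewrite Ew at 1. rewrite E by auto. apply Rmult_le_compat_r; [apply Cmod_ge_0|].
      left. exact (K (w - z)%C Hn Hw).
  - intros H eps He. destruct (H (eps / 2)) as [d [Hd K]]; [lra|]. exists d; split; auto.
    intros h0 Hh Hhd. set (h := h0 : C). change (h <> RtoC 0) in Hh. change (Cmod h < d) in Hhd.
    change (Cmod ((f (z + h)%C - f z) / h - l)%C < eps).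
    specialize (K (z + h)%C). replace (z + h - z)%C with h in K by ring. specialize (K Hhd).
    rewrite E in K by auto. pose proof (Cmod_pos h Hh).
    apply Rle_lt_trans with (eps / 2); [|lra].
    apply Rmult_le_reg_r with (Cmod h); auto.
Qed.

Lemma analytic_adisc (f : C -> C) : Defs.analytic f <-> adisc 1 f.
Proof.
  split; intros H z Hz; destruct (H z Hz) as [l Hl]; exists l; apply has_cderiv_cdiff; auto.
Qed.

Lemma cderiv_eq (f : C -> C) (z l : C) : cdiff f z l -> Defs.cderiv f z = l.
Proof.
  intros H. apply (cdiff_unique f z); auto. apply has_cderiv_cdiff.
  apply (epsilon_spec (inhabits Defs.C0) (fun l => Defs.has_cderiv f z l)).
  exists l. apply has_cderiv_cdiff, H.
Qed.

Lemma Defs_RInt (F : R -> R) (a b : R) : ex_RInt F a b -> Defs.RInt a b F = RInt F a b.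
Proof.
  intros H. set (pr := ex_RInt_Reals_0 _ _ _ H).
  assert (E : exists l, exists pr : Riemann_integrable F a b, RiemannInt pr = l) by (eexists; exists pr; reflexivity).
  pose proof (epsilon_spec (inhabits 0) _ E) as [pr' E'].
  unfold Defs.RInt. rewrite <- E'. symmetry. apply RInt_Reals.
Qed.

Lemma Mp_pmean (p r : R) (F : C -> C) : 0 < p -> adisc 1 F -> 0 <= r < 1 ->
  Defs.Mp p F r = rpow (/ (2 * PI) * pmean p r F) (/ p).
Proof.
  intros Hp HF Hr. unfold Defs.Mp. f_equal. f_equal. apply Defs_RInt. apply (excirc_rpow p r F); auto.
Qed.

Lemma Mp_ge0 (p r : R) (F : C -> C) : 0 <= Defs.Mp p F r.
Proof. apply rpow_ge0. Qed.

Lemma pmean_le_of_Mp (p r B : R) (F : C -> C) : 0 < p -> adisc 1 F -> 0 <= r < 1 -> 0 <= B ->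
  Defs.Mp p F r <= B -> pmean p r F <= 2 * PI * rpow B p.
Proof.
  intros Hp HF Hr HB H. pose proof PI_RGT_0. rewrite Mp_pmean in H by auto.
  pose proof (pmean_ge0 p r F Hp HF Hr).
  assert (Hx : 0 <= / (2 * PI) * pmean p r F) by (apply Rmult_le_pos; [left; apply Rinv_0_lt_compat; lra|auto]).
  assert (E : rpow (rpow (/ (2 * PI) * pmean p r F) (/ p)) p <= rpow B p).
  { apply rpow_mono; auto. split; [apply rpow_ge0|auto]. }
  rewrite rpow_inv_q in E by auto.
  apply Rmult_le_reg_l with (/ (2 * PI)); [apply Rinv_0_lt_compat; lra|].
  rewrite <- Rmult_assoc, Rinv_l, Rmult_1_l by lra. auto.
Qed.

Lemma Mp_le_of_pmean (p r B : R) (F : C -> C) : 0 < p -> adisc 1 F -> 0 <= r < 1 -> 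
  pmean p r F <= 2 * PI * B -> Defs.Mp p F r <= rpow B (/ p).
Proof.
  intros Hp HF Hr H. pose proof PI_RGT_0. rewrite Mp_pmean by auto.
  pose proof (pmean_ge0 p r F Hp HF Hr).
  apply rpow_mono; [apply Rinv_0_lt_compat; auto|]. split.
  - apply Rmult_le_pos; [left; apply Rinv_0_lt_compat; lra|auto].
  - apply Rmult_le_reg_l with (2 * PI); [lra|]. rewrite <- Rmult_assoc, Rinv_r, Rmult_1_l by lra. auto.
Qed.

(** The norm is chosen by [epsilon] and is known to be a supremum only when the means are bounded;
    this is why a bound [B] accompanies every lemma about it. *)
Lemma Hp_norm_lub (p B : R) (F : C -> C) : (forall r, 0 <= r < 1 -> Defs.Mp p F r <= B) ->
  is_lub (fun x => exists r, 0 <= r < 1 /\ x = Defs.Mp p F r) (Defs.Hp_norm p F).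
Proof.
  intros H. unfold Defs.Hp_norm. apply epsilon_spec.
  destruct (completeness (fun x => exists r, 0 <= r < 1 /\ x = Defs.Mp p F r)) as [L HL].
  - exists B. intros x (r & Hr & ->); auto.
  - exists (Defs.Mp p F 0), 0. split; [lra|auto].
  - exists L; auto.
Qed.

Lemma Hp_norm_le (p B : R) (F : C -> C) : (forall r, 0 <= r < 1 -> Defs.Mp p F r <= B) ->
  0 <= Defs.Hp_norm p F <= B.
Proof.
  intros H. destruct (Hp_norm_lub p B F H) as [H1 H2]. split.
  - apply Rle_trans with (Defs.Mp p F 0); [apply Mp_ge0|]. apply H1. exists 0; split; [lra|auto].
  - apply H2. intros x (r & Hr & ->); auto.
Qed.

Lemma Mp_le_Hp_norm (p B r : R) (F : C -> C) : (forall r, 0 <= r < 1 -> Defs.Mp p F r <= B) ->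
  0 <= r < 1 -> Defs.Mp p F r <= Defs.Hp_norm p F.
Proof. intros H Hr. apply (Hp_norm_lub p B F H). exists r; auto. Qed.

Lemma Hp_norm_approx (p B e : R) (F : C -> C) : (forall r, 0 <= r < 1 -> Defs.Mp p F r <= B) ->
  e < Defs.Hp_norm p F -> exists r, 0 <= r < 1 /\ e <= Defs.Mp p F r.
Proof.
  intros H He. apply Classical_Prop.NNPP. intros Hn.
  destruct (Hp_norm_lub p B F H) as [_ H2].
  assert (Defs.Hp_norm p F <= e); [|lra]. apply H2. intros x (r & Hr & ->).
  apply Rnot_lt_le. intros Hlt. apply Hn. exists r. split; auto. lra.
Qed.

Lemma Tg_volterra (g f : C -> C) : adisc 1 g -> adisc 1 f -> volterra g f (Defs.Tg g f).
Proof.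
  intros Hg Hf. destruct (analytic_derivative 1 g Hg) as (g' & Ag' & Hg').
  set (q := fun z => (f z * g' z)%C). assert (Aq : adisc 1 q) by (apply adisc_mult; auto).
  destruct (primitive_exists 1 q Aq) as [H HH].
  assert (E : forall z, Cmod z < 1 -> (H z - H 0)%C = Defs.Tg g f z).
  { intros z Hz. pose proof (Cmod_ge_0 z).
    assert (Hin : forall t : R, 0 <= t <= 1 -> Cmod (t * z) < 1).
    { intros t Ht. rewrite Cmod_mult, Cmod_R, Rabs_pos_eq by lra. nra. }
    assert (Rt : forall t, rcd (fun t => (t * z)%C) t z).
    { intros t. eapply rcd_eq; [|apply (rcd_mult RtoC (fun _ => z)); [apply rcd_RtoC|apply rcd_const]].
      cbv beta; ring. }
    assert (Cq : forall t, 0 <= t <= 1 -> ccurve (fun t => (q (t * z)%C * z)%C) t).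
    { intros t Ht. pose proof (Hin t Ht).
      apply (ccurve_comp (fun w => (q w * z)%C) (fun t => (t * z)%C)); [|eapply rcd_ccurve, Rt].
      apply ccont_mult; [|apply ccont_const]. eapply adisc_ccont; eauto. }
    assert (E1 : CI (fun t => (q (t * z)%C * z)%C) 0 1 = (H z - H 0)%C).
    { rewrite (CI_FTC (fun t => H (t * z)%C)).
      - rewrite Cmult_1_l, Cmult_0_l. auto.
      - intros t Ht. rewrite Rmin_left, Rmax_right in Ht by lra. pose proof (Hin t Ht).
        apply (rcd_comp H (fun t => (t * z)%C)); auto.
      - intros t Ht. rewrite Rmin_left, Rmax_right in Ht by lra. auto. }
    rewrite <- E1.
    set (phi := fun t : R => (f (t * z)%C * Defs.cderiv g (t * z)%C * z)%C).
    (* [cderiv g] is known to equal [g'] only inside the disc, so the integrands are compared on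
       [[0, 1]] alone and integrability is transferred on that interval. *)
    assert (Ep : forall t, 0 <= t <= 1 -> phi t = (q (t * z)%C * z)%C).
    { intros t Ht. unfold phi, q. rewrite (cderiv_eq g (t * z)%C (g' (t * z)%C)); auto. }
    assert (Ex : ex_CI (fun t => (q (t * z)%C * z)%C) 0 1).
    { apply ex_CI_curve. intros t Ht. rewrite Rmin_left, Rmax_right in Ht by lra. auto. }
    assert (Ex1 : ex_RInt (fun t => fst (phi t)) 0 1).
    { apply (ex_RInt_ext (fun t => fst (q (t * z)%C * z)%C)); [|exact (proj1 Ex)].
      intros t Ht. rewrite Rmin_left, Rmax_right in Ht by lra. rewrite Ep by lra. auto. }
    assert (Ex2 : ex_RInt (fun t => snd (phi t)) 0 1).
    { apply (ex_RInt_ext (fun t => snd (q (t * z)%C * z)%C)); [|exact (proj2 Ex)].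
      intros t Ht. rewrite Rmin_left, Rmax_right in Ht by lra. rewrite Ep by lra. auto. }
    transitivity (CI phi 0 1).
    { apply CI_ext. intros t Ht. rewrite Rmin_left, Rmax_right in Ht by lra. rewrite Ep by lra. auto. }
    change (CI phi 0 1 = (Defs.RInt 0 1 (fun t => fst (phi t)), Defs.RInt 0 1 (fun t => snd (phi t)))).
    rewrite !Defs_RInt by auto. reflexivity. }
  assert (D : forall z, Cmod z < 1 -> cdiff (Defs.Tg g f) z (q z)).
  { intros z Hz. apply (cdiff_disc_ext (fun w => (H w + - H 0)%C) _ _ _ 1 Hz).
    - intros w Hw. rewrite <- E by auto. reflexivity.
    - eapply cdiff_eq; [|apply cdiff_plus; [apply HH; auto|apply cdiff_const]]. ring. }
  split; [auto|split; [auto|split; [|split]]].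
  - intros z Hz. exists (q z). auto.
  - rewrite <- E by (rewrite Cmod_0; lra). ring.
  - intros z Hz. exists (g' z). split; [auto|apply D; auto].
Qed.

(** The potential comes from all automorphisms; the bound for the square means of [g] comes from
    [a = 0] alone, through [|g|^2 <= 2 |g - g(0)|^2 + 2 |g(0)|^2]. *)
Lemma BMOA_potential (g : C -> C) : Defs.BMOA g -> adisc 1 g /\ exists B, 0 <= B /\
  has_potential g B /\ forall r, 0 <= r < 1 -> circ (fun z => Cmod (g z) ^ 2) r <= 2 * PI * B.
Proof.
  intros (Hg & Hin & B & HB). pose proof (proj1 (analytic_adisc g) Hg) as Ag. split; auto.
  pose proof PI_RGT_0.
  assert (HK : forall a, Cmod a < 1 -> adisc 1 (fun z => (g (moebius a z) - g a)%C) /\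
     forall s, 0 <= s < 1 -> circ (fun z => Cmod (g (moebius a z) - g a) ^ 2) s <= 2 * PI * rpow (Rmax B 0) 2).
  { intros a Ha. destruct (Hin a Ha) as [A1 [B1 HB1]].
    change (Defs.analytic (fun z => (g (moebius a z) - g a)%C)) in A1.
    apply analytic_adisc in A1. split; auto. intros s Hs.
    (* [Rmax B 0] is visibly nonnegative, as required for squaring the bound. *)
    assert (M : Defs.Mp 2 (fun z => (g (moebius a z) - g a)%C) s <= Rmax B 0).
    { apply Rle_trans with B; [|apply Rmax_l]. eapply Rle_trans; [|exact (HB a Ha)].
      apply (Mp_le_Hp_norm 2 B1 s _ HB1 Hs). }
    pose proof (pmean_le_of_Mp 2 s _ _ ltac:(lra) A1 Hs (Rmax_r B 0) M) as P.
    unfold pmean in P.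
    rewrite (circ_ext (fun z => rpow (Cmod (g (moebius a z) - g a)) 2) (fun z => Cmod (g (moebius a z) - g a) ^ 2)) in P; auto.
    intros z. apply rpow_2, Cmod_ge_0. }
  set (B0 := rpow (Rmax B 0) 2) in *. assert (HB0 : 0 <= B0) by apply rpow_ge0.
  set (c := Cmod (g 0)). pose proof (Cmod_ge_0 (g 0)) as Hc. fold c in Hc.
  assert (Hc2 : 0 <= c ^ 2) by apply pow2_ge_0.
  (* One constant for both purposes: it exceeds the potential bound [B0] and is the bound that
     [a = 0] gives for the square means. *)
  exists (2 * B0 + 2 * c ^ 2). split; [lra|split].
  - intros r Hr. destruct (bmoa_potential g r B0 Ag Hr HK) as (S & AS & HS).
    exists S. split; auto. intros z Hz. specialize (HS z Hz). lra.
  - intros r Hr. destruct (HK 0) as [A0 H0]; [rewrite Cmod_0; lra|]. specialize (H0 r Hr).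
    assert (M0 : forall z, moebius 0 z = (- z)%C).
    { intros z. unfold moebius. replace (1 - Cconj 0 * z)%C with (RtoC 1) by (apply Ceq; simpl; ring).
      field. }
    set (k := fun z => (g (moebius 0 z) - g 0)%C) in *.
    assert (Xk : excirc (fun z => Cmod (k z) ^ 2) r).
    { apply excirc_rcont; [lra|]. intros z Hz. apply rcont_Cmod2. eapply adisc_ccont; [exact A0|lra]. }
    assert (Xg : forall t, continuity_pt (fun t => Cmod (g (cpt r t)) ^ 2) t).
    { intros t. apply (rcont_ccurve (fun z => Cmod (g z) ^ 2) (cpt r)); [|apply ccurve_cpt].
      apply rcont_Cmod2. eapply adisc_ccont; eauto. rewrite Cmod_cpt; lra. }
    (* the automorphism [σ_0 = -z] rotates the circle by [π] *)
    assert (E : circ (fun z => Cmod (g z) ^ 2) r = circ (fun z => Cmod (g (- z)%C) ^ 2) r).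
    { unfold circ. rewrite <- (RInt_shift (fun t => Cmod (g (cpt r t)) ^ 2) PI); auto.
      apply RInt_Rext. intros t. replace (cpt r (t + PI)) with (- cpt r t)%C; auto.
      unfold cpt. rewrite neg_cos, neg_sin. apply Ceq; simpl; ring.
      intros t. rewrite cpt_period; auto. }
    rewrite E.
    apply Rle_trans with (circ (fun z => 2 * Cmod (k z) ^ 2 + 2 * c ^ 2) r).
    + apply circ_le; [lra| |apply excirc_plus; [apply excirc_scal; auto|apply excirc_const]|].
      { apply excirc_rcont; [lra|]. intros z Hz. apply (rcont_Cmod2 (fun z => g (- z)%C)).
        destruct (Ag (- z)%C) as [l Hl]; [rewrite Cmod_opp; lra|]. eapply cdiff_ccont.
        apply (cdiff_comp (fun z => (- z)%C) g z (- (1)) l); auto.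
        apply (cdiff_ext_loc (fun w => (- (1) * w)%C) _ _ _ 1 Rlt_0_1); [intros; ring|].
        eapply cdiff_eq; [|apply cdiff_scal, cdiff_id]. ring. }
      intros z Hz. unfold k. rewrite M0.
      pose proof (Cmod_triangle_sub (g (- z)%C) (g 0)) as T. fold c in T.
      pose proof (Cmod_ge_0 (g (- z)%C)). set (x := Cmod (g (- z)%C)) in *.
      set (y := Cmod (g (- z)%C - g 0)%C) in *.
      assert (x ^ 2 <= (c + y) ^ 2) by (apply pow_incr; lra). pose proof (pow2_ge_0 (c - y)). nra.
    + rewrite circ_plus, circ_scal, circ_const; [|auto|apply excirc_scal; auto|apply excirc_const].
      unfold k. lra.
Qed.

(* Equivalence of a subsequence with the unit vector basis of [l^p] *)
Require Import Defs.
Open Scope R_scope.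

(** The infinite combination is represented by the limit [F] of its partial sums in the [H^p] norm,
    membership in [l^p] by convergence of the series of [|alpha_j|^p] to [A], and the positive lower
    limit by an eventual lower bound. *)
Theorem theorem3p1 (g : Cx -> Cx) (p : R) (f : nat -> Cx -> Cx) :
  BMOA g -> 1 <= p ->
  (forall n, in_Hp p (f n)) ->
  (forall n, Hp_norm p (f n) = 1) ->
  (* f_n -> 0 uniformly on compact subsets of D *)
  (forall r, 0 <= r < 1 -> forall eps, 0 < eps -> exists N, forall n, (N <= n)%nat ->
      forall z, Cmod z <= r -> Cmod (f n z) < eps) ->
  (* liminf_n ||T_g f_n||_{H^p} > 0 *)
  (exists delta N, 0 < delta /\
      forall n, (N <= n)%nat -> delta <= Hp_norm p (Tg g (f n))) ->
  exists (nj : nat -> nat) (c : R),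
    (forall j, (nj j < nj (S j))%nat) /\ 0 < c /\
    forall (alpha : nat -> Cx) (A : R),
      infinite_sum (fun j => rpow (Cmod (alpha j)) p) A ->
      exists F : Cx -> Cx,
        in_Hp p F /\
        Un_cv (fun N => Hp_norm p
                 (fun z => Csub (F z) (Clincomb alpha (fun j => Tg g (f (nj j))) N z))) 0 /\
        / c * rpow A (/ p) <= Hp_norm p F <= c * rpow A (/ p).
Proof.
  intros HB Hp1 Hf Hf1 Hf0 (delta & N0 & Hdelta & Hlow).
  assert (Hp : 0 < p) by lra. pose proof PI_RGT_0.
  destruct (BMOA_potential g HB) as (Ag & B & HB0 & HP & HG).
  assert (Af : forall n, adisc 1 (f n)) by (intros n; apply analytic_adisc, (Hf n)).
  set (h := fun n => Tg g (f n)).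
  assert (HV : forall n, volterra g (f n) (h n)) by (intros; apply Tg_volterra; auto).
  assert (Ah : forall n, adisc 1 (h n)) by (intros n; apply (HV n)).
  assert (Mf : forall n r, 0 <= r < 1 -> pmean p r (f n) <= 2 * PI).
  { intros n r Hr. destruct (Hf n) as [_ [b Hb]].
    pose proof (Mp_le_Hp_norm p b r (f n) Hb Hr) as M. rewrite Hf1 in M.
    pose proof (pmean_le_of_Mp p r 1 (f n) Hp (Af n) Hr ltac:(lra) M) as Q.
    rewrite rpow_one in Q. lra. }
  destruct (volterra_bounded p B Hp HB0) as (K & HK0 & HK).
  set (C1 := K * (2 * PI)). assert (HC1 : 0 <= C1) by (apply Rmult_le_pos; lra).
  assert (Mh : forall n r, 0 <= r < 1 -> pmean p r (h n) <= C1).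
  { intros n r Hr. eapply Rle_trans; [apply (HK g (f n) (h n) r); auto|].
    apply Rmult_le_compat_l; auto. apply Mf; auto. }
  assert (MpH : forall n r, 0 <= r < 1 -> Defs.Mp p (h n) r <= rpow K (/ p)).
  { intros n r Hr. apply Mp_le_of_pmean; auto. specialize (Mh n r Hr). unfold C1 in Mh. lra. }
  assert (Uf : uoc0 f) by exact Hf0.
  assert (Uh : uoc0 h) by (apply (volterra_uoc0 g f); auto).
  assert (Mq : means_to0 (2 * p / (p + 2)) h).
  { apply (volterra_means_q p (2 * PI * B) (2 * PI) g f); auto. }
  assert (Mhalf : means_to0 (p / 2) h).
  { apply (means_half p (2 * p / (p + 2)) C1); auto. apply Rdiv_lt_0_compat; lra. }
  assert (Cross : forall n, means_to0 (p / 2) (fun m z => (h n z * h m z)%C)).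
  { intros n. apply (cross_means p C1 C1); auto. intros r Hr; apply (Mh n r Hr). }
  (* Half of [delta], because the norm is a supremum over radii that need not be attained; [2 * PI]
     undoes the normalisation of [Mp]. *)
  set (d0 := 2 * PI * rpow (delta / 2) p).
  assert (Hd0 : 0 < d0) by (apply Rmult_lt_0_compat; [lra|apply rpow_pos; lra]).
  assert (Low : forall n, (N0 <= n)%nat -> exists r, 0 <= r < 1 /\ d0 <= pmean p r (h n)).
  { intros n Hn. destruct (Hp_norm_approx p _ (delta / 2) (h n) (MpH n)) as (r & Hr & M).
    - specialize (Hlow n Hn). unfold h; lra.
    - exists r. split; auto. rewrite Mp_pmean in M by auto.
      pose proof (pmean_ge0 p r (h n) Hp (Ah n) Hr) as P0.
      assert (Hx : 0 <= / (2 * PI) * pmean p r (h n)) by (apply Rmult_le_pos; [left; apply Rinv_0_lt_compat; lra|auto]).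
      assert (Q : rpow (delta / 2) p <= / (2 * PI) * pmean p r (h n)).
      { rewrite <- (rpow_inv_q (/ (2 * PI) * pmean p r (h n)) p) by auto. apply rpow_mono; lra. }
      unfold d0. apply Rle_trans with (2 * PI * (/ (2 * PI) * pmean p r (h n))).
      apply Rmult_le_compat_l; lra. right; field; lra. }
  (* The error of almost disjointness must leave part of the lower bound: [d0 - kap] stays
     positive. *)
  set (kap := d0 / 2).
  destruct (select_subsequence p C1 kap N0 h Hp HC1 ltac:(unfold kap; lra) Ah Mh Uh Cross)
    as (nj & Hinc & HN0 & HAD & Hsm).
  set (k := fun j => h (nj j)) in *.
  (* The upper and lower constants for the [p]-th power of the norm. The sum [c] below dominates
     both [u^(1/p)] and [l^(-1/p)]. *)
  set (u := (C1 + kap) / (2 * PI)). set (l := (d0 - kap) / (2 * PI)).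
  assert (Hu : 0 < u) by (apply Rdiv_lt_0_compat; unfold kap; lra).
  assert (Hl : 0 < l) by (apply Rdiv_lt_0_compat; unfold kap; lra).
  pose proof (rpow_pos u (/ p) Hu) as Hu'. pose proof (rpow_pos l (/ p) Hl) as Hl'.
  set (c := rpow u (/ p) + / rpow l (/ p)).
  assert (Hil : 0 < / rpow l (/ p)) by (apply Rinv_0_lt_compat; auto).
  assert (Hc : 0 < c) by (unfold c; lra).
  exists nj, c. split; [auto|split; [auto|]]. intros alpha A HA.
  destruct (lp_sum p C1 kap d0 k Hp HC1 ltac:(unfold kap; lra) ltac:(lra) (fun j => Ah (nj j))
    (fun j => Mh (nj j)) (fun j => Low (nj j) (HN0 j)) HAD Hsm alpha A HA) as (F & AF & HT & HL).
  set (a := fun j => rpow (Complex.Cmod (alpha j)) p) in *.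
  change (infinite_sum a A) in HA.
  assert (Ha0 : forall j, 0 <= a j) by (intros; apply rpow_ge0).
  destruct (infinite_sum_rsum a A Ha0 HA) as [HA1 HA2].
  assert (HA0 : 0 <= A) by (apply (Rle_trans _ (rsum a 0)); [simpl; lra|apply HA1]).
  assert (AS : forall N, adisc 1 (fun z => (F z - lincomb alpha k N z)%C)).
  { intros N. apply adisc_minus; auto. apply adisc_lincomb. intros; apply Ah. }
  assert (MT : forall N r, 0 <= r < 1 -> Mp p (fun z => (F z - lincomb alpha k N z)%C) r <=
     rpow (u * (A - rsum a N)) (/ p)).
  { intros N r Hr. apply Mp_le_of_pmean; auto. eapply Rle_trans; [apply HT; auto|].
    right. unfold u. field. lra. }
  assert (MF : forall r, 0 <= r < 1 -> Mp p F r <= rpow (u * A) (/ p)).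
  { intros r Hr. apply Mp_le_of_pmean; auto.
    rewrite (pmean_ext p r F (fun z => (F z - lincomb alpha k 0 z)%C)) by (intros; simpl; ring).
    eapply Rle_trans; [apply HT; auto|]. simpl. right. unfold u. field. lra. }
  pose proof (Hp_norm_le p _ F MF) as [NF0 NF1].
  exists F. split; [|split; [|split]].
  - split; [apply analytic_adisc; auto|]. eexists; exact MF.
  - intros eps He.
    (* A tail of this size has norm at most [eps / 2] by [MT]; the half yields the strict
       inequality. *)
    destruct (HA2 (rpow (eps / 2) p / u)) as [N HN].
    { apply Rdiv_lt_0_compat; auto. apply rpow_pos; lra. }
    exists N. intros n Hn. specialize (HN n Hn).
    assert (Q : 0 <= Hp_norm p (fun z => (F z - lincomb alpha k n z)%C) <= eps / 2).
    { apply Hp_norm_le. intros r Hr. eapply Rle_trans; [apply MT; auto|].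
      rewrite <- (rpow_1 (eps / 2)) by lra. rewrite <- (Rinv_r p) by lra.
      rewrite <- (rpow_rpow (eps / 2)) by lra.
      apply rpow_mono; [apply Rinv_0_lt_compat; auto|]. specialize (HA1 n). split.
      - apply Rmult_le_pos; lra.
      - apply Rle_trans with (u * (rpow (eps / 2) p / u)).
        apply Rmult_le_compat_l; lra. right; field; lra. }
    unfold R_dist. rewrite Rminus_0_r.
    change (Rabs (Hp_norm p (fun z => (F z - lincomb alpha k n z)%C)) < eps).
    rewrite Rabs_pos_eq; lra.
  - assert (Q : l * A <= rpow (Hp_norm p F) p).
    { apply Rle_plus_epsilon. intros eps He.
      destruct (HL (eps * (2 * PI))) as (r & Hr & HLr); [apply Rmult_lt_0_compat; lra|].
      pose proof (pmean_le_of_Mp p r (Hp_norm p F) F Hp AF Hr NF0 (Mp_le_Hp_norm p _ r F MF Hr)) as M.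
      apply Rmult_le_reg_l with (2 * PI); [lra|].
      replace (2 * PI * (l * A)) with ((d0 - kap) * A) by (unfold l; field; lra). lra. }
    assert (Q2 : rpow l (/ p) * rpow A (/ p) <= Hp_norm p F).
    { rewrite <- rpow_mult by lra.
      rewrite <- (rpow_1 (Hp_norm p F)) by lra. rewrite <- (Rinv_r p) by lra.
      rewrite <- (rpow_rpow (Hp_norm p F)) by lra.
      apply rpow_mono; [apply Rinv_0_lt_compat; auto|]. split; [apply Rmult_le_pos; lra|auto]. }
    eapply Rle_trans; [|exact Q2]. apply Rmult_le_compat_r; [apply rpow_ge0|].
    rewrite <- (Rinv_inv (rpow l (/ p))). apply Rinv_le_contravar; [auto|unfold c; lra].
  - eapply Rle_trans; [exact NF1|]. rewrite rpow_mult by lra.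
    apply Rmult_le_compat_r; [apply rpow_ge0|]. unfold c; lra.
Qed.
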